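(* Assume (A1) and (A2) (recalled in the context) and that there exist $W_1\in M^{\widehat u}\cap\mathbb{S}$ and $x\in\mathbb{R}$ such that $U^{W_1}(x)<u(\infty)$. Then: 1. for all $W\in L^{\widehat u}_+$, $U^W(x)\le U_\Phi(x)$; 2. $$\sup_{H\in\mathcal{H}^{\widehat u}}E[u(x+(H\cdot S)_T)]=\min_{\lambda>0,\;Q\in\mathbb{M}_\sigma\cap\mathbb{P}_\Phi}\left\{\lambda x+E\left[\Phi\left(\lambda\frac{dQ}{dP}\right)\right]\right\}=U_\Phi(x);$$ 3. if $W\in L^{\widehat u}$ satisfies $W\ge\overline W$ for some $\overline W\in M^{\widehat u}\cap\mathbb{S}$, then $U^W(x)=U^{\overline W}(x)=U_\Phi(x)$.
   Context: Market: $T\in(0,\infty]$; $S$ is an $\mathbb{R}^d$-valued càdlàg semimartingale (not necessarily locally bounded) on a filtered probability space $(\Omega,\mathcal{F},(\mathcal{F}_t)_{t\in[0,T]},P)$ satisfying the usual conditions, with $\mathcal{F}_0$ trivial; if $T=\infty$, every process $Y$ considered is assumed to have a limit $Y_\infty=\lim_{t\uparrow\infty}Y_t$. $L(S)$ is the set of $\mathbb{R}^d$-valued predictable $S$-integrable processes and $H\cdot S$ is the stochastic integral. For $W\in L^0_+$, $\mathcal{H}^W=\{H\in L(S): \exists c>0,\ (H\cdot S)_t\ge -cW\ \forall t\le T\}$, $K^W=\{(H\cdot S)_T: H\in\mathcal{H}^W\}$ and $U^W(x)=\sup_{k\in K^W}E[u(x+k)]$. $\mathbb{S}$ is the set of suitable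 random variables: $W\in L^0_+$ with $W\ge1$ such that for each $i=1,\dots,d$ there is $H^i\in L(S^i)$ with $P(\{\omega:\exists t\ge0,\ H^i_t(\omega)=0\})=0$ and $|(H^i\cdot S^i)_t|\le W$ for all $t\in[0,T]$, $P$-a.s. $\mathbb{M}_\sigma$ is the set of probabilities $Q\ll P$ under which $S$ is a $\sigma$-martingale. Utility: $u:\mathbb{R}\to\mathbb{R}\cup\{-\infty\}$ is increasing, concave on the interior $(a,\infty)$, $a\in[-\infty,0)$, of its effective domain, with $\lim_{x\to-\infty}u(x)=-\infty$ (and $u(x)=-\infty$ for $x<a$ if $a$ is finite); $u(\infty)=\lim_{x\to\infty}u(x)$. $\Phi(y)=\sup_{x\in\mathbb{R}}\{u(x)-xy\}$ for $y\ge0$, $\Phi(0)=u(\infty)$. (A1): $u$ is increasing, strictly concave and continuously differentiable on $(a,\infty)$ and $u'(a):=\lim_{x\downarrow a}u'(x)=+\infty$, $\lim_{x\uparrow\infty}u'(x)=0$. (A2): for every $\lambda>0$, $\mathbb{P}_\Phi=\mathbb{P}_{\Phi_\lambda}$, where $\Phi_\lambda(y)=\Phi(\lambda y)$ and, for a function $\Psi$, $\mathbb{P}_\Psi$ is the set of probabilities $Q\ll P$ with $E[\Psi(dQ/dP)]<\infty$. Expectations $E[u(\cdot)]$ are set to $-\infty$ whenever the negative part has infinite expectation. $U_\Phi(x)=\min_{\lambda>0,\,Q\in\mathbb{M}_\sigma\cap\mathbb{P}_\Phi}\{\lambda x+E[\Phi(\lambda\frac{dQ}{dP})]\}$. Orlicz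 spaces: $\widehat u(x)=-u(-|x|)+u(0)$; $L^{\widehat u}=\{f\in L^0:\exists\alpha>0,\ E[\widehat u(\alpha f)]<\infty\}$; $M^{\widehat u}=\{f\in L^0: E[\widehat u(\alpha f)]<\infty\ \forall\alpha>0\}$ (if $a$ is finite, $M^{\widehat u}=\{0\}$, so the hypothesis $M^{\widehat u}\cap\mathbb{S}\ne\varnothing$ forces $a=-\infty$). $\mathcal{H}^{\widehat u}=\bigcup_{W\in L^{\widehat u},\,W\ge1}\mathcal{H}^W$. *)

(* Defs.v *)
From HB Require Import structures.
From mathcomp Require Import all_boot all_order all_algebra.
From mathcomp Require Import all_classical all_reals all_analysis.
Set Implicit Arguments.
Unset Strict Implicit.
Unset Printing Implicit Defensive.
Import Order.TTheory GRing.Theory Num.Theory.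
Import numFieldNormedType.Exports.
Local Open Scope classical_set_scope.
Local Open Scope ring_scope.

(* The horizon T is an extended real in ]0, +oo]; trading dates are the finite
   t in [0, T], and a value at T = +oo is a limit (see [terminal]).  Processes
   are functions on all of R, whose values off the trading dates are
   irrelevant; everything is up to indistinguishability. *)
Section StochasticCalculus.
Context {R : realType} {dO : measure_display} {Omega : measurableType dO}.
Variable T : \bar R.

Definition process := R -> Omega -> R.

Definition date : set R := [set t | 0 <= t /\ (t%:E <= T)%E].

Definition is_filtration (F : R -> set (set Omega)) : Prop :=
  (forall t, date t -> sigma_algebra setT (F t) /\ F t `<=` measurable) /\
  (forall s t, date s -> date t -> s <= t -> F s `<=` F t).

Definition usual_conditions (P : probability Omega R)
    (F : R -> set (set Omega)) : Prop :=
  (forall N, P.-negligible N -> F 0 N) /\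
  (forall t, date t -> (t%:E < T)%E ->
     F t = \bigcap_(s in [set s | date s /\ t < s]) F s).

Definition trivial_at_0 (P : probability Omega R)
    (F : R -> set (set Omega)) : Prop :=
  forall A, F 0 A -> P A = 0%E \/ P A = 1%E.

(* The usual augmentation for a possibly smaller measure Q << P. *)
Definition augment (Q : probability Omega R) (F : R -> set (set Omega)) (t : R)
    : set (set Omega) :=
  <<s F t `|` [set N | measurable N /\ Q N = 0%E] >>.

Definition wrt (A : set (set Omega)) (f : Omega -> R) : Prop :=
  preimage_set_system setT f measurable `<=` A.

Definition adapted (F : R -> set (set Omega)) (X : process) : Prop :=
  forall t, date t -> wrt (F t) (X t).

Definition cadlag (X : process) : Prop := forall w,
  (forall t, date t -> (t%:E < T)%E -> X s w @[s --> t^'+] --> X t w) /\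
  (forall t, date t -> 0 < t -> cvg (X s w @[s --> t^'-])).

Definition cadlag_adapted (F : R -> set (set Omega)) (X : process) : Prop :=
  cadlag X /\ adapted F X.

Definition predictable_rect (F : R -> set (set Omega))
    : set (set (R * Omega)) :=
  [set C | (exists2 A, F 0 A & C = [set 0] `*` A) \/
     (exists s t A, [/\ date s, date t, s < t, F s A & C = `]s, t] `*` A])].

Definition predictable (F : R -> set (set Omega)) (H : process) : Prop :=
  preimage_set_system (date `*` setT) (fun z => H z.1 z.2) measurable `<=`
  <<s date `*` setT, predictable_rect F >>.

Definition indist (Q : probability Omega R) (X Y : process) : Prop :=
  {ae Q, forall w, forall t, date t -> X t w = Y t w}.

Definition martingale (Q : probability Omega R) (F : R -> set (set Omega))
    (M : process) : Prop :=
  [/\ cadlag_adapted F M,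
      (forall t, date t -> Q.-integrable setT (EFin \o M t)) &
      (forall s t A, date s -> date t -> s <= t -> F s A ->
         (\int[Q]_(w in A) (M t w)%:E = \int[Q]_(w in A) (M s w)%:E)%E)].

Definition stopping_time (F : R -> set (set Omega)) (tau : Omega -> \bar R)
    : Prop :=
  (forall w, 0 <= tau w)%E /\
  (forall t, date t -> F t [set w | (tau w <= t%:E)%E]).

Definition stopped (tau : Omega -> \bar R) (X : process) : process :=
  fun t w => X (fine (Order.min t%:E (tau w))) w.

Definition local_martingale (Q : probability Omega R)
    (F : R -> set (set Omega)) (M : process) : Prop :=
  cadlag_adapted F M /\
  exists tau : nat -> Omega -> \bar R,
    [/\ (forall n, stopping_time F (tau n)),
        (forall n w, (tau n w <= tau n.+1 w)%E),
        {ae Q, forall w, forall t, date t -> exists n, (t%:E <= tau n w)%E} &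
        (forall n, martingale Q F (stopped (tau n) M))].

Definition semimartingale (Q : probability Omega R)
    (F : R -> set (set Omega)) (X : process) : Prop :=
  cadlag_adapted F X /\
  exists M A : process,
    [/\ local_martingale Q F M /\ (forall w, M 0 w = 0),
        cadlag_adapted F A /\ (forall w, A 0 w = 0),
        (forall w t, date t -> bounded_variation 0 t (A ^~ w)) &
        indist Q X (fun t w => X 0 w + M t w + A t w)].

(* An elementary integrand
     c0 1_{0} + \sum_(i < n) c_i 1_{]s_i, t_i]}. *)
Record elementary := Elementary {
  el_size : nat;
  el_0 : Omega -> R;
  el_s : nat -> R;
  el_t : nat -> R;
  el_c : nat -> Omega -> R }.

Definition elementary_integrand (F : R -> set (set Omega)) (e : elementary)
    : Prop :=
  [/\ wrt (F 0) (el_0 e),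
      (exists c, forall w, `|el_0 e w| <= c) &
      forall i, (i < el_size e)%N ->
        [/\ date (el_s e i), date (el_t e i), el_s e i <= el_t e i,
            wrt (F (el_s e i)) (el_c e i) &
            exists c, forall w, `|el_c e i w| <= c]].

Definition el_val (e : elementary) : process := fun t w =>
  el_0 e w * (t == 0)%:R +
  \sum_(i < el_size e) el_c e i w * (el_s e i < t <= el_t e i)%R%:R.

(* Integrals run over ]0, t], so that they vanish at 0. *)
Definition el_int (X : process) (e : elementary) : process := fun t w =>
  \sum_(i < el_size e)
     el_c e i w * (X (Num.min (el_t e i) t) w - X (Num.min (el_s e i) t) w).

Definition ucp_cvg (Q : probability Omega R) (Xn : nat -> process)
    (X : process) : Prop :=
  forall t eps, date t -> 0 < eps ->
    Q [set w | exists2 s, 0 <= s <= t & eps < `|Xn n s w - X s w| ]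
      @[n --> \oo] --> 0%E.

(* Convergence for the semimartingale (Emery) topology, whose Ky Fan type
   distances are sup over elementary |K| <= 1.  The increments seen by K do not
   determine the starting value, which is therefore added. *)
Definition emery_cvg (Q : probability Omega R) (F : R -> set (set Omega))
    (Xn : nat -> process) (X : process) : Prop :=
  forall t eps, date t -> 0 < eps ->
    \forall n \near \oo, forall K, elementary_integrand F K ->
      (forall s w, date s -> `|el_val K s w| <= 1) ->
      Order.le (Q [set w | exists2 s, 0 <= s <= t &
            eps < `|Xn n 0 w - X 0 w| +
                  `|el_int (fun r v => Xn n r v - X r v) K s w| ])
        eps%:E.

Definition bounded_predictable (F : R -> set (set Omega)) (H : process)
    : Prop :=
  predictable F H /\ exists c, forall t w, date t -> `|H t w| <= c.

(* The stochastic integral of bounded predictable processes against X: the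
   linear extension of [el_int] that satisfies dominated convergence.  Such an
   extension exists when X is a semimartingale and is unique up to
   indistinguishability. *)
Definition bounded_integral (Q : probability Omega R)
    (F : R -> set (set Omega)) (X : process) (I : process -> process) : Prop :=
  [/\ (forall H, bounded_predictable F H -> cadlag_adapted F (I H)),
      (forall e, elementary_integrand F e ->
         indist Q (I (el_val e)) (el_int X e)),
      (forall (a : R) H K, bounded_predictable F H ->
         bounded_predictable F K ->
         indist Q (I (fun t w => a * H t w + K t w))
                  (fun t w => a * I H t w + I K t w)) &
      (forall (Hn : nat -> process) (H : process) (c : R),
         (forall n, predictable F (Hn n)) -> predictable F H ->
         (forall n t w, date t -> `|Hn n t w| <= c) ->
         (forall t w, date t -> Hn n t w @[n --> \oo] --> H t w) ->
         ucp_cvg Q (fun n => I (Hn n)) (I H))].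

(* H 1_{|H| <= n} *)
Definition truncate d (n : nat) (H : 'I_d -> process) (i : 'I_d) : process :=
  fun t w => if \sum_(j < d) H j t w ^+ 2 <= n%:R ^+ 2 then H i t w else 0.

(* [stoch_int Q F S H X]: H is S-integrable (as a vector) and X is a version of
   H . S.  Here H is integrable when the integrals of its truncations converge
   in the semimartingale topology, and the limit is H . S; no integrability of
   H^i with respect to S^i is asked. *)
Definition stoch_int d (Q : probability Omega R) (F : R -> set (set Omega))
    (S H : 'I_d -> process) (X : process) : Prop :=
  [/\ (forall i, predictable F (H i)), cadlag_adapted F X &
      exists I : 'I_d -> process -> process,
        (forall i, bounded_integral Q F (S i) (I i)) /\
        emery_cvg Q F (fun n t w => \sum_(i < d) I i (truncate n H i) t w) X].

Definition scalar_int (Q : probability Omega R) (F : R -> set (set Omega))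
    (S H X : process) : Prop :=
  stoch_int Q F (fun _ : 'I_1 => S) (fun _ : 'I_1 => H) X.

Definition sigma_martingale d (Q : probability Omega R)
    (F : R -> set (set Omega)) (S : 'I_d -> process) : Prop :=
  exists (M : 'I_d -> process) (phi : process),
    (forall i, martingale Q F (M i)) /\
    (forall t w, date t -> 0 < phi t w) /\
    (forall i, exists X, scalar_int Q F (M i) phi X /\
       indist Q (S i) (fun t w => S i 0 w + X t w)).

Definition has_terminal (Q : probability Omega R) (X : process) : Prop :=
  T = +oo%E -> {ae Q, forall w, cvg (X t w @[t --> +oo])}.

Definition terminal (X : process) (w : Omega) : R :=
  if T is t%:E then X t w else lim (X t w @[t --> +oo]).

End StochasticCalculus.

Section Utility.
Context {R : realType}.
Variables (a : \bar R) (u : R -> \bar R).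

Definition utility : Prop :=
  [/\ (forall x, u x != +oo%E),
      (forall x, (a < x%:E)%E -> u x != -oo%E) /\
        (forall x, (x%:E < a)%E -> u x = -oo%E),
      (forall x y, x <= y -> (u x <= u y)%E),
      (forall x y t, (a < x%:E)%E -> (a < y%:E)%E -> 0 <= t <= 1 ->
        (t%:E * u x + (1 - t)%:E * u y <= u (t * x + (1 - t) * y)%R)%E) &
      u x @[x --> -oo] --> -oo%E].

Definition u_inf : \bar R := lim (u x @[x --> +oo]).

Definition right_of_a : set_system R :=
  if a is r%:E then r^'+ else -oo.

Definition A1 : Prop :=
  [/\ (forall x y t, (a < x%:E)%E -> (a < y%:E)%E -> x != y -> 0 < t < 1 ->
        (t%:E * u x + (1 - t)%:E * u y < u (t * x + (1 - t) * y)%R)%E),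
      (forall x, (a < x%:E)%E -> derivable (fine \o u) x 1 /\
        {for x, continuous (derive1 (fine \o u))}),
      derive1 (fine \o u) x @[x --> right_of_a] --> +oo &
      derive1 (fine \o u) x @[x --> +oo] --> 0].

Definition Phi (y : R) : \bar R :=
  ereal_sup [set (u x - (x * y)%:E)%E | x in [set: R]].

Definition u_hat (x : R) : \bar R := (- u (- `|x|)%R + u 0%R)%E.

End Utility.

Section Market.
Context {R : realType} {dO : measure_display} {Omega : measurableType dO}.
Variable P : probability Omega R.

Definition density (Q : probability Omega R) (w : Omega) : R :=
  fine (Radon_Nikodym (charge_of_finite_measure Q) P w).

Definition P_of (Psi : R -> \bar R) : set (probability Omega R) :=
  [set Q : probability Omega R | Q `<< P /\ (\int[P]_w Psi (density Q w) < +oo)%E].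

Definition A2 (u : R -> \bar R) : Prop :=
  forall lam : R, 0 < lam -> P_of (Phi u) = P_of (fun y => Phi u (lam * y)).

Definition L_hat (u : R -> \bar R) : set (Omega -> R) :=
  [set f : Omega -> R | measurable_fun setT f /\
     exists2 alpha : R, 0 < alpha & (\int[P]_w u_hat u (alpha * f w) < +oo)%E].

Definition M_hat (u : R -> \bar R) : set (Omega -> R) :=
  [set f : Omega -> R | measurable_fun setT f /\
     forall alpha : R, 0 < alpha -> (\int[P]_w u_hat u (alpha * f w) < +oo)%E].

Variables (T : \bar R) (F : R -> set (set Omega)).

(* For T = +oo the integrals considered are those with a limit at infinity. *)
Definition gain d (S H : 'I_d -> process) (X : process) : Prop :=
  stoch_int T P F S H X /\ has_terminal T P X.

(* The H^i are integrated one coordinate at a time. *)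
Definition suitable d (S : 'I_d -> process) : set (Omega -> R) :=
  [set W : Omega -> R | [/\ measurable_fun setT W, {ae P, forall w, 1 <= W w} &
     forall i, exists H X,
       [/\ gain (fun _ : 'I_1 => S i) (fun _ : 'I_1 => H) X,
           {ae P, forall w, forall t, date T t -> H t w != 0} &
           {ae P, forall w, forall t, date T t -> `|X t w| <= W w}]]].

Definition M_sigma d (S : 'I_d -> process) : set (probability Omega R) :=
  [set Q : probability Omega R | Q `<< P /\ sigma_martingale T Q (augment Q F) S].

Definition admissible d (S : 'I_d -> process) (W : Omega -> R)
    : set ('I_d -> process) :=
  [set H | exists X c, [/\ gain S H X, 0 < c &
     {ae P, forall w, forall t, date T t -> - (c * W w) <= X t w}]].

Definition admissible_hat d (S : 'I_d -> process) (u : R -> \bar R)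
    : set ('I_d -> process) :=
  \bigcup_(W in [set W | L_hat u W /\ {ae P, forall w, 1 <= W w}])
    admissible S W.

Definition terminal_gains d (S : 'I_d -> process) (A : set ('I_d -> process))
    : set (Omega -> R) :=
  [set k | exists H X, [/\ A H, gain S H X & k = terminal T X]].

(* \int is \int of the positive part minus \int of the negative part, and -oo
   absorbs +oo in \bar R: the value is -oo as soon as the negative part is not
   integrable. *)
Definition sup_utility d (S : 'I_d -> process) (u : R -> \bar R)
    (A : set ('I_d -> process)) (x : R) : \bar R :=
  ereal_sup [set (\int[P]_w u (x + k w)%R)%E | k in terminal_gains S A].

Definition U_W d (S : 'I_d -> process) (u : R -> \bar R) (W : Omega -> R)
    (x : R) : \bar R :=
  sup_utility S u (admissible S W) x.

Definition dual_value (u : R -> \bar R) (x lam : R) (Q : probability Omega R)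
    : \bar R :=
  ((lam * x)%:E + \int[P]_w Phi u (lam * density Q w)%R)%E.

Definition U_Phi d (S : 'I_d -> process) (u : R -> \bar R) (x : R) : \bar R :=
  ereal_inf [set v | exists (lam : R) (Q : probability Omega R),
    [/\ 0 < lam, M_sigma S Q, P_of (Phi u) Q & v = dual_value u x lam Q]].

End Market.

(* Main.v *)
Require Import Defs.
From HB Require Import structures.
From mathcomp Require Import all_boot all_order all_algebra.
From mathcomp Require Import all_classical all_reals all_analysis.
From mathcomp Require Import measurable_realfun.
From mathcomp Require Import ring lra.
Set Implicit Arguments.
Unset Strict Implicit.
Unset Printing Implicit Defensive.
Import Order.TTheory GRing.Theory Num.Theory.
Import numFieldNormedType.Exports.
Local Open Scope classical_set_scope.
Local Open Scope ring_scope.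

(* Weak duality. Let Q << P be a sigma-martingale measure and X = H . S >= - c W. Then
   S = S_0 + phi . M for Q-martingales M_i, and X is a limit, uniformly on compacts in
   Q-probability, of integrals of bounded integrands against Q-martingales whose jumps are
   either 0 or those of X. Stopping the approximations when they leave X by more than 1 keeps
   them above - c W - 1 up to and including the stopping time, whence E_Q[X_T] <= 0 by Fatou,
   and Fenchel's inequality bounds the utility. E_Q[W] is finite by Fenchel's inequality again.

   Existence. Replacing the integrands H^i of a suitable W by one predictable phi > 0 such that
   |phi . S^i| <= W for all i, the bounded integrands whose gains are dominated by a multiple of
   W yield a linear space D of claims. Since sup {E[u(x + f)] : f in D} <= V < u(oo), where
   V = U^W(x), convex Hahn-Banach gives a linear l, null on D, with E[u(x + f)] <= V + l(f) for
   all f dominated by W. Because W is in M^u, l is sigma-order continuous, hence l = lam E_Q.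
   A measurable maximizer of v(y) - y lam dQ/dP shows that the dual value of (lam, Q) is at
   most V, and orthogonality to D makes each phi . S^i a Q-martingale, i.e. S a
   Q-sigma-martingale. *)

(** All facts on the integral come from the four clauses of [bounded_integral], by induction over
    bounded predictable integrands whose limit step is dominated convergence. The main obstacle is
    that Q is only absolutely continuous: Q-martingales live in the augmented filtration, whose
    predictable integrands have F-predictable versions only off sets that are Q-null but may be
    P-large. Locality of the P-integral on arbitrary sets of outcomes makes the choice of version
    harmless. Since S need not be locally bounded, the overshoot at a stopping time is never small;
    it is controlled through the jump it consists of, which shapes the common density phi, the
    optional stopping estimates and the mean of gains. On the dual side, the strict inequality
    U^W(x) < u(oo) is what yields lam > 0. Membership of W in M^u allows every multiple of W as a
    dominating variable, and concavity turns the resulting lower estimate of u into a two-sided one.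
    Condition (A2) exchanges finiteness of E[Phi(lam dQ/dP)] with that of E[Phi(dQ/dP)]. *)

Lemma g_sigma_restrict (Z : pointedType) (D : set Z) (G : set (set Z)) :
  (forall C, G C -> C `<=` D) -> <<s G >> D ->
  forall B, <<s D, G >> B <-> (B `<=` D /\ <<s G >> B).
Proof.
move=> GD mD B; split.
  suff H : <<s D, G >> `<=` [set B | B `<=` D /\ <<s G >> B] by move=> /H.
  apply: smallest_sub; last by move=> C GC; split; [exact: GD|exact: sub_sigma_algebra].
  split.
  - by split=> //; exact: sigma_algebra0.
  - move=> A [AD mA]; split; first exact: subDsetl.
    exact: (@measurableD _ (g_sigma_algebraType G)).
  - move=> A hA; split; first by apply: bigcup_sub => i _; have [] := hA i.
    by apply: sigma_algebra_bigcup => i; have [] := hA i.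
case=> BD mB.
suff H : <<s G >> `<=` [set B | <<s D, G >> (D `&` B)].
  by have := H _ mB; rewrite /= setIidr.
apply: smallest_sub; last first.
  by move=> C GC /=; rewrite setIidr; [exact: sub_sigma_algebra|exact: GD].
split.
- by rewrite /= setI0; exact: sigma_algebra0.
- move=> A /= /(@sigma_algebraCD _ D G); rewrite setDIr setDv set0U => h.
  by rewrite setTD -setDE.
- move=> A hA; rewrite /= setI_bigcupr; exact: sigma_algebra_bigcup.
Qed.

(** * Predictable processes *)

Section Predictable.
Context {R : realType} {dO : measure_display} {Omega : measurableType dO}.
Variables (T : \bar R) (F : R -> set (set Omega)).
Hypotheses (T_gt0 : (0 < T)%E) (filtF : is_filtration T F).

(** Projects a nonnegative number onto the dates, so that [cap n%:R], for integers n, is a cofinal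
    sequence of dates whether the horizon is finite or infinite. *)
Definition cap (x : R) : R := if T is t%:E then Num.min x t else x.

Lemma cap_date x : 0 <= x -> date T (cap x).
Proof.
rewrite /cap /date; move: T_gt0; case: T => [t||] //= t0 x0.
  rewrite lte_fin in t0; split; first by rewrite le_min x0 ltW.
  by rewrite lee_fin ge_min lexx orbT.
by split => //; rewrite leey.
Qed.

Lemma cap_id t : date T t -> cap t = t.
Proof.
by rewrite /cap => -[t0]; case: T => [s||] //; rewrite lee_fin => /min_idPl.
Qed.

Lemma le_cap x y : x <= y -> cap x <= cap y.
Proof. by rewrite /cap; case: T => [s||] // xy; rewrite le_min !ge_min xy lexx orbT. Qed.

Lemma cap_le x : cap x <= x.
Proof. by rewrite /cap; case: T => [s||] //; rewrite ge_min lexx. Qed.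

Lemma date0 : date T 0.
Proof. by split => //; exact: ltW. Qed.

Lemma date_le s t : date T t -> 0 <= s -> s <= t -> date T s.
Proof.
by move=> [_ tT] s0 st; split => //; rewrite (le_trans _ tT)// lee_fin.
Qed.

Definition dates : set (R * Omega) := date T `*` setT.

(** The rectangles generate an ordinary sigma-algebra on the whole of R x Omega. Its trace on
    [dates] is the one used by [predictable], so the theory of measurable functions applies to
    processes. *)
Definition PT := g_sigma_algebraType (predictable_rect T F).

Lemma filtT t : date T t -> F t setT.
Proof.
move=> dt; have [[F0 FC _] _] := filtF.1 t dt.
by have := FC _ F0; rewrite setD0.
Qed.

Lemma rect_dates C : predictable_rect T F C -> C `<=` dates.
Proof.
case=> [[A _ ->]|[s [t [A [ds dt st _ ->]]]]] [r w] /=.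
  by move=> [-> _]; split => //; exact: date0.
move=> [/=]; rewrite in_itv/= => /andP[sr rt] _; split => //.
by apply: (date_le dt) => //; rewrite (le_trans ds.1)// ltW.
Qed.

Lemma rect0_measurable A : F 0 A -> measurable ([set 0] `*` A : set PT).
Proof. by move=> FA; apply: sub_sigma_algebra; left; exists A. Qed.

Lemma rect_measurable s t A : date T s -> date T t -> F s A ->
  measurable (`]s, t] `*` A : set PT).
Proof.
move=> ds dt FA; have [st|ts] := ltP s t; last first.
  rewrite (_ : _ `*` _ = set0); first exact: measurable0.
  rewrite set_itv_ge ?set0X// -leNgt bnd_simp//.
by apply: sub_sigma_algebra; right; exists s, t, A.
Qed.

Lemma half_line_bigcup s : 0 <= s ->
  [set r | date T r /\ s < r] = \bigcup_n `]s, cap n%:R]%classic.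
Proof.
move=> s0; apply/seteqP; split => r /=.
  move=> [dr sr]; exists (Num.truncn r).+1 => //=; rewrite in_itv/= sr/=.
  by rewrite -{1}(cap_id dr) le_cap// ltW// truncnS_gt.
move=> [n _] /=; rewrite in_itv/= => /andP[sr rn]; split => //.
apply: (date_le (@cap_date n%:R _)) => //.
by rewrite (le_trans s0)// ltW.
Qed.

Lemma half_line_measurable s A : date T s -> F s A ->
  measurable ([set r | date T r /\ s < r] `*` A : set PT).
Proof.
move=> ds FA; rewrite half_line_bigcup; last exact: ds.1.
have -> : (\bigcup_n `]s, cap n%:R]%classic) `*` A = \bigcup_n (`]s, cap n%:R] `*` A).
  apply/seteqP; split=> [[r w] /= [[n _ rn] Aw]|[r w] [n _ [/= rn Aw]]].
    by exists n.
  by split => //; exists n.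
apply: bigcupT_measurable => n; apply: rect_measurable => //.
exact: cap_date.
Qed.

Lemma dates_measurable : measurable (dates : set PT).
Proof.
have -> : dates = [set 0] `*` setT `|` [set r | date T r /\ 0 < r] `*` setT.
  apply/seteqP; split => [[r w] [/= dr _]|[r w] /= [[-> _]|[[dr r0] _]]].
  - have [->|r0] := eqVneq r 0; [by left|right; split => //; split => //].
    by rewrite lt_neqAle eq_sym r0 dr.1.
  - by split => //; exact: date0.
  - by split.
apply: measurableU; first by apply: rect0_measurable; exact: (filtT date0).
by apply: half_line_measurable; [exact: date0|exact: (filtT date0)].
Qed.

Lemma predictableP (K : @process R dO Omega) :
  predictable T F K <-> measurable_fun (dates : set PT) (fun z : PT => K z.1 z.2).
Proof.
have H := g_sigma_restrict rect_dates dates_measurable.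
split.
  move=> pK _ Y mY.
  suff : <<s dates, predictable_rect T F >> (dates `&` (fun z => K z.1 z.2) @^-1` Y).
    by move=> /H[].
  by apply: pK; exists Y.
move=> mK _ [Y mY <-].
suff : <<s dates, predictable_rect T F >> (dates `&` (fun z => K z.1 z.2) @^-1` Y) by [].
by apply/H; split; [exact: subIsetl|exact: (mK dates_measurable)].
Qed.

Lemma wrtP t (dt : date T t) (f : Omega -> R) :
  wrt (F t) f <-> measurable_fun setT (f : g_sigma_algebraType (F t) -> R).
Proof.
have sF := (filtF.1 t dt).1.
have E : <<s F t >> = F t by exact: sigma_algebra_id.
split=> [h _ Y mY|h _ [Y mY <-]].
  by rewrite /measurable/= E; apply: h; exists Y.
by have := h measurableT _ mY; rewrite /measurable/= E.
Qed.

Lemma wrt_le s t (f : Omega -> R) : date T s -> date T t -> s <= t ->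
  wrt (F s) f -> wrt (F t) f.
Proof. by move=> ds dt st h A /h; exact: filtF.2. Qed.

Lemma wrt_measurable t (f : Omega -> R) : date T t -> wrt (F t) f ->
  measurable_fun setT f.
Proof.
by move=> dt h _ Y mY; apply: ((filtF.1 t dt).2); apply: h; exists Y.
Qed.

End Predictable.

Lemma lim_norm_le (R : realType) (f : nat -> R) (l c : R) :
  f n @[n --> \oo] --> l -> (forall n, `|f n| <= c) -> `|l| <= c.
Proof.
move=> fl fc; rewrite leNgt; apply/negP => cl.
have /cvgrPdist_lt /(_ (`|l| - c)) := fl.
rewrite subr_gt0 => /(_ cl) [N _ /(_ N (leqnn N))] /=.
have := fc N; have := ler_normD (l - f N) (f N); rewrite subrK => *; lra.
Qed.

(** * Bounded predictable processes as limits of dyadic step processes *)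

Section Closure.
Context {R : realType} {dO : measure_display} {Omega : measurableType dO}.
Variables (T : \bar R) (F : R -> set (set Omega)).
Hypotheses (T_gt0 : (0 < T)%E) (filtF : is_filtration T F).

Local Notation process := (@process R dO Omega).
Local Notation cap := (@cap R T).
Local Notation dates := (@dates R dO Omega T).
Local Notation PT := (@PT R dO Omega T F).
Implicit Types (K : process).

Definition bounded1 (K : process) := forall t w, date T t -> `|K t w| <= 1.

(** Dyadic points projected onto the dates: beyond a finite horizon the cells become empty, and no
    case distinction on T is needed. *)
Definition grid (n j : nat) : R := cap (j%:R / 2 ^+ n).

Lemma grid_date n j : date T (grid n j).
Proof. by apply: cap_date => //; rewrite divr_ge0// exprn_ge0. Qed.

Lemma grid_le n i j : (i <= j)%N -> grid n i <= grid n j.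
Proof. by move=> ij; apply: le_cap; rewrite ler_pM2r ?ler_nat// invr_gt0 exprn_gt0. Qed.

Lemma grid_refine n j : grid n.+1 j.*2 = grid n j.
Proof.
rewrite /grid; congr cap; rewrite -muln2 natrM exprS invfM.
by rewrite -mulrA mulVKf ?pnatr_eq0.
Qed.

Definition adapted1 t (c : Omega -> R) := wrt (F t) c /\ forall w, `|c w| <= 1.

(** A step process is described by its properties and not as a sum: refining the grid then leaves
    the function untouched, and two step processes are combined on a common grid. *)
Definition dsimple n N K :=
  [/\ adapted1 0 (K 0),
      forall j, (j < N)%N -> exists2 c, adapted1 (grid n j) c &
        forall t w, grid n j < t <= grid n j.+1 -> K t w = c w &
      forall t w, date T t -> grid n N < t -> K t w = 0].

Lemma adapted1_0 t : date T t -> adapted1 t (fun=> 0).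
Proof.
move=> dt; split; last by move=> w; rewrite normr0.
by apply/(wrtP filtF dt); exact: measurable_cst.
Qed.

Lemma dsimple_widen n N N' K : (N <= N')%N -> dsimple n N K -> dsimple n N' K.
Proof.
move=> NN [h0 h1 h2]; split => //.
- move=> j jN'; have [jN|Nj] := ltnP j N; first exact: h1.
  exists (fun=> 0); first exact: adapted1_0 (grid_date n j).
  move=> t w /andP[jt tj]; apply: h2.
    apply: (date_le (grid_date n j.+1)) => //.
    by rewrite (le_trans (grid_date n j).1)// ltW.
  by rewrite (le_lt_trans _ jt)// grid_le.
- move=> t w dt Nt; apply: h2 => //; apply: le_lt_trans Nt; exact: grid_le.
Qed.

Lemma adapted1_le s t c : date T s -> date T t -> s <= t ->
  adapted1 s c -> adapted1 t c.
Proof. by move=> ds dt st; case=> h1 h2; split => //; exact: (wrt_le filtF ds dt st). Qed.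

Lemma dsimple_refine n N K : dsimple n N K -> dsimple n.+1 N.*2 K.
Proof.
move=> [h0 h1 h2]; split => //; last by rewrite grid_refine.
move=> j jN; have jj : (j./2 < N)%N by rewrite -ltn_double (leq_ltn_trans _ jN)// -{2}(odd_double_half j) leq_addl.
have [c hc cK] := h1 _ jj.
have e : grid n j./2 <= grid n.+1 j.
  by rewrite -grid_refine grid_le// -{2}(odd_double_half j) leq_addl.
exists c.
  by apply: (adapted1_le (grid_date _ _) (grid_date _ _) e).
move=> t w /andP[jt tj]; apply: cK; rewrite (le_lt_trans e jt)/=.
rewrite (le_trans tj)// -[X in _ <= X]grid_refine grid_le//.
by rewrite doubleS -{1}(odd_double_half j) -addSn -(addn2 _) addnC leq_add2l; case: odd.
Qed.

Lemma dsimple_le n n' N K : (n <= n')%N -> dsimple n N K ->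
  exists N', dsimple n' N' K.
Proof.
move=> /subnK <-; elim: (n' - n)%N => [|m ih] h; first by exists N.
by have [N' h'] := ih h; exists N'.*2; exact: dsimple_refine.
Qed.

(** Quantified over the measurable space because it is applied to the sigma-algebras [F t] of all
    dates. *)
Definition measurable_op (op : R -> R -> R) :=
  forall d (Z : measurableType d) (f g : Z -> R), measurable_fun setT f ->
    measurable_fun setT g -> measurable_fun setT (fun z => op (f z) (g z)).

Lemma dsimple_op op n N K K' : measurable_op op -> op 0 0 = 0 ->
  (forall a b, `|op a b| <= 1) ->
  dsimple n N K -> dsimple n N K' -> dsimple n N (fun t w => op (K t w) (K' t w)).
Proof.
move=> mop op0 op1 [h0 h1 h2] [h0' h1' h2'].
have A t c c' : date T t -> adapted1 t c -> adapted1 t c' ->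
    adapted1 t (fun w => op (c w) (c' w)).
  move=> dt [mc _] [mc' _]; split => //.
  by apply/(wrtP filtF dt); apply: mop; exact/(wrtP filtF dt).
split.
- exact: A (date0 T_gt0) _ _.
- move=> j jN; have [c hc cK] := h1 _ jN; have [c' hc' cK'] := h1' _ jN.
  exists (fun w => op (c w) (c' w)); first exact: A (grid_date _ _) _ _.
  by move=> t w jt; rewrite cK// cK'.
- by move=> t w dt Nt; rewrite h2// h2'.
Qed.

Definition limit_closed (Pr : process -> Prop) :=
  forall (Kn : nat -> process) K, (forall n, Pr (Kn n)) ->
    (forall n, bounded1 (Kn n)) ->
    (forall t w, date T t -> Kn n t w @[n --> \oo] --> K t w) -> Pr K.

Definition date_ext (Pr : process -> Prop) :=
  forall K K', (forall t w, date T t -> K t w = K' t w) -> Pr K -> Pr K'.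

(** The smallest class that contains the dyadic step processes and is stable under bounded pointwise
    limits and changes off the dates. In this impredicative form a membership proof is its own
    induction principle. *)
Definition CL K := forall Pr : process -> Prop,
  (forall n N K, dsimple n N K -> Pr K) -> date_ext Pr -> limit_closed Pr -> Pr K.

Lemma CL_dsimple n N K : dsimple n N K -> CL K.
Proof. by move=> h Pr h1 _ _; exact: h1 h. Qed.

Lemma CL_ext : date_ext CL.
Proof. by move=> K K' KK' h Pr h1 h2 h3; apply: (h2 K) => //; exact: h. Qed.

Lemma CL_lim : limit_closed CL.
Proof. by move=> Kn K h b l Pr h1 h2 h3; apply: (h3 Kn) => // n; exact: h. Qed.

Lemma dsimple_bounded n N K : dsimple n N K -> bounded1 K.
Proof.
move=> [h0 h1 h2] t w dt.
have [Nt|tN] := ltP (grid n N) t; first by rewrite h2 ?normr0.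
have [->|t0] := eqVneq t 0; first exact: h0.2.
have : exists j, [&& (j < N)%N, grid n j < t & t <= grid n j.+1].
  elim: N tN {h1 h2} => [|N ih] tN.
    move: t0; rewrite eq_le dt.1 andbT (le_trans tN)//.
    by rewrite /grid mul0r cap_le.
  have [Nt|/ih[j /and3P[jN ? ?]]] := ltP (grid n N) t; first by exists N; rewrite ltnSn Nt.
  by exists j; apply/and3P; split => //; exact: ltnW.
case=> j /and3P[jN jt tj]; have [c [_ c1] cK] := h1 _ jN.
by rewrite cK ?jt.
Qed.

Lemma dsimple_predictable n N K : dsimple n N K -> predictable T F K.
Proof.
move=> [h0 h1 h2]; apply/(predictableP T_gt0 filtF).
have mD : measurable (dates : set PT) by exact: dates_measurable.
have aux (A : set PT) (I : set R) c t : date T t -> adapted1 t c ->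
    (forall B, F t B -> measurable (I `*` B : set PT)) -> A = I `*` setT ->
    (forall z : PT, A z -> K z.1 z.2 = c z.2) ->
    measurable_fun A (fun z : PT => K z.1 z.2).
  move=> dt [mc _] mI -> Kc _ Y mY.
  have -> : I `*` setT `&` (fun z : PT => K z.1 z.2) @^-1` Y = I `*` (c @^-1` Y).
    apply/seteqP; split => [[r w] [[/= Ir _]]|[r w] /= [Ir cY]] /=.
      by rewrite (Kc (r, w)).
    by split => //; rewrite (Kc (r, w)).
  by apply: mI; apply: mc; exists Y => //; rewrite setTI.
(* Time 0, the cells and the final half line cover the dates; on each piece K depends on the outcome
   alone, through a variable known at the left end. *)
pose E j : set PT := match j with 0 => [set 0] `*` setT
  | j.+1 => if (j < N)%N then `]grid n j, grid n j.+1] `*` setT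
            else [set r | date T r /\ grid n N < r] `*` setT end.
have mE j : measurable (E j) /\ measurable_fun (E j) (fun z : PT => K z.1 z.2).
  case: j => [|j]; rewrite /E.
    split; first by apply: rect0_measurable; exact: (filtT filtF (date0 T_gt0)).
    apply: (aux _ [set 0] (K 0) 0 (date0 T_gt0)) => //.
      by move=> B; exact: rect0_measurable.
    by move=> [r w] /= [-> _].
  case: ifPn => [jN|_].
    have [c hc cK] := h1 _ jN; split.
      apply: rect_measurable; [exact: grid_date|exact: grid_date|].
      exact: (filtT filtF (grid_date _ _)).
    apply: (aux _ `]grid n j, grid n j.+1]%classic c (grid n j) (grid_date _ _)) => //.
      by move=> B; apply: rect_measurable; exact: grid_date.
    by move=> [r w] /= [/=]; rewrite in_itv/= => h _; exact: cK.
  split.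
    apply: half_line_measurable; [by []|exact: grid_date|].
    exact: (filtT filtF (grid_date _ _)).
  apply: (aux _ [set r | date T r /\ grid n N < r] (fun=> 0) (grid n N) (grid_date _ _)) => //.
  - exact: adapted1_0 (grid_date _ _).
  - by move=> B; apply: half_line_measurable => //; exact: grid_date.
  - by move=> [r w] [/= [dr Nr] _]; exact: h2.
have -> : dates = \bigcup_j (E j).
  apply/seteqP; split => [[t w] [/= dt _]|[t w] [j _]].
    have [->|t0] := eqVneq t 0; first by exists 0%N.
    have [Nt|tN] := ltP (grid n N) t.
      by exists N.+1 => //; rewrite /E ltnn.
    have : exists j, [&& (j < N)%N, grid n j < t & t <= grid n j.+1].
      elim: N tN {h1 h2 E mE} => [|N ih] tN.
        move: t0; rewrite eq_le dt.1 andbT (le_trans tN)//.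
        by rewrite /grid mul0r cap_le.
      have [Nt|/ih[j /and3P[jN ? ?]]] := ltP (grid n N) t; first by exists N; rewrite ltnSn Nt.
      by exists j; apply/and3P; split => //; exact: ltnW.
    by case=> j /and3P[jN jt tj]; exists j.+1 => //; rewrite /E jN; split => //=; rewrite in_itv/= jt.
  case: j => [|j]; rewrite /E.
    by move=> [/= -> _]; split => //; exact: date0.
  case: ifPn => [jN [/=]|_ [/= []]//].
  rewrite in_itv/= => /andP[jt tj] _; split => //.
  apply: (date_le (grid_date n j.+1)) => //.
  by rewrite (le_trans (grid_date n j).1)// ltW.
by apply/measurable_fun_bigcup => j; have [] := mE j.
Qed.

Lemma predictable_ext : date_ext (predictable T F).
Proof.
move=> K K' KK' /(predictableP T_gt0 filtF) pK; apply/(predictableP T_gt0 filtF).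
apply: eq_measurable_fun pK => -[t w]; rewrite inE => -[/= dt _]; exact: KK'.
Qed.

Lemma predictable_lim (Kn : nat -> process) K :
  (forall n, predictable T F (Kn n)) ->
  (forall t w, date T t -> Kn n t w @[n --> \oo] --> K t w) -> predictable T F K.
Proof.
move=> pK l; apply/(predictableP T_gt0 filtF).
apply: (@measurable_fun_cvg _ _ _ _ (fun n (z : PT) => Kn n z.1 z.2)).
  by move=> n; exact/(predictableP T_gt0 filtF).
by move=> [t w] [/= dt _]; exact: l.
Qed.

Lemma CL_predictable K : CL K -> predictable T F K.
Proof.
move=> h; apply: (h (predictable T F)); first by move=> *; apply: dsimple_predictable; eassumption.
  exact: predictable_ext.
by move=> Kn K0 pK _ l; exact: predictable_lim pK l.
Qed.

Lemma CL_bounded K : CL K -> bounded1 K.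
Proof.
move=> h; apply: (h bounded1); first by move=> *; apply: dsimple_bounded; eassumption.
  by move=> K1 K2 KK h' t w dt; rewrite -KK ?h'.
move=> Kn K0 _ b l t w dt; apply: (lim_norm_le (l t w dt)) => n; exact: b.
Qed.

(** Two-step monotone class argument: one argument is kept a step process while the other passes to
    limits, then the roles change. The condition [op 0 0 = 0] keeps the result zero beyond the last
    cell. *)
Lemma CL_op op K K' : measurable_op op -> op 0 0 = 0 ->
  (forall a b, `|op a b| <= 1) -> (forall a, continuous (op a)) ->
  (forall b, continuous (op^~ b)) ->
  CL K -> CL K' -> CL (fun t w => op (K t w) (K' t w)).
Proof.
move=> mop op0 op1 cr cl CK CK'.
suff H n N K2 : dsimple n N K2 -> CL (fun t w => op (K t w) (K2 t w)).
  apply: (CK' (fun K' => CL (fun t w => op (K t w) (K' t w)))) => //.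
    by move=> K1 K2 KK; apply: CL_ext => t w dt; rewrite KK.
  move=> Kn K0 h b l; apply: CL_lim h _ _; first by move=> n t w _; exact: op1.
  by move=> t w dt; apply: continuous_cvg; [exact: cr|exact: l].
move=> h2.
apply: (CK (fun K => CL (fun t w => op (K t w) (K2 t w)))).
- move=> n1 N1 K1 h1.
  have [M1 g1] := dsimple_le (leq_maxl n1 n) h1.
  have [M2 g2] := dsimple_le (leq_maxr n1 n) h2.
  apply: (@CL_dsimple (maxn n1 n) (maxn M1 M2)); apply: dsimple_op => //.
    by apply: dsimple_widen g1; exact: leq_maxl.
  by apply: dsimple_widen g2; exact: leq_maxr.
- by move=> K1 K3 KK; apply: CL_ext => t w dt; rewrite KK.
- move=> Kn K0 h b l; apply: CL_lim h _ _; first by move=> m t w _; exact: op1.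
  by move=> t w dt; apply: (@continuous_cvg _ _ _ _ _ _ (op^~ (K2 t w))); [exact: cl|exact: l].
Qed.

Definition clip (L x : R) : R := Num.max (- L) (Num.min L x).

Lemma clip_id L x : `|x| <= L -> clip L x = x.
Proof. by rewrite ler_norml /clip => /andP[? ?]; rewrite min_r// max_r. Qed.

Lemma clip_bound L x : 0 <= L -> `|clip L x| <= L.
Proof.
move=> L0; rewrite /clip ler_norml le_max lexx/= ge_max; apply/andP; split; first lra.
by rewrite ge_min lexx.
Qed.

Lemma clip_continuous L : continuous (clip L).
Proof.
move=> x; apply: (@continuous_max R _ (fun _ => - L) (fun x => Num.min L x)); first exact: cvg_cst.
by apply: (@continuous_min R _ (fun _ => L) (fun x => x)); [exact: cvg_cst|exact: cvg_id].
Qed.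

(** Members of [CL] are bounded by 1, so linear combinations have to be clipped. On indicators the
    clipping is invisible in differences of nested sets and turns a sum into the indicator of the
    union. *)
Lemma CL_clip (a b : R) K K' : CL K -> CL K' ->
  CL (fun t w => clip 1 (a * K t w + b * K' t w)).
Proof.
apply: (@CL_op (fun x y => clip 1 (a * x + b * y))).
- move=> d Z f g mf mg; rewrite /clip.
  apply: measurable_maxr => //; apply: measurable_minr => //.
  by apply: measurable_funD; exact: measurable_funM.
- by rewrite !mulr0 addr0 clip_id// normr0.
- by move=> *; exact: clip_bound.
- move=> x y; apply: (@continuous_comp _ _ _ (fun y => a * x + b * y) (clip 1)); last exact: clip_continuous.
  by apply: cvgD; [exact: cvg_cst|apply: cvgM; [exact: cvg_cst|exact: cvg_id]].
- move=> y x; apply: (@continuous_comp _ _ _ (fun x => a * x + b * y) (clip 1)); last exact: clip_continuous.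
  by apply: cvgD; [apply: cvgM; [exact: cvg_cst|exact: cvg_id]|exact: cvg_cst].
Qed.

Definition ind (B : set (R * Omega)) : process := fun t w => \1_B (t, w).

Lemma ind_in B t w : B (t, w) -> ind B t w = 1.
Proof. by move=> h; rewrite /ind indicE mem_set. Qed.

Lemma ind_out B t w : ~ B (t, w) -> ind B t w = 0.
Proof. by move=> h; rewrite /ind indicE memNset. Qed.

Lemma ind_bounded B t w : `|ind B t w| <= 1.
Proof. by rewrite /ind indicE; case: (_ \in _); rewrite ?normr1 ?normr0. Qed.

Lemma dsimple_cells n N j A : F (grid n j) A -> 
  dsimple n N (ind [set z | grid n j < z.1 <= grid n N /\ A z.2]).
Proof.
move=> FA; split.
- rewrite (_ : ind _ 0 = fun=> 0); first exact: adapted1_0 (date0 T_gt0).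
  apply/funext => w; apply: ind_out => /= -[/andP[j0 _] _].
  by have := (grid_date n j).1; rewrite leNgt j0.
- move=> i iN; have [ji|ij] := leqP j i.
    have FiA : F (grid n i) A.
      exact: (filtF.2 (grid n j) (grid n i) (grid_date _ _) (grid_date _ _) (grid_le _ ji)).
    exists (\1_A); first split.
    + apply/(wrtP filtF (grid_date n i)); apply: measurable_indic.
      by rewrite /measurable/=; exact: sub_sigma_algebra.
    + by move=> w; rewrite indicE; case: (_ \in _); rewrite ?normr1 ?normr0.
    move=> t w /andP[it ti]; rewrite /ind !indicE; congr ((_ : bool)%:R).
    apply/idP/idP; rewrite !inE /=; first by case.
    move=> Aw; split => //.
    by rewrite (le_lt_trans _ it) ?grid_le//= (le_trans ti)// grid_le.
  exists (fun=> 0); first exact: adapted1_0 (grid_date _ _).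
  move=> t w /andP[it ti]; apply: ind_out => /= -[/andP[jt _] _].
  by have := lt_le_trans jt (le_trans ti (grid_le _ ij)); rewrite ltxx.
- move=> t w dt Nt; apply: ind_out => /= -[/andP[_ tN] _].
  by move: (le_lt_trans tN Nt); rewrite ltxx.
Qed.

Lemma cvg_near_eq (f : nat -> R) (l : R) :
  (\forall n \near \oo, f n = l) -> f n @[n --> \oo] --> l.
Proof. by move=> h; apply/cvgrPdist_lt => e e0; apply: filterS h => n ->; rewrite subrr normr0. Qed.

(** The start s is approached from the right by grid points, at which A, known at time s, is known
    as well. *)
Lemma CL_half_line s A : date T s -> F s A ->
  CL (ind [set z | date T z.1 /\ s < z.1 /\ A z.2]).
Proof.
move=> ds FA.
pose j n := (Num.truncn (s * 2 ^+ n)).+1.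
have j1 n : s < (j n)%:R / 2 ^+ n.
  by rewrite ltr_pdivlMr ?exprn_gt0// truncnS_gt.
have j2 n : (j n)%:R / 2 ^+ n <= s + 2 ^- n.
  rewrite ler_pdivrMr ?exprn_gt0// mulrDl mulVf ?expf_neq0 ?pnatr_eq0//.
  by rewrite /j -natr1 lerD2r truncn_le mulr_ge0 ?exprn_ge0// ds.1.
have sj n : s <= grid n (j n) by rewrite -{1}(cap_id ds) le_cap// ltW.
(* The right end is [cap n%:R], which eventually reaches every given date. *)
apply: (@CL_lim (fun n => ind [set z | grid n (j n) < z.1 <= grid n (n * 2 ^ n) /\ A z.2])).
- move=> n; apply: (@CL_dsimple n (n * 2 ^ n)); apply: dsimple_cells.
  by apply: (filtF.2 s _ ds (grid_date _ _) (sj n)).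
- by move=> n t w _; exact: ind_bounded.
- move=> t w dt; apply: cvg_near_eq.
  have [[st Aw]|nA] := pselect (s < t /\ A w); last first.
    apply: nearW => n; rewrite !ind_out//=; first by move=> -[_].
    move=> -[/andP[jt _] Aw]; apply: nA; split => //.
    by apply: le_lt_trans jt.
  have : \forall n \near \oo, (2 ^- n : R) < t - s.
    have /cvgrPdist_lt /(_ (t - s)) : ((2^-1 : R) ^+ n) @[n --> \oo] --> (0 : R).
      by apply: cvg_expr; rewrite ger0_norm ?invr_ge0// invf_lt1// ltr1n.
    rewrite subr_gt0 => /(_ st); apply: filterS => n.
    by rewrite sub0r normrN exprVn ger0_norm// invr_ge0 exprn_ge0.
  move=> hn; near=> n.
  rewrite !ind_in//=; split => //.
  have dg : grid n (j n) < t.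
    rewrite (le_lt_trans (cap_le _ _))// (le_lt_trans (j2 n))//.
    by rewrite -ltrBrDl; near: n.
  rewrite dg /= /grid natrM natrX mulfK ?expf_neq0 ?pnatr_eq0//.
  rewrite -{1}(cap_id dt) le_cap//; near: n; exact: nbhs_infty_ger.
Unshelve. all: by end_near. Qed.

Lemma CL0 : CL (fun _ _ => 0).
Proof.
apply: (@CL_dsimple 0 0); split => //; exact: adapted1_0 (date0 T_gt0).
Qed.

Lemma CL_rect0 A : F 0 A -> CL (ind ([set 0] `*` A)).
Proof.
move=> FA; apply: (@CL_dsimple 0 0); split => //.
  split; last by move=> w; exact: ind_bounded.
  rewrite (_ : ind _ 0 = \1_A).
    apply/(wrtP filtF (date0 T_gt0)); apply: measurable_indic.
    by rewrite /measurable/=; exact: sub_sigma_algebra.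
  by apply/funext => w; rewrite /ind !indicE; congr ((_ : bool)%:R); apply/idP/idP; rewrite !inE => //= -[].
move=> t w dt; rewrite /grid mul0r => t0; apply: ind_out => /= -[t00 _].
by move: t0; rewrite t00 cap_id ?ltxx//; exact: date0.
Qed.

Lemma CL_dates : CL (ind dates).
Proof.
have h0 := CL_rect0 (filtT filtF (date0 T_gt0)).
have h1 := CL_half_line (date0 T_gt0) (filtT filtF (date0 T_gt0)).
apply: CL_ext (CL_clip 1 1 h0 h1) => t w dt; rewrite !mul1r (@ind_in dates)//.
have [t0|t0] := eqVneq t 0.
  rewrite (@ind_in (_ `*` _))// ?ind_out ?addr0 ?clip_id ?normr1//=; last first.
    by move=> [_ [+ _]]; rewrite t0 ltxx.
rewrite (@ind_out (_ `*` _))// ?ind_in ?add0r ?clip_id ?normr1//=.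
- by split => //; split => //; rewrite lt_neqAle eq_sym t0 dt.1.
- by move=> [/= + _]; move/eqP: t0.
Qed.

Lemma CL_setD B : CL (ind B) -> CL (ind (dates `\` B)).
Proof.
move=> h; apply: CL_ext (CL_clip 1 (-1) CL_dates h) => t w dt.
rewrite (@ind_in dates)//; have [Bt|Bt] := pselect (B (t, w)).
  by rewrite ind_in// ind_out ?mulN1r ?mulr1 ?subrr ?clip_id ?normr0//= => -[].
by rewrite ind_out// (@ind_in (_ `\` _)) ?mulr0 ?mulr1 ?addr0 ?clip_id ?normr1.
Qed.

Lemma CL_setU B C : CL (ind B) -> CL (ind C) -> CL (ind (B `|` C)).
Proof.
move=> hB hC; apply: CL_ext (CL_clip 1 1 hB hC) => t w dt; rewrite !mul1r.
rewrite /ind !indicE in_setU; case: (_ \in B); case: (_ \in C) => /=.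
- by rewrite /clip min_l ?max_r//; lra.
- by rewrite addr0 clip_id// normr1.
- by rewrite add0r clip_id// normr1.
- by rewrite add0r clip_id// normr0.
Qed.

Lemma CL_bigcup (B : nat -> set (R * Omega)) : (forall n, CL (ind (B n))) ->
  CL (ind (\bigcup_n B n)).
Proof.
move=> h.
apply: (@CL_lim (fun n => ind (\bigcup_(i < n) B i))).
- elim=> [|n ih].
    rewrite bigcup_mkord big_ord0; apply: CL_ext CL0 => t w _.
    by rewrite ind_out.
  by rewrite bigcup_mkord big_ord_recr/= -bigcup_mkord; exact: CL_setU.
- by move=> n t w _; exact: ind_bounded.
- move=> t w _; apply: cvg_near_eq.
  have [[k _ Bk]|nB] := pselect ((\bigcup_n B n) (t, w)).
    near=> n; rewrite !ind_in//; first by exists k.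
    by exists k => //=; near: n; exact: nbhs_infty_gt.
  by apply: nearW => n; rewrite !ind_out// => -[i _ Bi]; apply: nB; exists i.
Unshelve. all: by end_near. Qed.

Lemma CL_measurable B : B `<=` dates -> measurable (B : set PT) -> CL (ind B).
Proof.
move=> BD mB.
have /(g_sigma_restrict (rect_dates T_gt0) (dates_measurable T_gt0 filtF)) : B `<=` dates /\ <<s predictable_rect T F >> B by split.
suff H : <<s dates, predictable_rect T F >> `<=` [set B | CL (ind B)] by move=> /H.
apply: smallest_sub.
  split; first by apply: CL_ext CL0 => t w _; rewrite ind_out.
  - by move=> A; exact: CL_setD.
  - by move=> A; exact: CL_bigcup.
move=> C [[A FA ->]|[s [t [A [ds dt st FA ->]]]]]; first exact: CL_rect0.
have h1 := CL_half_line ds FA.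
have h2 := CL_half_line dt (filtF.2 s t ds dt (ltW st) _ FA).
apply: CL_ext (CL_setD (CL_setU (CL_setD h1) h2)) => r w dr.
have [rC|rC] := pselect ((`]s, t] `*` A) (r, w)).
  rewrite !ind_in//; move: rC => [/=]; rewrite in_itv/= => /andP[sr rt] Aw.
  split=> // -[[_]|[_ [tr _]]]; first by apply.
  by move: (lt_le_trans tr rt); rewrite ltxx.
rewrite !ind_out// => -[_ /= h]; apply: rC; rewrite /= in_itv/=.
apply: contrapT => nC; apply: h; have [tr|rt] := ltP t r.
  have [Aw|nAw] := pselect (A w); first by right.
  by left; split => // -[_ []].
by left; split => // -[_ [sr Aw]]; apply: nC; rewrite sr rt.
Qed.

(** Binary expansion: the approximation L is raised by 2^-(n+1) exactly where it does not thereby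
    exceed K, and the error stays in [0, 2^-n]. *)
Lemma predictable_CL01 K : predictable T F K ->
  (forall t w, date T t -> 0 <= K t w <= 1) -> CL K.
Proof.
move=> pK K01.
have : exists Kn : nat -> process, forall n, CL (Kn n) /\
    (forall t w, date T t -> 0 <= K t w - Kn n t w <= 2 ^- n).
  suff /choice[Kn hK] : forall n, exists L : process, CL L /\
    (forall t w, date T t -> 0 <= K t w - L t w <= 2 ^- n) by exists Kn.
  elim=> [|n [L [CLL hL]]].
    exists (fun _ _ => 0); split; first exact: CL0.
    by move=> t w dt; rewrite subr0 expr0 invr1 K01.
  pose B : set (R * Omega) := dates `&` [set z | L z.1 z.2 + 2 ^- n.+1 <= K z.1 z.2].
  have mB : measurable (B : set PT).
    have mL := (predictableP T_gt0 filtF L).1 (CL_predictable CLL).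
    have mK := (predictableP T_gt0 filtF K).1 pK.
    have := @measurable_fun_ler _ PT R dates (fun z => L z.1 z.2 + 2 ^- n.+1) (fun z => K z.1 z.2).
    move=> /(_ _ mK (dates_measurable T_gt0 filtF) [set true]) h; apply: h => //.
    by apply: measurable_funD => //; exact: measurable_cst.
  have CB := CL_measurable (@subIsetl _ _ _) mB.
  exists (fun t w => clip 1 (1 * L t w + 2 ^- n.+1 * ind B t w)).
  split; first exact: CL_clip.
  move=> t w dt; have := hL t w dt; have := K01 t w dt; have := CL_bounded CLL w dt.
  have -> : (2 ^- n : R) = 2 ^- n.+1 + 2 ^- n.+1.
    by rewrite exprS invfM; field; rewrite expf_neq0 ?pnatr_eq0.
  have : 0 < (2 ^- n.+1 : R) by rewrite invr_gt0 exprn_gt0.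
  set e := 2 ^- n.+1; rewrite ler_norml mul1r => e0 /andP[L1 L2] /andP[K1 K2] /andP[h1 h2].
  have [Bt|Bt] := pselect (L t w + e <= K t w).
    rewrite ind_in// mulr1 clip_id ?ler_norml; last by apply/andP; split; lra.
    by apply/andP; split; lra.
  rewrite ind_out ?mulr0 ?addr0 ?clip_id ?ler_norml; last 2 first.
    by rewrite L1.
    by move=> [_ /=].
  by move/negP: Bt; rewrite -ltNge => Bt; apply/andP; split; lra.
move=> [Kn hK]; apply: (@CL_lim Kn).
- by move=> n; have [] := hK n.
- by move=> n; apply: CL_bounded; have [] := hK n.
- move=> t w dt; apply/cvgrPdist_le => e e0; near=> n.
  have /andP[h1 h2] := (hK n).2 t w dt; rewrite ger0_norm// (le_trans h2)//.
  near: n.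
  have /cvgrPdist_lt /(_ e e0) : ((2^-1 : R) ^+ n) @[n --> \oo] --> (0 : R).
    by apply: cvg_expr; rewrite ger0_norm ?invr_ge0// invf_lt1// ltr1n.
  apply: filterS => n.
  by rewrite sub0r normrN exprVn ger0_norm ?invr_ge0 ?exprn_ge0// => /ltW.
Unshelve. all: by end_near. Qed.

Lemma predictable_CL K : predictable T F K -> bounded1 K -> CL K.
Proof.
move=> pK K1.
have h : CL (fun t w => (K t w + 1) / 2).
  apply: predictable_CL01.
    apply/(predictableP T_gt0 filtF); apply: measurable_funM; last exact: measurable_cst.
    by apply: measurable_funD; [exact/(predictableP T_gt0 filtF)|exact: measurable_cst].
  by move=> t w dt; have := K1 t w dt; rewrite ler_norml => /andP[? ?]; apply/andP; split; lra.
apply: CL_ext (CL_clip 2 (-1) h CL_dates) => t w dt.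
rewrite ind_in// mulr1 (_ : 2 * _ + _ = K t w); last by field.
by rewrite clip_id// K1.
Qed.

End Closure.

Section AtLeftRight.
Context {R : realType}.

Lemma near_rightP (t : R) (P : R -> Prop) : (\forall s \near t^'+, P s) ->
  exists2 e, 0 < e & forall s, t < s < t + e -> P s.
Proof.
rewrite /at_right => /nbhs_ballP[e /= e0 h]; exists e => // s /andP[ts se].
by apply: h => //=; rewrite /ball/= ltr_norml; apply/andP; split; lra.
Qed.

Lemma near_leftP (t : R) (P : R -> Prop) : (\forall s \near t^'-, P s) ->
  exists2 e, 0 < e & forall s, t - e < s < t -> P s.
Proof.
rewrite /at_left => /nbhs_ballP[e /= e0 h]; exists e => // s /andP[ts se].
by apply: h => //=; rewrite /ball/= ltr_norml; apply/andP; split; lra.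
Qed.

End AtLeftRight.

(** * Elementary integrands and induction over predictable processes *)

Section Elementary.
Context {R : realType} {dO : measure_display} {Omega : measurableType dO}.
Variables (T : \bar R) (F : R -> set (set Omega)).
Hypotheses (T_gt0 : (0 < T)%E) (filtF : is_filtration T F).
Local Notation process := (@process R dO Omega).
Local Notation PT := (@PT R dO Omega T F).
Local Notation dates := (@dates R dO Omega T).
Implicit Types (K L X Y Z : process).

Lemma dsimple_elementary n N K : dsimple T F n N K ->
  exists2 e, elementary_integrand T F e &
    forall t w, date T t -> el_val e t w = K t w.
Proof.
move=> sK; have [h0 h1 h2] := sK.
have /choice[c hc] : forall j, exists c : Omega -> R, (j < N)%N ->
    adapted1 F (grid T n j) c /\
    (forall t w, grid T n j < t <= grid T n j.+1 -> K t w = c w).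
  move=> j; have [jN|_] := boolP (j < N)%N; last by exists (fun=> 0).
  by have [c c1 c2] := h1 j jN; exists c.
pose e := Elementary N (K 0) (grid T n) (fun j => grid T n j.+1) c.
exists e.
  split; [exact: h0.1|by exists 1; exact: h0.2|].
  move=> i iN; have [[c1 c2] _] := hc i iN; split => //.
  - exact: grid_date.
  - exact: grid_date.
  - exact: grid_le.
  - by exists 1.
move=> t w dt; rewrite /el_val /=.
have [->|t0] := eqVneq t 0.
  rewrite mulr1 big1 ?addr0// => i _.
  by rewrite ltNge (grid_date T_gt0 n i).1/= mulr0.
rewrite mulr0 add0r.
have [Nt|tN] := ltP (grid T n N) t.
  rewrite h2// big1// => i _; rewrite (_ : (t <= _) = false) ?andbF ?mulr0//.
  by apply/negbTE; rewrite -ltNge (le_lt_trans _ Nt)// grid_le.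
have [j /and3P[jN jt tj]] : exists j, [&& (j < N)%N, grid T n j < t & t <= grid T n j.+1].
  elim: N tN {h1 h2 hc sK e} => [|M ih] tN.
    move: t0; rewrite eq_le dt.1 andbT (le_trans tN)//.
    by rewrite /grid mul0r cap_le.
  have [Nt|/ih[j /and3P[jN ? ?]]] := ltP (grid T n M) t; first by exists M; rewrite ltnSn Nt.
  by exists j; apply/and3P; split => //; exact: ltnW.
rewrite (bigD1 (Ordinal jN))//= jt tj/= mulr1 big1 ?addr0; last first.
  move=> i; rewrite -val_eqE/= => ij.
  have [it|] := ltP (grid T n i) t; last by rewrite mulr0.
  have [ti|] := leP t (grid T n i.+1); last by rewrite mulr0.
  exfalso; move: ij; rewrite neq_ltn => /orP[ij|ij].
    by have := le_lt_trans (le_trans ti (grid_le T n ij)) jt; rewrite ltxx.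
  by have := le_lt_trans (le_trans tj (grid_le T n ij)) it; rewrite ltxx.
by have [_ ->//] := hc j jN; rewrite jt.
Qed.

Lemma el_val_bounded e : elementary_integrand T F e ->
  exists c, forall t w, `|el_val e t w| <= c.
Proof.
move=> [_ [c0 hc0] h].
have : forall i : 'I_(el_size e), exists c, forall w, `|el_c e i w| <= c.
  by move=> i; have [_ _ _ _ hc] := h i (ltn_ord i).
move=> /choice[c hc].
exists (c0 + \sum_(i < el_size e) c i) => t w.
have b (x : R) (b : bool) y : `|x| <= y -> `|x * b%:R| <= y.
  by case: b => /=; rewrite ?mulr1// mulr0 normr0; apply: le_trans.
rewrite /el_val (le_trans (ler_normD _ _))// lerD ?b//.
by rewrite (le_trans (ler_norm_sum _ _ _))// ler_sum// => i _; exact: b.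
Qed.

Lemma cell_predictable s t c : date T s -> date T t -> wrt (F s) c ->
  predictable T F (fun r w => c w * (s < r <= t)%R%:R).
Proof.
move=> ds dt mc; apply/(predictableP T_gt0 filtF) => _ Y mY.
pose S := [set r : R | s < r <= t].
have mI B : F s B -> measurable (S `*` B : set PT).
  rewrite (_ : S = `]s, t]%classic); first exact: rect_measurable.
  by apply/seteqP; split => r /=; rewrite in_itv.
have Sd r : S r -> date T r.
  by move=> /andP[sr rt]; apply: (date_le dt) => //; rewrite (le_trans ds.1)// ltW.
have mcY : F s (c @^-1` Y) by apply: mc; exists Y => //; rewrite setTI.
have mD := dates_measurable T_gt0 filtF.
have mST := mI _ (filtT filtF ds).
have [Y0|Y0] := pselect (Y 0).
  rewrite (_ : _ `&` _ = (S `*` (c @^-1` Y)) `|` (dates `\` (S `*` setT))).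
    by apply: measurableU; [exact: mI|exact: measurableD].
  apply/seteqP; split => [[r w] [/= [dr _]]|[r w]].
    case: (boolP (s < r <= t)) => rS; rewrite ?mulr1 ?mulr0 => cY; [left|right].
      by split.
    by split => // -[/= rS2 _]; rewrite rS2 in rS.
  case=> [[/= rS cY]|[[/= dr _] h]].
    by split; [split => //; exact: Sd|rewrite rS mulr1].
  split; first by split.
  case: (boolP (s < r <= t)) => rS; rewrite ?mulr0//.
  by exfalso; apply: h.
rewrite (_ : _ `&` _ = S `*` (c @^-1` Y)); first exact: mI.
apply/seteqP; split => [[r w] [/= [dr _]]|[r w] [/= rS cY]].
  by case: (boolP (s < r <= t)) => rS; rewrite ?mulr1 ?mulr0 => cY.
by split; [split => //; exact: Sd|rewrite rS mulr1].
Qed.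

Lemma predictable_cst (c : R) : predictable T F (fun _ _ => c).
Proof. by apply/(predictableP T_gt0 filtF); exact: measurable_cst. Qed.

Lemma predictableD K L : predictable T F K -> predictable T F L ->
  predictable T F (fun t w => K t w + L t w).
Proof.
move=> /(predictableP T_gt0 filtF) pK /(predictableP T_gt0 filtF) pL.
by apply/(predictableP T_gt0 filtF); exact: measurable_funD.
Qed.

Lemma predictableM K L : predictable T F K -> predictable T F L ->
  predictable T F (fun t w => K t w * L t w).
Proof.
move=> /(predictableP T_gt0 filtF) pK /(predictableP T_gt0 filtF) pL.
by apply/(predictableP T_gt0 filtF); exact: measurable_funM.
Qed.

Lemma predictable_sum n (K : 'I_n -> process) :
  (forall i, predictable T F (K i)) ->
  predictable T F (fun t w => \sum_(i < n) K i t w).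
Proof.
move=> h; have h' : forall i, predictable T F (K i) by [].
elim: n K h h' => [|n ih] K h _.
  rewrite (_ : (fun _ _ => _) = fun _ _ => 0); first exact: predictable_cst.
  by apply/funext => t; apply/funext => w; rewrite big_ord0.
rewrite (_ : (fun _ _ => _) = fun t w => \sum_(i < n) K (widen_ord (leqnSn n) i) t w + K ord_max t w).
  by apply: predictableD => //; apply: ih => i; exact: h.
by apply/funext => t; apply/funext => w; rewrite big_ord_recr.
Qed.

Lemma predictable_borel (f : R -> R) K : measurable_fun setT f ->
  predictable T F K -> predictable T F (fun t w => f (K t w)).
Proof.
move=> mf /(predictableP T_gt0 filtF) pK; apply/(predictableP T_gt0 filtF).
exact: (measurableT_comp mf pK).
Qed.

Lemma predictable_ind (B : set (R * Omega)) : measurable (B : set PT) ->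
  predictable T F (ind B).
Proof.
move=> mB; apply/(predictableP T_gt0 filtF).
rewrite (_ : (fun z : PT => _) = \1_(B : set PT)); last first.
  by apply/funext => -[t w].
exact: measurable_indic.
Qed.

Lemma el_val_predictable e : elementary_integrand T F e ->
  predictable T F (el_val e).
Proof.
move=> [m0 _ h]; apply: predictableD.
  apply/(predictableP T_gt0 filtF) => _ Y mY.
  have F0Y : F 0 (el_0 e @^-1` Y) by apply: m0; exists Y => //; rewrite setTI.
  have mD := dates_measurable T_gt0 filtF.
  have d0 := date0 T_gt0.
  have mR B : F 0 B -> measurable ([set 0] `*` B : set PT) by exact: rect0_measurable.
  have mRT := mR _ (filtT filtF d0).
  have [Y0|Y0] := pselect (Y 0).
    rewrite (_ : _ `&` _ = ([set 0] `*` (el_0 e @^-1` Y)) `|` (dates `\` ([set 0] `*` setT))).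
      by apply: measurableU; [exact: mR|exact: measurableD].
    apply/seteqP; split => [[r w] [/= [dr _]]|[r w]].
      have [->|r0] := eqVneq r 0; rewrite ?mulr1 ?mulr0 => cY; [by left|right].
      by split => // -[/= /eqP]; rewrite (negbTE r0).
    case=> [[/= -> cY]|[[/= dr _] h0]].
      by split; [split|rewrite eqxx mulr1].
    split; first by split.
    have [r0|r0] := eqVneq r 0; rewrite ?mulr0//.
    by exfalso; apply: h0.
  rewrite (_ : _ `&` _ = [set 0] `*` (el_0 e @^-1` Y)); first exact: mR.
  apply/seteqP; split => [[r w] [/= [dr _]]|[r w] [/= -> cY]].
    by have [->|r0] := eqVneq r 0; rewrite ?mulr1 ?mulr0 => cY.
  by split; [split|rewrite eqxx mulr1].
apply: predictable_sum => i; have [ds dt st mc _] := h i (ltn_ord i).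
exact: cell_predictable.
Qed.

(** The induction principle behind all facts on the integral: elementary integrands are the base,
    and the limit step offers exactly the hypotheses of the dominated convergence clause of
    [bounded_integral]. *)
Theorem predictable_rec (Pr : process -> Prop) :
  (forall e, elementary_integrand T F e -> bounded1 T (el_val e) -> Pr (el_val e)) ->
  date_ext T Pr ->
  (forall Kn K, (forall n, predictable T F (Kn n)) -> (forall n, bounded1 T (Kn n)) ->
    (forall n, Pr (Kn n)) -> predictable T F K -> bounded1 T K ->
    (forall t w, date T t -> Kn n t w @[n --> \oo] --> K t w) -> Pr K) ->
  forall K, predictable T F K -> bounded1 T K -> Pr K.
Proof.
move=> hel hext hlim K pK K1.
suff [] : [/\ predictable T F K, bounded1 T K & Pr K] by [].
apply: (predictable_CL T_gt0 filtF pK K1 (Pr := fun K => [/\ predictable T F K, bounded1 T K & Pr K])).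
- move=> n N L sL; have b := dsimple_bounded sL.
  split => //; first exact: (dsimple_predictable T_gt0 filtF sL).
  have [e he eL] := dsimple_elementary sL.
  by apply: (hext (el_val e)) => //; apply: hel => // t w dt; rewrite eL ?b.
- move=> L L' LL [pL bL prL]; split.
  + exact: (predictable_ext T_gt0 filtF LL).
  + by move=> t w dt; rewrite -LL ?bL.
  + exact: (hext L).
- move=> Ln L h b l.
  have pL : predictable T F L.
    by apply: (predictable_lim T_gt0 filtF (Kn := Ln)) => // n; have [] := h n.
  have bL : bounded1 T L by move=> t w dt; apply: (lim_norm_le (l t w dt)) => n; exact: b.
  by split => //; apply: (hlim Ln) => // n; have [] := h n.
Qed.

End Elementary.

(** * Integrals of bounded predictable integrands *)

Section Integral.
Context {R : realType} {dO : measure_display} {Omega : measurableType dO}.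
Variables (T : \bar R) (F : R -> set (set Omega)).
Hypotheses (T_gt0 : (0 < T)%E) (filtF : is_filtration T F).
Local Notation process := (@process R dO Omega).
Local Notation PT := (@PT R dO Omega T F).
Local Notation dates := (@dates R dO Omega T).
Implicit Types (K L X Y Z : process).

Lemma cadlag_adapted_lin (a b : R) X Y : cadlag_adapted T F X -> cadlag_adapted T F Y ->
  cadlag_adapted T F (fun t w => a * X t w + b * Y t w).
Proof.
move=> [cX aX] [cY aY]; split.
  move=> w; have [rX lX] := cX w; have [rY lY] := cY w; split.
    by move=> t dt tT; apply: cvgD; apply: cvgM; (try exact: cvg_cst); [exact: rX|exact: rY].
  move=> t dt t0; apply: is_cvgD; apply: is_cvgM; (try exact: is_cvg_cst); [exact: lX|exact: lY].
move=> t dt; apply/(wrtP filtF dt); apply: measurable_funD; apply: measurable_funM => //.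
  by apply/(wrtP filtF dt); exact: aX.
by apply/(wrtP filtF dt); exact: aY.
Qed.

Lemma cadlag_adapted0 : cadlag_adapted T F (fun _ _ => 0).
Proof.
split; first by move=> w; split=> *; [exact: cvg_cst|exact: is_cvg_cst].
by move=> t dt; apply/(wrtP filtF dt); exact: measurable_cst.
Qed.

Lemma cadlag_adapted_sum n (X : 'I_n -> process) :
  (forall i, cadlag_adapted T F (X i)) ->
  cadlag_adapted T F (fun t w => \sum_(i < n) X i t w).
Proof.
elim: n X => [|n ih] X hX.
  rewrite (_ : (fun _ _ => _) = fun _ _ => 0); first exact: cadlag_adapted0.
  by apply/funext => t; apply/funext => w; rewrite big_ord0.
rewrite (_ : (fun _ _ => _) = fun t w => 1 * (\sum_(i < n) X (widen_ord (leqnSn n) i) t w) + 1 * X ord_max t w).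
  by apply: cadlag_adapted_lin => //; apply: ih => i; exact: hX.
by apply/funext => t; apply/funext => w; rewrite big_ord_recr/= !mul1r.
Qed.

(** By right-continuity an excess at s < t persists at rational times just after s, which leaves a
    countable union; the endpoint t is kept apart because its right neighbours are not observed at
    t. *)
Lemma exceed_measurable (Z : process) (t eps : R) : cadlag_adapted T F Z -> date T t ->
  F t [set w | exists2 s, 0 <= s <= t & eps < `|Z s w|].
Proof.
move=> [cZ aZ] dt.
have mE s : date T s -> F s [set w | eps < `|Z s w|].
  move=> ds; apply: (aZ s ds); exists [set x | eps < `|x|]; last by rewrite setTI.
  have := normr_measurable (R := R) measurableT (measurable_itv `]eps, +oo[).
  by rewrite setTI; congr measurable; apply/seteqP; split => x /=; rewrite in_itv/= andbT.
have -> : [set w | exists2 s, 0 <= s <= t & eps < `|Z s w|] = [set w | eps < `|Z t w|] `|`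
  \bigcup_n [set w | exists q : rat, [/\ unpickle n = Some q, 0 <= (ratr q : R) <= t & eps < `|Z (ratr q) w|]].
  apply/seteqP; split => [w /= [s /andP[s0 st] sZ]|w /= [h|[n _ [q [_ q0 h]]]]]; last 2 first.
    by exists t => //; rewrite lexx (dt.1).
    by exists (ratr q).
  move: st; rewrite le_eqVlt => /predU1P[st|st]; first by left; rewrite /= -st.
  right; have ds : date T s by exact: (date_le dt s0 (ltW st)).
  have sT : (s%:E < T)%E by apply: (lt_le_trans _ dt.2); rewrite lte_fin.
  have h : \forall r \near s^'+, eps < `|Z r w|.
    by have /cvg_norm /cvgr_gt := (cZ w).1 s ds sT; apply.
  have [e e0 he] := near_rightP h.
  have [q] := @rat_in_itvoo R s (Num.min t (s + e)) ltac:(by rewrite lt_min st ltrDl).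
  rewrite in_itv/= lt_min => /and3P[sq qt qe].
  exists (pickle q) => //; exists q; split => //.
  - by rewrite pickleK.
  - by rewrite (le_trans s0) ?ltW.
  - by apply: he; rewrite sq qe.
have [[_ _ sU] _] := filtF.1 t dt.
have sUU A B : F t A -> F t B -> F t (A `|` B).
  move=> FA FB; rewrite (_ : A `|` B = \bigcup_n (if n is 0 then A else B)).
    by apply: sU; case.
  apply/seteqP; split => [w [Aw|Bw]|w [[|n] _ h]]; [by exists 0%N|by exists 1%N|by left|by right].
apply: sUU; first exact: mE.
apply: sU => n; case E : (unpickle n) => [q|]; last first.
  rewrite (_ : [set w | _] = set0); first by have [[]] := filtF.1 t dt.
  by apply/seteqP; split => // w /= [q []].
have [/andP[q0 qt]|nq] := boolP (0 <= (ratr q : R) <= t).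
  have dq : date T (ratr q) by exact: (date_le dt).
  rewrite (_ : [set w | _] = [set w | eps < `|Z (ratr q) w|]).
    by apply: (filtF.2 (ratr q) t) => //; exact: mE.
  apply/seteqP; split => [w /= [q' [[<-]]]//|w /= h].
  by exists q; split => //; rewrite q0.
rewrite (_ : [set w | _] = set0); first by have [[]] := filtF.1 t dt.
by apply/seteqP; split => // w /= [q' [[<-]]]; rewrite (negbTE nq).
Qed.

Lemma date_nat t : date T t -> exists n : nat, t <= cap T n%:R.
Proof.
move=> dt; exists (Num.truncn t).+1.
by rewrite -{1}(cap_id dt) le_cap// ltW// truncnS_gt.
Qed.

Variable Q : probability Omega R.

Definition unif_cvg (t : R) (Xn : nat -> process) X w := forall eps, 0 < eps ->
  exists N, forall n, (N <= n)%N -> forall s, 0 <= s <= t -> `|Xn n s w - X s w| <= eps.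

Lemma exceed_measurableB X Y (t eps : R) : cadlag_adapted T F X -> cadlag_adapted T F Y ->
  date T t -> measurable [set w | exists2 s, 0 <= s <= t & eps < `|X s w - Y s w|].
Proof.
move=> cX cY dt; apply: ((filtF.1 t dt).2).
rewrite (_ : [set w | _] =
  [set w | exists2 s, 0 <= s <= t & eps < `|1 * X s w + -1 * Y s w|]).
  exact: exceed_measurable eps (cadlag_adapted_lin 1 (-1) cX cY) dt.
by apply/seteqP; split => w /= [s st h]; exists s => //; move: h; rewrite mul1r mulN1r.
Qed.

(** Borel-Cantelli along indices at which the threshold 2^-n is exceeded with probability at most
    2^-(n+1). The bound [n <= sigma n] keeps all other limits valid along the subsequence. *)
Lemma ucp_as Xn X t : (forall n, cadlag_adapted T F (Xn n)) -> cadlag_adapted T F X ->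
  ucp_cvg T Q Xn X -> date T t ->
  exists sigma : nat -> nat, (forall n, (n <= sigma n)%N) /\
    {ae Q, forall w, unif_cvg t (fun n => Xn (sigma n)) X w}.
Proof.
move=> cXn cX ucp dt.
pose E n m := [set w | exists2 s, 0 <= s <= t & 2 ^- n < `|Xn m s w - X s w|].
have /choice[sigma hs] : forall n, exists m, (n <= m)%N /\ (Q (E n m) <= (1 / 2 ^+ n.+1)%:E)%E.
  move=> n; have := ucp t (2 ^- n) dt.
  rewrite invr_gt0 exprn_gt0// => /(_ isT) /fine_cvgP[fin].
  move=> /cvgrPdist_le /(_ (1 / 2 ^+ n.+1)).
  rewrite divr_gt0 ?exprn_gt0// => /(_ isT) h.
  have [m [nm [fm hm]]] : exists m, (n <= m)%N /\ Q (E n m) \is a fin_num /\ `|0 - fine (Q (E n m))| <= 1 / 2 ^+ n.+1.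
    have : \forall m \near \oo, (n <= m)%N /\ Q (E n m) \is a fin_num /\ `|0 - fine (Q (E n m))| <= 1 / 2 ^+ n.+1.
      by near=> m; split; [near: m; exact: nbhs_infty_ge|split; near: m].
    by case=> N _ /(_ N (leqnn N)); exists N.
  exists m; split => //; rewrite -(fineK fm) lee_fin.
  by move: hm; rewrite sub0r normrN; apply: le_trans; exact: ler_norm.
exists sigma; split; first by move=> n; have [] := hs n.
have mE n : measurable (E n (sigma n)) by exact: exceed_measurableB.
have : Q (lim_sup_set (fun n => E n (sigma n))) = 0.
  apply: lim_sup_set_cvg0 => //.
  apply: (@le_lt_trans _ _ 1%:E); last by rewrite ltry.
  apply: le_trans (@epsilon_trick0 R 1 xpredT ler01).
  apply: lee_nneseries => // n _; rewrite natrX; exact: (hs n).2.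
move=> Q0; exists (lim_sup_set (fun n => E n (sigma n))); split => //.
  apply: bigcap_measurable => [|k _]; first by exists 0%N.
  by apply: bigcup_measurable => j _.
move=> w /= nu n _; apply: contrapT => hn; apply: nu => eps eps0.
have [N hN] : exists N, forall m, (N <= m)%N -> 2 ^- m <= eps.
  have /cvgrPdist_lt /(_ eps eps0) : ((2^-1 : R) ^+ n) @[n --> \oo] --> (0 : R).
    by apply: cvg_expr; rewrite ger0_norm ?invr_ge0// invf_lt1// ltr1n.
  case=> N _ hN; exists N => m /hN /=.
  by rewrite sub0r normrN exprVn ger0_norm ?invr_ge0 ?exprn_ge0// => /ltW.
exists (maxn n N) => m; rewrite geq_max => /andP[nm Nm] s st.
rewrite leNgt; apply/negP => h; apply: hn; exists m => //=.
by exists s => //; apply: le_lt_trans h; exact: hN.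
Unshelve. all: by end_near. Qed.

Lemma unif_cvg_pt t Xn X w s : unif_cvg t Xn X w -> 0 <= s <= t ->
  Xn n s w @[n --> \oo] --> X s w.
Proof.
move=> h st; apply/cvgrPdist_le => e /h[N hN]; exists N => // n /= Nn.
by rewrite distrC hN.
Qed.

Lemma ae_dates (Pr : R -> Omega -> Prop) :
  (forall t, date T t -> {ae Q, forall w, forall s, 0 <= s <= t -> Pr s w}) ->
  {ae Q, forall w, forall s, date T s -> Pr s w}.
Proof.
move=> h.
have : {ae Q, forall w, forall n : nat, forall s, 0 <= s <= cap T n%:R -> Pr s w}.
  by apply: ae_foralln => n; apply: h; exact: cap_date.
apply: filterS => w hw s ds; have [n sn] := date_nat ds.
by apply: (hw n); rewrite ds.1.
Qed.

Lemma ucp_unique Xn X Y : (forall n, cadlag_adapted T F (Xn n)) ->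
  cadlag_adapted T F X -> cadlag_adapted T F Y ->
  ucp_cvg T Q Xn X -> (forall n, indist T Q (Xn n) Y) -> indist T Q X Y.
Proof.
move=> cXn cX cY ucp hY; apply: ae_dates => t dt.
have [sigma [_ hs]] := ucp_as cXn cX ucp dt.
have hY' : {ae Q, forall w, forall n, forall s, date T s -> Xn n s w = Y s w}.
  by apply: ae_foralln => n; exact: hY.
apply: filterS2 hs hY' => w u hw s st.
have ds : date T s by case/andP: st => s0; exact: date_le.
have h1 := unif_cvg_pt u st.
have h2 : Xn (sigma n) s w @[n --> \oo] --> Y s w.
  by apply: cvg_near_eq; apply: nearW => n; rewrite hw.
by rewrite -(cvg_lim (@Rhausdorff R) h1) (cvg_lim (@Rhausdorff R) h2).
Qed.

Variables (X : process) (I : process -> process).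
Hypothesis hI : bounded_integral T Q F X I.
Hypothesis cX : cadlag_adapted T F X.
Local Notation bp := (bounded_predictable T F).
Local Notation indist := (indist T Q).

Lemma bpP K : predictable T F K -> bounded1 T K -> bp K.
Proof. by move=> pK bK; split => //; exists 1. Qed.

Lemma bpM K L : bp K -> bp L -> bp (fun t w => K t w * L t w).
Proof.
move=> [pK [a ha]] [pL [b hb]]; split; first exact: predictableM.
by exists (a * b) => t w dt; rewrite normrM ler_pM// ?ha ?hb.
Qed.

Lemma bpL (a : R) K L : bp K -> bp L -> bp (fun t w => a * K t w + L t w).
Proof.
move=> [pK [c hc]] [pL [b hb]]; split.
  by apply: predictableD => //; apply: predictableM => //; exact: predictable_cst.
exists (`|a| * c + b) => t w dt; rewrite (le_trans (ler_normD _ _))// lerD ?hb//.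
by rewrite normrM ler_wpM2l ?hc.
Qed.

Lemma bpD K L : bp K -> bp L -> bp (fun t w => K t w + L t w).
Proof.
move=> bK bL; have := bpL 1 bK bL.
rewrite (_ : (fun _ _ => 1 * _ + _) = (fun t w => K t w + L t w))//.
by apply/funext => t; apply/funext => w; rewrite mul1r.
Qed.

Lemma bp_cst (c : R) : bp (fun _ _ => c).
Proof. by split; [exact: predictable_cst|exists `|c|]. Qed.

Lemma bp_ind (B : set (R * Omega)) : measurable (B : set PT) -> bp (ind B).
Proof.
by move=> mB; apply: bpP; [exact: predictable_ind|move=> t w _; exact: ind_bounded].
Qed.

Lemma bp_el e : elementary_integrand T F e -> bp (el_val e).
Proof.
move=> he; split; first exact: el_val_predictable.
by have [c hc] := el_val_bounded he; exists c.
Qed.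

Lemma int_cadlag K : bp K -> cadlag_adapted T F (I K).
Proof. by move=> bK; have [h _ _ _] := hI; exact: h. Qed.

Lemma int_el e : elementary_integrand T F e -> indist (I (el_val e)) (el_int X e).
Proof. by have [_ h _ _] := hI; exact: h. Qed.

Lemma int_lin (a : R) K L : bp K -> bp L ->
  indist (I (fun t w => a * K t w + L t w)) (fun t w => a * I K t w + I L t w).
Proof. by have [_ _ h _] := hI; exact: h. Qed.

Lemma int_dct (Kn : nat -> process) K (c : R) : (forall n, predictable T F (Kn n)) ->
  predictable T F K -> (forall n t w, date T t -> `|Kn n t w| <= c) ->
  (forall t w, date T t -> Kn n t w @[n --> \oo] --> K t w) ->
  ucp_cvg T Q (fun n => I (Kn n)) (I K).
Proof. by have [_ _ _ h] := hI; exact: h. Qed.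

(** Dominated convergence along the constant sequence K, which converges to L at every date: the
    integral ignores values off the dates. *)
Lemma int_ext K L : bp K -> (forall t w, date T t -> K t w = L t w) ->
  bp L /\ indist (I L) (I K).
Proof.
move=> bK KL.
have bL : bp L.
  have [pK [c hc]] := bK; split; first exact: (predictable_ext T_gt0 filtF KL).
  by exists c => t w dt; rewrite -KL ?hc.
split => //; have [pK [c hc]] := bK.
have ucp : ucp_cvg T Q (fun _ => I K) (I L).
  apply: (@int_dct (fun _ => K) L c) => //; first exact: bL.1.
  by move=> t w dt; rewrite KL//; exact: cvg_cst.
apply: (ucp_unique _ (int_cadlag bL) (int_cadlag bK) ucp).
  by move=> _; exact: int_cadlag.
by move=> _; apply: aeW.
Qed.

Lemma int0 : indist (I (fun _ _ => 0)) (fun _ _ => 0).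
Proof.
have b0 := bp_cst 0.
have := int_lin 1 b0 b0.
rewrite (_ : (fun _ _ => 1 * 0 + 0) = (fun _ _ => 0)); last first.
  by apply/funext => t; apply/funext => w; rewrite mulr0 addr0.
by apply: filterS => w h t dt; have := h t dt; lra.
Qed.

Lemma intZ (a : R) K : bp K -> indist (I (fun t w => a * K t w)) (fun t w => a * I K t w).
Proof.
move=> bK; have := int_lin a bK (bp_cst 0).
rewrite (_ : (fun _ _ => a * _ + 0) = (fun t w => a * K t w)); last first.
  by apply/funext => t; apply/funext => w; rewrite addr0.
by move=> h; apply: filterS2 h int0 => w h h0 t dt; rewrite h// h0// addr0.
Qed.

Lemma intD K L : bp K -> bp L ->
  indist (I (fun t w => K t w + L t w)) (fun t w => I K t w + I L t w).
Proof.
move=> bK bL; have := int_lin 1 bK bL.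
rewrite (_ : (fun _ _ => 1 * _ + _) = (fun t w => K t w + L t w)); last first.
  by apply/funext => t; apply/funext => w; rewrite mul1r.
by apply: filterS => w h t dt; rewrite h// mul1r.
Qed.

Lemma intB K L : bp K -> bp L ->
  indist (I (fun t w => K t w - L t w)) (fun t w => I K t w - I L t w).
Proof.
move=> bK bL; have := int_lin (-1) bL bK.
rewrite (_ : (fun _ _ => -1 * _ + _) = (fun t w => K t w - L t w)); last first.
  by apply/funext => t; apply/funext => w; rewrite mulN1r addrC.
by apply: filterS => w h t dt; rewrite h// mulN1r addrC.
Qed.

(** A limit step may pass to a subsequence, so the induction offers almost sure uniform convergence
    of the integrals on [0, t0] instead of convergence in probability. *)
Theorem int_rec t0 (Pr : process -> Prop) : date T t0 ->
  (forall e, elementary_integrand T F e -> bounded1 T (el_val e) -> Pr (el_val e)) ->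
  date_ext T Pr ->
  (forall Kn K, (forall n, predictable T F (Kn n)) -> (forall n, bounded1 T (Kn n)) ->
    (forall n, Pr (Kn n)) -> predictable T F K -> bounded1 T K ->
    (forall t w, date T t -> Kn n t w @[n --> \oo] --> K t w) ->
    {ae Q, forall w, unif_cvg t0 (fun n => I (Kn n)) (I K) w} -> Pr K) ->
  forall K, predictable T F K -> bounded1 T K -> Pr K.
Proof.
move=> dt hel hext hlim; apply: (predictable_rec T_gt0 filtF) => // Kn K pKn bKn PrKn pK bK l.
have ucp := int_dct pKn pK bKn l.
have bp1 n : bp (Kn n) by exact: bpP.
have [s [ns hs]] := ucp_as (fun n => int_cadlag (bp1 n)) (int_cadlag (bpP pK bK)) ucp dt.
apply: (hlim (fun n => Kn (s n))) => // t w dt'.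
apply: cvg_trans (l t w dt'); apply: (@cvg_app _ _ (s n @[n --> \oo]) \oo).
by move=> A [N _ hA]; exists N => // n Nn; apply: hA => /=; exact: leq_trans (ns n).
Qed.

Lemma el_int0 e w : elementary_integrand T F e -> el_int X e 0 w = 0.
Proof.
move=> [_ _ h]; rewrite /el_int big1// => i _.
have [ds dt st _ _] := h i (ltn_ord i).
by rewrite (min_r ds.1) (min_r dt.1) subrr mulr0.
Qed.

Lemma bp_scale K : bp K -> exists (c : R) (L : process), [/\ 0 < c, predictable T F L,
  bounded1 T L & K = (fun t w => c * L t w)].
Proof.
move=> [pK [c hc]]; have c0 : 0 < Num.max 1 c by rewrite lt_max ltr01.
exists (Num.max 1 c), (fun t w => (Num.max 1 c)^-1 * K t w); split => //.
- by apply: predictableM => //; exact: predictable_cst.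
- move=> t w dt; rewrite normrM gtr0_norm ?invr_gt0// mulrC ler_pdivrMr// mul1r.
  by rewrite (le_trans (hc t w dt))// le_max lexx orbT.
- by apply/funext => t; apply/funext => w; rewrite mulVKf// gt_eqF.
Qed.

Lemma int_start K : bp K -> {ae Q, forall w, I K 0 w = 0}.
Proof.
have d0 := date0 T_gt0.
suff H L : predictable T F L -> bounded1 T L -> {ae Q, forall w, I L 0 w = 0}.
  move=> /bp_scale[c [L [c0 pL bL ->]]].
  apply: filterS2 (H _ pL bL) (intZ c (bpP pL bL)) => w h1 h2.
  by rewrite h2// h1 mulr0.
move=> pL bL; have [] : bp L /\ {ae Q, forall w, I L 0 w = 0}; last by [].
move: L pL bL; apply: (int_rec (Pr := fun L => bp L /\ {ae Q, forall w, I L 0 w = 0}) d0).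
- move=> e he be; split; first exact: bp_el.
  by apply: filterS (int_el he) => w h; rewrite h//; exact: el_int0.
- move=> L L' LL [bL h]; have [bL' h'] := int_ext bL LL; split => //.
  by apply: filterS2 h h' => w h h'; rewrite h'.
- move=> Kn L _ _ hK pL bL _ u; split; first exact: bpP.
  have : {ae Q, forall w, forall n, I (Kn n) 0 w = 0}.
    by apply: ae_foralln => n; have [] := hK n.
  apply: filterS2 u => w u h.
  have h1 := @unif_cvg_pt _ _ _ _ 0 u ltac:(by rewrite lexx).
  have h2 : I (Kn n) 0 w @[n --> \oo] --> (0 : R).
    by apply: cvg_near_eq; apply: nearW => n; rewrite h.
  by rewrite -(cvg_lim (@Rhausdorff R) h1) (cvg_lim (@Rhausdorff R) h2).
Qed.

(** The jump of Z at t equals K times the jump of X, written with a single left limit so that the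
    left limits of Z and X need no names. *)
Definition jump_eq (Z K : process) t w :=
  (Z t w - Z s w - K t w * (X t w - X s w)) @[s --> t^'-] --> (0 : R).

Lemma jump_ext Z K Z' K' t w : (forall s, 0 <= s <= t -> Z s w = Z' s w) ->
  K t w = K' t w -> 0 < t -> jump_eq Z K t w -> jump_eq Z' K' t w.
Proof.
move=> ZZ KK t0; apply: cvg_trans; apply: near_eq_cvg; near=> s.
have s0 : 0 <= s by near: s; exact: nbhs_left_ge.
have st : s <= t by near: s; exact: nbhs_left_le.
by rewrite /= -(ZZ t) ?lexx ?ltW// -(ZZ s) ?s0// KK.
Unshelve. all: by end_near. Qed.

Lemma jump_scale c Z K t w : jump_eq Z K t w ->
  jump_eq (fun t w => c * Z t w) (fun t w => c * K t w) t w.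
Proof.
move=> h.
have : (c * (Z t w - Z s w - K t w * (X t w - X s w))) @[s --> t^'-] --> c * 0.
  by apply: cvgM; [exact: cvg_cst|exact: h].
rewrite mulr0 /jump_eq; apply: cvg_trans; apply: near_eq_cvg; apply: nearW => s /=; ring.
Qed.

Lemma jump_el e w t : elementary_integrand T F e -> 0 < t ->
  jump_eq (el_int X e) (el_val e) t w.
Proof.
move=> [_ _ h] t0; rewrite /jump_eq /el_int /el_val gt_eqF// mulr0 add0r.
suff : (\sum_(i < el_size e)
  el_c e i w * (X (Num.min (el_t e i) t) w - X (Num.min (el_s e i) t) w) -
  \sum_(i < el_size e)
  el_c e i w * (X (Num.min (el_t e i) s) w - X (Num.min (el_s e i) s) w) -
  (\sum_(i < el_size e) el_c e i w * (el_s e i < t <= el_t e i)%R%:R) *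
  (X t w - X s w)) @[s --> t^'-] --> \sum_(i < el_size e) (0 : R) by rewrite big1_eq.
rewrite (_ : (fun s => _) = (fun s => \sum_(i < el_size e)
  (el_c e i w * (X (Num.min (el_t e i) t) w - X (Num.min (el_s e i) t) w)
  - el_c e i w * (X (Num.min (el_t e i) s) w - X (Num.min (el_s e i) s) w)
  - el_c e i w * (el_s e i < t <= el_t e i)%R%:R * (X t w - X s w)))); last first.
  by apply/funext => s; rewrite mulr_suml -!sumrB.
apply: (cvg_big (op := +%R) (x0 := 0)) => //; first exact: add_continuous.
move=> i _; have [ds dt st _ _] := h i (ltn_ord i).
set si := el_s e i in ds st *; set ti := el_t e i in dt st *; set c := el_c e i w.
apply/cvgrPdist_le => eps eps0.
have [tsi|sit] := leP t si.
  have tti := le_trans tsi st.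
  near=> s; have st' : s <= t by near: s; exact: nbhs_left_le.
  rewrite (min_r tti) (min_r (le_trans st' tti)) (min_r (le_trans st' tsi)) /= mulr0.
  by rewrite [X in `|_ - X|](_ : _ = 0) ?subrr ?normr0 ?ltW//; ring.
have [tti|tit] := leP t ti.
  near=> s; have st' : s <= t by near: s; exact: nbhs_left_le.
  have si_s : si <= s by near: s; exact: nbhs_left_ge.
  rewrite (min_r (le_trans st' tti)) (min_l si_s) /= mulr1.
  by rewrite [X in `|_ - X|](_ : _ = 0) ?subrr ?normr0 ?ltW//; ring.
near=> s.
have ti_s : ti <= s by near: s; exact: nbhs_left_ge.
rewrite (min_l ti_s) (min_l (le_trans st ti_s)) andbF mulr0.
by rewrite [X in `|_ - X|](_ : _ = 0) ?subrr ?normr0 ?ltW//; ring.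
Unshelve. all: by end_near. Qed.

Lemma left_limit_bounded (Y : R -> R) t : cvg (Y s @[s --> t^'-]) ->
  exists2 C, 0 < C & \forall s \near t^'-, `|Y t - Y s| <= C.
Proof.
move=> /cvgrPdist_le /(_ 1 ltr01) h; set l := lim _ in h.
exists (`|Y t| + `|l| + 1); first by rewrite addrC ltr_pwDl// addr_ge0.
apply: filterS h => s h; have := ler_normB (Y t) (Y s).
rewrite distrC in h; have := ler_normD (Y s - l) l; rewrite subrK => *; lra.
Qed.

(** Increments of X just before t are bounded, so one index n at which both [Kn n t w] and the path
    of [Zn n] are close to their limits transfers the jump relation. *)
Lemma jump_lim (Kn Zn : nat -> process) K Z t w :
  0 < t -> cvg (X s w @[s --> t^'-]) ->
  (forall n, jump_eq (Zn n) (Kn n) t w) -> unif_cvg t Zn Z w ->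
  Kn n t w @[n --> \oo] --> K t w -> jump_eq Z K t w.
Proof.
move=> t0 /left_limit_bounded[C C0 hC] hJ u l.
apply/cvgrPdist_le => eps eps0.
have e4 : 0 < eps / 4 by lra.
have [N hN] := u _ e4.
have /cvgrPdist_le /(_ (eps / 4 / C)) := l; rewrite divr_gt0// => /(_ isT) [M _ hM].
pose n := maxn N M.
have /cvgrPdist_le /(_ _ e4) hJn := hJ n.
near=> s.
have s0 : 0 <= s by near: s; exact: nbhs_left_ge.
have st : s <= t by near: s; exact: nbhs_left_le.
have h1 := hN n (leq_maxl _ _) t ltac:(by rewrite (ltW t0) lexx).
have h2 := hN n (leq_maxl _ _) s ltac:(by rewrite s0 st).
have h3 := hM n (leq_maxr _ _).
have h4 : `|X t w - X s w| <= C by near: s.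
have h5 : `|0 - (Zn n t w - Zn n s w - Kn n t w * (X t w - X s w))| <= eps / 4 by near: s.
have h6 : `|(K t w - Kn n t w) * (X t w - X s w)| <= eps / 4.
  rewrite normrM (le_trans (ler_pM _ _ h3 h4))//.
  by rewrite divfK// gt_eqF.
move: h1 h2 h5 h6; rewrite !ler_norml => /andP[? ?] /andP[? ?] /andP[? ?] /andP[? ?].
by apply/andP; split; lra.
Unshelve. all: by end_near. Qed.

Lemma int_jump K : bp K ->
  {ae Q, forall w, forall t, date T t -> 0 < t -> jump_eq (I K) K t w}.
Proof.
suff H L : predictable T F L -> bounded1 T L -> forall t0, date T t0 ->
    {ae Q, forall w, forall t, 0 <= t <= t0 -> 0 < t -> jump_eq (I L) L t w}.
  move=> /bp_scale[c [L [c0 pL bL ->]]].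
  have := ae_dates (H _ pL bL) => /= h.
  apply: filterS2 h (intZ c (bpP pL bL)) => w h1 h2 t dt t0.
  apply: (jump_ext _ _ t0 (jump_scale c (h1 t dt t0))) => //.
  by move=> s st; rewrite h2//; case/andP: st => *; exact: date_le dt _ _.
move=> pL bL t0 d0.
have [] : bp L /\ {ae Q, forall w, forall t, 0 <= t <= t0 -> 0 < t -> jump_eq (I L) L t w}; last by [].
move: L pL bL; apply: (int_rec (Pr := fun L => bp L /\
  {ae Q, forall w, forall t, 0 <= t <= t0 -> 0 < t -> jump_eq (I L) L t w}) d0).
- move=> e he be; split; first exact: bp_el.
  apply: filterS (int_el he) => w h t tt t1.
  have dt : date T t by case/andP: tt => t2; exact: date_le.
  apply: (jump_ext _ _ t1 (jump_el w he t1)) => // s /andP[s0 st].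
  by rewrite h//; exact: date_le dt s0 st.
- move=> L L' LL [bL h]; have [bL' h'] := int_ext bL LL; split => //.
  apply: filterS2 h h' => w h h' t tt t1.
  have dt : date T t by case/andP: tt => t2; exact: date_le.
  apply: (jump_ext _ _ t1 (h t tt t1)); last exact: LL.
  by move=> s /andP[s0 st]; rewrite h'//; exact: date_le dt s0 st.
- move=> Kn L _ _ hK pL bL l u; split; first exact: bpP.
  have : {ae Q, forall w, forall n, forall t, 0 <= t <= t0 -> 0 < t -> jump_eq (I (Kn n)) (Kn n) t w}.
    by apply: ae_foralln => n; have [] := hK n.
  apply: filterS2 u => w u h t tt t1.
  have dt : date T t by case/andP: tt => t2; exact: date_le.
  apply: (jump_lim (Kn := Kn) (Zn := fun n => I (Kn n))) => //.
  + by have [_] := cX.1 w; apply.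
  + by move=> n; exact: h.
  + move=> e e0; have [N hN] := u e e0; exists N => n Nn s /andP[s0 st]; apply: hN => //.
    by rewrite s0 (le_trans st)//; case/andP: tt.
  + exact: l.
Unshelve. all: by end_near. Qed.

Definition cell (s t : R) (c : Omega -> R) : process := fun r w => c w * (s < r <= t)%R%:R.

Lemma bp_cell s t c : date T s -> date T t -> wrt (F s) c -> (exists b, forall w, `|c w| <= b) ->
  bp (cell s t c).
Proof.
move=> ds dt mc [b hb]; split; first exact: cell_predictable.
exists b => r w _; rewrite /cell; case: (_ < _ <= _) => /=; first by rewrite mulr1.
by rewrite mulr0 normr0 (le_trans _ (hb w)).
Qed.

(** The increment of f over the intersection of ]si, ti] and ]s, t], stopped at r. The outer maximum
    collapses an empty intersection to a degenerate cell. *)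
Lemma min_cell (f : R -> R) (si ti s t r : R) : si <= ti -> s <= t ->
  f (Num.min (Num.max (Num.min ti t) (Num.max si s)) r) - f (Num.min (Num.max si s) r) =
  (f (Num.min ti (Num.min t r)) - f (Num.min si (Num.min t r))) -
  (f (Num.min ti (Num.min s r)) - f (Num.min si (Num.min s r))).
Proof.
move=> h1 h2.
rewrite !(minA ti) !(minA si).
pose g u := f (Num.min u r); rewrite -!/(g _); clearbody g.
have [a1|a1] := leP si s; have [a2|a2] := leP ti t; have [a3|a3] := leP si t;
  have [a4|a4] := leP s ti; try (exfalso; lra);
  repeat (match goal with
    | |- context[Num.max ?a ?b] => first [rewrite (@max_l _ _ a b); last lra | rewrite (@max_r _ _ a b); last lra]
    | |- context[Num.min ?a ?b] => first [rewrite (@min_l _ _ a b); last lra | rewrite (@min_r _ _ a b); last lra] end); ring.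
Qed.

(** The product of an elementary integrand with a cell is elementary, which settles the base case,
    and both sides pass to limits. This is the stopping rule of the integral at deterministic
    times. *)
Lemma int_cell K s t c : bp K -> date T s -> date T t -> s <= t ->
  wrt (F s) c -> (exists b, forall w, `|c w| <= b) ->
  indist (I (fun r w => K r w * cell s t c r w))
         (fun r w => c w * (I K (Num.min t r) w - I K (Num.min s r) w)).
Proof.
move=> bK ds dt st mc hc; have bc := bp_cell ds dt mc hc.
have dmin r u : date T r -> date T u -> date T (Num.min r u).
  by move=> dr du; case: (leP r u).
suff H L : predictable T F L -> bounded1 T L -> indist (I (fun r w => L r w * cell s t c r w))
         (fun r w => c w * (I L (Num.min t r) w - I L (Num.min s r) w)).
  have [k [L [k0 pL bL ->]]] := bp_scale bK.
  have h1 := intZ k (bpP pL bL); have h2 := intZ k (bpM (bpP pL bL) bc).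
  have E : (fun r w => k * L r w * cell s t c r w) = (fun r w => k * (L r w * cell s t c r w)).
    by apply/funext => r; apply/funext => w; rewrite mulrA.
  apply: filterS3 h1 h2 (H L pL bL) => w h1 h2 h3 r dr.
  by have d1 := dmin _ _ dt dr; have d2 := dmin _ _ ds dr; rewrite E h2// h3// !h1//; ring.
move=> pL bL; apply: (ae_dates (Pr := fun r w => I (fun r w => L r w * cell s t c r w) r w = c w * (I L (Num.min t r) w - I L (Num.min s r) w))) => t0 d0.
pose Pr L := bp L /\ {ae Q, forall w r, 0 <= r <= t0 -> I (fun r w => L r w * cell s t c r w) r w = c w * (I L (Num.min t r) w - I L (Num.min s r) w)}.
suff [] : Pr L by [].
have d0r (r : R) : 0 <= r <= t0 -> date T r by move=> /andP[r0 rt]; exact: date_le d0 r0 rt.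
move: L pL bL; apply: (int_rec (Pr := Pr) d0).
- move=> e he be; split; first exact: bp_el.
  pose e' := Elementary (el_size e) (fun=> 0) (fun i => Num.max (el_s e i) s)
    (fun i => Num.max (Num.min (el_t e i) t) (Num.max (el_s e i) s)) (fun i w => el_c e i w * c w).
  have he' : elementary_integrand T F e'.
    have [_ _ h] := he; split => /=.
    + apply/(wrtP filtF (date0 T_gt0)); exact: measurable_cst.
    + by exists 0 => w; rewrite normr0.
    + move=> i ie; have [dsi dti sti mci [b hb]] := h i ie.
      have dm : date T (Num.max (el_s e i) s) by case: (leP (el_s e i) s).
      split => //.
      * by case: (leP (Num.min (el_t e i) t)) => // _; exact: dmin.
      * by rewrite le_max lexx orbT.
      * apply/(wrtP filtF dm); apply: measurable_funM; apply/(wrtP filtF dm).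
          by apply: (wrt_le filtF dsi dm) => //; rewrite le_max lexx.
        by apply: (wrt_le filtF ds dm) => //; rewrite le_max lexx orbT.
      * have [b' hb'] := hc; exists (b * b') => w.
        by rewrite normrM ler_pM.
  have ee' r w : date T r -> el_val e' r w = el_val e r w * cell s t c r w.
    move=> dr; have [_ _ h] := he; rewrite /el_val /cell/= mul0r add0r mulrDl.
    rewrite (_ : _ * (_ * _) = 0) ?add0r; last first.
      have [->|r0] := eqVneq r 0; last by rewrite mulr0 mul0r.
      by rewrite ltNge ds.1 /= !mulr0.
    rewrite mulr_suml; apply: eq_bigr => i _.
    have [dsi dti sti _ _] := h i (ltn_ord i).
    rewrite -mulrA [RHS]mulrACA -natrM -!mulrA; congr (_ * (_ * _)).
    congr (_%:R); rewrite mulnb; congr nat_of_bool.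
    rewrite gt_max le_max le_min.
    apply/idP/idP.
      move=> /andP[/andP[a b] /orP[/andP[c1 d1]|]]; first by rewrite a b c1 d1.
      by rewrite le_max => /orP[c1|c1]; exfalso; lra.
    by move=> /andP[/andP[a b] /andP[c1 d1]]; rewrite a b c1 d1.
  have [_ h1] := int_ext (bp_el he') ee'.
  apply: filterS3 h1 (int_el he') (int_el he) => w h1 h2 h3 r rt.
  have dr := d0r _ rt.
  have d1 := dmin _ _ dt dr; have d2 := dmin _ _ ds dr.
  rewrite h1// h2// !h3// /el_int /= -sumrB mulr_sumr; apply: eq_bigr => i _.
  have [_ _ h] := he; have [dsi dti sti _ _] := h i (ltn_ord i).
  by rewrite (@min_cell (X^~ w))//; ring.
- move=> L L' LL [bL h]; have [bL' h'] := int_ext bL LL; split => //.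
  have [_ h2] : bp (fun r w => L' r w * cell s t c r w) /\
      indist (I (fun r w => L' r w * cell s t c r w)) (I (fun r w => L r w * cell s t c r w)).
    by apply: (int_ext (bpM bL bc)) => r w dr; rewrite LL.
  apply: filterS3 h h' h2 => w h h' h2 r rt; have dr := d0r _ rt.
  by have d1 := dmin _ _ dt dr; have d2 := dmin _ _ ds dr; rewrite h2// h// !h'.
- move=> Kn L pKn bKn hK pL bL l u; split; first exact: bpP.
  pose Mn n : process := fun r w => Kn n r w * cell s t c r w.
  pose M : process := fun r w => L r w * cell s t c r w.
  have bMn n : bp (Mn n) by apply: bpM => //; exact: bpP.
  have bM : bp M by apply: bpM => //; exact: bpP.
  have [_ [b hb]] := bc.
  have ucp : ucp_cvg T Q (fun n => I (Mn n)) (I M).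
    apply: (@int_dct _ _ b) => //.
    + by move=> n; have [] := bMn n.
    + by have [] := bM.
    + move=> n r w dr; rewrite /Mn normrM -[leRHS]mul1r ler_pM ?hb//.
      exact: bKn.
    + by move=> r w dr; apply: cvgM; [exact: l|exact: cvg_cst].
  have [sg [nsg hs]] := ucp_as (fun n => int_cadlag (bMn n)) (int_cadlag bM) ucp d0.
  have hK' : {ae Q, forall w n r, 0 <= r <= t0 -> I (Mn n) r w = c w * (I (Kn n) (Num.min t r) w - I (Kn n) (Num.min s r) w)}.
    by apply: ae_foralln => n; have [] := hK n.
  apply: filterS3 u hs hK' => w u hs hK' r rt; have dr := d0r _ rt.
  have h1 := unif_cvg_pt hs rt.
  have mr x : date T x -> 0 <= Num.min x r <= t0.
    move=> [x0 _]; case/andP: rt => r0 rt; rewrite le_min x0 r0/=.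
    by rewrite ge_min rt orbT.
  have hsg : sg n @[n --> \oo] --> \oo.
    by move=> A [N _ hA]; exists N => // n Nn; apply: hA => /=; exact: leq_trans (nsg n).
  have h2 : I (Mn (sg n)) r w @[n --> \oo] --> c w * (I L (Num.min t r) w - I L (Num.min s r) w).
    under eq_fun do rewrite hK'//.
    apply: cvgM; first exact: cvg_cst.
    apply: cvgB.
      exact: (cvg_comp sg (fun n => I (Kn n) (Num.min t r) w) hsg (unif_cvg_pt u (mr _ dt))).
    exact: (cvg_comp sg (fun n => I (Kn n) (Num.min s r) w) hsg (unif_cvg_pt u (mr _ ds))).
  by rewrite -(cvg_lim (@Rhausdorff R) h1) (cvg_lim (@Rhausdorff R) h2).
Qed.

End Integral.

(** * Locality of the integral *)

Section Locality.
Context {R : realType} {dO : measure_display} {Omega : measurableType dO}.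
Variables (T : \bar R) (F : R -> set (set Omega)).
Hypotheses (T_gt0 : (0 < T)%E) (filtF : is_filtration T F).
Local Notation process := (@process R dO Omega).
Local Notation PT := (@PT R dO Omega T F).
Local Notation dates := (@dates R dO Omega T).
Local Notation bp := (bounded_predictable T F).
Local Notation cap := (@cap R T).
Implicit Types (K L X Y Z : process) (B C E : set (R * Omega)).

(** Rectangles closed in time have compact time sections; the strict gap between s, where A is
    known, and the start s' keeps them predictable. *)
Inductive base_rect : set (R * Omega) -> Prop :=
| base_rect0 A : F 0 A -> base_rect ([set 0] `*` A)
| base_rectI s s' t A : date T s -> date T t -> s < s' -> F s A ->
    base_rect [set z | s' <= z.1 <= t /\ A z.2].

Inductive elset : set (R * Omega) -> Prop :=
| elset0 : elset set0
| elsetU B E : base_rect B -> elset E -> elset (B `|` E).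

Lemma FI t A A' : date T t -> F t A -> F t A' -> F t (A `&` A').
Proof.
move=> dt FA FA'; have [[F0 FC FU] _] := filtF.1 t dt.
have := @measurableI _ (g_sigma_algebraType (F t)) A A'.
by rewrite /measurable/= sigma_algebra_id//; apply.
Qed.

Lemma base_rect_setI B C : base_rect B -> base_rect C -> elset (B `&` C).
Proof.
have F00 : F 0 set0 by have [[]] := filtF.1 0 (date0 T_gt0).
have E0 : elset set0 by exact: elset0.
have E1 D : base_rect D -> elset D by move=> h; rewrite -(setU0 D); exact: elsetU.
case=> [A FA|s s' t A ds dt ss FA]; case=> [A' FA'|r r' u A' dr du rr FA'].
- apply: E1; rewrite -setXI setIid; apply: base_rect0; apply: FI => //; exact: date0.
- rewrite (_ : _ `&` _ = set0)//; apply/seteqP; split => // -[x w] [[/= -> _] [/andP[/= r0 _] _]].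
  by have := le_lt_trans dr.1 rr; rewrite ltNge r0.
- rewrite (_ : _ `&` _ = set0)//; apply/seteqP; split => // -[x w] [[/andP[/= r0 _] _] [/= x0 _]].
  by have := le_lt_trans ds.1 ss; rewrite ltNge -x0 r0.
- apply: E1; rewrite (_ : _ `&` _ =
    [set z | Num.max s' r' <= z.1 <= Num.min t u /\ (A `&` A') z.2]).
    have dm : date T (Num.max s r) by case: (leP s r).
    apply: (@base_rectI (Num.max s r)) => //.
    + by case: (leP t u).
    + by rewrite gt_max !lt_max ss rr orbT.
    + apply: FI => //; first by apply: (filtF.2 s) => //; rewrite le_max lexx.
      by apply: (filtF.2 r) => //; rewrite le_max lexx orbT.
  apply/seteqP; split => -[x w] /=; rewrite ge_max le_min.
    by move=> [[/andP[-> ->] ?] [/andP[-> ->] ?]].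
  by move=> [/andP[/andP[-> ->] /andP[-> ->]] [? ?]].
Qed.

Lemma elset_setU E E' : elset E -> elset E' -> elset (E `|` E').
Proof.
by elim=> [|B E1 hB _ ih] hE'; [rewrite set0U|rewrite -setUA; apply: elsetU => //; exact: ih].
Qed.

Lemma elset_setI E E' : elset E -> elset E' -> elset (E `&` E').
Proof.
elim=> [|B E1 hB _ ih] hE'; first by rewrite set0I; exact: elset0.
rewrite setIUl; apply: elset_setU; last exact: ih.
elim: hE' => [|C E2 hC _ ih2]; first by rewrite setI0; exact: elset0.
by rewrite setIUr; apply: elset_setU => //; exact: base_rect_setI.
Qed.

Lemma base_rectE s s' t A : date T s -> date T t -> s < s' -> F s A ->
  [set z : R * Omega | s' <= z.1 <= t /\ A z.2] =
  \bigcap_n (`](s' - (s' - s) / n.+2%:R), t] `*` A).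
Proof.
move=> ds dt ss FA; apply/seteqP; split => [[x w] /= [/andP[sx xt] Aw] n _|[x w] h] /=.
  split => //=; rewrite in_itv/= xt andbT (lt_le_trans _ sx)// ltrBlDr ltrDl divr_gt0//; lra.
have [/=] := h 0%N I; rewrite in_itv/= => /andP[_ xt] Aw; split => //; rewrite xt andbT.
rewrite leNgt; apply/negP => xs.
have s0 : 0 < s' - s by lra.
pose n := Num.truncn ((s' - s) / (s' - x)).
have := h n I => -[/=]; rewrite in_itv/= => /andP[h1 _] _.
have h2 : (s' - s) / (s' - x) < n.+2%:R.
  by apply: lt_trans (truncnS_gt _) _; rewrite ltr_nat.
have sx0 : 0 < s' - x by lra.
move: h2; rewrite ltr_pdivrMr// => h2.
move: h1; rewrite ltrBlDr -ltrBlDl.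
rewrite ltr_pdivlMr// => h1; have := lt_trans h1 h2.
by rewrite mulrC ltxx.
Qed.

Lemma base_rect_measurable B : base_rect B -> measurable (B : set PT).
Proof.
case=> [A FA|s s' t A ds dt ss FA]; first exact: rect0_measurable.
rewrite (base_rectE ds dt ss FA); apply: bigcapT_measurable => n.
have h : s <= s' - (s' - s) / n.+2%:R.
  have : (s' - s) / n.+2%:R <= (s' - s) by rewrite ler_pdivrMr// ler_peMr ?ler1n//; lra.
  by set e := _ / _ => he; lra.
have [st|ts] := leP (s' - (s' - s) / n.+2%:R) t; last first.
  by rewrite set_itv_ge ?set0X ?bnd_simp -?leNgt 1?ltW//; exact: measurable0.
have d1 : date T (s' - (s' - s) / n.+2%:R) by apply: (date_le dt) => //; exact: le_trans ds.1 h.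
by apply: rect_measurable => //; apply: (filtF.2 s).
Qed.

Lemma elset_measurable E : elset E -> measurable (E : set PT).
Proof.
elim=> [|B E1 hB _ ih]; first exact: measurable0.
by apply: measurableU => //; exact: base_rect_measurable.
Qed.

Lemma elset_compact E w : elset E -> compact [set t | E (t, w)].
Proof.
elim=> [|B E1 hB _ ih]; first by rewrite (_ : [set t | _] = set0); [exact: compact0|apply/seteqP; split].
rewrite (_ : [set t | _] = [set t | B (t, w)] `|` [set t | E1 (t, w)]); last by apply/seteqP; split.
apply: compactU => //; case: hB => [A FA|s s' t A ds dt ss FA].
  have [Aw|nA] := pselect (A w).
    rewrite (_ : [set t | _] = [set 0]); first exact: compact_set1.
    by apply/seteqP; split => [x [//]|x ->].
  by rewrite (_ : [set t | _] = set0); [exact: compact0|apply/seteqP; split => // x []].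
have [Aw|nA] := pselect (A w).
  rewrite (_ : [set t | _] = `[s', t]%classic); first exact: segment_compact.
  by apply/seteqP; split => x /=; rewrite in_itv/= => // -[].
by rewrite (_ : [set t | _] = set0); [exact: compact0|apply/seteqP; split => // x []].
Qed.

Lemma elset_date E t w : elset E -> E (t, w) -> date T t.
Proof.
elim=> [|B E1 hB hE ih] // [|//]; case: hB => [A FA [/= -> _]|s s' u A ds du ss FA [/= /andP[h1 h2] _]].
  exact: date0.
apply: (date_le du) => //; rewrite (le_trans _ h1)// (le_trans ds.1)//; exact: ltW.
Qed.

(* The time sections of a cset are decreasing intersections of compacts: csets play the
   role of compact sets in the inner regularity argument behind int_local. *)
Definition cset C := exists E : nat -> set (R * Omega), [/\ (forall n, elset (E n)),
  (forall n, E n.+1 `<=` E n) & C = \bigcap_n E n].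

Lemma cset_elset E : elset E -> cset E.
Proof.
move=> h; exists (fun=> E); split => //; first by move=> _.
by apply/seteqP; split => [z Ez _ _ //|z /(_ 0%N I)].
Qed.

Lemma cset_measurable C : cset C -> measurable (C : set PT).
Proof.
by move=> [E [hE _ ->]]; apply: bigcapT_measurable => n; exact: elset_measurable.
Qed.

Lemma decr_le (E : nat -> set (R * Omega)) : (forall n, E n.+1 `<=` E n) ->
  forall m n, (m <= n)%N -> E n `<=` E m.
Proof.
by move=> h m n /subnK <-; elim: (n - m)%N => [//|k ih]; apply: subset_trans ih; exact: h.
Qed.

Lemma cset_setU C C' : cset C -> cset C' -> cset (C `|` C').
Proof.
move=> [E [hE dE ->]] [E' [hE' dE' ->]]; exists (fun n => E n `|` E' n); split.
- by move=> n; exact: elset_setU.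
- by move=> n; exact: setUSS.
apply/seteqP; split => [z [h|h] n _|z h]; [by left; exact: h|by right; exact: h|].
apply: contrapT => /not_orP[/existsNP[n /not_implyP[_ n1]] /existsNP[m /not_implyP[_ n2]]].
case: (h (maxn n m) I) => h'.
  by apply: n1; apply: (decr_le dE _ h'); exact: leq_maxl.
by apply: n2; apply: (decr_le dE' _ h'); exact: leq_maxr.
Qed.

Lemma cset_bigcap (C : nat -> set (R * Omega)) : (forall n, cset (C n)) ->
  cset (\bigcap_n C n).
Proof.
move=> /choice[E hE].
pose G n := \bigcap_(k < n.+1) E k n.
exists G; split.
- move=> n; rewrite /G; have h k : elset (E k n) by have [] := hE k.
  elim: {1}n => [|m ih]; first by rewrite bigcap_mkord big_ord1.
  rewrite (_ : \bigcap_(k < m.+2) _ = (\bigcap_(k < m.+1) E k n) `&` E m.+1 n).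
    exact: elset_setI.
  apply/seteqP; split => [z hz|z [h1 h2] k /=].
    by split => [k /= km|]; apply: hz => //=; exact: ltnW.
  by rewrite ltnS leq_eqVlt => /predU1P[->//|]; exact: h1.
- move=> n z h k /= kn; have [_ dE _] := hE k; apply: dE; apply: h => /=.
  exact: ltn_trans kn _.
- apply/seteqP; split => [z h n _ k /= _|z h k _].
    by have [_ _ CE] := hE k; have := h k I; rewrite CE => /(_ n I).
  have [_ dE ->] := hE k => n _.
  apply: (decr_le dE (leq_maxl n k)); apply: (h (maxn n k) I) => /=.
  by rewrite ltnS leq_maxr.
Qed.

(** If every [E n] had a time in its section, a cluster point of these times would lie in all
    sections, which are compact and decreasing. *)
Lemma cset_empty_section (E : nat -> set (R * Omega)) w : (forall n, elset (E n)) ->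
  (forall n, E n.+1 `<=` E n) -> (forall t, ~ (\bigcap_n E n) (t, w)) ->
  exists n, forall t, ~ E n (t, w).
Proof.
move=> hE dE h; apply: contrapT => /forallNP hn.
have /choice[x hx] : forall n, exists t, E n (t, w).
  by move=> n; have := hn n => /existsNP[t /contrapT Et]; exists t.
have cE n : compact [set t | E n (t, w)] by exact: elset_compact.
have := cE 0%N (x @ \oo).
have FF : ProperFilter (x @ \oo) by apply: fmap_proper_filter.
move=> /(_ FF) []; first by exists 0%N => // n _; apply: (decr_le dE (leq0n n)).
move=> p [_ cp]; apply: (h p) => n _.
have clE : closed [set t | E n (t, w)] by apply: compact_closed; [exact: Rhausdorff|exact: cE].
apply: (clE p) => B nB; apply: (cp [set t | E n (t, w)] B _ nB).
by exists n => // m /= nm; apply: (decr_le dE nm).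
Qed.

Local Notation mres K B := (fun t w => (K t w * ind B t w)%R).
Variables (Q : probability Omega R) (X : process) (I : process -> process).
Hypothesis hI : bounded_integral T Q F X I.
Local Notation indist := (indist T Q).

Lemma mul_ind_bounded K B t w : `|K t w * ind B t w| <= `|K t w|.
Proof.
by rewrite normrM -[leRHS]mulr1 ler_wpM2l//; exact: ind_bounded.
Qed.

Lemma bpMind K B : bp K -> measurable (B : set PT) -> bp (mres K B).
Proof. by move=> bK mB; apply: (bpM T_gt0 filtF bK); exact: bp_ind. Qed.

Lemma int_congr K L : bp K -> (forall t w, date T t -> K t w = L t w) -> indist (I L) (I K).
Proof. by move=> bK KL; have [] := int_ext T_gt0 filtF hI bK KL. Qed.

Lemma int_zero K : (forall t w, date T t -> K t w = 0) -> indist (I K) (fun _ _ => 0).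
Proof.
move=> K0; have := int_congr (bp_cst T_gt0 filtF 0) (fun t w dt => esym (K0 t w dt)).
by apply: filterS2 (int0 T_gt0 filtF hI) => w h0 h t dt; rewrite h// h0.
Qed.

Definition local_on B := forall K, bp K -> forall Om0 : set Omega,
  (forall w t, Om0 w -> date T t -> ~ B (t, w)) ->
  {ae Q, forall w, Om0 w -> forall t, date T t -> I (mres K B) t w = 0}.

Lemma local_on_rect s t A : date T s -> date T t -> F s A ->
  forall K, bp K -> {ae Q, forall w, ~ A w -> forall r, date T r ->
    I (fun r w => K r w * ind (`]s, t] `*` A) r w) r w = 0}.
Proof.
move=> ds dt FA K bK.
have [st|ts] := leP s t; last first.
  rewrite set_itv_ge ?set0X ?bnd_simp -?leNgt 1?ltW//.
  have : indist (I (fun r w => K r w * ind set0 r w)) (fun _ _ => 0).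
    by apply: int_zero => r w _; rewrite ind_out ?mulr0.
  by apply: filterS => w h _ r dr; exact: h.
have mA : wrt (F s) (\1_A : Omega -> R).
  apply/(wrtP filtF ds); apply: measurable_indic.
  by rewrite /measurable/=; exact: sub_sigma_algebra.
have bA : exists b : R, forall w, `|\1_A w| <= b.
  by exists 1 => w; rewrite indicE; case: (_ \in _); rewrite ?normr1 ?normr0.
have bc := bpM T_gt0 filtF bK (bp_cell T_gt0 filtF ds dt mA bA).
have e : forall r w, date T r -> K r w * cell s t \1_A r w = K r w * ind (`]s, t] `*` A) r w.
  move=> x v _; congr (_ * _).
  rewrite /ind /cell !indicE -natrM mulnb; congr (_%:R); congr nat_of_bool.
  by apply/andP/idP; rewrite !inE/= in_itv/= => -[].
apply: filterS2 (int_congr bc e) (int_cell T_gt0 filtF hI bK ds dt st mA bA) => w h1 h nA r dr.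
by rewrite h1// h// indicE memNset// mul0r.
Qed.

(** For a rectangle at time 0 the integral starts at 0 and has no increments. Otherwise [int_cell]
    produces the factor [\1_A], and an empty section, tested at the date t, means that the outcome
    is not in A. *)
Lemma local_on_base B : base_rect B -> local_on B.
Proof.
have d0 := date0 T_gt0.
case=> [A FA|s s' t A ds dt ss FA] K bK Om0 hO.
  have mB : measurable ([set 0] `*` A : set PT) by exact: rect0_measurable.
  pose L : process := fun r w => K r w * ind ([set 0] `*` A) r w.
  have bL : bp L := bpMind bK mB.
  have h n : {ae Q, forall w r, date T r ->
      I L (Num.min (cap n%:R) r) w - I L (Num.min 0 r) w = 0}.
    have dn := cap_date T_gt0 (ler0n R n).
    have m1 : wrt (F 0) (fun _ : Omega => 1 : R) by apply/(wrtP filtF d0); exact: measurable_cst.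
    have b1 : exists b : R, forall w : Omega, `|1 : R| <= b by exists 1 => w; rewrite normr1.
    have h2 : indist (I (fun r w => L r w * cell 0 (cap n%:R) (fun=> 1) r w)) (fun _ _ => 0).
      apply: int_zero => r w _; rewrite /cell /L.
      have [->|r0] := eqVneq r 0; first by rewrite ltxx !mulr0.
      by rewrite ind_out ?mulr0 ?mul0r//= => -[/= /eqP]; rewrite (negbTE r0).
    apply: filterS2 h2 (int_cell T_gt0 filtF hI bL d0 dn dn.1 m1 b1) => w h1 h2 r dr.
    by have := h2 r dr; rewrite h1// mul1r.
  have hz := ae_foralln h.
  apply: filterS2 (int_start T_gt0 filtF hI bL) hz => w h0 h1 Ow r dr.
  have [n rn] := date_nat dr.
  by have := h1 n r dr; rewrite (min_r rn) min_l ?dr.1// h0 subr0.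
have mB := base_rect_measurable (base_rectI ds dt ss FA).
set D := [set z | _] in mB *.
have [ts|st] := ltP t s'.
  have : indist (I (fun r w => K r w * ind D r w)) (fun _ _ => 0).
    apply: int_zero => r w _; rewrite ind_out ?mulr0//= => -[/andP[h1 h2] _].
    by have := lt_le_trans ts (le_trans h1 h2); rewrite ltxx.
  by apply: filterS => w h _.
have e r w : date T r -> K r w * ind D r w * ind (`]s, t] `*` A) r w = K r w * ind D r w.
  move=> _; rewrite -mulrA; congr (_ * _).
  have [h|h] := pselect (D (r, w)); last by rewrite (ind_out h) mul0r.
  rewrite ind_in// mul1r ind_in//; case: h => /= /andP[h1 h2] h3; split => //=.
  by rewrite in_itv/= h2 (lt_le_trans ss).
have mA : measurable (`]s, t] `*` A : set PT) by exact: rect_measurable.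
have bL := bpMind bK mB.
apply: filterS2 (int_congr (bpMind bL mA) e) (local_on_rect ds dt FA bL) => w h1 h Ow r dr.
rewrite h1// h// => Aw; apply: (hO w t Ow dt); split => //=.
by rewrite st lexx.
Qed.

Lemma local_on_setU B C : measurable (B : set PT) -> measurable (C : set PT) ->
  local_on B -> local_on C -> local_on (B `|` C).
Proof.
move=> mB mC lB lC K bK Om0 hO.
have mBc : measurable (~` B : set PT) by exact: measurableC.
have bK1 := bpMind bK mB; have bK2 := bpMind (bpMind bK mBc) mC.
have e t w : date T t -> K t w * ind B t w + K t w * ind (~` B) t w * ind C t w =
    K t w * ind (B `|` C) t w.
  move=> _; rewrite /ind !indicE in_setU in_setC.
  by case: (_ \in B); case: (_ \in C) => /=; ring.
have bD : bp (fun t w => K t w * ind B t w + K t w * ind (~` B) t w * ind C t w).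
  exact: bpD.
have h1 := lB _ bK Om0 (fun w t Ow dt Bt => hO w t Ow dt (or_introl Bt)).
have h2 := lC _ (bpMind bK mBc) Om0 (fun w t Ow dt Ct => hO w t Ow dt (or_intror Ct)).
have h3 : {ae Q, forall w, (Om0 w -> forall t, date T t -> I (mres K B) t w = 0) /\
   (Om0 w -> forall t, date T t -> I (fun t w => K t w * ind (~` B) t w * ind C t w) t w = 0)}.
  by apply: filterS2 h1 h2 => w; split.
apply: filterS3 h3 (int_congr bD e) (intD hI bK1 bK2) => w [h1' h2'] h4 h5 Ow t dt.
by rewrite h4// h5// h1'// h2'// addr0.
Qed.

Lemma local_on_elset E : elset E -> local_on E.
Proof.
elim=> [|B E1 hB hE ih].
  move=> K bK Om0 _.
  have : indist (I (fun r w => K r w * ind set0 r w)) (fun _ _ => 0).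
    by apply: int_zero => r w _; rewrite ind_out ?mulr0.
  by apply: filterS => w h _.
apply: local_on_setU => //; [exact: base_rect_measurable|exact: elset_measurable|exact: local_on_base].
Qed.

Lemma pred_bpMind K B : predictable T F K -> bounded1 T K -> measurable (B : set PT) ->
  predictable T F (mres K B) /\ bounded1 T (mres K B).
Proof.
move=> pK bK mB; split; first by have [] := bpMind (bpP pK bK) mB.
by move=> t w dt; rewrite (le_trans (mul_ind_bounded _ _ _ _))// bK.
Qed.

Lemma ind_cvg (Bn : nat -> set (R * Omega)) B t w :
  (\forall n \near \oo, Bn n (t, w) <-> B (t, w)) ->
  ind (Bn n) t w @[n --> \oo] --> ind B t w.
Proof.
move=> h; apply: cvg_near_eq; apply: filterS h => n [h1 h2].
have [Bt|Bt] := pselect (B (t, w)); first by rewrite !ind_in//; exact: h2.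
by rewrite !ind_out// => /h1.
Qed.

(** Where the section of the intersection is empty, some [E m] has an empty section already, with m
    depending on the outcome. From m on the integrals along [E n] vanish there, and so does their
    limit. *)
Lemma local_on_cset C : cset C -> local_on C.
Proof.
move=> [E [hE dE ->]] K bK Om0 hO.
have mE n := elset_measurable (hE n).
have mC : measurable (\bigcap_n E n : set PT) by exact: bigcapT_measurable.
suff H t0 : date T t0 -> {ae Q, forall w s, 0 <= s <= t0 -> Om0 w -> I (mres K (\bigcap_n E n)) s w = 0}.
  apply: filterS (ae_dates T_gt0 H) => w h Ow t dt; exact: h.
move=> dt0.
have [pK [b hb]] := bK.
have ucp : ucp_cvg T Q (fun n => I (mres K (E n))) (I (mres K (\bigcap_n E n))).
  apply: (int_dct hI (c := b)).
  - by move=> n; have [] := bpMind bK (mE n).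
  - by have [] := bpMind bK mC.
  - by move=> n t w dt; rewrite (le_trans (mul_ind_bounded _ _ _ _))// hb.
  - move=> t w dt; apply: cvgM; first exact: cvg_cst.
    apply: ind_cvg; have [h|/existsNP[m /not_implyP[_ nm]]] := pselect ((\bigcap_n E n) (t, w)).
      by apply: nearW => n; split => // _; exact: h.
    exists m => // n /= mn; split => [h|h]; last exact: h.
    by exfalso; apply: nm; exact: (decr_le dE mn).
have [sg [nsg hs]] := ucp_as filtF (fun n => int_cadlag hI (bpMind bK (mE n))) (int_cadlag hI (bpMind bK mC)) ucp dt0.
have hloc : {ae Q, forall w m, (forall t, date T t -> ~ E m (t, w)) -> forall n, (m <= n)%N ->
    forall t, date T t -> I (mres K (E n)) t w = 0}.
  apply: ae_foralln => m.
  have h n : {ae Q, forall w, (m <= n)%N -> (forall t, date T t -> ~ E m (t, w)) ->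
      forall t, date T t -> I (mres K (E n)) t w = 0}.
    have [mn|_] := boolP (m <= n)%N; last by apply: aeW.
    have := @local_on_elset _ (hE n) K bK [set w | forall t, date T t -> ~ E m (t, w)].
    have hh : forall w t, [set w | forall t, date T t -> ~ E m (t, w)] w -> date T t -> ~ E n (t, w).
      by move=> w t /= h dt /(decr_le dE mn); exact: h.
    by move=> /(_ hh); apply: filterS => w h _; exact: h.
  by apply: filterS (ae_foralln h) => w h' hm n mn; exact: h'.
apply: filterS2 hs hloc => w u hl s st Ow.
have [m hm] : exists m, forall t, date T t -> ~ E m (t, w).
  have h t : ~ (\bigcap_n E n) (t, w).
    by move=> ht; apply: (hO w t Ow _ ht); exact: elset_date (hE 0%N) (ht 0%N Logic.I).
  have [m hm] := cset_empty_section hE dE h.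
  by exists m => t _; exact: hm.
have ds : date T s by case/andP: st => s0; exact: date_le.
have h1 := unif_cvg_pt u st.
have h2 : I (mres K (E (sg n))) s w @[n --> \oo] --> (0 : R).
  apply: cvg_near_eq; exists m => // n /= mn; apply: (hl m) => //.
  exact: leq_trans mn (nsg n).
by rewrite -(cvg_lim (@Rhausdorff R) h1) (cvg_lim (@Rhausdorff R) h2).
Qed.

Definition exceeds t0 (eps : R) Z := [set w | exists2 s, 0 <= s <= t0 & eps < `|Z s w|].

(** Stands for a bound eps on the size of B under the vector measure given by the integral,
    uniformly over integrands bounded by 1; eps serves both as threshold and as probability. *)
Definition small t0 B (eps : R) := forall K, predictable T F K -> bounded1 T K ->
  (Q (exceeds t0 eps (I (mres K B))) <= eps%:E)%E.

Lemma exceeds_measurable t0 eps K : date T t0 -> bp K -> measurable (exceeds t0 eps (I K)).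
Proof.
move=> dt bK; apply: ((filtF.1 t0 dt).2).
exact: (exceed_measurable filtF eps (int_cadlag hI bK) dt).
Qed.

Lemma le_measure_ae (A B : set Omega) : measurable A -> measurable B ->
  {ae Q, forall w, A w -> B w} -> (Q A <= Q B)%E.
Proof.
move=> mA mB [N [mN N0 AN]].
apply: (@le_trans _ _ (Q (B `|` N))).
  apply: le_measure; rewrite ?inE//; first exact: measurableU.
  move=> w Aw; apply: contrapT => /not_orP[nB nN]; apply: nN; apply: AN => /= h.
  by apply: nB; exact: h.
by rewrite (le_trans (measureU2 Q mB mN))// [X in (_ + X)%E](_ : _ = 0%E) ?adde0.
Qed.

Lemma small_mono t0 B C eps : date T t0 -> measurable (B : set PT) -> measurable (C : set PT) ->
  B `<=` C -> small t0 C eps -> small t0 B eps.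
Proof.
move=> dt mB mC BC sC K pK bK.
have [pL bL] := pred_bpMind pK bK mB.
apply: le_trans (sC _ pL bL).
have e t w : date T t -> K t w * ind B t w * ind C t w = K t w * ind B t w.
  move=> _; rewrite -mulrA; congr (_ * _).
  have [h|h] := pselect (B (t, w)); last by rewrite (ind_out h) mul0r.
  by rewrite !ind_in// ?mul1r//; exact: BC.
apply: le_measure_ae; [exact: exceeds_measurable (bpP pL bL)|exact: exceeds_measurable (bpMind (bpP pL bL) mC)|].
apply: filterS (int_congr (bpMind (bpP pL bL) mC) e) => w h [s st hs].
by exists s => //; rewrite -h//; case/andP: st => *; exact: date_le dt _ _.
Qed.

(** An integrand on the union splits into its part on B and its part on C off B, both again bounded
    by 1. *)
Lemma small_setU t0 B C eps eps' : date T t0 -> measurable (B : set PT) -> measurable (C : set PT) ->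
  small t0 B eps -> small t0 C eps' -> small t0 (B `|` C) (eps + eps').
Proof.
move=> dt mB mC sB sC K pK bK.
have mBc : measurable (~` B : set PT) by exact: measurableC.
have [pL bL] := pred_bpMind pK bK mBc.
have b1 := bpMind (bpP pK bK) mB; have b2 := bpMind (bpP pL bL) mC.
have e t w : date T t -> K t w * ind B t w + K t w * ind (~` B) t w * ind C t w =
    K t w * ind (B `|` C) t w.
  move=> _; rewrite /ind !indicE in_setU in_setC.
  by case: (_ \in B); case: (_ \in C) => /=; ring.
have m1 := exceeds_measurable eps dt b1; have m2 := exceeds_measurable eps' dt b2.
have mU := measurableU _ _ m1 m2.
have m3 : measurable (exceeds t0 (eps + eps') (I (mres K (B `|` C)))).
  by apply: exceeds_measurable => //; apply: bpMind; [exact: bpP|exact: measurableU].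
rewrite EFinD; apply: le_trans (leeD (sB _ pK bK) (sC _ pL bL)).
apply: le_trans (measureU2 Q m1 m2).
apply: le_measure_ae => //.
apply: filterS2 (int_congr (bpD T_gt0 filtF b1 b2) e) (intD hI b1 b2) => w h1 h2 [s st].
have ds : date T s by case/andP: st => s0 sT; exact: date_le dt s0 sT.
rewrite h1// h2// => hs.
have [h|h] := ltP eps `|I (mres K B) s w|; first by left; exists s.
right; exists s => //; rewrite -(ltrD2l eps) (lt_le_trans hs)// (le_trans (ler_normD _ _))//.
by rewrite lerD2r.
Qed.

(** The second eps pays for the distance between the integrals along B and along a late [Bn n]. *)
Lemma small_lim t0 (Bn : nat -> set (R * Omega)) B eps : date T t0 -> 0 < eps ->
  (forall n, measurable (Bn n : set PT)) -> measurable (B : set PT) ->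
  (forall n, Bn n `<=` Bn n.+1) -> B = \bigcup_n Bn n ->
  (forall n, small t0 (Bn n) eps) -> small t0 B (eps + eps).
Proof.
move=> dt e0 mBn mB incr BE sBn K pK bK.
have b1 n := bpMind (bpP pK bK) (mBn n); have b2 := bpMind (bpP pK bK) mB.
have inc m n : (m <= n)%N -> Bn m `<=` Bn n.
  by move=> /subnK <-; elim: (n - m)%N => [//|k ih]; apply: subset_trans ih _; exact: incr.
have ucp : ucp_cvg T Q (fun n => I (mres K (Bn n))) (I (mres K B)).
  apply: (int_dct hI (c := 1)).
  - by move=> n; have [] := b1 n.
  - by have [] := b2.
  - by move=> n t w dt'; rewrite (le_trans (mul_ind_bounded _ _ _ _))// bK.
  - move=> t w dt'; apply: cvgM; first exact: cvg_cst.
    apply: ind_cvg; rewrite BE; have [[m _ hm]|h] := pselect ((\bigcup_n Bn n) (t, w)).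
      by exists m => // n /= mn; split => _; [exists m|exact: inc mn _ hm].
    by apply: nearW => n; split => // hn; exfalso; apply: h; exists n.
pose D n := [set w | exists2 s, 0 <= s <= t0 & eps < `|I (mres K (Bn n)) s w - I (mres K B) s w|].
have := ucp t0 eps dt e0 => /fine_cvgP[fin /cvgrPdist_le /(_ eps e0) h].
have [n [fn hn]] : exists n, Q (D n) \is a fin_num /\
    `|0 - fine (Q (D n))| <= eps.
  have : \forall n \near \oo, Q (D n) \is a fin_num /\
    `|0 - fine (Q (D n))| <= eps.
    by near=> n; split; near: n.
  by case=> N _ /(_ N (leqnn N)); exists N.
have m1 := exceeds_measurable eps dt (b1 n).
have m2 := exceed_measurableB filtF eps (int_cadlag hI (b1 n)) (int_cadlag hI b2) dt.
have m3 := exceeds_measurable (eps + eps) dt b2.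
rewrite EFinD; apply: (@le_trans _ _ (Q (exceeds t0 eps (I (mres K (Bn n)))) + Q (D n))%E); last first.
  apply: leeD; first exact: sBn.
  rewrite -(fineK fn) lee_fin; move: hn; rewrite sub0r normrN.
  by apply: le_trans; exact: ler_norm.
apply: le_trans (measureU2 Q m1 m2).
apply: le_measure; rewrite ?inE//; first exact: measurableU.
move=> w [s st hs].
set x := I _ s w in hs; pose y := I (mres K (Bn n)) s w.
have [h1|h1] := ltP eps `|y|; first by left; exists s.
right; exists s => //=; rewrite -/x -/y.
have := ler_normB y (y - x); rewrite subKr => h2.
have := lt_le_trans hs h2 => h3; lra.
Unshelve. all: by end_near. Qed.

(** Continuity at the empty set: otherwise each n has a bad integrand [K n], but [K n] restricted to
    [Bn n] tends to 0 pointwise, and dominated convergence contradicts the choice. *)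
Lemma small_decr t0 (Bn : nat -> set (R * Omega)) eps : date T t0 -> 0 < eps ->
  (forall n, measurable (Bn n : set PT)) -> (forall n, Bn n.+1 `<=` Bn n) ->
  (forall z, ~ (\bigcap_n Bn n) z) -> exists n, small t0 (Bn n) eps.
Proof.
move=> dt e0 mBn dB hB; apply: contrapT => /forallNP h.
have /choice[K hK] : forall n, exists K : process, [/\ predictable T F K, bounded1 T K &
    (eps%:E < Q (exceeds t0 eps (I (mres K (Bn n)))))%E].
  move=> n; have := h n => /existsNP[K /not_implyP[pK /not_implyP[bK /negP]]].
  by rewrite -ltNge => hK; exists K.
have b1 n : bp (mres (K n) (Bn n)).
  by have [pK bK _] := hK n; exact: bpMind (bpP pK bK) (mBn n).
have ucp : ucp_cvg T Q (fun n => I (mres (K n) (Bn n))) (I (fun _ _ => 0)).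
  apply: (int_dct hI (c := 1)).
  - by move=> n; have [] := b1 n.
  - by have [] := bp_cst T_gt0 filtF 0.
  - by move=> n t w dt'; rewrite (le_trans (mul_ind_bounded _ _ _ _))//; have [_ + _] := hK n; exact.
  - move=> t w dt'; apply: cvg_near_eq.
    have := hB (t, w) => /existsNP[m /not_implyP[_ nm]].
    by exists m => // n /= mn; rewrite ind_out ?mulr0// => /(decr_le dB mn).
pose D n := [set w | exists2 s, 0 <= s <= t0 & eps < `|I (mres (K n) (Bn n)) s w - I (fun _ _ => 0) s w|].
have := ucp t0 eps dt e0 => /fine_cvgP[fin /cvgrPdist_lt /(_ eps e0) hh].
have [n [fn hn]] : exists n, Q (D n) \is a fin_num /\
    `|0 - fine (Q (D n))| < eps.
  have : \forall n \near \oo, Q (D n) \is a fin_num /\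
    `|0 - fine (Q (D n))| < eps.
    by near=> n; split; near: n.
  by case=> N _ /(_ N (leqnn N)); exists N.
have [pK bK] := hK n; apply/negP; rewrite -leNgt.
have b0 := bp_cst T_gt0 filtF 0.
have m2 := exceed_measurableB filtF eps (int_cadlag hI (b1 n)) (int_cadlag hI b0) dt.
apply: (@le_trans _ _ (Q (D n))); last first.
  rewrite -(fineK fn) lee_fin; move: hn; rewrite sub0r normrN => hn.
  by apply: le_trans (ltW hn); exact: ler_norm.
apply: le_measure_ae => //; first exact: exceeds_measurable (b1 n).
apply: filterS (int0 T_gt0 filtF hI) => w h0 [s st hs].
have ds : date T s by case/andP: st => s0 sT; exact: date_le dt s0 sT.
by exists s => //; rewrite h0// subr0.
Unshelve. all: by end_near. Qed.

Lemma small_set0 t0 eps : date T t0 -> 0 <= eps -> small t0 set0 eps.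
Proof.
move=> dt e0 K pK bK.
have b0 : bp (mres K set0) by apply: bpMind (bpP pK bK) _; exact: measurable0.
apply: (@le_trans _ _ 0%:E); last by rewrite lee_fin.
rewrite (_ : 0%:E = Q set0); last by rewrite measure0.
apply: le_measure_ae => //; first exact: exceeds_measurable.
have : indist (I (mres K set0)) (fun _ _ => 0).
  by apply: int_zero => t w _; rewrite ind_out ?mulr0.
apply: filterS => w h [s st]; rewrite h ?normr0 ?ltNge ?e0//.
by case/andP: st => s0 sT; exact: date_le dt s0 sT.
Qed.

(** Inner regularity: approximation from inside by csets, measured by [small], as compact sets
    approximate for a Radon measure. *)
Definition inner t0 B := [/\ B `<=` dates, measurable (B : set PT) &
  forall eps, 0 < eps -> exists C, [/\ cset C, C `<=` B & small t0 (B `\` C) eps]].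

Lemma inner_cset t0 C : date T t0 -> C `<=` dates -> cset C -> inner t0 C.
Proof.
move=> dt CD hC; split => //; first exact: cset_measurable.
move=> eps e0; exists C; split => //; rewrite setDv.
by apply: small_set0 => //; exact: ltW.
Qed.

Lemma small_bigcup t0 (Bn : nat -> set (R * Omega)) eps : date T t0 -> 0 < eps ->
  (forall n, measurable (Bn n : set PT)) ->
  (forall n, small t0 (Bn n) (eps / 2 ^+ n.+1)) -> small t0 (\bigcup_n Bn n) (eps + eps).
Proof.
move=> dt e0 mBn sB.
pose U n := \bigcup_(i < n) Bn i.
have mU n : measurable (U n : set PT) by apply: bigcup_measurable => k _.
apply: (@small_lim t0 U) => //.
- exact: bigcupT_measurable.
- by move=> n z [k /= kn h]; exists k => //=; exact: ltn_trans kn _.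
- apply/seteqP; split => z [k _]; first by move=> h; exists k.+1 => //; exists k => //=.
  by move=> [j _ h]; exists j.
move=> n.
have sle C e e' : measurable (C : set PT) -> e <= e' -> small t0 C e -> small t0 C e'.
  move=> mC ee sC K pK bK; apply: (@le_trans _ _ e%:E); last by rewrite lee_fin.
  apply: le_trans (sC K pK bK).
  have bC := bpMind (bpP pK bK) mC.
  apply: le_measure; rewrite ?inE; [exact: exceeds_measurable|exact: exceeds_measurable|].
  by move=> w [s st hs]; exists s => //; exact: le_lt_trans hs.
suff : small t0 (U n) (eps * (1 - 2 ^- n)).
  apply: sle => //; rewrite ler_piMr ?ltW// lerBlDr lerDl invr_ge0 exprn_ge0//.
elim: n => [|n ih].
  rewrite expr0 invr1 subrr mulr0 (_ : U 0%N = set0); first exact: small_set0.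
  by apply/seteqP; split => // z [].
have -> : eps * (1 - 2 ^- n.+1) = eps * (1 - 2 ^- n) + eps / 2 ^+ n.+1.
  by rewrite exprS invfM; field; rewrite expf_neq0 ?pnatr_eq0.
rewrite (_ : U n.+1 = U n `|` Bn n); first exact: small_setU.
apply/seteqP; split => [z [k /=]|z [[k /= kn h]|h]].
- by rewrite ltnS leq_eqVlt => /predU1P[->|kn] h; [right|left; exists k].
- by exists k => //=; exact: ltn_trans kn _.
- by exists n => /=.
Qed.

Lemma inner_bigcup t0 (Bn : nat -> set (R * Omega)) : date T t0 ->
  (forall n, inner t0 (Bn n)) -> inner t0 (\bigcup_n Bn n).
Proof.
move=> dt h; have mB n : measurable (Bn n : set PT) by have [] := h n.
split; first by apply: bigcup_sub => n _; have [] := h n.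
  exact: bigcupT_measurable.
move=> eps e0; have e4 : 0 < eps / 4 by lra.
have /choice[C hC] : forall n, exists C, [/\ cset C, C `<=` Bn n & small t0 (Bn n `\` C) (eps / 4 / 2 ^+ n.+1)].
  by move=> n; have [_ _ +] := h n; apply; rewrite divr_gt0// exprn_gt0.
have mC n : measurable (C n : set PT) by apply: cset_measurable; have [] := hC n.
pose U n := \bigcup_(i < n) C i.
have mU n : measurable (U n : set PT) by apply: bigcup_measurable => k _.
have mUC : measurable (\bigcup_n C n : set PT) by exact: bigcupT_measurable.
have [||||N hN] := @small_decr t0 (fun n => \bigcup_n C n `\` U n) (eps / 2) dt.
- lra.
- by move=> n; exact: measurableD.
- move=> n z [h1 h2]; split => // -[k /= kn hk]; apply: h2; exists k => //=.
  exact: ltn_trans kn _.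
- move=> z hz; have [[k _ Ck] _] := hz 0%N Logic.I.
  by have [_] := hz k.+1 Logic.I; apply; exists k => /=.
exists (U N); split.
- rewrite /U; elim: (N) => [|n ih].
    by rewrite (_ : \bigcup_(i < 0) _ = set0); [apply: cset_elset; exact: elset0|apply/seteqP; split => // z []].
  rewrite (_ : \bigcup_(i < n.+1) C i = (\bigcup_(i < n) C i) `|` C n).
    by apply: cset_setU => //; have [] := hC n.
  apply/seteqP; split => [z [k /=]|z [[k /= kn hz]|hz]].
  + by rewrite ltnS leq_eqVlt => /predU1P[->|kn] hz; [right|left; exists k].
  + by exists k => //=; exact: ltn_trans kn _.
  + by exists n => /=.
- by move=> z [k /= _ Ck]; exists k => //; have [_ + _] := hC k; apply.
have mD n : measurable (Bn n `\` C n : set PT) by exact: measurableD.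
have mDU : measurable (\bigcup_n (Bn n `\` C n) : set PT) by exact: bigcupT_measurable.
have s1 : small t0 (\bigcup_n (Bn n `\` C n)) (eps / 4 + eps / 4).
  by apply: small_bigcup => // n; have [] := hC n.
have s2 := small_setU dt mDU (measurableD mUC (mU N)) s1 hN.
rewrite (_ : eps = eps / 4 + eps / 4 + eps / 2); last by field.
apply: small_mono s2 => //.
- by apply: measurableD => //; exact: bigcupT_measurable.
- by apply: measurableU => //; exact: measurableD.
move=> z [[k _ Bk] nU]; have [Ck|nC] := pselect ((\bigcup_n C n) z); first by right.
by left; exists k => //; split => // Ck; apply: nC; exists k.
Qed.

Lemma inner_bigcap t0 (Bn : nat -> set (R * Omega)) : date T t0 ->
  (forall n, inner t0 (Bn n)) -> inner t0 (\bigcap_n Bn n).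
Proof.
move=> dt h; have mB n : measurable (Bn n : set PT) by have [] := h n.
split; first by move=> z /(_ 0%N Logic.I); have [+ _ _] := h 0%N; apply.
  exact: bigcapT_measurable.
move=> eps e0; have e4 : 0 < eps / 2 by lra.
have /choice[C hC] : forall n, exists C, [/\ cset C, C `<=` Bn n & small t0 (Bn n `\` C) (eps / 2 / 2 ^+ n.+1)].
  by move=> n; have [_ _ +] := h n; apply; rewrite divr_gt0// exprn_gt0.
have mC n : measurable (C n : set PT) by apply: cset_measurable; have [] := hC n.
exists (\bigcap_n C n); split.
- by apply: cset_bigcap => n; have [] := hC n.
- by move=> z hz n _; have [_ + _] := hC n; apply; exact: hz.
have mD n : measurable (Bn n `\` C n : set PT) by exact: measurableD.
have s1 : small t0 (\bigcup_n (Bn n `\` C n)) (eps / 2 + eps / 2).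
  by apply: small_bigcup => // n; have [] := hC n.
rewrite (_ : eps = eps / 2 + eps / 2); last by field.
apply: small_mono s1 => //.
- by apply: measurableD; exact: bigcapT_measurable.
- exact: bigcupT_measurable.
move=> z [hz /existsNP[n /not_implyP[_ nC]]]; exists n => //; split => //; exact: hz.
Qed.

Lemma inner_rect t0 s t A : date T t0 -> date T s -> date T t -> F s A ->
  inner t0 (`]s, t] `*` A).
Proof.
move=> dt0 ds dt FA.
have mB : measurable (`]s, t] `*` A : set PT) by exact: rect_measurable.
have sub : `]s, t] `*` A `<=` dates.
  move=> [r w] [/=]; rewrite in_itv/= => /andP[sr rt] _; split => //=.
  by apply: (date_le dt) => //; rewrite (le_trans ds.1)// ltW.
split => // eps e0.
pose D n : set (R * Omega) := [set z | s + 2 ^- n <= z.1 <= t /\ A z.2].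
have p0 n : 0 < (2 ^- n : R) by rewrite invr_gt0 exprn_gt0.
have bD n : base_rect (D n) by apply: (base_rectI ds dt _ FA); rewrite ltrDl.
have mD n := base_rect_measurable (bD n).
have [|||N hN] := @small_decr t0 (fun n => `]s, t] `*` A `\` D n) eps dt0 e0.
- by move=> n; exact: measurableD.
- move=> n z [h1 h2]; split => // -[/andP[h3 h4] h5]; apply: h2; split => //; rewrite h4 andbT.
  by rewrite (le_trans _ h3)// lerD2l lef_pV2 ?posrE ?exprn_gt0// exprS ler_peMl ?exprn_ge0// ler1n.
- move=> [r w] hz; have [[/= rst Aw] _] := hz 0%N Logic.I.
  move: rst; rewrite in_itv/= => /andP[sr rt].
  have /cvgrPdist_lt /(_ (r - s)) : ((2^-1 : R) ^+ n) @[n --> \oo] --> (0 : R).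
    by apply: cvg_expr; rewrite ger0_norm ?invr_ge0// invf_lt1// ltr1n.
  rewrite subr_gt0 => /(_ sr) [n _ /(_ n (leqnn n))] /=.
  rewrite sub0r normrN exprVn gtr0_norm// => hn.
  by have [_] := hz n Logic.I; apply; split => //=; rewrite rt andbT; lra.
exists (D N); split => //.
- by apply: cset_elset; rewrite -(setU0 (D N)); apply: elsetU => //; exact: elset0.
- move=> [r w] /= [/andP[h1 h2] Aw]; split => //=; rewrite in_itv/= h2 andbT.
  by rewrite (lt_le_trans _ h1)// ltrDl.
Qed.

Lemma inner_rect0 t0 A : date T t0 -> F 0 A -> inner t0 ([set 0] `*` A).
Proof.
move=> dt FA; apply: inner_cset => //.
  by move=> [r w] /= [-> _]; split => //; exact: date0.
rewrite -(setU0 (_ `*` _)); apply: cset_elset; apply: elsetU; last exact: elset0.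
exact: base_rect0.
Qed.

Lemma inner_half t0 s : date T t0 -> date T s ->
  inner t0 ([set r | date T r /\ s < r] `*` setT).
Proof.
move=> dt ds; rewrite (half_line_bigcup T_gt0 ds.1).
rewrite (_ : _ `*` _ = \bigcup_n (`]s, cap n%:R] `*` setT)).
  apply: inner_bigcup => // n; apply: inner_rect => //; first exact: cap_date.
  exact: (filtT filtF ds).
apply/seteqP; split=> [[r w] /= [[n _ rn] Aw]|[r w] [n _ [/= rn Aw]]].
  by exists n.
by split => //; exists n.
Qed.

Lemma inner_setU t0 B C : date T t0 -> inner t0 B -> inner t0 C -> inner t0 (B `|` C).
Proof.
move=> dt hB hC; rewrite (_ : B `|` C = \bigcup_n (if n is 0 then B else C)).
  by apply: inner_bigcup => // -[|n].
apply/seteqP; split => [w [Aw|Bw]|w [[|n] _ h]]; [by exists 0%N|by exists 1%N|by left|by right].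
Qed.

(** Complements are carried along: the sets that are inner together with their complement in [dates]
    form a sigma-algebra, and complements of generating rectangles are finite unions of rectangles
    and half lines. *)
Lemma inner_measurable t0 B : date T t0 -> B `<=` dates -> measurable (B : set PT) ->
  inner t0 B.
Proof.
move=> dt BD mB; have d0 := date0 T_gt0.
have FC t A : date T t -> F t A -> F t (~` A).
  by move=> du FA; have [[_ + _] _] := filtF.1 t du; rewrite -setTD; apply.
have /(g_sigma_restrict (rect_dates T_gt0) (dates_measurable T_gt0 filtF)) : B `<=` dates /\ <<s predictable_rect T F >> B by split.
suff H : <<s dates, predictable_rect T F >> `<=` [set B | inner t0 B /\ inner t0 (dates `\` B)] by move=> /H[].
have iT : inner t0 dates.
  rewrite (_ : dates = [set 0] `*` setT `|` [set r | date T r /\ 0 < r] `*` setT).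
    by apply: inner_setU => //; [apply: inner_rect0 => //; exact: (filtT filtF d0)|exact: inner_half].
  apply/seteqP; split => [[r w] [/= dr _]|[r w] /= [[-> _]|[[dr r0] _]]].
  - have [->|r0] := eqVneq r 0; [by left|right; split => //; split => //].
    by rewrite lt_neqAle eq_sym r0 dr.1.
  - by split.
  - by split.
have i0 : inner t0 set0.
  by apply: inner_cset => //; apply: cset_elset; exact: elset0.
apply: smallest_sub.
  split => /=.
  - by rewrite setD0.
  - by move=> A [h1 h2]; split => //; rewrite setDD setIidr//; have [] := h1.
  - move=> A hA; split; first by apply: inner_bigcup => // n; have [] := hA n.
    rewrite (_ : _ `\` _ = \bigcap_n (dates `\` A n)).
      by apply: inner_bigcap => // n; have [] := hA n.
    apply/seteqP; split => [z [h1 h2] n _|z h].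
      by split => // h; apply: h2; exists n.
    by split; [have [] := h 0%N Logic.I|move=> [n _ An]; have [_] := h n Logic.I; apply].
move=> C [[A FA ->]|[s [t [A [ds du st FA ->]]]]] /=.
  split; first exact: inner_rect0.
  rewrite (_ : _ `\` _ = [set 0] `*` (~` A) `|` [set r | date T r /\ 0 < r] `*` setT).
    by apply: inner_setU => //; [apply: inner_rect0 => //; exact: FC|exact: inner_half].
  apply/seteqP; split => [[r w] [[/= dr _] h]|[r w] [[/= -> nA]|[/= [dr r0] _]]].
  - have [r0|r0] := eqVneq r 0; [left|right; split => //; split => //].
      by split => // Aw; apply: h.
    by rewrite lt_neqAle eq_sym r0 dr.1.
  - by split => // -[].
  - by split => // -[/= r00]; rewrite r00 ltxx in r0.
split; first exact: inner_rect.
rewrite (_ : _ `\` _ = [set 0] `*` setT `|` `]0, s] `*` setT `|` `]s, t] `*` (~` A) `|`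
  [set r | date T r /\ t < r] `*` setT).
  apply: inner_setU => //; last exact: inner_half.
  apply: inner_setU => //; last by apply: inner_rect => //; exact: FC.
  apply: inner_setU => //; first by apply: inner_rect0 => //; exact: (filtT filtF d0).
  by apply: inner_rect => //; exact: (filtT filtF d0).
apply/seteqP; split => [[r w] [[/= dr _] h]|[r w]].
  have [tr|rt] := ltP t r; first by right.
  left; have [sr|rs] := ltP s r.
    by right; split => [|Aw]; rewrite /= ?in_itv/= ?sr//; apply: h; split => //=; rewrite in_itv/= sr.
  left; have [r0|r0] := eqVneq r 0; [by left|right; split => //=].
  by rewrite in_itv/= rs andbT lt_neqAle eq_sym r0 dr.1.
case=> [[[[/= -> _]|[/=]]|[/=]]|[/= [dr tr] _]].
- by split; [split|move=> [/=]; rewrite in_itv/= ltNge ds.1].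
- rewrite in_itv/= => /andP[r0 rs] _; split; first by split => //; exact: (date_le ds (ltW r0)).
  by move=> [/=]; rewrite in_itv/= ltNge rs.
- rewrite in_itv/= => /andP[sr rt] nA; split; last by move=> [].
  by split => //; apply: (date_le du) => //; rewrite (le_trans ds.1)// ltW.
- by split => // -[/=]; rewrite in_itv/= leNgt tr andbF.
Qed.

(** For a cset C inside B, locality along C identifies on [Om0] the integral along B with the one
    along the rest of B, which inner regularity makes small. *)
Lemma local_on_measurable B : B `<=` dates -> measurable (B : set PT) -> local_on B.
Proof.
move=> BD mB.
suff H K : predictable T F K -> bounded1 T K -> forall Om0 : set Omega,
    (forall w t, Om0 w -> date T t -> ~ B (t, w)) -> forall t0, date T t0 ->
    {ae Q, forall w s, 0 <= s <= t0 -> Om0 w -> I (mres K B) s w = 0}.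
  move=> K bK Om0 hO; have [c [L [c0 pL bL KE]]] := bp_scale T_gt0 filtF bK.
  have e t w : date T t -> c * (L t w * ind B t w) = K t w * ind B t w by rewrite KE mulrA.
  have bLB := bpMind (bpP pL bL) mB.
  have bc : bp (fun t w => c * (L t w * ind B t w)).
    by apply: (bpM T_gt0 filtF (K := fun _ _ => c) (L := mres L B)) => //; exact: bp_cst.
  have := @ae_dates R dO Omega T T_gt0 Q _ (H L pL bL Om0 hO).
  apply: filterS3 (int_congr bc e) (intZ T_gt0 filtF hI c bLB) => w h1 h2 h3 Ow t dt.
  by rewrite h1// h2// h3// mulr0.
move=> pK bK Om0 hO t0 dt0.
have bKB := bpMind (bpP pK bK) mB.
suff hN (m : nat) : Q.-negligible (exceeds t0 (2 ^- m) (I (mres K B)) `&` Om0).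
  have := negligible_bigcup hN; apply: negligibleS => w /= /existsNP[s /not_implyP[st /not_implyP[Ow /eqP hs]]].
  have /cvgrPdist_lt /(_ `|I (mres K B) s w|) : ((2^-1 : R) ^+ n) @[n --> \oo] --> (0 : R).
    by apply: cvg_expr; rewrite ger0_norm ?invr_ge0// invf_lt1// ltr1n.
  rewrite normr_gt0 => /(_ hs) [n _ /(_ n (leqnn n))] /=.
  rewrite sub0r normrN exprVn gtr0_norm ?invr_gt0 ?exprn_gt0// => hn.
  by exists n => //; split => //; exists s.
have [_ _ inB] := inner_measurable dt0 BD mB.
(* The exponent n + m keeps the threshold below 2^-m while the probability tends to 0 with n, so
   exceeding 2^-m has probability zero. *)
have /choice[C hC] : forall n : nat, exists C, [/\ cset C, C `<=` B & small t0 (B `\` C) (2 ^- (n + m))].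
  by move=> n; apply: inB; rewrite invr_gt0 exprn_gt0.
have mC n : measurable (C n : set PT) by apply: cset_measurable; have [] := hC n.
have mD n : measurable (B `\` C n : set PT) by exact: measurableD.
pose V n := exceeds t0 (2 ^- (n + m)) (I (mres K (B `\` C n))).
have mV n : measurable (V n) by apply: exceeds_measurable => //; exact: bpMind (bpP pK bK) (mD n).
have Vs n : (Q (V n) <= (2 ^- (n + m))%:E)%E by have [_ _] := hC n; exact.
have V0 : Q (\bigcap_n V n) = 0.
  apply/eqP; rewrite eq_le measure_ge0 andbT; apply/lee_addgt0Pr => e e0; rewrite add0e.
  have /cvgrPdist_lt /(_ e e0) : ((2^-1 : R) ^+ n) @[n --> \oo] --> (0 : R).
    by apply: cvg_expr; rewrite ger0_norm ?invr_ge0// invf_lt1// ltr1n.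
  move=> [n _ /(_ n (leqnn n))] /=.
  rewrite sub0r normrN exprVn gtr0_norm ?invr_gt0 ?exprn_gt0// => hn.
  apply: (@le_trans _ _ (Q (V n))).
    apply: le_measure; rewrite ?inE//; first exact: bigcapT_measurable.
    by move=> z; exact.
  rewrite (le_trans (Vs n))// lee_fin (le_trans _ (ltW hn))// lef_pV2 ?posrE ?exprn_gt0//.
  by rewrite ler_eXn2l// ?ltr1n// leq_addr.
have h1 n : {ae Q, forall w, Om0 w -> forall t, date T t -> I (mres K (C n)) t w = 0}.
  have [cC CB _] := hC n.
  apply: (local_on_cset cC (bpP pK bK)) => w t Ow dt /CB; exact: hO.
have h2 n : {ae Q, forall w, Om0 w -> forall t, date T t -> I (mres K B) t w = I (mres K (B `\` C n)) t w}.
  have [_ CB _] := hC n.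
  have b1 := bpMind (bpP pK bK) (mC n); have b2 := bpMind (bpP pK bK) (mD n).
  have e t w : date T t -> K t w * ind (C n) t w + K t w * ind (B `\` C n) t w = K t w * ind B t w.
    move=> _; rewrite -mulrDr; congr (_ * _).
    have [h|h] := pselect (C n (t, w)).
      by rewrite (ind_in h) (ind_in (CB _ h)) ind_out ?addr0// => -[].
    rewrite (ind_out h) add0r; have [hB|hB] := pselect (B (t, w)); first by rewrite !ind_in.
    by rewrite !ind_out// => -[].
  apply: filterS3 (h1 n) (int_congr (bpD T_gt0 filtF b1 b2) e) (intD hI b1 b2) => w g1 g2 g3 Ow t dt.
  by rewrite g2// g3// g1// add0r.
have [N [mN N0 hNN]] := ae_foralln h2.
exists (\bigcap_n V n `|` N); split.
- by apply: measurableU => //; exact: bigcapT_measurable.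
- apply/eqP; rewrite eq_le measure_ge0 andbT.
  rewrite (le_trans (measureU2 _ _ _))//; first exact: bigcapT_measurable.
  by rewrite [X in (_ + X)%E](_ : _ = 0%E) ?[X in (X + _)%E](_ : _ = 0%E) ?adde0.
move=> w [[s st hs] Ow]; have [nw|nN] := pselect (N w); [by right|left => n _].
have hw : forall n, Om0 w -> forall t, date T t -> I (mres K B) t w = I (mres K (B `\` C n)) t w.
  by apply: contrapT => h; apply: nN; apply: hNN.
exists s => //; rewrite -hw//; last by case/andP: st => s0 sT; exact: date_le dt0 s0 sT.
apply: le_lt_trans hs; rewrite lef_pV2 ?posrE ?exprn_gt0//.
by rewrite ler_eXn2l// ?ltr1n// leq_addl.
Qed.

(* No measurability of Om0 is asked: this is what lets the integral pass to Q << P,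
   under which a predictable integrand agrees with its version only off a Q-null set. *)
Theorem int_local K (Om0 : set Omega) : bp K ->
  (forall w t, Om0 w -> date T t -> K t w = 0) ->
  {ae Q, forall w, Om0 w -> forall t, date T t -> I K t w = 0}.
Proof.
move=> bK hK; pose B : set (R * Omega) := dates `&` [set z | K z.1 z.2 != 0].
have mB : measurable (B : set PT).
  have mK := (predictableP T_gt0 filtF K).1 bK.1.
  rewrite (_ : B = dates `\` (dates `&` (fun z : PT => K z.1 z.2) @^-1` [set 0])).
    apply: measurableD; first exact: dates_measurable.
    by apply: mK; [exact: dates_measurable|exact: measurable_set1].
  apply/seteqP; split => [z [h1 h2]|z [h1 h2]]; split => //.
    by move=> [_ /= h]; rewrite /= h eqxx in h2.
  by apply/eqP => h; apply: h2.
have e t w : date T t -> K t w * ind B t w = K t w.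
  move=> dt; have [K0|K0] := eqVneq (K t w) 0; first by rewrite K0 mul0r.
  by rewrite ind_in ?mulr1.
have hO w t : Om0 w -> date T t -> ~ B (t, w).
  by move=> Ow dt [_ /=]; rewrite hK// eqxx.
apply: filterS2 (int_congr (bpMind bK mB) e) (local_on_measurable (@subIsetl _ _ _) mB bK hO) => w h1 h2 Ow t dt.
by rewrite h1// h2.
Qed.

End Locality.

(** * Change to an absolutely continuous measure *)

Section AbsoluteContinuity.
Context {R : realType} {dO : measure_display} {Omega : measurableType dO}.
Variables (P Q : probability Omega R).
Hypothesis QP : Q `<< P.

Lemma ac_null A : measurable A -> P A = 0%E -> Q A = 0%E.
Proof. by move/null_content_dominatesP : QP => h mA A0; exact: h. Qed.

Lemma ac_ae (Pr : Omega -> Prop) : {ae P, forall w, Pr w} -> {ae Q, forall w, Pr w}.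
Proof. by move=> [A [mA A0 hA]]; exists A; split => //; exact: ac_null. Qed.

(** Borel-Cantelli: sets of P-measure at most 2^-(n+1) and Q-measure above eps would have an upper
    limit that is P-null but of Q-measure at least eps. *)
Lemma ac_eps (eps : R) : 0 < eps -> exists2 delta : R, 0 < delta &
  forall A, measurable A -> (P A <= delta%:E)%E -> (Q A <= eps%:E)%E.
Proof.
move=> e0; apply: contrapT => hN.
have /choice[A hA] : forall n : nat, exists A, [/\ measurable A, (P A <= (1 / 2 ^+ n.+1)%:E)%E & (eps%:E < Q A)%E].
  move=> n; apply: contrapT => hn; apply: hN; exists (1 / 2 ^+ n.+1).
    by rewrite divr_gt0// exprn_gt0.
  move=> A mA PA; rewrite leNgt; apply/negP => QA; apply: hn; by exists A.
have mA n : measurable (A n) by have [] := hA n.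
have P0 : P (lim_sup_set A) = 0%E.
  apply: lim_sup_set_cvg0 => //.
  apply: (@le_lt_trans _ _ 1%:E); last by rewrite ltry.
  apply: le_trans (@epsilon_trick0 R 1 xpredT ler01).
  apply: lee_nneseries => // n _; rewrite natrX; by have [] := hA n.
have mL : measurable (lim_sup_set A).
  apply: bigcap_measurable => [|k _]; first by exists 0%N.
  by apply: bigcup_measurable => j _.
have Q0 := ac_null mL P0.
have h1 : (Q (\bigcup_(k >= 0) A k) < +oo)%E.
  apply: le_lt_trans (probability_le1 _ _) _; last by rewrite ltry.
  by apply: bigcup_measurable => j _.
have cv : Q (\bigcup_(k >= n) A k) @[n --> \oo] --> Q (lim_sup_set A) by exact: lim_sup_set_cvg.
rewrite Q0 in cv.
have : (eps%:E <= 0)%E.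
  rewrite -(cvg_lim _ cv)//; apply: lime_ge; first by apply/cvg_ex; exists 0%E.
  apply: nearW => n; have [_ _ /ltW h] := hA n; apply: le_trans h _.
  apply: le_measure; rewrite ?inE//; first by apply: bigcup_measurable => j _.
  by move=> z Az; exists n => /=.
by rewrite lee_fin leNgt e0.
Qed.

Lemma ac_ucp (T : \bar R) (F : R -> set (set Omega)) (filtF : is_filtration T F)
    (Xn : nat -> @process R dO Omega) X :
  (forall n, cadlag_adapted T F (Xn n)) -> cadlag_adapted T F X ->
  ucp_cvg T P Xn X -> ucp_cvg T Q Xn X.
Proof.
move=> cXn cX ucp t eps dt e0.
pose D n := [set w | exists2 s, 0 <= s <= t & eps < `|Xn n s w - X s w|].
have mD n : measurable (D n) by exact: (exceed_measurableB filtF).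
have finQ (A : set Omega) : measurable A -> Q A \is a fin_num by exact: fin_num_measure.
apply/fine_cvgP; split; first by apply: nearW => n; apply: finQ; exact: mD.
apply/cvgrPdist_le => e e'; have [dl d0 hd] := ac_eps e'.
have /fine_cvgP[_ /cvgrPdist_le /(_ dl d0)] := ucp t eps dt e0.
apply: filterS => n /=; rewrite !sub0r !normrN => h.
have h1 : (P (D n) <= dl%:E)%E.
  rewrite -(@fineK _ (P (D n))) ?fin_num_measure// lee_fin.
  by apply: le_trans h; exact: ler_norm.
have h2 := hd _ (mD n) h1.
rewrite ger0_norm ?fine_ge0// -lee_fin fineK// finQ//; exact: mD.
Qed.

End AbsoluteContinuity.

(** * Versions of integrands and the integral for the augmented filtration *)

Section Augment.
Context {R : realType} {dO : measure_display} {Omega : measurableType dO}.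
Variables (T : \bar R) (F : R -> set (set Omega)) (Q : probability Omega R).
Hypotheses (T_gt0 : (0 < T)%E) (filtF : is_filtration T F).
Local Notation process := (@process R dO Omega).
Local Notation F' := (augment Q F).

Lemma augment_filtration : is_filtration T F'.
Proof.
split.
  move=> t dt; split; first exact: smallest_sigma_algebra.
  apply: smallest_sub; first exact: sigma_algebra_measurable.
  by move=> A [/(filtF.1 t dt).2//|[]].
move=> s t ds dt st; apply: sub_sigma_algebra2 => A [FA|hA]; last by right.
by left; exact: (filtF.2 s t).
Qed.

Lemma sub_augment t : F t `<=` F' t.
Proof. by move=> A FA; apply: sub_sigma_algebra; left. Qed.

Lemma augment_wrt t (f : Omega -> R) : wrt (F t) f -> wrt (F' t) f.
Proof. by move=> h A /h; exact: sub_augment. Qed.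

Lemma augment_cadlag (X : process) : cadlag_adapted T F X -> cadlag_adapted T F' X.
Proof. by move=> [h1 h2]; split => // t dt; apply: augment_wrt; exact: h2. Qed.

Lemma augment_predictable (K : process) : predictable T F K -> predictable T F' K.
Proof.
move=> pK A /pK; apply: sub_sigma_algebra2 => C [[B FB ->]|[s [t [B [ds dt st FB ->]]]]].
  by left; exists B => //; exact: sub_augment.
by right; exists s, t, B; split => //; exact: sub_augment.
Qed.

Lemma augment_bp (K : process) : bounded_predictable T F K -> bounded_predictable T F' K.
Proof. by move=> [pK bK]; split => //; exact: augment_predictable. Qed.

Lemma augment_version t A : date T t -> F' t A ->
  exists2 A', F t A' & {ae Q, forall w, A w <-> A' w}.
Proof.
move=> dt; have [[F0 FC FU] Fm] := filtF.1 t dt.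
suff H : F' t `<=` [set A | exists2 A', F t A' & {ae Q, forall w, A w <-> A' w}] by move=> /H.
apply: smallest_sub.
  split.
  - by exists set0 => //; apply: aeW.
  - move=> B [B' FB' h]; exists (setT `\` B'); first exact: FC.
    by apply: filterS h => w h; split => -[_ nB]; split => // /h.
  - move=> B hB; have /choice[B' hB'] : forall n, exists B', F t B' /\ {ae Q, forall w, B n w <-> B' w}.
      by move=> n; have [B' ? ?] := hB n; exists B'.
    exists (\bigcup_n B' n); first by apply: FU => n; have [] := hB' n.
    have := ae_foralln (fun n => (hB' n).2); apply: filterS => w h.
    by split => -[n _ /h]; exists n.
move=> B [FB|[mB QB]]; first by exists B => //; apply: aeW.
exists set0 => //; exists B; split => // w /= h; apply: contrapT => nB; apply: h.
by split.
Qed.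

(** For a generating rectangle only the base in Omega is modified, so a single Q-null set of
    outcomes serves all times at once; countable operations preserve this. *)
Lemma augment_set_version (B : set (R * Omega)) : measurable (B : set (PT T F')) ->
  exists2 B', measurable (B' : set (PT T F)) & {ae Q, forall w t, B (t, w) <-> B' (t, w)}.
Proof.
pose G := [set B : set (R * Omega) | exists2 B', measurable (B' : set (PT T F)) &
   {ae Q, forall w t, B (t, w) <-> B' (t, w)}].
suff H : <<s predictable_rect T F' >> `<=` G by move=> /H.
apply: smallest_sub.
  split.
  - by exists set0; [exact: measurable0|apply: aeW].
  - move=> A [A' mA' h]; exists (setT `\` A'); first by rewrite setTD; exact: measurableC.
    by apply: filterS h => w h t; split => -[_ nB]; split => // /h.
  - move=> A hA; have /choice[A' hA'] : forall n, exists B', measurable (B' : set (PT T F)) /\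
      {ae Q, forall w t, A n (t, w) <-> B' (t, w)}.
      by move=> n; have [B' ? ?] := hA n; exists B'.
    exists (\bigcup_n A' n); first by apply: bigcupT_measurable => n; have [] := hA' n.
    have := ae_foralln (fun n => (hA' n).2); apply: filterS => w h t.
    by split => -[n _ /h]; exists n.
move=> C [[A FA ->]|[s [t [A [ds dt st FA ->]]]]].
  have [A' FA' h] := augment_version (date0 T_gt0) FA.
  exists ([set 0] `*` A'); first exact: rect0_measurable.
  by apply: filterS h => w h r /=; split => -[-> /h].
have [A' FA' h] := augment_version ds FA.
exists (`]s, t] `*` A'); first exact: rect_measurable.
by apply: filterS h => w h r /=; split => -[rs /h].
Qed.

(** A function is the supremum of the rationals below it. With measurable substitutes [A q] for the
    sets {q < f} this yields a measurable function that equals f wherever the substitutes are exact;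
    clipping and the default - c keep it bounded by c everywhere. *)
Lemma sup_version d (Z : measurableType d) (f : Z -> R) (c : R) (A : rat -> set Z) : 0 <= c ->
  (forall q, measurable (A q)) -> exists f' : Z -> R, [/\ measurable_fun setT f', (forall z, `|f' z| <= c) &
    forall z, `|f z| <= c -> (forall q, A q z <-> ratr q < f z) -> f' z = f z].
Proof.
move=> c0 mA.
pose cl (x : R) := Num.max (- c) (Num.min c x).
have clb x : - c <= cl x <= c.
  by rewrite /cl le_max lexx/= ge_max ge_min lexx/= andbT; lra.
pose g (n : nat) (z : Z) : R := if unpickle n is Some q then (if z \in A q then cl (ratr q) else - c) else - c.
have gb n z : - c <= g n z <= c.
  rewrite /g; case: (unpickle n) => [q|]; last by lra.
  by case: ifP => _; [exact: clb|lra].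
have mg n : measurable_fun setT (g n).
  rewrite /g; case: (unpickle n) => [q|]; last exact: measurable_cst.
  apply: measurable_fun_ifT; [|exact: measurable_cst|exact: measurable_cst].
  apply: (measurable_fun_bool true); rewrite setTI.
  rewrite (_ : _ @^-1` _ = A q)//; apply/seteqP; split => z /=; first by move=> /set_mem.
  by move=> h; rewrite mem_set.
have ub z : has_ubound (range (g^~ z)).
  by exists c => _ [n _ <-]; have /andP[] := gb n z.
have hs z : has_sup (range (g^~ z)).
  by split => //; exists (g 0%N z), 0%N.
pose f' z := sup (range (g^~ z)).
exists f'; split.
- have := @measurable_fun_sups _ Z R setT g 0%N (fun z _ => ub z) mg.
  apply: eq_measurable_fun => z _; rewrite /f' /sups /sdrop; congr sup.
  by apply/seteqP; split => x /= [n _ <-]; exists n.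
- move=> z; rewrite ler_norml; apply/andP; split.
    apply: le_trans (_ : g 0%N z <= _); first by have /andP[] := gb 0%N z.
    by apply: ub_le_sup => //; exists 0%N.
  by apply: ge_sup; [exists (g 0%N z), 0%N|move=> _ [n _ <-]; have /andP[] := gb n z].
move=> z; rewrite ler_norml => /andP[f1 f2] hA; apply/eqP; rewrite eq_le; apply/andP; split.
  apply: ge_sup; first by exists (g 0%N z), 0%N.
  move=> _ [n _ <-]; rewrite /g; case: (unpickle n) => [q|]//.
  case: ifPn => // /set_mem /hA qf.
  by rewrite /cl ge_max f1/= ge_min (ltW qf) orbT.
rewrite leNgt; apply/negP => h.
have [q] := @rat_in_itvoo R _ _ h; rewrite in_itv/= => /andP[q1 q2].
have hq : A q z by apply/hA.
have : g (pickle q) z <= f' z by apply: ub_le_sup => //; exists (pickle q).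
rewrite /g pickleK mem_set// /cl min_r; last by apply/ltW; exact: lt_le_trans f2.
by rewrite ge_max => /andP[_]; rewrite leNgt q1.
Qed.

Lemma augment_fun_version t (f : Omega -> R) c : date T t -> wrt (F' t) f ->
  (forall w, `|f w| <= c) -> exists f', [/\ wrt (F t) f', (forall w, `|f' w| <= c) &
    {ae Q, forall w, f w = f' w}].
Proof.
move=> dt mf fc.
have c0 : 0 <= c by apply: le_trans (fc point).
have /choice[A hA] : forall q : rat, exists A, F t A /\ {ae Q, forall w, ratr q < f w <-> A w}.
  move=> q; have := @augment_version t [set w | ratr q < f w] dt.
  have h : F' t [set w | ratr q < f w].
    apply: mf; exists `]ratr q, +oo[%classic => //.
    by rewrite setTI; apply/seteqP; split => w /=; rewrite in_itv/= andbT.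
  by move=> /(_ h)[A FA hA]; exists A.
have mA q : measurable (A q : set (g_sigma_algebraType (F t))).
  by rewrite /measurable/=; apply: sub_sigma_algebra; have [] := hA q.
have [f' [mf' f'c ff']] := @sup_version _ (g_sigma_algebraType (F t)) f c A c0 mA.
exists f'; split => //; first exact/(wrtP filtF dt).
have : {ae Q, forall w (n : nat), if unpickle n is Some q then (ratr q < f w <-> A q w) else True}.
  apply: ae_foralln => n; case: (unpickle n) => [q|]; last exact: aeW.
  by have [] := hA q.
apply: filterS => w h; rewrite ff'// => q.
by have := h (pickle q); rewrite pickleK => -[h1 h2]; split.
Qed.

Lemma augment_process_version (K : process) : bounded_predictable T F' K ->
  exists K', bounded_predictable T F K' /\ indist T Q K K'.
Proof.
move=> [pK [c0 hc0]].
pose c := Num.max 0 c0.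
have hc t w : date T t -> `|K t w| <= c by move=> dt; rewrite le_max hc0 ?orbT.
have filtF' := augment_filtration.
have mD := dates_measurable T_gt0 filtF'.
have /choice[A hA] : forall q : rat, exists A, measurable (A : set (PT T F)) /\
    {ae Q, forall w t, (date T t /\ ratr q < K t w) <-> A (t, w)}.
  move=> q; pose B : set (R * Omega) := @dates R dO Omega T `&` [set z | ratr q < K z.1 z.2].
  have mB : measurable (B : set (PT T F')).
    have := (predictableP T_gt0 filtF' K).1 pK mD _ (measurable_itv `]ratr q, +oo[).
    congr measurable; apply/seteqP; split => z /= [h1 h2]; split => //; move: h2; rewrite /= in_itv/= andbT//.
  have [A mA h] := augment_set_version mB; exists A; split => //.
  by apply: filterS h => w h t; rewrite -h; split => [[h1 h2]|[[h1 _] h2]].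
have [K' [mK' K'c KK']] := @sup_version _ (PT T F) (fun z => K z.1 z.2) c A ltac:(by rewrite le_max lexx) (fun q => (hA q).1).
exists (fun t w => K' (t, w)); split.
  split; last by exists c => t w _; exact: K'c.
  apply/(predictableP T_gt0 filtF).
  apply: (@eq_measurable_fun _ _ _ _ _ K'); first by case.
  by apply: measurable_funS mK'.
have : {ae Q, forall w (n : nat), if unpickle n is Some q then (forall t, (date T t /\ ratr q < K t w) <-> A q (t, w)) else True}.
  apply: ae_foralln => n; case: (unpickle n) => [q|]; last exact: aeW.
  by have [] := hA q.
apply: filterS => w h t dt; rewrite KK'//=; first exact: hc.
by move=> q; have := h (pickle q); rewrite pickleK => /(_ t) [h1 h2]; split => [/h2[]//|hq]; apply: h1.
Qed.

Variables (P : probability Omega R) (X : process) (I : process -> process).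
Hypotheses (QP : Q `<< P) (hI : bounded_integral T P F X I).

(** K and L may differ on a P-large set of outcomes. Locality of the P-integral, applied to K - L on
    the outcomes where they agree, equates the integrals P-a.e. there, and this passes to Q, for
    which that set has a negligible complement. *)
Lemma int_indist (K L : process) : bounded_predictable T F K -> bounded_predictable T F L ->
  indist T Q K L -> indist T Q (I K) (I L).
Proof.
move=> bK bL KL.
have bKL : bounded_predictable T F (fun t w => K t w - L t w).
  have := bpL T_gt0 filtF (-1) bL bK.
  rewrite (_ : (fun _ _ => -1 * _ + _) = (fun t w => K t w - L t w))//.
  by apply/funext => t; apply/funext => w; rewrite mulN1r addrC.
have h1 := int_local T_gt0 filtF hI (Om0 := [set w | forall t, date T t -> K t w = L t w]) bKL.
have hh : forall w t, [set w | forall t, date T t -> K t w = L t w] w -> date T t -> K t w - L t w = 0.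
  by move=> w t /= h dt; rewrite h// subrr.
have := ac_ae QP (h1 hh); have := ac_ae QP (intB hI bK bL) => h2 h3.
apply: filterS3 KL h2 h3 => w g1 g2 g3 t dt.
by have := g3 g1 t dt; rewrite g2// => /eqP; rewrite subr_eq0 => /eqP.
Qed.

Definition version (K : process) : process := xget K [set K' : process |
  bounded_predictable T F K' /\ indist T Q K K'].

Lemma versionP K : bounded_predictable T F' K ->
  bounded_predictable T F (version K) /\ indist T Q K (version K).
Proof. by move=> /augment_process_version h; exact: (xgetPex K h). Qed.

(** An integrand is integrated through an F-predictable version. The delicate clause is dominated
    convergence: versions converge and are bounded only up to a Q-null set, hence the clipping [cl]
    and the restriction to the set C of convergence, under which the P-integral can be used. *)
Theorem augment_integral : exists I', bounded_integral T Q F' X I' /\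
  (forall K, bounded_predictable T F K -> indist T Q (I' K) (I K)).
Proof.
exists (fun K => I (version K)); split; last first.
  move=> K bK; have [b1 h1] := versionP (augment_bp bK).
  by apply: int_indist => //; apply: filterS h1 => w h t dt; rewrite h.
split.
- move=> K /versionP[b1 _]; apply: augment_cadlag; exact: (int_cadlag hI b1).
- move=> e he; have [w0 [c0 hc0] h] := he.
  have [e0 [me0 be0 ee0]] := augment_fun_version (date0 T_gt0) w0 hc0.
  have /choice[c hc] : forall i : nat, exists c : Omega -> R, (i < el_size e)%N ->
     [/\ wrt (F (el_s e i)) c, (exists b, forall w, `|c w| <= b) & {ae Q, forall w, el_c e i w = c w}].
    move=> i; have [ie|_] := boolP (i < el_size e)%N; last by exists (fun=> 0).
    have [ds dt st mc [b hb]] := h i ie.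
    have [c' [m' b' h']] := augment_fun_version ds mc hb.
    by exists c' => _; split => //; exists b.
  pose e' := Elementary (el_size e) e0 (el_s e) (el_t e) c.
  have he' : elementary_integrand T F e'.
    split => //=; first by exists c0.
    by move=> i ie; have [ds dt st _ _] := h i ie; have [m' b' _] := hc i ie; split.
  have hcae : {ae Q, forall w (i : nat), (i < el_size e)%N -> el_c e i w = c i w}.
    apply: ae_foralln => i; have [ie|_] := boolP (i < el_size e)%N; last by apply: aeW.
    by have [_ _] := hc i ie; apply: filterS => w.
  have [b1 h1] := versionP (bp_el T_gt0 augment_filtration he).
  have b2 := bp_el T_gt0 filtF he'.
  have h2 : indist T Q (version (el_val e)) (el_val e').
    apply: filterS3 h1 hcae ee0 => w g1 g2 g3 t dt; rewrite -g1// /el_val /= g3.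
    by congr (_ + _); apply: eq_bigr => i _; rewrite g2.
  apply: filterS3 (int_indist b1 b2 h2) (ac_ae QP (int_el hI he')) hcae => w g1 g2 g3 t dt.
  by rewrite g1// g2// /el_int /=; apply: eq_bigr => i _; rewrite g3.
- move=> a K L bK bL.
  have [b1 h1] := versionP bK; have [b2 h2] := versionP bL.
  have [b3 h3] := versionP (bpL T_gt0 augment_filtration a bK bL).
  have b4 := bpL T_gt0 filtF a b1 b2.
  have h4 : indist T Q (version (fun t w => a * K t w + L t w)) (fun t w => a * version K t w + version L t w).
    by apply: filterS3 h1 h2 h3 => w g1 g2 g3 t dt; rewrite -g3// g1// g2.
  by apply: filterS2 (int_indist b3 b4 h4) (ac_ae QP (int_lin hI a b1 b2)) => w g1 g2 t dt; rewrite g1// g2.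
- move=> Hn H c pHn pH bHn l.
  have filtF' := augment_filtration.
  have bH : bounded_predictable T F' H.
    by split => //; exists c => t w dt; apply: (lim_norm_le (l t w dt)) => n; exact: bHn.
  have bn n : bounded_predictable T F' (Hn n) by split => //; exists c => t w; exact: bHn.
  have /all_and2[v1 v2] n := versionP (bn n); have [v3 v4] := versionP bH.
  pose cl (x : R) := Num.max (- c) (Num.min c x).
  have clc x : - c <= c -> `|cl x| <= c.
    by move=> c0; rewrite ler_norml /cl le_max lexx/= ge_max ge_min lexx/= andbT; lra.
  have clid x : `|x| <= c -> cl x = x.
    by rewrite ler_norml /cl => /andP[? ?]; rewrite min_r// max_r.
  have mcl : measurable_fun setT cl.
    by apply: measurable_maxr; [exact: measurable_cst|apply: measurable_minr => //; exact: measurable_cst].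
  pose C : set (R * Omega) := @dates R dO Omega T `&` [set z | cl (version (Hn n) z.1 z.2) @[n --> \oo] --> cl (version H z.1 z.2)].
  have mV K : predictable T F K -> measurable_fun (@dates R dO Omega T : set (PT T F)) (fun z : PT T F => K z.1 z.2).
    by move/(predictableP T_gt0 filtF).
  have pcn n : predictable T F (fun t w => cl (version (Hn n) t w)) by apply: (predictable_borel T_gt0 filtF mcl); have [] := v1 n.
  have pc : predictable T F (fun t w => cl (version H t w)) by apply: (predictable_borel T_gt0 filtF mcl); have [] := v3.
  have mC : measurable (C : set (PT T F)).
    rewrite (_ : C = \bigcap_k \bigcup_N \bigcap_(n in [set n | (N <= n)%N]) (@dates R dO Omega T `&`
       [set z | `|cl (version H z.1 z.2) - cl (version (Hn n) z.1 z.2)| <= k.+1%:R^-1])).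
      apply: bigcapT_measurable => k; apply: bigcupT_measurable => N.
      apply: bigcap_measurable; first by exists N => /=.
      move=> n _.
      have mf : measurable_fun (@dates R dO Omega T : set (PT T F)) (fun z : PT T F => `|cl (version H z.1 z.2) - cl (version (Hn n) z.1 z.2)|).
        apply: (mV (fun t w => `|cl (version H t w) - cl (version (Hn n) t w)|)).
        apply: (@predictable_borel _ _ _ _ _ T_gt0 filtF (fun x => `|x|) (fun t w => cl (version H t w) - cl (version (Hn n) t w))).
          exact: normr_measurable.
        apply/(predictableP T_gt0 filtF); apply: measurable_funB.
          exact: (mV (fun t w => cl (version H t w))).
        exact: (mV (fun t w => cl (version (Hn n) t w))).
      have := mf (dates_measurable T_gt0 filtF) _ (measurable_itv `]-oo, k.+1%:R^-1]).
      by congr measurable; apply/seteqP; split => z /= [h1 h2]; split => //; move: h2; rewrite /= in_itv/=.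
    apply/seteqP; split => [z [Dz /cvgrPdist_le h] k _|z h].
      have [N _ hN] := h k.+1%:R^-1 ltac:(by rewrite invr_gt0).
      by exists N => // n Nn; split => //; exact: hN.
    split; first by have [N _ /(_ N (leqnn N))[]] := h 0%N Logic.I.
    apply/cvgrPdist_le => eps e0.
    pose k := Num.truncn eps^-1.
    have [N _ hN] := h k Logic.I; exists N => // n /hN[_ /= hh]; apply: le_trans hh _.
    by rewrite invf_ple ?posrE// ltW// truncnS_gt.
  have [c0|c0] := leP (- c) c; last first.
    move=> t eps dt e0; have := bHn 0%N t point dt.
    by move=> /(le_trans (normr_ge0 _)) h; exfalso; lra.
  pose Kn n : process := fun t w => cl (version (Hn n) t w) * ind C t w.
  pose K : process := fun t w => cl (version H t w) * ind C t w.
  have bc1 n : bounded_predictable T F (fun t w => cl (version (Hn n) t w)).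
    by split => //; exists c => t w _; exact: clc.
  have bc2 : bounded_predictable T F (fun t w => cl (version H t w)).
    by split => //; exists c => t w _; exact: clc.
  have bKn n : bounded_predictable T F (Kn n) by exact: bpMind.
  have bK : bounded_predictable T F K by exact: bpMind.
  have hae : {ae Q, forall w t, date T t -> C (t, w) /\ (version H t w = K t w /\ forall n, version (Hn n) t w = Kn n t w)}.
    have hn : {ae Q, forall w n t, date T t -> Hn n t w = version (Hn n) t w} by exact: ae_foralln.
    apply: filterS2 hn v4 => w g1 g2 t dt.
    have Ct : C (t, w).
      split => //=; rewrite -g2// clid; last by apply: (lim_norm_le (l t w dt)) => n; exact: bHn.
      apply: cvg_trans (l t w dt); apply: near_eq_cvg; apply: nearW => n.
      by rewrite -g1// clid ?bHn.
    split => //; split => [|n]; rewrite /Kn /K ind_in// mulr1 clid// -?g1 -?g2 ?bHn//.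
    by apply: (lim_norm_le (l t w dt)) => n; exact: bHn.
  have e1 n : indist T Q (I (version (Hn n))) (I (Kn n)).
    apply: int_indist => //.
    by apply: filterS hae => w h t dt; have [_ [_ ->]] := h t dt.
  have e2 : indist T Q (I (version H)) (I K).
    apply: int_indist => //.
    by apply: filterS hae => w h t dt; have [_ [-> _]] := h t dt.
  have ucp : ucp_cvg T Q (fun n => I (Kn n)) (I K).
    apply: (ac_ucp QP filtF (fun n => int_cadlag hI (bKn n)) (int_cadlag hI bK)).
    apply: (int_dct hI (c := c)).
    + by move=> n; have [] := bKn n.
    + by have [] := bK.
    + by move=> n t w dt; rewrite /Kn normrM -[leRHS]mulr1 ler_pM ?clc//; exact: ind_bounded.
    + move=> t w dt; have [[_ Ct]|nC] := pselect (C (t, w)).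
        by apply: cvgM; [exact: Ct|exact: cvg_cst].
      by rewrite /Kn /K; apply: cvg_near_eq; apply: nearW => n; rewrite ind_out// !mulr0.
  move=> t eps dt e0.
  have ee := ae_foralln e1.
  suff E n : Q [set w | exists2 s, 0 <= s <= t & eps < `|I (version (Hn n)) s w - I (version H) s w|] =
             Q [set w | exists2 s, 0 <= s <= t & eps < `|I (Kn n) s w - I K s w|].
    by rewrite (funext E); exact: ucp.
  have m1 := exceed_measurableB filtF eps (int_cadlag hI (v1 n)) (int_cadlag hI v3) dt.
  have m2 := exceed_measurableB filtF eps (int_cadlag hI (bKn n)) (int_cadlag hI bK) dt.
  have hd s : 0 <= s <= t -> date T s by move=> /andP[s0 st]; exact: date_le dt s0 st.
  apply/eqP; rewrite eq_le; apply/andP; split; apply: le_measure_ae => //.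
    by apply: filterS2 (e1 n) e2 => w g1 g2 [s st hs]; have ds := hd s st; exists s => //; rewrite -g1// -g2.
  by apply: filterS2 (e1 n) e2 => w g1 g2 [s st hs]; have ds := hd s st; exists s => //; rewrite g1// g2.
Qed.

End Augment.

(** * Associativity for bounded densities *)

Section Associativity.
Context {R : realType} {dO : measure_display} {Omega : measurableType dO}.
Variables (T : \bar R) (F : R -> set (set Omega)).
Hypotheses (T_gt0 : (0 < T)%E) (filtF : is_filtration T F).
Local Notation process := (@process R dO Omega).
Local Notation cap := (@cap R T).
Variables (Q : probability Omega R) (X : process) (I : process -> process).
Hypothesis hI : bounded_integral T Q F X I.
Local Notation bp := (bounded_predictable T F).
Local Notation indist := (indist T Q).

(** The product of K with a cell starting at 0 is zero, so [int_cell] shows that the integral never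
    leaves its initial value 0. *)
Lemma int_at0 (K : process) : bp K -> (forall t w, 0 < t -> K t w = 0) ->
  indist (I K) (fun _ _ => 0).
Proof.
move=> bK K0; have d0 := date0 T_gt0.
have h n : {ae Q, forall w r, date T r -> I K (Num.min (cap n%:R) r) w - I K (Num.min 0 r) w = 0}.
  have dn := cap_date T_gt0 (ler0n R n).
  have m1 : wrt (F 0) (fun _ : Omega => 1 : R) by apply/(wrtP filtF d0); exact: measurable_cst.
  have b1 : exists b : R, forall w : Omega, `|1 : R| <= b by exists 1 => w; rewrite normr1.
  have h2 : indist (I (fun r w => K r w * cell 0 (cap n%:R) (fun=> 1) r w)) (fun _ _ => 0).
    apply: (int_zero T_gt0 filtF hI) => r w _; rewrite /cell.
    by have [r0|r0] := ltP 0 r; [rewrite K0// mul0r|rewrite /= !mulr0].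
  apply: filterS2 h2 (int_cell T_gt0 filtF hI bK d0 dn dn.1 m1 b1) => w h1 h2 r dr.
  by have := h2 r dr; rewrite h1// mul1r.
apply: filterS2 (int_start T_gt0 filtF hI bK) (ae_foralln h) => w h0 h1 r dr.
have [n rn] := date_nat dr.
by have := h1 n r dr; rewrite (min_r rn) min_l ?dr.1// h0 subr0.
Qed.

Lemma bp_sum n (K : 'I_n -> process) : (forall i, bp (K i)) ->
  bp (fun t w => \sum_(i < n) K i t w).
Proof.
elim: n K => [|n ih] K h.
  rewrite (_ : (fun _ _ => _) = fun _ _ => 0); first exact: (bp_cst T_gt0 filtF 0).
  by apply/funext => t; apply/funext => w; rewrite big_ord0.
rewrite (_ : (fun _ _ => _) = fun t w => \sum_(i < n) K (widen_ord (leqnSn n) i) t w + K ord_max t w).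
  by apply: bpD => //; apply: ih => i; exact: h.
by apply/funext => t; apply/funext => w; rewrite big_ord_recr.
Qed.

Lemma int_sum n (K : 'I_n -> process) : (forall i, bp (K i)) ->
  indist (I (fun t w => \sum_(i < n) K i t w)) (fun t w => \sum_(i < n) I (K i) t w).
Proof.
elim: n K => [|n ih] K h.
  have := int_zero T_gt0 filtF hI (K := fun t w => \sum_(i < 0) K i t w) (fun t w _ => big_ord0 _ _ _ _).
  by apply: filterS => w h0 t dt; rewrite h0// big_ord0.
have b1 := bp_sum (fun i => h (widen_ord (leqnSn n) i)).
have := intD hI b1 (h ord_max).
rewrite (_ : (fun t w => _ + _) = (fun t w => \sum_(i < n.+1) K i t w)); last first.
  by apply/funext => t; apply/funext => w; rewrite big_ord_recr.
apply: filterS2 (ih _ (fun i => h (widen_ord (leqnSn n) i))) => w h1 h2 t dt.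
by rewrite h2// h1// big_ord_recr.
Qed.

Lemma int_assoc_el (phi : process) e : bp phi -> elementary_integrand T F e ->
  indist (I (fun t w => phi t w * el_val e t w)) (el_int (I phi) e).
Proof.
move=> bphi he; have [m0 [c0 hc0] h] := he.
have d0 := date0 T_gt0.
pose K0 : process := fun t w => phi t w * (el_0 e w * (t == 0)%:R).
pose K (i : 'I_(el_size e)) : process := fun t w => phi t w * cell (el_s e i) (el_t e i) (el_c e i) t w.
have bK i : bp (K i).
  have [ds dt st mc bc] := h i (ltn_ord i).
  exact: (bpM T_gt0 filtF bphi (bp_cell T_gt0 filtF ds dt mc bc)).
pose e0 := @Elementary R dO Omega 0%N (el_0 e) (el_s e) (el_t e) (el_c e).
have he0 : elementary_integrand T F e0 by split => //; exists c0.
have bK0 : bp K0.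
  have := bpM T_gt0 filtF bphi (bp_el T_gt0 filtF he0).
  rewrite (_ : (fun _ _ => _) = K0)//; apply/funext => t; apply/funext => w.
  by rewrite /K0 /el_val /= big_ord0 addr0.
have K00 t w : 0 < t -> K0 t w = 0 by move=> t0; rewrite /K0 gt_eqF// !mulr0.
have bS := bp_sum bK.
have e1 : (fun t w => phi t w * el_val e t w) = (fun t w => K0 t w + \sum_(i < el_size e) K i t w).
  by apply/funext => t; apply/funext => w; rewrite /el_val mulrDr mulr_sumr.
have hK : {ae Q, forall w (i : nat) (ie : (i < el_size e)%N) r, date T r ->
    I (K (Ordinal ie)) r w = el_c e i w * (I phi (Num.min (el_t e i) r) w - I phi (Num.min (el_s e i) r) w)}.
  apply: ae_foralln => i; have [ie|nie] := pselect (is_true (i < el_size e)%N); last first.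
    by apply: aeW => w ie.
  have [ds dt st mc bc] := h i ie.
  apply: filterS (int_cell T_gt0 filtF hI bphi ds dt st mc bc) => w hw ie' r dr.
  exact: hw.
rewrite e1.
have hs : {ae Q, forall w t, date T t -> I (fun t w => K0 t w + \sum_(i < el_size e) K i t w) t w = \sum_(i < el_size e) I (K i) t w}.
  apply: filterS3 (intD hI bK0 bS) (int_at0 bK0 K00) (int_sum bK) => w h1 h2 h3 t dt.
  by rewrite h1// h2// h3// add0r.
apply: filterS2 hs hK => w h1 h2 t dt; rewrite h1// /el_int; apply: eq_bigr => i _.
by rewrite -h2//; case: i.
Qed.

(** The clause with content is agreement on elementary integrands, given by [int_assoc_el]; the
    others are those of I for the product with phi. *)
Theorem int_density (phi : process) : bp phi ->
  bounded_integral T Q F (I phi) (fun K => I (fun t w => phi t w * K t w)).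
Proof.
move=> bphi; split.
- by move=> K bK; apply: (int_cadlag hI); exact: bpM.
- by move=> e he; exact: int_assoc_el.
- move=> a K L bK bL.
  have := int_lin hI a (bpM T_gt0 filtF bphi bK) (bpM T_gt0 filtF bphi bL).
  rewrite (_ : (fun _ _ => a * _ + _) = (fun t w => phi t w * (a * K t w + L t w)))//.
  by apply/funext => t; apply/funext => w; ring.
- move=> Hn H c pHn pH hc l; have [pphi [b hb]] := bphi.
  apply: (int_dct hI (c := b * c)).
  + by move=> n; exact: predictableM.
  + exact: predictableM.
  + by move=> n t w dt; rewrite normrM ler_pM ?hb ?hc.
  + by move=> t w dt; apply: cvgM; [exact: cvg_cst|exact: l].
Qed.

Lemma int_one : cadlag_adapted T F X -> indist (I (fun _ _ => 1)) (fun t w => X t w - X 0 w).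
Proof.
move=> cX; have d0 := date0 T_gt0; have b1 := bp_cst T_gt0 filtF 1.
have h n : {ae Q, forall w r, date T r -> I (fun _ _ => 1) (Num.min (cap n%:R) r) w - I (fun _ _ => 1) (Num.min 0 r) w = X (Num.min (cap n%:R) r) w - X (Num.min 0 r) w}.
  have dn := cap_date T_gt0 (ler0n R n).
  have m1 : wrt (F 0) (fun _ : Omega => 1 : R) by apply/(wrtP filtF d0); exact: measurable_cst.
  have bb : exists b : R, forall w : Omega, `|1 : R| <= b by exists 1 => w; rewrite normr1.
  pose e := @Elementary R dO Omega 1%N (fun=> 0) (fun=> 0) (fun=> cap n%:R) (fun=> fun=> 1).
  have he : elementary_integrand T F e.
    split => /=.
    + by apply/(wrtP filtF d0); exact: measurable_cst.
    + by exists 0 => w; rewrite normr0.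
    + by move=> i _; split => //; exact: dn.1.
  have ee t w : date T t -> el_val e t w = 1 * cell 0 (cap n%:R) (fun=> 1) t w.
    by move=> dt; rewrite /el_val /cell big_ord1/= mul0r add0r !mul1r.
  have g1 := int_congr T_gt0 filtF hI (bp_el T_gt0 filtF he) ee.
  apply: filterS3 g1 (int_el hI he) (int_cell T_gt0 filtF hI b1 d0 dn dn.1 m1 bb) => w g1 g2 g3 r dr.
  by have := g3 r dr; rewrite g1// g2// /el_int big_ord1/= !mul1r.
apply: filterS2 (int_start T_gt0 filtF hI b1) (ae_foralln h) => w h0 h1 r dr.
have [n rn] := date_nat dr.
by have := h1 n r dr; rewrite (min_r rn) (min_l dr.1) h0 subr0.
Qed.

End Associativity.

Lemma ae_ord (R : realType) d (Omega : measurableType d) (Q : probability Omega R) n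
    (Pr : 'I_n -> Omega -> Prop) : (forall i, {ae Q, forall w, Pr i w}) ->
  {ae Q, forall w i, Pr i w}.
Proof.
move=> h; have : {ae Q, forall w (k : nat) (i : 'I_n), val i = k -> Pr i w}.
  apply: ae_foralln => k; have [kn|kn] := ltnP k n.
    by apply: filterS (h (Ordinal kn)) => w hw i ik; rewrite (_ : i = Ordinal kn)//; exact: val_inj.
  by apply: aeW => w i ik; move: kn; rewrite -ik leqNgt ltn_ord.
by apply: filterS => w hw i; exact: (hw i).
Qed.

Lemma wrt_norm (R : realType) d (Omega : measurableType d) (G : set (set Omega)) (f : Omega -> R) :
  wrt G f -> wrt G (fun w => `|f w|).
Proof.
move=> h _ [Y mY <-]; apply: h; exists ((fun x : R => `|x|) @^-1` Y) => //.
have := normr_measurable (R := R) measurableT mY.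
by rewrite setTI.
Qed.

(** * Boundedness and jumps of paths *)

Section Paths.
Context {R : realType} {dO : measure_display} {Omega : measurableType dO}.
Variables (T : \bar R).
Local Notation process := (@process R dO Omega).

(** Take the largest m such that the path is bounded on [0, r] for r < m: the left limit adds m
    itself, and right-continuity would go beyond m unless m = t. *)
Lemma cadlag_bounded (X : process) w t : cadlag T X -> date T t -> 0 <= t ->
  exists C, forall s, 0 <= s <= t -> `|X s w| <= C.
Proof.
move=> cX dt t0; have [rX lX] := cX w.
pose bd r := exists C, forall s, 0 <= s <= r -> `|X s w| <= C.
pose A := [set r | 0 <= r <= t /\ bd r].
have A0 : A 0.
  split; first by rewrite lexx.
  by exists `|X 0 w| => s; rewrite -eq_le => /eqP <-.
have ubA : ubound A t by move=> r [/andP[]].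
have hs : has_sup A by split; [exists 0|exists t].
pose m := sup A.
have m0 : 0 <= m by apply: ub_le_sup => //; exists t.
have mt : m <= t by apply: ge_sup => //; exists 0.
have dm : date T m by exact: date_le dt m0 mt.
have bm : bd m.
  move: m0; rewrite le_eqVlt => /predU1P[<-|m0]; first by have [] := A0.
  have [C C0 hC] := left_limit_bounded (lX m dm m0).
  have [e e0 he] := near_leftP hC.
  have [r [/andP[r0 rt] [C' hC']] rm] := sup_adherent e0 hs.
  exists (Num.max C' (`|X m w| + C)) => s /andP[s0 sm].
  have [sr|rs] := leP s r; first by rewrite le_max hC' ?s0.
  rewrite le_max; apply/orP; right.
  move: sm; rewrite le_eqVlt => /predU1P[->|sm]; first by rewrite lerDl ltW.
  have := he s; rewrite sm andbT => /(_ (lt_trans rm rs)) h.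
  have := ler_normB (X m w) (X m w - X s w); rewrite subKr => h'.
  by apply: le_trans h' _; rewrite lerD2l.
move: mt; rewrite le_eqVlt => /predU1P[<-//|mt].
have mT : (m%:E < T)%E by apply: (lt_le_trans _ dt.2); rewrite lte_fin.
have /cvgrPdist_le /(_ 1 ltr01) h := rX m dm mT.
have [e e0 he] := near_rightP h.
pose m' := Num.min t (m + e / 2).
have mm' : m < m' by rewrite lt_min mt ltrDl divr_gt0.
have : A m'.
  split; first by rewrite ge_min lexx andbT (le_trans m0)// ltW.
  have [C hC] := bm; exists (Num.max C (`|X m w| + 1)) => s /andP[s0 sm'].
  have [sm|ms] := leP s m; first by rewrite le_max hC ?s0.
  rewrite le_max; apply/orP; right.
  have := he s; rewrite ms /= => /(_ _) h1.
  have h2 : `|X m w - X s w| <= 1.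
    apply: h1; apply: le_lt_trans sm' _; rewrite gt_min; apply/orP; right.
    by rewrite ltrD2l; lra.
  have := ler_normB (X m w) (X m w - X s w); rewrite subKr => h'.
  by apply: le_trans h' _; rewrite lerD2l.
move=> Am'; have : m' <= m by apply: ub_le_sup => //; exists t.
by rewrite leNgt mm'.
Qed.

Lemma left_unif_lim (Yn : nat -> process) X (g : R -> R) t w : 0 < t ->
  unif_cvg t Yn X w ->
  (\forall n \near \oo, (Yn n t w - Yn n s w - g s) @[s --> t^'-] --> (0 : R)) ->
  (X t w - X s w - g s) @[s --> t^'-] --> (0 : R).
Proof.
move=> t0 u [N _ hN]; apply/cvgrPdist_le => e e0.
have e3 : 0 < e / 3 by lra.
have [M hM] := u _ e3.
pose n := maxn N M.
have /cvgrPdist_le /(_ _ e3) h := hN n (leq_maxl _ _).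
near=> s.
have s0 : 0 <= s by near: s; exact: nbhs_left_ge.
have st : s <= t by near: s; exact: nbhs_left_le.
have h1 := hM n (leq_maxr _ _) t ltac:(by rewrite (ltW t0) lexx).
have h2 := hM n (leq_maxr _ _) s ltac:(by rewrite s0 st).
have h3 : `|0 - (Yn n t w - Yn n s w - g s)| <= e / 3 by near: s.
move: h1 h2 h3; rewrite !ler_norml => /andP[? ?] /andP[? ?] /andP[? ?].
by apply/andP; split; lra.
Unshelve. all: by end_near. Qed.

End Paths.

(** * Suitable weights: a common integrand *)

Section StochInt.
Context {R : realType} {dO : measure_display} {Omega : measurableType dO}.
Variables (T : \bar R) (F : R -> set (set Omega)).
Hypotheses (T_gt0 : (0 < T)%E) (filtF : is_filtration T F).
Local Notation process := (@process R dO Omega).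
Local Notation cap := (@cap R T).
Local Notation dates := (@dates R dO Omega T).
Local Notation PT := (@PT R dO Omega T F).
Local Notation bp := (bounded_predictable T F).
Variables (Q : probability Omega R).

(** The test integrand 1 on ]0, t] recovers the deviation from the starting value, and the starting
    value is itself part of the distance. *)
Lemma emery_ucp (Xn : nat -> process) X : (forall n, cadlag_adapted T F (Xn n)) ->
  cadlag_adapted T F X -> emery_cvg T Q F Xn X -> ucp_cvg T Q Xn X.
Proof.
move=> cXn cX em t eps dt e0; have d0 := date0 T_gt0.
pose D n := [set w | exists2 s, 0 <= s <= t & eps < `|Xn n s w - X s w|].
have mD n : measurable (D n) by exact: (exceed_measurableB filtF).
apply/fine_cvgP; split; first by apply: nearW => n; rewrite fin_num_measure//; exact: mD.
apply/cvgrPdist_le => e e0'.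
pose eps' := Num.min e eps.
have e'0 : 0 < eps' by rewrite lt_min e0' e0.
have := em t eps' dt e'0; apply: filterS => n hn.
pose K := @Elementary R dO Omega 1%N (fun=> 0) (fun=> 0) (fun=> t) (fun=> fun=> 1).
have hK : elementary_integrand T F K.
  split => /=.
  - by apply/(wrtP filtF d0); exact: measurable_cst.
  - by exists 0 => w; rewrite normr0.
  - move=> i _; split => //; first exact: dt.1.
      by apply/(wrtP filtF d0); exact: measurable_cst.
    by exists 1 => w; rewrite normr1.
have bK : forall s w, date T s -> `|el_val K s w| <= 1.
  move=> s w _; rewrite /el_val big_ord1 /= mul0r add0r mul1r.
  by case: (_ < _ <= _); rewrite ?normr1 ?normr0.
have h := hn K hK bK.
rewrite /= sub0r normrN ger0_norm ?fine_ge0//.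
rewrite -lee_fin fineK ?fin_num_measure//; last exact: mD.
apply: (@le_trans _ _ eps'%:E); last by rewrite lee_fin ge_min lexx.
apply: le_trans h.
pose Z : process := fun s w => Xn n s w - X s w.
have cZ : cadlag_adapted T F Z.
  have := cadlag_adapted_lin filtF 1 (-1) (cXn n) cX.
  rewrite (_ : (fun _ _ => 1 * _ + _) = Z)//.
  by apply/funext => s; apply/funext => w; rewrite mul1r mulN1r.
have elE s w : 0 <= s <= t -> el_int (fun r v => Xn n r v - X r v) K s w = Z s w - Z 0 w.
  by move=> /andP[s0 st]; rewrite /el_int big_ord1/= mul1r (min_r st) (min_l s0).
apply: le_measure; rewrite ?inE; [exact: mD| |].
  pose Z' : process := fun s w => `|Z 0 w| + `|Z s w - Z 0 w|.
  have cZ' : cadlag_adapted T F Z'.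
    split.
      move=> w; have [rZ lZ] := cZ.1 w; split.
        move=> s ds sT; apply: cvgD; first exact: cvg_cst.
        by apply: cvg_norm; apply: cvgB; [exact: rZ|exact: cvg_cst].
      move=> s ds s0; apply: is_cvgD; first exact: is_cvg_cst.
      by apply: is_cvg_norm; apply: is_cvgB; [exact: lZ|exact: is_cvg_cst].
    move=> s ds; apply/(wrtP filtF ds).
    have m0 : wrt (F s) (Z 0) by apply: (wrt_le filtF d0 ds ds.1); exact: cZ.2.
    have ms : wrt (F s) (Z s) by exact: cZ.2.
    have mf := wrt_norm m0.
    have mg : wrt (F s) (fun w => `|Z s w - Z 0 w|).
      apply: (wrt_norm (f := fun w => Z s w - Z 0 w)).
      by apply/(wrtP filtF ds); apply: measurable_funB; exact/(wrtP filtF ds).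
    by apply: measurable_funD; exact/(wrtP filtF ds).
  have := exceed_measurable filtF eps' cZ' dt => /((filtF.1 t dt).2).
  have E s w : `|Z' s w| = `|Z 0 w| + `|Z s w - Z 0 w| by rewrite ger0_norm// addr_ge0.
  by congr measurable; apply/seteqP; split => w [s st hs]; exists s => //; move: hs; rewrite elE// E.
move=> w [s st hs]; exists s => //; rewrite elE//.
apply: (@le_lt_trans _ _ eps); first by rewrite ge_min lexx orbT.
apply: lt_le_trans hs _; rewrite -/(Z s w) -{1}(subrK (Z 0 w) (Z s w)) addrC.
exact: ler_normD.
Qed.

Variables (d : nat) (S H : 'I_d -> process) (X : process) (I : 'I_d -> process -> process).
Hypotheses (cS : forall i, cadlag_adapted T F (S i))
  (pH : forall i, predictable T F (H i)) (cX : cadlag_adapted T F X)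
  (hI : forall i, bounded_integral T Q F (S i) (I i))
  (em : emery_cvg T Q F (fun n t w => \sum_(i < d) I i (truncate n H i) t w) X).

Lemma bp_truncate n i : bp (truncate n H i).
Proof.
split; last first.
  exists n%:R => t w _; rewrite /truncate; case: ifPn => h; last by rewrite normr0.
  rewrite -(@ler_pXn2r _ 2%N) ?nnegrE// real_normK ?num_real//.
  apply: le_trans h; rewrite (bigD1 i)//= lerDl sumr_ge0// => j _; exact: sqr_ge0.
apply/(predictableP T_gt0 filtF); rewrite /truncate.
have mD := dates_measurable T_gt0 filtF.
apply: measurable_fun_if => //.
- apply: measurable_fun_ler; last exact: measurable_cst.
  have : predictable T F (fun t w => \sum_(j < d) H j t w * H j t w).
    apply: (predictable_sum T_gt0 filtF (K := fun j t w => H j t w * H j t w)) => j.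
    by apply: (predictableM T_gt0 filtF); exact: pH.
  by move/(predictableP T_gt0 filtF).
- have h : measurable_fun (dates : set PT) (fun z : PT => H i z.1 z.2) by apply/(predictableP T_gt0 filtF).
  apply: measurable_funS h => //; exact: subIsetl.
Qed.

Lemma truncate_near t w : \forall n \near \oo, forall i, truncate n H i t w = H i t w.
Proof.
near=> n => i; rewrite /truncate; case: ifPn => // /negP[].
set x := \sum_(j < d) _.
have x0 : 0 <= x by apply: sumr_ge0 => j _; exact: sqr_ge0.
have h : x + 1 <= n%:R by near: n; exact: nbhs_infty_ger.
rewrite expr2; have : (x + 1) * (x + 1) <= n%:R * n%:R by apply: ler_pM => //; lra.
by apply: le_trans; nra.
Unshelve. all: by end_near. Qed.

Definition truncated_int n : process := fun t w => \sum_(i < d) I i (truncate n H i) t w.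

Lemma truncated_int_cadlag n : cadlag_adapted T F (truncated_int n).
Proof. by apply: cadlag_adapted_sum => // i; apply: (int_cadlag (hI i)); exact: bp_truncate. Qed.

Lemma truncated_ucp : ucp_cvg T Q truncated_int X.
Proof. exact: (emery_ucp truncated_int_cadlag cX em). Qed.

Lemma truncated_jump n : {ae Q, forall w t, date T t -> 0 < t ->
  (truncated_int n t w - truncated_int n s w - \sum_(i < d) truncate n H i t w * (S i t w - S i s w))
    @[s --> t^'-] --> (0 : R)}.
Proof.
have h : {ae Q, forall w i t, date T t -> 0 < t ->
    jump_eq (S i) (I i (truncate n H i)) (truncate n H i) t w}.
  by apply: ae_ord => i; exact: (int_jump T_gt0 filtF (hI i) (cS i) (bp_truncate n i)).
apply: filterS h => w h t dt t0.
suff : (\sum_(i < d) (I i (truncate n H i) t w - I i (truncate n H i) s w - truncate n H i t w * (S i t w - S i s w)))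
    @[s --> t^'-] --> \sum_(i < d) (0 : R).
  rewrite big1_eq; apply: cvg_trans; apply: near_eq_cvg; apply: nearW => s.
  by rewrite /truncated_int -!sumrB.
apply: (cvg_big (op := +%R) (x0 := 0)) => //; first exact: add_continuous.
by move=> i _; exact: h.
Qed.

(** At a fixed date and outcome the truncations eventually equal H, so the jump relation of the
    truncated integrals survives the limit for the whole sum, even though H is integrable only as a
    vector. *)
Lemma stoch_int_jump : {ae Q, forall w t, date T t -> 0 < t ->
  (X t w - X s w - \sum_(i < d) H i t w * (S i t w - S i s w)) @[s --> t^'-] --> (0 : R)}.
Proof.
suff h : {ae Q, forall w t, date T t -> (0 < t -> 
  (X t w - X s w - \sum_(i < d) H i t w * (S i t w - S i s w)) @[s --> t^'-] --> (0 : R))} by [].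
apply: (ae_dates T_gt0) => t0 dt0.
have [sg [nsg hs]] := ucp_as filtF truncated_int_cadlag cX truncated_ucp dt0.
apply: filterS2 hs (ae_foralln truncated_jump) => w u hj t tt t1.
have dt : date T t by case/andP: tt => tt1 tt2; exact: date_le dt0 tt1 tt2.
apply: (left_unif_lim (Yn := fun n => truncated_int (sg n))) => //.
  move=> e e0; have [N hN] := u e e0; exists N => n Nn s /andP[s0 st]; apply: hN => //.
  by rewrite s0 (le_trans st)//; case/andP: tt.
have [N _ hN] := truncate_near t w; exists N => // n /= Nn.
have := hj (sg n) t dt t1; apply: cvg_trans; apply: near_eq_cvg; apply: nearW => s.
congr (_ - _); apply: eq_bigr => i _; rewrite hN//=; exact: leq_trans Nn (nsg n).
Qed.

End StochInt.

(** * Stopping at levels and a positive common integrand *)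

Section SuitableDensity.
Context {R : realType} {dO : measure_display} {Omega : measurableType dO}.
Variables (T : \bar R) (F : R -> set (set Omega)).
Hypotheses (T_gt0 : (0 < T)%E) (filtF : is_filtration T F).
Local Notation process := (@process R dO Omega).
Local Notation cap := (@cap R T).
Local Notation dates := (@dates R dO Omega T).
Local Notation PT := (@PT R dO Omega T F).
Local Notation bp := (bounded_predictable T F).
Variables (P : probability Omega R) (d : nat) (S : 'I_d -> process) (W : Omega -> R).
Hypothesis cS : forall i, cadlag_adapted T F (S i).

Lemma predictable_prod n (K : 'I_n -> process) :
  (forall i, predictable T F (K i)) ->
  predictable T F (fun t w => \prod_(i < n) K i t w).
Proof.
elim: n K => [|n ih] K h.
  rewrite (_ : (fun _ _ => _) = fun _ _ => 1); first exact: predictable_cst.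
  by apply/funext => t; apply/funext => w; rewrite big_ord0.
rewrite (_ : (fun _ _ => _) = fun t w => \prod_(i < n) K (widen_ord (leqnSn n) i) t w * K ord_max t w).
  by apply: predictableM => //; apply: ih => i; exact: h.
by apply/funext => t; apply/funext => w; rewrite big_ord_recr.
Qed.

Lemma cadlag_adapted_norm (X : process) : cadlag_adapted T F X ->
  cadlag_adapted T F (fun t w => `|X t w|).
Proof.
move=> [cX aX]; split.
  move=> w; have [rX lX] := cX w; split.
    by move=> t dt tT; apply: cvg_norm; exact: rX.
  by move=> t dt t0; apply: is_cvg_norm; exact: lX.
by move=> t dt; apply: wrt_norm; exact: aX.
Qed.

(** The stochastic interval up to and including the first passage of Z above k. Only values strictly
    before t are inspected, which makes it predictable, and for right-continuous paths rational
    times suffice. *)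
Definition below (Z : process) (k : R) : set (R * Omega) :=
  dates `&` [set z | forall q : rat, 0 <= (ratr q : R) < z.1 -> Z (ratr q) z.2 <= k].

Lemma below_measurable Z k : cadlag_adapted T F Z -> measurable (below Z k : set PT).
Proof.
move=> [cZ aZ].
pose C (n : nat) : set PT := if unpickle n is Some q then
  (if `[< date T (ratr q : R) >] then [set r | date T r /\ ratr q < r] `*` [set w | k < Z (ratr q) w] else set0)
  else set0.
have mC n : measurable (C n).
  rewrite /C; case: (unpickle n) => [q|]; last exact: measurable0.
  case: asboolP => dq; last exact: measurable0.
  apply: half_line_measurable => //; apply: (aZ _ dq).
  exists `]k, +oo[%classic => //.
  by rewrite setTI; apply/seteqP; split => w /=; rewrite in_itv/= andbT.
have -> : below Z k = dates `\` \bigcup_n (C n).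
  apply/seteqP; split => [[t w] [Dz /= h]|[t w] [Dz h]]; split => //.
    move=> [n _]; rewrite /C; case: (unpickle n) => [q|] //.
    case: asboolP => // dq [/= [_ qt]]; rewrite ltNge h// qt andbT; exact: dq.1.
  move=> q /= /andP[q0 qt]; rewrite leNgt; apply/negP => hq; apply: h.
  have dq : date T (ratr q : R) by case: Dz => dt _; exact: date_le dt q0 (ltW qt).
  exists (pickle q); first by [].
  rewrite /C pickleK asboolT//; split; [split => //|].
    by case: Dz.
  exact: hq.
by apply: measurableD; [exact: dates_measurable|exact: bigcupT_measurable].
Qed.

Lemma below_le Z k s t w : below Z k (t, w) -> 0 <= s -> s <= t -> below Z k (s, w).
Proof.
move=> [[dt _] h] s0 st; split; first by split => //; exact: date_le dt s0 st.
by move=> q /= /andP[q0 qs]; apply: h; rewrite /= q0 (lt_le_trans qs).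
Qed.

Variables (psi : process) (i0 : 'I_d) (I : process -> process) (H X : process).
Hypotheses (hI : bounded_integral T P F (S i0) I) (bpsi : bp psi)
  (psi0 : forall t w, date T t -> 0 <= psi t w <= `|H t w|)
  (hX : {ae P, forall w t, date T t -> 0 < t -> (X t w - X s w - H t w * (S i0 t w - S i0 s w)) @[s --> t^'-] --> (0 : R)})
  (XW : {ae P, forall w t, date T t -> `|X t w| <= W w}).

(** N arises from N' by a jump close to x; x is dominated by a jump y of a quantity bounded by c,
    hence by about 2 c. The two errors e / 2 come from replacing left limits by nearby values. *)
Lemma jump_arith (N N' a a' x y k c e : R) :
  `|0 - (N - N' - x)| <= e / 2 -> `|0 - (a - a' - y)| <= e / 2 -> `|x| <= `|y| ->
  `|N'| <= k -> `|a| <= c -> `|a'| <= c -> `|N| <= k + 2 * c + e.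
Proof.
rewrite !sub0r !normrN => hN ha xy hN' a1 a2.
have hy : `|y| <= 2 * c + e / 2.
  have -> : y = a - a' - (a - a' - y) by ring.
  apply: le_trans (ler_normB _ _) _; apply: lerD => //.
  by rewrite mulr_natl mulr2n; apply: le_trans (ler_normB _ _) _; exact: lerD.
have -> : N = N' + x + (N - N' - x) by ring.
have -> : k + 2 * c + e = k + (2 * c + e / 2) + e / 2 by field.
apply: le_trans (ler_normD _ _) _; apply: lerD => //.
by apply: le_trans (ler_normD _ _) _; apply: lerD => //; exact: le_trans xy hy.
Qed.

(* Up to the level k of Z the integral is stopped; the jump that crosses the
   level is dominated by a jump of X, hence by 2 W. *)
Lemma stopped_bound Z k : cadlag_adapted T F Z -> (0 <= k) ->
  (forall t w, date T t -> `|I psi t w| <= Z t w) ->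
  {ae P, forall w t, date T t ->
    `|I (fun t w => psi t w * ind (below Z k) t w) t w| <= k + 2 * W w}.
Proof.
move=> cZ k0 YZ; set B := below Z k; have d0 := date0 T_gt0.
have mB : measurable (B : set PT) by exact: below_measurable.
pose N := I (fun t w => psi t w * ind B t w).
have bN : bp (fun t w => psi t w * ind B t w) by exact: (bpMind T_gt0 filtF bpsi mB).
have cN : cadlag_adapted T F N by exact: (int_cadlag hI bN).
have mBc : measurable (~` B : set PT) by exact: measurableC.
have bNc : bp (fun t w => psi t w * ind (~` B) t w) by exact: (bpMind T_gt0 filtF bpsi mBc).
have wcst t : date T t -> wrt (F t) (fun _ : Omega => 1 : R).
  by move=> dt; apply/(wrtP filtF dt); exact: measurable_cst.
have bcst : exists b : R, forall w : Omega, `|1 : R| <= b by exists 1 => w; rewrite normr1.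
have hsplit : indist T P (I psi) (fun t w => N t w + I (fun t w => psi t w * ind (~` B) t w) t w).
  have e t w : date T t -> psi t w * ind B t w + psi t w * ind (~` B) t w = psi t w.
    move=> _; rewrite -mulrDr /ind !indicE in_setC.
    by case: (_ \in B); rewrite /= ?addr0 ?add0r mulr1.
  apply: filterS2 (int_congr T_gt0 filtF hI (bpD T_gt0 filtF bN bNc) e) (intD hI bN bNc) => w h1 h2 t dt.
  by rewrite h1// h2.
(* At a rational date inside B the integral along B has not been stopped yet; [L2] says that from a
   rational date outside B on it is constant. *)
have L1 : {ae P, forall w (n : nat), if unpickle n is Some q then
    (date T (ratr q : R) -> B (ratr q, w) -> N (ratr q) w = I psi (ratr q) w) else True}.
  apply: ae_foralln => n; case: (unpickle n) => [q|]; last exact: aeW.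
  have [dq|ndq] := pselect (date T (ratr q : R)); last by apply: aeW.
  set r : R := ratr q in dq *.
  have bK := bpM T_gt0 filtF bNc (bp_cell T_gt0 filtF d0 dq (wcst _ d0) bcst).
  have hl := int_local T_gt0 filtF hI (Om0 := [set w | B (r, w)]) bK.
  have hh : forall w t, [set w | B (r, w)] w -> date T t -> psi t w * ind (~` B) t w * cell 0 r (fun=> 1) t w = 0.
    move=> w t /= Br dt; have [tr|rt] := leP t r; last by rewrite /cell (leNgt t r) rt andbF !mulr0.
    by rewrite ind_out ?mulr0 ?mul0r// => nB; apply: nB; exact: (below_le Br dt.1 tr).
  apply: filterS3 hsplit (hl hh) (filterI (int_start T_gt0 filtF hI bNc) (int_cell T_gt0 filtF hI bNc d0 dq dq.1 (wcst _ d0) bcst)) => w h1 h2 [h3 h4] _ Br.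
  have := h4 r dq; rewrite h2// mul1r min_l// (min_l dq.1) h3 subr0 => h5.
  by rewrite h1// -h5 addr0.
have L2 : {ae P, forall w (n m : nat), if unpickle n is Some q then
    (date T (ratr q : R) -> ~ B (ratr q, w) -> forall t, date T t -> ratr q <= t -> t <= cap m%:R -> N t w = N (ratr q) w) else True}.
  apply: ae_foralln => n; apply: ae_foralln => m; case: (unpickle n) => [q|]; last exact: aeW.
  have [dq|ndq] := pselect (date T (ratr q : R)); last by apply: aeW.
  set r : R := ratr q in dq *; have dm := cap_date T_gt0 (ler0n R m).
  have [rm|mr] := leP r (cap m%:R); last first.
    apply: aeW => w _ _ t dt rt tm.
    by have := lt_le_trans mr (le_trans rt tm); rewrite ltxx.
  have bK := bpM T_gt0 filtF bN (bp_cell T_gt0 filtF dq dm (wcst _ dq) bcst).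
  have hl := int_local T_gt0 filtF hI (Om0 := [set w | ~ B (r, w)]) bK.
  have hh : forall w t, [set w | ~ B (r, w)] w -> date T t -> psi t w * ind B t w * cell r (cap m%:R) (fun=> 1) t w = 0.
    move=> w t /= nBr dt; have [tr|rt] := leP t r; first by rewrite /cell (ltNge r t) tr !mulr0.
    rewrite ind_out ?mulr0 ?mul0r// => Bt; apply: nBr; exact: (below_le Bt dq.1 (ltW rt)).
  apply: filterS2 (hl hh) (int_cell T_gt0 filtF hI bN dq dm rm (wcst _ dq) bcst) => w h2 h4 _ nBr t dt rt tm.
  by have := h4 t dt; rewrite h2// mul1r (min_r tm) (min_l rt) -/N => /eqP; rewrite eq_sym subr_eq0 => /eqP.
have hNj := int_jump T_gt0 filtF hI (cS i0) bN.
have hN0 := int_start T_gt0 filtF hI bN.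
apply: filterS3 (filterI hX XW) (filterI L1 L2) (filterI hNj hN0) => w [hXj hXW] [hL1 hL2] [hj h0].
have W0 : 0 <= W w by apply: le_trans (hXW 0 d0).
have case1 t : date T t -> B (t, w) -> `|N t w| <= k + 2 * W w.
  move=> dt Bt; have := dt.1; rewrite le_eqVlt => /predU1P[<-|t0].
    by rewrite /N h0 normr0 addr_ge0// mulr_ge0.
  apply/ler_addgt0Pr => e e0; have e2 : 0 < e / 2 by lra.
  have /cvgrPdist_le /(_ _ e2) n1 := hj t dt t0.
  have /cvgrPdist_le /(_ _ e2) n2 := hXj t dt t0.
  have n3 : \forall s \near t^'-, 0 <= s by exact: nbhs_left_ge.
  have [dl dl0 hdl] := near_leftP (filterI n1 (filterI n2 n3)).
  have [q] := @rat_in_itvoo R (t - dl) t ltac:(lra).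
  rewrite in_itv/= => /andP[q1 q2].
  have [g1 [g2 g3]] := hdl (ratr q) ltac:(by rewrite q1 q2).
  set r : R := ratr q in q1 q2 g1 g2 g3.
  have dr : date T r by exact: date_le dt g3 (ltW q2).
  have Br : B (r, w) by exact: (below_le Bt g3 (ltW q2)).
  have Nr : `|N r w| <= k.
    have := hL1 (pickle q); rewrite pickleK => ->//.
    apply: le_trans (YZ _ _ dr) _; have [_ + ] := Bt; apply => /=.
    by rewrite g3 q2.
  have [X1 X2] := (hXW t dt, hXW r dr).
  have [p0 pH] := andP (psi0 w dt).
  rewrite ind_in// mulr1 in g1.
  have g4 : psi t w * `|S i0 t w - S i0 r w| <= `|H t w * (S i0 t w - S i0 r w)|.
    by rewrite normrM ler_wpM2r.
  have g5 : `|psi t w * (S i0 t w - S i0 r w)| = psi t w * `|S i0 t w - S i0 r w|.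
    by rewrite normrM ger0_norm.
  rewrite -g5 in g4; exact: jump_arith g1 g2 g4 Nr X1 X2.
move=> t dt; have [Bt|nBt] := pselect (B (t, w)); first exact: case1.
pose A := [set s | 0 <= s <= t /\ B (s, w)].
have A0 : A 0.
  split; first by rewrite lexx dt.1.
  by split => //= q /=; lra.
have hs : has_sup A by split; [exists 0|exists t => s [/andP[]]].
pose tau := sup A.
have tau0 : 0 <= tau by apply: ub_le_sup; [exact: hs.2|].
have taut : tau <= t by apply: ge_sup; [exists 0|move=> s [/andP[]]].
have dtau : date T tau by exact: date_le dt tau0 taut.
have Btau : B (tau, w).
  split => // q /= /andP[q0 qtau].
  have [s [_ [_ hs']] qs] := sup_adherent (ltac:(by rewrite subr_gt0) : 0 < tau - ratr q) hs.
  by apply: hs' => /=; rewrite q0/=; move: qs; rewrite subKr.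
have tt : tau < t.
  by rewrite lt_neqAle taut andbT; apply/negP => /eqP tt; apply: nBt; rewrite -tt.
have tauT : (tau%:E < T)%E by apply: (lt_le_trans _ dt.2); rewrite lte_fin.
rewrite -/(N t w); have -> : N t w = N tau w; last exact: case1.
have [m tm] := date_nat dt.
apply/eqP; rewrite -subr_eq0 -normr_le0; apply/ler_addgt0Pr => e e0; rewrite add0r.
have /cvgrPdist_le /(_ _ e0) n1 := (cN.1 w).1 tau dtau tauT.
have [dl dl0 hdl] := near_rightP n1.
have [q] := @rat_in_itvoo R tau (Num.min t (tau + dl)) ltac:(by rewrite lt_min tt ltrDl).
rewrite in_itv/= lt_min => /and3P[q1 q2 q3].
have := hdl (ratr q); rewrite q1 q3 => /(_ isT).
have dq : date T (ratr q : R) by apply: date_le dt _ (ltW q2); rewrite (le_trans tau0)// ltW.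
have nBq : ~ B (ratr q, w).
  move=> Bq; have : ratr q <= tau.
    by apply: ub_le_sup; [exact: hs.2|split => //; rewrite dq.1 ltW].
  by rewrite leNgt q1.
have := hL2 (pickle q) m; rewrite pickleK => /(_ dq nBq t dt (ltW q2) tm) ->.
by rewrite distrC.
Qed.

End SuitableDensity.

Section SuitableDensityTheorem.
Context {R : realType} {dO : measure_display} {Omega : measurableType dO}.
Variables (T : \bar R) (F : R -> set (set Omega)).
Hypotheses (T_gt0 : (0 < T)%E) (filtF : is_filtration T F).
Local Notation process := (@process R dO Omega).
Local Notation PT := (@PT R dO Omega T F).
Local Notation bp := (bounded_predictable T F).
Variables (P : probability Omega R) (d : nat) (S : 'I_d -> process) (W : Omega -> R).
Hypothesis cS : forall i, cadlag_adapted T F (S i).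

Lemma suitable_jump i : suitable P T F S W -> exists (H X : process) (I : process -> process),
  [/\ predictable T F H /\ cadlag_adapted T F X, bounded_integral T P F (S i) I,
   {ae P, forall w t, date T t -> 0 < t -> (X t w - X s w - H t w * (S i t w - S i s w)) @[s --> t^'-] --> (0 : R)},
   {ae P, forall w t, date T t -> H t w != 0} &
   {ae P, forall w t, date T t -> `|X t w| <= W w}].
Proof.
move=> [_ _ /(_ i) [H [X [[[pH cX [I [hI em]]] _] H0 XW]]]].
exists H, X, (I ord0); split => //; first by split => //; exact: (pH ord0).
have := stoch_int_jump T_gt0 filtF (fun _ : 'I_1 => cS i) pH cX hI em.
apply: filterS => w h t dt t0; apply: cvg_trans (h t dt t0).
by apply: near_eq_cvg; apply: nearW => s; rewrite big_ord1.
Qed.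

(** For x >= 1 one has k + 2 x <= (k + 2) x: the factor 1 / (k + 2) absorbs the level k, and the
    geometric factor makes the whole series of bounds sum to at most x. *)
Definition weight (k : nat) : R := 2 ^- k.+1 / k.+2%:R.

Lemma weight_gt0 k : 0 < weight k.
Proof. by rewrite /weight divr_gt0// invr_gt0 exprn_gt0. Qed.

Lemma geom_sum n : \sum_(k < n) (2 ^- k.+1 : R) = 1 - 2 ^- n.
Proof.
elim: n => [|n ih]; first by rewrite big_ord0 expr0 invr1 subrr.
rewrite big_ord_recr/= ih exprS invfM; field; by rewrite expf_neq0 ?pnatr_eq0.
Qed.

Lemma sum_weight (n : nat) (x : R) : 1 <= x -> \sum_(k < n) weight k * (k%:R + 2 * x) <= x.
Proof.
move=> x1; apply: (@le_trans _ _ (\sum_(k < n) 2 ^- k.+1 * x)).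
  apply: ler_sum => k _; rewrite /weight -mulrA ler_wpM2l ?invr_ge0 ?exprn_ge0//.
  rewrite mulrC ler_pdivrMr//.
  have -> : (k.+2%:R : R) = k%:R + 2 by rewrite -addn2 natrD.
  rewrite mulrDr [x * 2]mulrC lerD2r mulrC ler_peMr//.
have x0 : 0 <= x by lra.
by rewrite -mulr_suml geom_sum ler_piMl// lerBlDr lerDl invr_ge0 exprn_ge0.
Qed.

(** The density is a product psi G: psi is small enough to control jumps, and G is the weighted sum
    of the indicators of the sets [below] at all integer levels. Paths are bounded on compacts, so
    some level contains each date and G is positive; the bounds k + 2 W of the stopped integrals add
    up to at most W. *)
Theorem suitable_density : suitable P T F S W ->
  exists (phi : process) (I : 'I_d -> process -> process),
    [/\ bp phi, (forall t w, date T t -> 0 < phi t w),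
        (forall i, bounded_integral T P F (S i) (I i)) &
        (forall i, {ae P, forall w t, date T t -> `|I i phi t w| <= W w})].
Proof.
move=> sW; have [_ W1 _] := sW; have d0 := date0 T_gt0.
have /choice[H /choice[X /choice[I hall]]] := fun i => suitable_jump i sW.
have pH i : predictable T F (H i) by have [[]] := hall i.
have cX i : cadlag_adapted T F (X i) by have [[]] := hall i.
have hI i : bounded_integral T P F (S i) (I i) by have [] := hall i.
(* Lying below every |H i|, this integrand has, against each S i, jumps no larger than those of the
   dominated integral of H i. *)
pose psi : process := fun t w => \prod_(i < d) Num.min 1 `|H i t w|.
have min01 (x : R) : 0 <= Num.min 1 `|x| <= 1.
  by rewrite le_min ler01 normr_ge0 ge_min lexx.
have psi_ge0 t w : 0 <= psi t w by apply: prodr_ge0 => i _; have /andP[] := min01 (H i t w).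
have psi_le i t w : psi t w <= Num.min 1 `|H i t w|.
  have /andP[m0 _] := min01 (H i t w); rewrite /psi (bigD1 i)//= ler_piMr//.
  by apply: prodr_ile1 => j _; exact: min01.
have psi_le1 t w : psi t w <= 1.
  by rewrite /psi; apply: prodr_ile1 => j _; exact: min01.
have bpsi : bp psi.
  split; last by exists 1 => t w _; rewrite ger0_norm.
  apply: (predictable_prod T_gt0 filtF (K := fun i t w => Num.min 1 `|H i t w|)) => i.
  apply: (predictable_borel T_gt0 filtF (f := fun x => Num.min 1 `|x|)); last exact: pH.
  by apply: measurable_minr; [exact: measurable_cst|exact: normr_measurable].
pose Z : process := fun t w => \sum_(i < d) `|I i psi t w|.
have cZ : cadlag_adapted T F Z.
  apply: (cadlag_adapted_sum filtF (X := fun i t w => `|I i psi t w|)) => i.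
  by apply: cadlag_adapted_norm => //; exact: (int_cadlag (hI i) bpsi).
have YZ i t w : date T t -> `|I i psi t w| <= Z t w.
  by move=> _; rewrite /Z (bigD1 i)//= lerDl sumr_ge0.
pose B (k : nat) := below T Z k%:R.
have mB k : measurable (B k : set PT) by exact: below_measurable.
have hN i (k : nat) : {ae P, forall w t, date T t ->
    `|I i (fun t w => psi t w * ind (B k) t w) t w| <= k%:R + 2 * W w}.
  have [_ _ hX _ XW] := hall i.
  have p0 t w : date T t -> 0 <= psi t w <= `|H i t w|.
    by move=> _; rewrite psi_ge0 (le_trans (psi_le i t w))// ge_min lexx orbT.
  exact: (stopped_bound T_gt0 filtF cS (hI i) bpsi p0 hX XW cZ (ler0n R k) (YZ i)).
pose g (n : nat) : process := fun t w => \sum_(k < n) weight k * ind (B k) t w.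
have ind_ge0 (C : set (R * Omega)) t w : 0 <= ind C t w by rewrite /ind indicE.
have ind_le1 (C : set (R * Omega)) t w : ind C t w <= 1 by rewrite /ind indicE; case: (_ \in _).
have g_ge0 n t w : 0 <= g n t w.
  by apply: sumr_ge0 => k _; rewrite mulr_ge0// ltW// weight_gt0.
have g_le1 n t w : g n t w <= 1.
  apply: (@le_trans _ _ (\sum_(k < n) 2 ^- k.+1)); last first.
    by rewrite geom_sum lerBlDr lerDl invr_ge0 exprn_ge0.
  apply: ler_sum => k _; apply: (@le_trans _ _ (weight k)).
    by rewrite ler_piMr// ltW// weight_gt0.
  by rewrite /weight ler_pdivrMr// ler_peMr ?ler1n// invr_ge0 exprn_ge0.
have g_nd t w : nondecreasing_seq (fun n => g n t w).
  apply/nondecreasing_seqP => n; rewrite /g big_ord_recr/= lerDl mulr_ge0// ltW// weight_gt0//.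
have g_ub t w : has_ubound (range (fun n => g n t w)) by exists 1 => _ [n _ <-].
have g_cvg t w : g n t w @[n --> \oo] --> lim (g n t w @[n --> \oo]).
  exact: (nondecreasing_is_cvgn (@g_nd t w) (g_ub t w)).
pose G : process := fun t w => lim (g n t w @[n --> \oo]).
have gG n t w : g n t w <= G t w.
  by apply: nondecreasing_cvgn_le => //; exact: g_cvg.
have G01 t w : 0 <= G t w <= 1.
  rewrite (le_trans (g_ge0 0%N t w) (gG _ _ _))/=.
  by apply: limr_le; [exact: g_cvg|apply: nearW => n; exact: g_le1].
have G_gt0 t w : date T t -> 0 < G t w.
  move=> dt; have [C hC] := cadlag_bounded w cZ.1 dt dt.1.
  have C0 : 0 <= C by apply: le_trans (hC 0 _) => //; rewrite lexx dt.1.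
  pose k := (Num.truncn C).+1.
  have Bk : B k (t, w).
    split; first by split.
    move=> q /= /andP[q0 qt]; apply: le_trans (ler_norm _) _.
    apply: le_trans (hC (ratr q) _) _; first by rewrite q0 ltW.
    by rewrite ltW// truncnS_gt.
  apply: lt_le_trans (gG k.+1 t w).
  rewrite /g big_ord_recr/= ind_in// mulr1 ltr_wpDl ?weight_gt0//; exact: g_ge0.
pose c k : process := fun t w => weight k * (psi t w * ind (B k) t w).
have bB k : bp (fun t w => psi t w * ind (B k) t w) by exact: (bpMind T_gt0 filtF bpsi (mB k)).
have bc k : bp (c k).
  by apply: (bpM T_gt0 filtF (K := fun _ _ => weight k) (L := fun t w => psi t w * ind (B k) t w)) => //; exact: bp_cst.
have cE n t w : psi t w * g n t w = \sum_(k < n) c k t w.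
  by rewrite /g mulr_sumr; apply: eq_bigr => k _; rewrite /c; ring.
have bpg n : bp (fun t w => psi t w * g n t w).
  have := bp_sum T_gt0 filtF (fun k : 'I_n => bc k).
  by rewrite (_ : (fun _ _ => _) = (fun t w => psi t w * g n t w))//; apply/funext => t; apply/funext => w; rewrite cE.
have pG t w : date T t -> psi t w * g n t w @[n --> \oo] --> psi t w * G t w.
  by move=> dt; apply: cvgM; [exact: cvg_cst|exact: g_cvg].
have bG : bp (fun t w => psi t w * G t w).
  split.
    apply: (predictable_lim T_gt0 filtF (Kn := fun n t w => psi t w * g n t w)) => //.
    by move=> n; have [] := bpg n.
  exists 1 => t w dt; rewrite normrM -[leRHS]mulr1 ler_pM// ger0_norm//.
    by have /andP[] := G01 t w.
  by have /andP[] := G01 t w.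
have hg i : {ae P, forall w (n : nat) t, date T t -> `|I i (fun t w => psi t w * g n t w) t w| <= W w}.
  apply: ae_foralln => n.
  have e t w : date T t -> \sum_(k < n) c k t w = psi t w * g n t w by move=> _; rewrite cE.
  have h1 := int_congr T_gt0 filtF (hI i) (bp_sum T_gt0 filtF (fun k : 'I_n => bc k)) e.
  have h2 := int_sum T_gt0 filtF (hI i) (fun k : 'I_n => bc k).
  have h3 : {ae P, forall w k t, date T t -> I i (c k) t w = weight k * I i (fun t w => psi t w * ind (B k) t w) t w}.
    by apply: ae_foralln => k; exact: (intZ T_gt0 filtF (hI i) (weight k) (bB k)).
  have h4 : {ae P, forall w (k : nat) t, date T t ->
    `|I i (fun t w => psi t w * ind (B k) t w) t w| <= k%:R + 2 * W w} by exact: ae_foralln.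
  apply: filterS3 W1 (filterI h1 h2) (filterI h3 h4) => w w1 [g1 g2] [g3 g4] t dt.
  rewrite g1// g2//; apply: le_trans (ler_norm_sum _ _ _) _.
  apply: le_trans (sum_weight n w1); apply: ler_sum => k _.
  rewrite g3// normrM gtr0_norm ?weight_gt0// ler_wpM2l ?g4// ltW// weight_gt0//.
have hG i : {ae P, forall w t, date T t -> `|I i (fun t w => psi t w * G t w) t w| <= W w}.
  apply: (ae_dates T_gt0) => t0 dt0.
  have ucp : ucp_cvg T P (fun n => I i (fun t w => psi t w * g n t w)) (I i (fun t w => psi t w * G t w)).
    apply: (int_dct (hI i) (c := 1)) => //.
    - by move=> n; have [] := bpg n.
    - by have [] := bG.
    - by move=> n t w dt; rewrite normrM -[leRHS]mulr1 ler_pM// ger0_norm.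
  have [sg [_ hs]] := ucp_as filtF (fun n => int_cadlag (hI i) (bpg n)) (int_cadlag (hI i) bG) ucp dt0.
  apply: filterS2 hs (hg i) => w u h s st.
  have ds : date T s by case/andP: st => s0 s1; exact: date_le dt0 s0 s1.
  by apply: (lim_norm_le (unif_cvg_pt u st)) => n; exact: h.
(* Almost surely the product is positive at all dates, since no H i vanishes; the value 1 elsewhere
   makes phi positive for every outcome without changing the integrals. *)
pose phi : process := fun t w => if 0 < psi t w * G t w then psi t w * G t w else 1.
have bphi : bp phi.
  split; last first.
    exists 1 => t w dt; rewrite /phi; case: ifP => h; last by rewrite normr1.
    rewrite gtr0_norm// -[leRHS]mulr1 ler_pM//; have /andP[] := G01 t w => //.
  apply: (predictable_borel T_gt0 filtF (f := fun x : R => if 0 < x then x else 1)); last by have [] := bG.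
  by apply: measurable_fun_ifT => //; apply: measurable_fun_ltr.
exists phi, I; split => //.
  by move=> t w dt; rewrite /phi; case: ifP.
move=> i.
have H0 : {ae P, forall w j t, date T t -> H j t w != 0}.
  by apply: ae_ord => j; have [] := hall j.
have h : indist T P phi (fun t w => psi t w * G t w).
  apply: filterS H0 => w h t dt; rewrite /phi ifT// mulr_gt0 ?G_gt0//.
  by apply: prodr_gt0 => j _; rewrite lt_min ltr01 normr_gt0 h.
have PP : P `<< P by move=> A.
apply: filterS2 (int_indist T_gt0 filtF PP (hI i) bphi bG h) (hG i) => w h1 h2 t dt.
by rewrite h1// h2.
Qed.

End SuitableDensityTheorem.

(** * Optional stopping *)

Section Expectation.
Context {R : realType} {dO : measure_display} {Omega : measurableType dO}.
Variable Q : probability Omega R.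
Implicit Types f g : Omega -> R.

Definition L1 f := Q.-integrable setT (EFin \o f).
Definition ex f : R := \int[Q]_w f w.

Lemma L1_meas f : L1 f -> measurable_fun setT f.
Proof. by move=> /measurable_int/measurable_EFinP. Qed.

Lemma L1_bound f (c : R) : measurable_fun setT f -> (forall w, `|f w| <= c) -> L1 f.
Proof.
move=> mf fc; apply: measurable_bounded_integrable => //.
  by rewrite (le_lt_trans (probability_le1 _ _))// ltry.
by exists c; split => [|M cM w _]; [exact: num_real|exact: le_trans (fc w) (ltW cM)].
Qed.

Lemma L1_cst (c : R) : L1 (fun _ => c).
Proof. by apply: (L1_bound (c := `|c|)) => //; exact: measurable_cst. Qed.

Lemma L1_dom f g : measurable_fun setT f -> L1 g -> {ae Q, forall w, `|f w| <= g w} -> L1 f.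
Proof.
move=> mf ig fg; have mg := L1_meas ig.
apply/integrableP; split; first exact/measurable_EFinP.
have /integrableP[_] := integrable_norm ig; apply: le_lt_trans.
apply: ae_ge0_le_integral => //.
- by apply/measurable_EFinP; exact: measurableT_comp.
- by apply/measurable_EFinP; do 2 apply: measurableT_comp => //.
- apply: filterS fg => w h _ /=; rewrite lee_fin normr_id; exact: le_trans h (ler_norm _).
Qed.

Lemma L1_lin (a : R) f g : L1 f -> L1 g -> L1 (fun w => a * f w + g w).
Proof.
move=> hf hg; have := integrableD measurableT (integrableZl measurableT a hf) hg.
exact: eq_integrable.
Qed.

Lemma exL (a : R) f g : L1 f -> L1 g -> ex (fun w => a * f w + g w) = a * ex f + ex g.
Proof.
move=> hf hg; have hZ : Q.-integrable setT (EFin \o (fun w => a * f w)).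
  by have := integrableZl measurableT a hf; exact: eq_integrable.
by rewrite /ex RintegralD// RintegralZl.
Qed.

Lemma L1D f g : L1 f -> L1 g -> L1 (fun w => f w + g w).
Proof. by move=> hf hg; have := L1_lin 1 hf hg; under eq_fun do rewrite mul1r. Qed.

Lemma exD f g : L1 f -> L1 g -> ex (fun w => f w + g w) = ex f + ex g.
Proof. by move=> hf hg; have := exL 1 hf hg; under eq_fun do rewrite mul1r; rewrite mul1r. Qed.

Lemma L1Z a f : L1 f -> L1 (fun w => a * f w).
Proof. by move=> hf; have := L1_lin a hf (L1_cst 0); under eq_fun do rewrite addr0. Qed.

Lemma ex0 : ex (fun _ => 0) = 0.
Proof. by rewrite /ex Rintegral_cst// mul0r. Qed.

Lemma ex_cst (c : R) : ex (fun _ => c) = c.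
Proof. by rewrite /ex Rintegral_cst//; have -> : fine (Q setT) = 1; [by rewrite probability_setT|rewrite mulr1]. Qed.

Lemma exZ a f : L1 f -> ex (fun w => a * f w) = a * ex f.
Proof. by move=> hf; have := exL a hf (L1_cst 0); under eq_fun do rewrite addr0; rewrite ex0 addr0. Qed.

Lemma L1B f g : L1 f -> L1 g -> L1 (fun w => f w - g w).
Proof. by move=> hf hg; have := L1D hf (L1Z (-1) hg); under eq_fun do rewrite mulN1r. Qed.

Lemma exB f g : L1 f -> L1 g -> ex (fun w => f w - g w) = ex f - ex g.
Proof.
move=> hf hg; have := exD hf (L1Z (-1) hg); rewrite exZ// mulN1r => <-.
by congr ex; apply/funext => w; rewrite mulN1r.
Qed.

Lemma L1_norm f : L1 f -> L1 (fun w => `|f w|).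
Proof. exact: integrable_norm. Qed.

Lemma L1_sum n (f : 'I_n -> Omega -> R) : (forall i, L1 (f i)) -> L1 (fun w => \sum_(i < n) f i w).
Proof.
elim: n f => [|n ih] f h; first by under eq_fun do rewrite big_ord0; exact: L1_cst.
by under eq_fun do rewrite big_ord_recr/=; apply: L1D => //; exact: ih.
Qed.

Lemma ex_sum n (f : 'I_n -> Omega -> R) : (forall i, L1 (f i)) ->
  ex (fun w => \sum_(i < n) f i w) = \sum_(i < n) ex (f i).
Proof.
elim: n f => [|n ih] f h; first by under eq_fun do rewrite big_ord0; rewrite big_ord0 ex0.
under eq_fun do rewrite big_ord_recr/=.
by rewrite exD ?big_ord_recr//= ?ih//; exact: L1_sum.
Qed.

Lemma ex_eq f g : measurable_fun setT f -> measurable_fun setT g ->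
  {ae Q, forall w, f w = g w} -> ex f = ex g.
Proof.
move=> mf mg h; congr fine; apply: ae_eq_integral => //; try exact/measurable_EFinP.
by apply: filterS h => w ->.
Qed.

Lemma ex_ge0 f : {ae Q, forall w, 0 <= f w} -> measurable_fun setT f -> 0 <= ex f.
Proof.
move=> h mf; rewrite (@ex_eq f (fun w => `|f w|))//; last 2 first.
- exact: measurableT_comp.
- by apply: filterS h => w fw; rewrite ger0_norm.
by rewrite /ex; apply: Rintegral_ge0.
Qed.

Lemma ex_le f g : L1 f -> L1 g -> {ae Q, forall w, f w <= g w} -> ex f <= ex g.
Proof.
move=> hf hg h; rewrite -subr_ge0 -exB//; apply: ex_ge0.
  by apply: filterS h => w; rewrite subr_ge0.
exact: L1_meas (L1B hg hf).
Qed.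

Lemma norm_ex f : L1 f -> `|ex f| <= ex (fun w => `|f w|).
Proof. by move=> hf; apply: le_normr_Rintegral. Qed.

Lemma exE f : L1 f -> (\int[Q]_w (f w)%:E)%E = (ex f)%:E.
Proof. by move=> hf; rewrite /ex /Rintegral fineK//; exact: (integrable_fin_num measurableT hf). Qed.

Lemma ex_dct (fn : nat -> Omega -> R) f g : (forall n, measurable_fun setT (fn n)) ->
  measurable_fun setT f -> L1 g -> {ae Q, forall w, forall n, `|fn n w| <= g w} ->
  {ae Q, forall w, fn n w @[n --> \oo] --> f w} -> L1 f /\ ex (fn n) @[n --> \oo] --> ex f.
Proof.
move=> mfn mf ig bd cv.
have [] := @dominated_convergence _ _ _ Q setT measurableT (fun n => EFin \o fn n) (EFin \o f) (EFin \o g).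
- by move=> n; exact/measurable_EFinP.
- exact/measurable_EFinP.
- by apply: filterS cv => w h _; exact: (cvg_comp _ _ h).
- exact: ig.
- by apply: filterS bd => w h n _ /=; rewrite lee_fin.
move=> i1 _ h; split => //.
have ifn n : L1 (fn n) by apply: (L1_dom (mfn n) ig); apply: filterS bd => w.
have : (\int[Q]_w (fn n w)%:E)%E @[n --> \oo] --> (\int[Q]_w (f w)%:E)%E by exact: h.
by rewrite exE// => /fine_cvg.
Qed.

(** Fatou's lemma in the form used for supermartingale-type bounds: integrability of the limit is
    part of the conclusion. Absolute values turn the almost everywhere sign into one valid
    everywhere. *)
Lemma ex_fatou (fn : nat -> Omega -> R) f c : (forall n, L1 (fn n)) -> measurable_fun setT f ->
  {ae Q, forall w, forall n, 0 <= fn n w} -> (forall n, ex (fn n) <= c) ->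
  {ae Q, forall w, fn n w @[n --> \oo] --> f w} -> L1 f /\ ex f <= c.
Proof.
move=> ifn mf p0 hc cv; have mfn n := L1_meas (ifn n).
pose gn n w := `|fn n w|; pose g w := `|f w|.
have mg : measurable_fun setT (EFin \o g) by apply/measurable_EFinP; exact: measurableT_comp.
have mgn n : measurable_fun setT (EFin \o gn n) by apply/measurable_EFinP; exact: measurableT_comp.
have gn0 n w : [set: Omega] w -> (0 <= (EFin \o gn n) w)%E by move=> _; rewrite lee_fin /gn.
have hF := fatou Q measurableT mgn gn0.
have h1 : (\int[Q]_w (g w)%:E <= c%:E)%E.
  have e1 : (\int[Q]_w (EFin \o g) w = \int[Q]_w limn_einf (fun n => (EFin \o gn n) w))%E.
    apply: ae_eq_integral => //.
      apply: (emeasurable_fun_cvg (fun n w => einfs (fun m => (EFin \o gn m) w) n)) => [n|w _].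
        exact: measurable_fun_einfs.
      by rewrite limn_einf_lim; exact: is_cvg_einfs.
    apply: filterS cv => w h _.
    by have /cvg_limn_einf_sup[-> _] : (EFin \o gn n) w @[n --> \oo] --> (EFin \o g) w by exact: cvg_comp (cvg_norm h) _.
  move: hF; rewrite -e1 => hF; apply: le_trans hF _.
  rewrite limn_einf_lim; apply: lime_le; first exact: is_cvg_einfs.
  apply: nearW => n; apply: ge_ereal_inf; exists (\int[Q]_w (EFin \o gn n) w)%E; first by exists n => //=.
  have -> : (\int[Q]_w (EFin \o gn n) w = \int[Q]_w (fn n w)%:E)%E.
    apply: ae_eq_integral => //; first by apply/measurable_EFinP.
    by apply: filterS p0 => w h _; rewrite /= /gn ger0_norm.
  by rewrite exE// lee_fin.
have i1 : L1 g.
  apply/integrableP; split => //=; apply: le_lt_trans (ltry c); apply: le_trans h1.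
  by rewrite le_eqVlt; apply/orP; left; apply/eqP; apply: eq_integral => w _; rewrite /= /g normr_id.
have i2 : L1 f by apply: (L1_dom mf i1); exact: nearW.
split => //; rewrite -lee_fin -exE//; apply: le_trans h1.
by rewrite !exE// lee_fin; apply: ex_le => //; apply: nearW => w; exact: ler_norm.
Qed.

End Expectation.

(** * Sampling along finite grids *)

Section FirstEntry.
Context {R : realType} {dO : measure_display} {Omega : measurableType dO}.
Variables (T : \bar R) (F : R -> set (set Omega)).
Hypotheses (filtF : is_filtration T F).
Local Notation process := (@process R dO Omega).
Variables (Q : probability Omega R).

Lemma filtI t A B : date T t -> F t A -> F t B -> F t (A `&` B).
Proof.
move=> dt FA FB; have E : <<s F t >> = F t by apply: sigma_algebra_id; exact: (filtF.1 t dt).1.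
have := @measurableI _ (g_sigma_algebraType (F t)) A B.
by rewrite /measurable/= E; apply.
Qed.

Lemma filtC t A : date T t -> F t A -> F t (~` A).
Proof. by move=> dt FA; have [_ + _] := (filtF.1 t dt).1; rewrite -setTD; apply. Qed.

Lemma filt_meas t A : date T t -> F t A -> measurable A.
Proof. by move=> dt; exact: (filtF.1 t dt).2. Qed.

Lemma filt_le s t A : date T s -> date T t -> s <= t -> F s A -> F t A.
Proof. by move=> ds dt st; exact: filtF.2. Qed.

Lemma L1_ind f A : measurable A -> L1 Q f -> L1 Q (fun w => \1_A w * f w).
Proof.
move=> mA hf; apply: (L1_dom _ (L1_norm hf)).
  by apply: measurable_funM; [exact: measurable_indic|exact: L1_meas hf].
apply: nearW => w; rewrite normrM indicE; case: (w \in A); rewrite ?normr1 ?mul1r// normr0 mul0r//.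
Qed.

Lemma ex_indE (f : Omega -> R) A : ex Q (fun w => \1_A w * f w) = \int[Q]_(w in A) f w.
Proof.
rewrite Rintegral_mkcond /ex; congr fine; apply: eq_integral => w _; congr EFin.
by rewrite patchE indicE; case: ifP => _; rewrite ?mul1r ?mul0r.
Qed.

(** The positive part of |x| - L is convex and equals the distance from x to its clipping at L. Its
    expectation takes the place of uniform integrability. *)
Definition excess (L x : R) := Num.max 0 (`|x| - L).

Lemma excess_ge0 L x : 0 <= excess L x.
Proof. by rewrite le_max lexx. Qed.

Lemma excess_le L x : 0 <= L -> excess L x <= `|x|.
Proof. by move=> L0; rewrite ge_max normr_ge0 gerBl. Qed.

Lemma excess_meas L (f : Omega -> R) : measurable_fun setT f ->
  measurable_fun setT (fun w => excess L (f w)).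
Proof.
move=> mf; apply: measurable_maxr; first exact: measurable_cst.
by apply: measurable_funB; [exact: measurableT_comp|exact: measurable_cst].
Qed.

Lemma L1_excess L f : 0 <= L -> L1 Q f -> L1 Q (fun w => excess L (f w)).
Proof.
move=> L0 hf; apply: (L1_dom (excess_meas L (L1_meas hf)) (L1_norm hf)).
by apply: nearW => w; rewrite ger0_norm ?excess_ge0// excess_le.
Qed.

(** The value of M at the first grid time [g k] with k < n at which [A k] occurs, and at [g n] if
    there is none. The recursion on the first grid point matches the induction of optional
    sampling. *)
Fixpoint first_entry (M : process) n (g : nat -> R) (A : nat -> set Omega) : Omega -> R :=
  if n is m.+1 then fun w => \1_(A 0%N) w * M (g 0%N) w +
    \1_(~` A 0%N) w * first_entry M m (g \o S) (A \o S) w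
  else M (g 0%N).

Lemma first_entry_meas M n g A : adapted T F M -> (forall k, (k <= n)%N -> date T (g k)) ->
  (forall k, (k < n)%N -> F (g k) (A k)) -> measurable_fun setT (first_entry M n g A).
Proof.
move=> aM; elim: n g A => [|n ih] g A dg FA /=.
  by apply: (wrt_measurable filtF (dg 0%N isT)); exact: (aM _ (dg 0%N isT)).
have d0 := dg _ (leq0n _).
have mA : measurable (A 0%N) by exact: filt_meas d0 (FA _ _).
apply: measurable_funD; apply: measurable_funM.
- exact: measurable_indic.
- by apply: (wrt_measurable filtF d0); exact: aM.
- by apply: measurable_indic; exact: measurableC.
- by apply: ih => k kn; [exact: dg|exact: FA].
Qed.

(** When [A k] is {r < g k}, the sampled time is the first grid point after r, so it overshoots r by
    at most the mesh dl. *)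
Lemma first_entry_val M n g A (r dl : R) w : (forall k, (k < n)%N -> g k <= g k.+1 <= g k + dl) ->
  (forall k, (k < n)%N -> A k w <-> r < g k) -> r <= g n -> g 0%N <= r + dl ->
  exists s, [/\ first_entry M n g A w = M s w, r <= s <= r + dl, s <= g n & r < s \/ s = g n].
Proof.
elim: n g A => [|n ih] g A hg hA rn g0 /=.
  by exists (g 0%N); split => //; [rewrite rn g0|right].
have gmono k : (k <= n.+1)%N -> g 0%N <= g k.
  elim: k => [//|k ihk] kn; apply: le_trans (ihk (ltnW kn)) _.
  by have /andP[] := hg k kn.
have [rg|gr] := ltP r (g 0%N).
  exists (g 0%N); split => //; [|by rewrite ltW|exact: gmono|by left].
  have : A 0%N w by apply/hA.
  by move=> Aw; rewrite !indicE in_setC mem_set// mul1r mul0r addr0.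
have nA : ~ A 0%N w by move/hA => /(_ isT); rewrite ltNge gr.
have [||||s [e h1 h2 h3]] := ih (g \o S) (A \o S).
- by move=> k kn; exact: hg.
- by move=> k kn; exact: hA.
- exact: rn.
- have /andP[_ h] := hg 0%N isT; apply: le_trans h _; by rewrite lerD2r.
exists s; split => //.
by rewrite !indicE in_setC memNset// mul0r mul1r add0r.
Qed.

End FirstEntry.

Section OptionalStopping.
Context {R : realType} {dO : measure_display} {Omega : measurableType dO}.
Variables (T : \bar R) (F : R -> set (set Omega)).
Hypotheses (filtF : is_filtration T F).
Local Notation process := (@process R dO Omega).
Variables (Q : probability Omega R).

(** The strict inequality is what an entrance time into an open set satisfies, namely {r < q} in
    [F q], using the paths before q only. The augmented filtration is known to be a filtration, but
    its right-continuity has not been established. *)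
Definition optional (s t : R) (r : Omega -> R) := (forall w, s <= r w <= t) /\
  forall q, s <= q <= t -> F q [set w | r w < q].

(** The first dyadic point of [s, t] strictly after r, with t as default, decreases to r up to the
    mesh, and right-continuity of Y gives the limit. *)
Lemma optional_approx (Y : process) s t r : cadlag_adapted T F Y -> date T s -> date T t -> s <= t ->
  optional s t r -> exists g A, [/\ forall n k, (k <= 2 ^ n)%N -> date T (g n k),
    forall n k, (k < 2 ^ n)%N -> g n k <= g n k.+1,
    forall n k, (k < 2 ^ n)%N -> F (g n k) (A n k),
    forall n, g n 0%N = s /\ g n (2 ^ n)%N = t &
    forall w, first_entry Y (2 ^ n) (g n) (A n) w @[n --> \oo] --> Y (r w) w].
Proof.
move=> cY ds dt st [hr Fr].
pose g (n k : nat) : R := s + (t - s) * (k%:R / 2 ^+ n).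
pose A (n k : nat) := [set w | r w < g n k].
have e0 n : (0 : R) < 2 ^+ n by rewrite exprn_gt0.
have ts : 0 <= t - s by rewrite subr_ge0.
have gs n k : s <= g n k by rewrite lerDl mulr_ge0// divr_ge0// ltW.
have gt n k : (k <= 2 ^ n)%N -> g n k <= t.
  move=> kn; rewrite -lerBrDl ler_piMr// ler_pdivrMr// mul1r -natrX ler_nat//.
have dg n k : (k <= 2 ^ n)%N -> date T (g n k).
  by move=> kn; apply: date_le dt _ (gt _ _ kn); exact: le_trans ds.1 _.
have gS n k : g n k.+1 = g n k + (t - s) / 2 ^+ n by rewrite /g -natr1; field; rewrite gt_eqF.
have gm n k : g n k <= g n k.+1 by rewrite gS lerDl divr_ge0// ltW.
exists g, A; split => //.
- by move=> n k kn; apply: Fr; rewrite gs gt// ltnW.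
- by move=> n; rewrite /g mul0r mulr0 addr0 natrX divff ?gt_eqF// mulr1; split => //; ring.
move=> w; have /andP[sr rt] := hr w.
have val n : exists q, [/\ first_entry Y (2 ^ n) (g n) (A n) w = Y q w,
    r w <= q <= r w + (t - s) / 2 ^+ n, q <= t & r w < q \/ q = t].
  have gn : g n (2 ^ n)%N = t by rewrite /g natrX divff ?gt_eqF// mulr1; ring.
  have [||||q] := @first_entry_val _ _ _ Y (2 ^ n) (g n) (A n) (r w) ((t - s) / 2 ^+ n) w.
  - by move=> k kn; rewrite gm gS lexx.
  - by [].
  - by rewrite gn.
  - by rewrite /g mul0r mulr0 addr0; apply: le_trans sr _; rewrite lerDl divr_ge0// ltW.
  by rewrite gn => h; exists q.
have [rtE|rltt] := eqVneq (r w) t.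
  apply: cvg_near_cst; apply: nearW => n; have [q [-> /andP[rq _] qt _]] := val n.
  by congr (Y _ w); apply/eqP; rewrite eq_le rq rtE qt.
have rt' : r w < t by rewrite lt_neqAle rltt.
have dr : date T (r w) by apply: date_le dt _ rt; exact: le_trans ds.1 sr.
have rT : ((r w)%:E < T)%E by apply: lt_le_trans dt.2; rewrite lte_fin.
apply/cvgrPdist_le => e ep.
have /cvgrPdist_le/(_ _ ep)/near_rightP[dl dl0 hdl] := (cY.1 w).1 _ dr rT.
have lim0 : (t - s) / 2 ^+ n @[n --> \oo] --> (0 : R).
  rewrite -[X in _ --> X](mulr0 (t - s)); apply: cvgM; first exact: cvg_cst.
  have -> : (fun n => (2 ^+ n : R)^-1) = (fun n => (2^-1 : R) ^+ n) by apply/funext => n; rewrite exprVn.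
  by apply: cvg_expr; rewrite ger0_norm ?invr_ge0// invf_lt1// ltr1n.
have m0 : 0 < Num.min dl (t - r w) by rewrite lt_min dl0 subr_gt0.
have /cvgrPdist_lt/(_ _ m0) := lim0; apply: filterS => n.
rewrite sub0r normrN ger0_norm; last by rewrite divr_ge0// ltW.
rewrite lt_min => /andP[n1 n2]; have [q [-> /andP[q1 q2] q3 q4]] := val n.
case: q4 => [rq|qt]; last by exfalso; move: n2 q2; rewrite qt => ? ?; lra.
by apply: hdl; rewrite rq/=; apply: le_lt_trans q2 _; rewrite ltrD2l.
Qed.

Lemma optional_meas (Y : process) s t r : cadlag_adapted T F Y -> date T s -> date T t -> s <= t ->
  optional s t r -> measurable_fun setT (fun w => Y (r w) w).
Proof.
move=> cY ds dt st opt; have [g [A [dg _ FA _ hc]]] := optional_approx cY ds dt st opt.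
apply: (measurable_fun_cvg (h := fun n => first_entry Y (2 ^ n) (g n) (A n))) => [n|w _]; last exact: hc.
by apply: (first_entry_meas filtF cY.2); [exact: dg|exact: FA].
Qed.

Variable M : process.
Hypothesis hM : martingale T Q F M.

Lemma mart_L1 t : date T t -> L1 Q (M t).
Proof. by have [_ h _] := hM; exact: h. Qed.

Lemma mart_ind s t A : date T s -> date T t -> s <= t -> F s A ->
  ex Q (fun w => \1_A w * M t w) = ex Q (fun w => \1_A w * M s w).
Proof.
by move=> ds dt st FA; rewrite !ex_indE /Rintegral; have [_ _ h] := hM; rewrite (h s t A).
Qed.

(** Jensen's inequality through supporting lines chosen at time s: slope 1 on {M s > L}, slope - 1
    on {M s < - L}, and 0 between. [D s + q] is the excess at time s, [D t + q] bounds it from below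
    at time t, and the two means agree by the martingale property on B and C. *)
Lemma mart_excess s t A L : 0 <= L -> date T s -> date T t -> s <= t -> F s A ->
  ex Q (fun w => \1_A w * excess L (M s w)) <= ex Q (fun w => \1_A w * excess L (M t w)).
Proof.
move=> L0 ds dt st FA.
have cM : cadlag_adapted T F M by have [] := hM.
have FB (Y : set R) : measurable Y -> F s (A `&` (M s @^-1` Y)).
  move=> mY; apply: (filtI filtF ds) => //; apply: (cM.2 s ds); exists Y => //; by rewrite setTI.
pose B := A `&` (M s @^-1` `]L, +oo[%classic); pose C := A `&` (M s @^-1` `]-oo, -L[%classic).
have FB' : F s B by exact: FB. have FC' : F s C by exact: FB.
have mB := filt_meas filtF ds FB'; have mC := filt_meas filtF ds FC'; have mA := filt_meas filtF ds FA.
have iM r : date T r -> L1 Q (M r) by exact: mart_L1.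
pose D r w := \1_B w * M r w - \1_C w * M r w.
pose q w := - (L * (\1_B w + \1_C w)).
have iD r : date T r -> L1 Q (D r) by move=> dr; apply: L1B; apply: L1_ind => //; exact: iM.
have iq : L1 Q q.
  apply: (@L1_bound _ _ _ _ _ (L * 2)).
    by apply: measurableT_comp => //; apply: measurable_funM => //; apply: measurable_funD; exact: measurable_indic.
  move=> w; rewrite normrN normrM (ger0_norm L0) ler_wpM2l// !indicE ger0_norm//.
  by do 2 case: (_ \in _); rewrite /= ?mulr0n ?mulr1n; lra.
have eD : ex Q (D s) = ex Q (D t).
  by rewrite /D !exB; try (apply: L1_ind => //; exact: iM); rewrite !(mart_ind ds dt).
have es w : \1_A w * excess L (M s w) = D s w + q w.
  rewrite /D /q /excess !indicE.
  have [Aw|nAw] := pselect (A w); last first.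
    have nB : ~ B w by move=> []. have nC : ~ C w by move=> [].
    by rewrite !memNset//= !mulr0n !mul0r subrr addr0 mulr0 oppr0 addr0.
  rewrite (mem_set Aw) mul1r.
  have [LM|ML] := ltP L (M s w).
    have Bw : B w by split => //=; rewrite in_itv/= LM.
    have nC : ~ C w by move=> [_ /=]; rewrite in_itv/= => ?; lra.
    rewrite (mem_set Bw) (memNset nC) (gtr0_norm (le_lt_trans L0 LM)) max_r; last by lra.
    by rewrite /= mulr1n mulr0n; ring.
  have nB : ~ B w by move=> [_ /=]; rewrite in_itv/= andbT ltNge ML.
  have [ML'|LM] := ltP (M s w) (- L).
    have Cw : C w by split => //=; rewrite in_itv/= ML'.
    rewrite (mem_set Cw) (memNset nB) ltr0_norm; last by lra.
    by rewrite max_r; [rewrite /= mulr1n mulr0n; ring|lra].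
  have nC : ~ C w by move=> [_ /=]; rewrite in_itv/= ltNge LM.
  rewrite !memNset// max_l; first by rewrite /= !mulr0n; ring.
  by rewrite subr_le0 ler_norml LM ML.
have et w : D t w + q w <= \1_A w * excess L (M t w).
  rewrite /D /q /excess !indicE.
  have [Aw|nAw] := pselect (A w); last first.
    have nB : ~ B w by move=> []. have nC : ~ C w by move=> [].
    by rewrite !memNset//= !mulr0n !mul0r subrr addr0 mulr0 oppr0 addr0.
  rewrite (mem_set Aw) mul1r le_max.
  have [Bw|nBw] := pselect (B w).
    have nC : ~ C w by move: Bw => [_ /=]; rewrite in_itv/= => ? [_ /=]; rewrite in_itv/= => ?; lra.
    rewrite (mem_set Bw) (memNset nC) /= mulr1n mulr0n; apply/orP; right.
    by have := ler_norm (M t w); lra.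
  rewrite (memNset nBw); have [Cw|nCw] := pselect (C w).
    rewrite (mem_set Cw) /= mulr1n mulr0n; apply/orP; right.
    by have := ler_norm (- M t w); rewrite normrN; lra.
  by rewrite (memNset nCw) /= mulr0n; apply/orP; left; lra.
have iex r : date T r -> L1 Q (fun w => \1_A w * excess L (M r w)).
  by move=> dr; apply: L1_ind => //; apply: L1_excess => //; exact: iM.
rewrite (_ : (fun w => \1_A w * excess L (M s w)) = (fun w => D s w + q w)); last exact/funext.
rewrite exD//; last exact: iD.
rewrite eD -exD//; last exact: iD.
by apply: ex_le; [exact: L1D (iD _ dt) iq|exact: iex|exact: nearW].
Qed.

(** On [A 0] the sampled value is compared with the final date directly, off [A 0] the induction
    hypothesis applies. The event B is carried along because it has to be intersected with the
    complement of [A 0]. *)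
Lemma first_entry_sample n g A B : (forall k, (k <= n)%N -> date T (g k)) ->
  (forall k, (k < n)%N -> g k <= g k.+1) -> (forall k, (k < n)%N -> F (g k) (A k)) ->
  F (g 0%N) B ->
  [/\ L1 Q (first_entry M n g A),
    ex Q (fun w => \1_B w * first_entry M n g A w) = ex Q (fun w => \1_B w * M (g n) w) &
    forall L, 0 <= L -> ex Q (fun w => \1_B w * excess L (first_entry M n g A w)) <=
      ex Q (fun w => \1_B w * excess L (M (g n) w))].
Proof.
elim: n g A B => [|n ih] g A B dg gm FA FB.
  by split => //=; apply: mart_L1; exact: dg.
have d0 := dg _ (leq0n _); have d1 := dg 1%N isT; have dn := dg n.+1 (leqnn _).
have FA0 := FA 0%N isT.
have F1 : F (g 0%N) (B `&` A 0%N) by exact: (filtI filtF d0).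
have F2 : F (g 0%N) (B `&` ~` A 0%N) by apply: (filtI filtF d0) => //; exact: (filtC filtF d0).
have F2' : F (g 1%N) (B `&` ~` A 0%N) by exact: (filt_le filtF d0 d1 (gm 0%N isT) F2).
have [||||i1 e1 x1] := ih (g \o S) (A \o S) (B `&` ~` A 0%N).
- by move=> k kn; exact: dg.
- by move=> k kn; exact: gm.
- by move=> k kn; exact: FA.
- exact: F2'.
have g0n : g 0%N <= g n.+1.
  have H k : (k <= n.+1)%N -> g 0%N <= g k.
    by elim: k => [//|k ihk] kn; apply: le_trans (ihk (ltnW kn)) (gm k kn).
  exact: H.
have m0 := filt_meas filtF d0 FA0.
have m1 := filt_meas filtF d0 F1; have m2 := filt_meas filtF d0 F2.
have mB := filt_meas filtF d0 FB.
have iM k : (k <= n.+1)%N -> L1 Q (M (g k)) by move=> kn; exact: mart_L1 (dg _ kn).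
have i2 : L1 Q (first_entry M n.+1 g A).
  by rewrite /=; apply: L1D; apply: L1_ind => //; [exact: iM|exact: measurableC].
have split_ (h : R -> R) w : \1_B w * h (first_entry M n.+1 g A w) =
    \1_(B `&` A 0%N) w * h (M (g 0%N) w) +
    \1_(B `&` ~` A 0%N) w * h (first_entry M n (g \o S) (A \o S) w).
  rewrite /= !indicE !in_setI in_setC; case: (w \in A 0%N); rewrite /= ?andbT ?andbF.
    by rewrite !mul0r addr0 mul1r addr0.
  by rewrite !mul0r add0r mul1r add0r.
have split0 (f : Omega -> R) w : \1_B w * f w =
    \1_(B `&` A 0%N) w * f w + \1_(B `&` ~` A 0%N) w * f w.
  by rewrite !indicE !in_setI in_setC; case: (w \in A 0%N); rewrite /= ?andbT ?andbF !mul0r ?addr0 ?add0r.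
split => //.
  rewrite (funext (split_ id)) exD; try apply: L1_ind => //; try exact: iM.
  rewrite e1 -(mart_ind d0 dn g0n F1) -exD; try apply: L1_ind => //; try exact: iM.
  by rewrite -(funext (split0 _)).
move=> L L0; rewrite (funext (split_ (excess L))) exD; try (apply: L1_ind => //; apply: L1_excess => //; exact: iM).
rewrite (funext (split0 (fun w => excess L (M (g n.+1) w)))) [leRHS]exD; try (apply: L1_ind => //; apply: L1_excess => //; exact: iM).
by apply: lerD; [exact: mart_excess|exact: x1].
Qed.

Lemma clip_near (L x : R) : 0 <= L -> `|x - clip L x| = excess L x.
Proof.
move=> L0; rewrite /clip /excess.
have [Lx|xL] := leP L x.
  by rewrite !max_r; [rewrite !ger0_norm; lra|rewrite ger0_norm; lra|lra].
have [Lx'|xL'] := leP x (- L).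
  by rewrite (ler0_norm (_ : x <= 0)) ?(ler0_norm (_ : x - - L <= 0)) ?max_r; lra.
rewrite subrr normr0 max_l// subr_le0 ler_norml; apply/andP; split; lra.
Qed.

Lemma excess_cvg f : L1 Q f -> ex Q (fun w => excess n%:R (f w)) @[n --> \oo] --> (0 : R).
Proof.
move=> hf; rewrite -(ex0 Q).
apply: (ex_dct (g := fun w => `|f w|) _ (measurable_cst _) (L1_norm hf) _ _).2 => //.
- by move=> n; exact: excess_meas (L1_meas hf).
- by apply: nearW => w n; rewrite ger0_norm ?excess_ge0// excess_le.
- apply: nearW => w; apply: cvg_near_cst; near=> n.
  rewrite /excess max_l// subr_le0; near: n; exact: nbhs_infty_ger.
Unshelve. all: by end_near. Qed.

(** Sampled values clipped at L converge in mean by domination. The clipping error is at most the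
    expected excess of M t, uniformly in the approximation, and vanishes as L grows. *)
Theorem optional_stopping s t r : date T s -> date T t -> s <= t -> optional s t r ->
  L1 Q (fun w => M (r w) w) /\ forall B, F s B ->
    ex Q (fun w => \1_B w * M (r w) w) = ex Q (fun w => \1_B w * M t w).
Proof.
move=> ds dt st opt; have cM : cadlag_adapted T F M by have [] := hM.
have [g [A [dg gm FA g0 hc]]] := optional_approx cM ds dt st opt.
pose xi n := first_entry M (2 ^ n) (g n) (A n).
have hs B n : F s B -> [/\ L1 Q (xi n),
    ex Q (fun w => \1_B w * xi n w) = ex Q (fun w => \1_B w * M t w) &
    forall L, 0 <= L -> ex Q (fun w => \1_B w * excess L (xi n w)) <=
      ex Q (fun w => \1_B w * excess L (M t w))].
  move=> FB; have [e1 e2] := g0 n.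
  have := @first_entry_sample (2 ^ n) (g n) (A n) B; rewrite e1 e2; apply => //.
  - by move=> k; exact: dg.
  - by move=> k; exact: gm.
  - by move=> k; exact: FA.
have excess0 (f : Omega -> R) : (fun w => excess 0 (f w)) = (fun w => `|f w|).
  by apply/funext => w; rewrite /excess subr0 max_r.
have FT : F s setT by exact: (filtT filtF ds).
have exT (f : Omega -> R) : ex Q (fun w => \1_[set: Omega] w * f w) = ex Q f.
  by congr ex; apply/funext => w; rewrite indicE in_setT mul1r.
have ixi n : L1 Q (xi n) by have [] := hs setT n FT.
have iMt := mart_L1 dt.
have mMr := optional_meas cM ds dt st opt.
have iMr : L1 Q (fun w => M (r w) w).
  apply: (L1_dom mMr (g := fun w => `|M (r w) w|)); last exact: nearW.
  apply: (ex_fatou (fn := fun n w => `|xi n w|) (c := ex Q (fun w => `|M t w|)) _ _ _ _ _).1.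
  - by move=> n; exact: L1_norm.
  - exact: measurableT_comp.
  - exact: nearW.
  - move=> n; have [_ _ /(_ 0 (lexx _))] := hs setT n FT; rewrite !exT.
    by rewrite !excess0.
  - by apply: nearW => w; apply: cvg_norm; exact: hc.
split => // B FB; have mB := filt_meas filtF ds FB.
have key L : 0 <= L -> `|ex Q (fun w => \1_B w * M t w) - ex Q (fun w => \1_B w * clip L (M (r w) w))|
    <= ex Q (fun w => excess L (M t w)).
  move=> L0.
  have mclip (f : Omega -> R) : measurable_fun setT f -> measurable_fun setT (fun w => clip L (f w)).
    by move=> mf; apply: measurable_maxr; [exact: measurable_cst|apply: measurable_minr => //; exact: measurable_cst].
  have iclip (f : Omega -> R) : measurable_fun setT f -> L1 Q (fun w => clip L (f w)).
    by move=> mf; apply: (@L1_bound _ _ _ _ _ L); [exact: mclip|move=> w; exact: clip_bound].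
  have c1 : ex Q (fun w => \1_B w * clip L (xi n w)) @[n --> \oo] --> ex Q (fun w => \1_B w * clip L (M (r w) w)).
    apply: (ex_dct (g := fun _ => L) _ _ (L1_cst _ _) _ _).2.
    - by move=> n; apply: measurable_funM; [exact: measurable_indic|apply: mclip; exact: L1_meas].
    - by apply: measurable_funM; [exact: measurable_indic|exact: mclip].
    - apply: nearW => w n; rewrite normrM indicE; case: (w \in B); rewrite ?normr1 ?mul1r ?normr0 ?mul0r//.
      exact: clip_bound.
    - apply: nearW => w; apply: cvgM; first exact: cvg_cst.
      exact: (cvg_comp _ _ (hc w) (@clip_continuous _ L _)).
  have c2 : `|ex Q (fun w => \1_B w * M t w) - ex Q (fun w => \1_B w * clip L (xi n w))| @[n --> \oo] -->
      `|ex Q (fun w => \1_B w * M t w) - ex Q (fun w => \1_B w * clip L (M (r w) w))|.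
    by apply: cvg_norm; apply: cvgB => //; exact: cvg_cst.
  rewrite -(cvg_lim (@Rhausdorff R) c2); apply: limr_le; first by apply/cvg_ex; eexists; exact: c2.
  apply: nearW => n; have [_ <- _] := hs B n FB; have [_ _ hx] := hs setT n FT.
  have := hx L L0; rewrite !exT; apply: le_trans.
  have i1 := ixi n; have mi1 := L1_meas i1.
  rewrite -exB; [|exact: L1_ind|apply: L1_ind => //; exact: iclip].
  apply: le_trans (norm_ex _) _; first by apply: L1B; apply: L1_ind => //; exact: iclip.
  apply: ex_le; [|exact: L1_excess|].
    by apply: L1_norm; apply: L1B; apply: L1_ind => //; exact: iclip.
  apply: nearW => w; rewrite -mulrBr normrM clip_near// indicE.
  by case: (w \in B); rewrite ?normr1 ?mul1r// normr0 mul0r excess_ge0.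
have lim1 := excess_cvg iMt; have lim2 := excess_cvg iMr.
apply/eqP; rewrite eq_sym -subr_eq0 -normr_le0.
have bd (n : nat) : `|ex Q (fun w => \1_B w * M t w) - ex Q (fun w => \1_B w * M (r w) w)| <=
    ex Q (fun w => excess n%:R (M t w)) + ex Q (fun w => excess n%:R (M (r w) w)).
  have iclip : L1 Q (fun w => clip n%:R (M (r w) w)).
    apply: (@L1_bound _ _ _ _ _ n%:R); last by move=> w; exact: clip_bound.
    by apply: measurable_maxr; [exact: measurable_cst|apply: measurable_minr => //; exact: measurable_cst].
  have := key n%:R (ler0n _ _); set p := ex Q _; set q := ex Q _ => h; set q' := ex Q (fun w => \1_B w * M (r w) w).
  have -> : p - q' = (p - q) + (q - q') by ring.
  apply: le_trans (ler_normD _ _) _; apply: lerD => //.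
  rewrite /q /q' -exB; [|exact: L1_ind|exact: L1_ind].
  apply: le_trans (norm_ex _) _; first by apply: L1B; exact: L1_ind.
  apply: ex_le; [|exact: L1_excess|].
    by apply: L1_norm; apply: L1B; exact: L1_ind.
  apply: nearW => w; rewrite -mulrBr normrM distrC clip_near// indicE.
  by case: (w \in B); rewrite ?normr1 ?mul1r// normr0 mul0r excess_ge0.
have l12 : ex Q (fun w => excess n%:R (M t w)) + ex Q (fun w => excess n%:R (M (r w) w)) @[n --> \oo] --> (0 + 0 : R).
  exact: cvgD.
rewrite addr0 in l12; rewrite -(cvg_lim (@Rhausdorff R) l12); apply: limr_ge.
  by apply/cvg_ex; eexists; exact: l12.
exact: nearW.
Qed.

End OptionalStopping.

(** * Integrals against martingales *)

Section Debut.
Context {R : realType} {dO : measure_display} {Omega : measurableType dO}.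
Variables (T : \bar R) (F : R -> set (set Omega)).
Hypotheses (T_gt0 : (0 < T)%E) (filtF : is_filtration T F).
Local Notation process := (@process R dO Omega).

(** The alternative [s = t] makes the set nonempty and caps the time at t. *)
Definition debut (Y : process) (c t : R) (w : Omega) : R :=
  inf [set s | 0 <= s <= t /\ (c < `|Y s w| \/ s = t)].

Section DebutFacts.
Variables (Y : process) (c t : R) (w : Omega).
Hypothesis t0 : 0 <= t.
Let E := [set s | 0 <= s <= t /\ (c < `|Y s w| \/ s = t)].

Let Et : E t. Proof. by split; [rewrite t0 lexx|right]. Qed.

Let infE : has_inf E.
Proof. by split; [exists t; exact: Et|exists 0 => s [/andP[]]]. Qed.

Lemma debut_ge0 : 0 <= debut Y c t w.
Proof. by apply: lb_le_inf; [exists t; exact: Et|move=> s [/andP[]]]. Qed.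

Lemma debut_le : debut Y c t w <= t.
Proof. by apply: ge_inf; [exact: infE.2|exact: Et]. Qed.

Lemma before_debut s : 0 <= s < debut Y c t w -> `|Y s w| <= c.
Proof.
move=> /andP[s0 sd]; rewrite leNgt; apply/negP => h.
have st : s <= t by apply: ltW; apply: lt_le_trans sd debut_le.
by move: sd; rewrite ltNge; apply/negP/negPn; apply: ge_inf; [exact: infE.2|split; [rewrite s0|left]].
Qed.

Lemma debut_lt q : q <= t -> debut Y c t w < q <-> exists2 s, 0 <= s < q & c < `|Y s w|.
Proof.
move=> qt; split.
  move=> h; have [s [/andP[s0 st] hs] sq] := inf_lt infE.1 h.
  exists s; first by rewrite s0 sq.
  by case: hs => // e; move: sq; rewrite e ltNge qt.
move=> [s /andP[s0 sq] h]; apply: le_lt_trans (sq); apply: ge_inf; first exact: infE.2.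
by split; [rewrite s0 ltW// (lt_le_trans sq)|left].
Qed.

Lemma debut_full : (forall s, 0 <= s <= t -> `|Y s w| <= c) -> debut Y c t w = t.
Proof.
move=> h; apply/eqP; rewrite eq_le debut_le/=; apply: lb_le_inf; first by exists t; exact: Et.
by move=> s [/h hs [|->//]]; rewrite ltNge hs.
Qed.

End DebutFacts.

Lemma filtU_seq t (A : nat -> set Omega) : date T t -> (forall n, F t (A n)) -> F t (\bigcup_n A n).
Proof. by move=> dt h; have [_ _] := (filtF.1 t dt).1; apply. Qed.

Lemma filt0 t : date T t -> F t set0.
Proof. by move=> dt; have [] := (filtF.1 t dt).1. Qed.

(** An excess strictly before q occurs at or before q - q / (n + 1) for some n, and each of these
    events is known before q. *)
Lemma debut_optional Y c t : cadlag_adapted T F Y -> date T t -> optional F 0 t (debut Y c t).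
Proof.
move=> cY dt; split; first by move=> w; rewrite debut_ge0 ?debut_le//; exact: dt.1.
move=> q /andP[q0 qt].
have dq : date T q by exact: date_le dt q0 qt.
pose B (n : nat) := [set w | exists2 s, 0 <= s <= q - q / n.+1%:R & c < `|Y s w|] `&` [set _ : Omega | 0 < q].
rewrite (_ : [set w | _] = \bigcup_n (B n)); last first.
  apply/seteqP; split => w /=.
    move=> /(debut_lt Y c w dt.1 qt)[s /andP[s0 sq] h]; have q0' : 0 < q by exact: le_lt_trans sq.
    exists (Num.truncn (q / (q - s))) => //; split => //; exists s => //; rewrite s0/=.
    have qs : 0 < q - s by rewrite subr_gt0.
    rewrite lerBrDr -lerBrDl ler_pdivrMr ?ltr0Sn// mulrC -ler_pdivrMr// ltW// truncnS_gt//.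
  move=> [n _ [[s /andP[s0 sq] h] q0']]; apply/(debut_lt Y c w dt.1 qt); exists s => //.
  by rewrite s0/=; apply: le_lt_trans sq _; rewrite ltrBlDr ltrDl divr_gt0.
apply: filtU_seq => // n; rewrite /B.
have [q00|q00] := eqVneq q 0.
  rewrite (_ : _ `&` _ = set0); first exact: filt0.
  by apply/seteqP; split => w //= [_]; rewrite q00 ltxx.
have q0' : 0 < q by rewrite lt_neqAle eq_sym q00.
rewrite (_ : _ `&` _ = [set w | exists2 s, 0 <= s <= q - q / n.+1%:R & c < `|Y s w|]); last first.
  by apply/seteqP; split => w //= [].
have le1 : q - q / n.+1%:R <= q by rewrite gerBl divr_ge0.
have ge1 : 0 <= q - q / n.+1%:R by rewrite subr_ge0 ler_pdivrMr// ler_peMr// ler1n.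
have dq' : date T (q - q / n.+1%:R) by exact: date_le dt ge1 (le_trans le1 qt).
by apply: (filt_le filtF dq' dq le1); exact: (exceed_measurable filtF).
Qed.

Lemma optional_min s t r r' : date T s -> date T t -> optional F s t r -> optional F s t r' ->
  optional F s t (fun w => Num.min (r w) (r' w)).
Proof.
move=> ds dt [b1 m1] [b2 m2]; split.
  by move=> w; have /andP[x1 y1] := b1 w; have /andP[x2 y2] := b2 w; rewrite le_min x1 x2 ge_min y1.
move=> q sqt; have /andP[sq qt] := sqt.
have dq : date T q by apply: date_le dt _ qt; exact: le_trans ds.1 sq.
rewrite (_ : [set w | _] = ~` (~` [set w | r w < q] `&` ~` [set w | r' w < q])).
  by apply: (filtC filtF dq); apply: (filtI filtF dq); apply: (filtC filtF dq); [exact: m1|exact: m2].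
rewrite setCI !setCK; apply/seteqP; split => w /=; rewrite gt_min.
  by move=> /orP[]; [left|right].
by move=> [] ->; rewrite ?orbT.
Qed.

(** Meant for a stopping time t: Z is bounded strictly before t, and the last step adds k times a
    jump of Y, at most c (b + b). *)
Lemma jump_bound (Z Y : R -> R) (k a b c t : R) : 0 < t -> `|k| <= c ->
  (Z t - Z s - k * (Y t - Y s)) @[s --> t^'-] --> (0 : R) ->
  (forall s, 0 <= s < t -> `|Z s| <= a) -> (forall s, 0 <= s <= t -> `|Y s| <= b) ->
  `|Z t| <= a + c * (b + b).
Proof.
move=> t0 kc hj hZ hY; apply/ler_addgt0Pr => e e0.
have /cvgrPdist_le/(_ _ e0) h := hj.
have [dl dl0 hdl] := near_leftP (filterI h (nbhs_left_ge t0)).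
pose s := Num.max 0 (t - dl / 2).
have st : t - dl < s < t.
  by rewrite lt_max gt_max t0/=; apply/andP; split; [apply/orP; right; lra|lra].
have [] := hdl s st; rewrite sub0r normrN => h1 s0.
have /andP[_ st'] := st.
have -> : Z t = (Z t - Z s - k * (Y t - Y s)) + (Z s + k * (Y t - Y s)) by ring.
rewrite addrC; apply: le_trans (ler_normD _ _) _; apply: lerD => //.
apply: le_trans (ler_normD _ _) _; apply: lerD; first by apply: hZ; rewrite s0.
rewrite normrM; apply: ler_pM => //; apply: le_trans (ler_normB _ _) _; apply: lerD; apply: hY.
  by rewrite lexx ltW.
by rewrite s0 ltW.
Qed.

End Debut.

(** * Mean zero of dominated stopped integrals *)

Section ZeroExpectation.
Context {R : realType} {dO : measure_display} {Omega : measurableType dO}.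
Variables (T : \bar R) (F : R -> set (set Omega)).
Hypotheses (T_gt0 : (0 < T)%E) (filtF : is_filtration T F).
Local Notation process := (@process R dO Omega).
Local Notation bp := (bounded_predictable T F).
Variables (Q : probability Omega R).

Lemma truncn_sum (x : R) N : 0 <= x -> x <= N%:R ->
  let S := \sum_(j < N) (j.+1%:R <= x)%R%:R in S <= x <= S + 1.
Proof.
move=> x0 xN /=.
pose m := Num.truncn x.
have mE n : (n.+1%:R <= x) = (n < m)%N by rewrite -truncn_gt_nat.
have H n : (\sum_(j < n) (j.+1%:R <= x)%R%:R : R) = (minn n m)%:R.
  elim: n => [|n ih]; first by rewrite big_ord0 min0n.
  rewrite big_ord_recr/= ih mE -natrD; congr (_%:R).
  case: ltnP => h; first by rewrite (minn_idPl h) addn1.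
  by rewrite addn0 (minn_idPr (leqW h)).
have /andP[t1 t2] := truncn_itv x0; rewrite -/m in t1 t2.
rewrite H; have [tN|Nt] := leqP m N; first by rewrite t1 natr1 ltW.
rewrite (le_trans _ t1) ?ler_nat ?(ltnW Nt)//=.
by rewrite (le_trans xN)// lerDl.
Qed.

(** The sum of indicators counts the levels passed by f: it is the integer part of (f + b) (m +
    1). *)
Lemma step_approx (f : Omega -> R) (b : R) (m : nat) : (forall w, `|f w| <= b) ->
  exists N (r : nat -> R), forall w,
    `|f w - (m.+1%:R^-1 * (\sum_(j < N) \1_(f @^-1` `[r j, +oo[%classic) w) - b)| <= m.+1%:R^-1.
Proof.
move=> fb; pose N := (Num.truncn (2 * b * m.+1%:R)).+1.
exists N, (fun j => j.+1%:R / m.+1%:R - b) => w; pose x := (f w + b) * m.+1%:R.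
have := fb w; rewrite ler_norml => /andP[f1 f2].
have x0 : 0 <= x by rewrite mulr_ge0//; lra.
have xN : x <= N%:R.
  by apply: le_trans (ltW (truncnS_gt _)); rewrite ler_wpM2r//; lra.
have -> : \sum_(j < N) \1_(f @^-1` `[j.+1%:R / m.+1%:R - b, +oo[%classic) w = \sum_(j < N) (j.+1%:R <= x)%R%:R :> R.
  apply: eq_bigr => j _; rewrite indicE; congr (_%:R); congr nat_of_bool.
  by apply/idP/idP; rewrite inE /= in_itv/= andbT lerBlDr ler_pdivrMr.
have /andP[s1 s2] := truncn_sum x0 xN; set Sm := \sum_(j < N) _ in s1 s2 *.
have -> : f w - (m.+1%:R^-1 * Sm - b) = m.+1%:R^-1 * (x - Sm) by rewrite /x; field.
rewrite normrM ger0_norm ?invr_ge0// ler_piMr ?invr_ge0// ger0_norm; first lra.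
by rewrite subr_ge0.
Qed.

(** Uniform approximation of c by steps measurable for F s extends orthogonality from events to
    bounded weights; this stands in for conditional expectations. *)
Lemma cond_zero s c (D : Omega -> R) b : date T s -> wrt (F s) c -> (forall w, `|c w| <= b) ->
  L1 Q D -> (forall A, F s A -> ex Q (fun w => \1_A w * D w) = 0) ->
  ex Q (fun w => c w * D w) = 0.
Proof.
move=> ds mc cb iD h0.
have mc' : measurable_fun setT c by exact: (wrt_measurable filtF ds).
have key (m : nat) : `|ex Q (fun w => c w * D w)| <= ex Q (fun w => `|D w|) / m.+1%:R.
  have [N [r near]] := step_approx m cb.
  pose A (j : nat) := c @^-1` `[r j, +oo[%classic.
  have FA j : F s (A j) by apply: mc; exists `[r j, +oo[%classic => //; rewrite setTI.
  have mA j : measurable (A j) by exact: (filt_meas filtF ds (FA j)).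
  pose Sm w : R := \sum_(j < N) \1_(A j) w.
  have ex0 : ex Q (fun w => (m.+1%:R^-1 * Sm w - b) * D w) = 0.
    have iA (j : 'I_N) : L1 Q (fun w => \1_(A j) w * D w) by exact: L1_ind.
    rewrite (_ : (fun w => _) = (fun w => m.+1%:R^-1 * (\sum_(j < N) \1_(A j) w * D w) + (- b) * (\1_setT w * D w))).
      rewrite exL//; [|exact: L1_sum|exact: L1Z (L1_ind measurableT iD)].
      rewrite ex_sum// big1 ?mulr0 ?add0r; last by move=> j _; exact: h0.
      by rewrite exZ; [rewrite h0 ?mulr0//; exact: (filtT filtF ds)|exact: L1_ind].
    by apply/funext => w; rewrite indicE in_setT -mulr_suml /Sm /=; ring.
  have mS : measurable_fun setT Sm by apply: measurable_sum => j; exact: measurable_indic.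
  have ic : L1 Q (fun w => c w * D w).
    apply: (L1_dom (g := fun w => b * `|D w|)); [|exact: L1Z (L1_norm iD)|].
      by apply: measurable_funM => //; exact: L1_meas iD.
    by apply: nearW => w; rewrite normrM ler_wpM2r.
  have ica : L1 Q (fun w => (m.+1%:R^-1 * Sm w - b) * D w).
    apply: (L1_dom (g := fun w => (b + m.+1%:R^-1) * `|D w|)); [|exact: L1Z (L1_norm iD)|].
      apply: measurable_funM; last exact: L1_meas iD.
      by apply: measurable_funB => //; apply: measurable_funM.
    apply: nearW => w; rewrite normrM ler_wpM2r//.
    have -> : m.+1%:R^-1 * Sm w - b = c w - (c w - (m.+1%:R^-1 * Sm w - b)) by ring.
    by apply: le_trans (ler_normB _ _) _; apply: lerD.
  rewrite -[X in `|X|]subr0 -ex0 -exB//; apply: le_trans (norm_ex (L1B ic ica)) _.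
  rewrite mulrC -exZ; last exact: L1_norm.
  apply: ex_le; [exact: L1_norm (L1B ic ica)|exact: L1Z (L1_norm iD)|].
  by apply: nearW => w; rewrite -mulrBl normrM ler_wpM2r.
apply/eqP; rewrite -normr_le0; apply/ler_addgt0Pr => e e0; rewrite add0r.
pose a := ex Q (fun w => `|D w|).
apply: le_trans (key (Num.truncn (a / e))) _; rewrite ler_pdivrMr// mulrC -ler_pdivrMr// ltW//.
exact: truncnS_gt.
Qed.

Variables (M : process) (J : process -> process).
Hypotheses (hM : martingale T Q F M) (hJ : bounded_integral T Q F M J).

Let cM : cadlag_adapted T F M. Proof. by have [] := hM. Qed.

(** The stopped increment equals M r' - M s for r' = max s (min r u), an optional time between s and
    u, to which optional stopping applies. *)
Lemma increment_zero s u t c r b : date T s -> date T u -> date T t -> s <= u ->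
  wrt (F s) c -> (forall w, `|c w| <= b) -> optional F 0 t r ->
  L1 Q (fun w => c w * (M (Num.min u (r w)) w - M (Num.min s (r w)) w)) /\
  ex Q (fun w => c w * (M (Num.min u (r w)) w - M (Num.min s (r w)) w)) = 0.
Proof.
move=> ds du dt su mc cb [b1 m1].
pose r' w := Num.max s (Num.min (r w) u).
have rE w : M (Num.min u (r w)) w - M (Num.min s (r w)) w = M (r' w) w - M s w.
  rewrite /r' [Num.min u _]minC; have [rs|sr] := leP (r w) s.
    by rewrite (min_l (le_trans rs su)) (max_l rs) !subrr.
  by rewrite max_r// le_min (ltW sr) su.
have opt : optional F s u r'.
  split; first by move=> w; rewrite le_max lexx/= ge_max su ge_min lexx orbT.
  move=> q /andP[sq qu].
  have dq : date T q by apply: date_le du _ qu; exact: le_trans ds.1 sq.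
  have [sq'|qs] := ltP s q; last first.
    rewrite (_ : [set w | _] = set0); first exact: (filt0 filtF dq).
    by apply/seteqP; split => w //=; rewrite gt_max ltNge qs.
  rewrite (_ : [set w | _] = [set w | r w < q]); last first.
    apply/seteqP; split => w /=; rewrite gt_max gt_min sq'/=; last by move=> ->.
    by rewrite (ltNge u) qu orbF.
  have [qt|tq] := leP q t; first by apply: m1; rewrite qt (le_trans ds.1).
  rewrite (_ : [set w | _] = setT); first exact: (filtT filtF dq).
  by apply/seteqP; split => w //= _; have /andP[_ h] := b1 w; exact: le_lt_trans tq.
have [i1 e1] := optional_stopping filtF hM ds du su opt.
have is_ : L1 Q (M s) := mart_L1 hM ds.
have iD := L1B i1 is_.
rewrite (_ : (fun w => _) = (fun w => c w * (M (r' w) w - M s w))); last by apply/funext => w; rewrite rE.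
have mc' : measurable_fun setT c by exact: (wrt_measurable filtF ds).
split.
  apply: (L1_dom (g := fun w => b * `|M (r' w) w - M s w|)); [|exact: L1Z (L1_norm iD)|].
    by apply: measurable_funM => //; exact: L1_meas iD.
  by apply: nearW => w; rewrite normrM ler_wpM2r.
apply: (cond_zero ds mc cb iD) => A FA; have mA := filt_meas filtF ds FA.
under eq_fun do rewrite mulrBr.
by rewrite exB; [rewrite e1// (mart_ind hM ds du su FA) subrr|exact: L1_ind|exact: L1_ind].
Qed.

Definition dominated (K : process) (r : Omega -> R) := exists V : Omega -> R, L1 Q V /\
  {ae Q, forall w s, 0 <= s <= r w -> `|M s w| <= V w /\ `|J K s w| <= V w}.

Lemma el_zero e t r : elementary_integrand T F e -> date T t -> optional F 0 t r ->
  ex Q (fun w => J (el_val e) (r w) w) = 0.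
Proof.
move=> he dt opt; have [_ _ hi] := he.
have hel := int_el hJ he.
have hb i : exists b, (i < el_size e)%N -> forall w, `|el_c e i w| <= b.
  by case: (ltnP i (el_size e)) => [/hi[_ _ _ _ [b hb]]|_]; [exists b|exists 0].
have /choice[b hb'] := hb.
have hz (i : 'I_(el_size e)) := let: And5 d1 d2 d3 d4 _ := hi i (ltn_ord i) in
  increment_zero d1 d2 dt d3 d4 (hb' i (ltn_ord i)) opt.
rewrite (@ex_eq _ _ _ Q _ (fun w => el_int M e (r w) w)).
- rewrite /el_int ex_sum; last by move=> i; exact: (hz i).1.
  by apply: big1 => i _; exact: (hz i).2.
- exact: (optional_meas filtF (int_cadlag hJ (bp_el T_gt0 filtF he)) (date0 T_gt0) dt dt.1 opt).
- by apply: (@L1_meas _ _ _ Q); apply: L1_sum => i; exact: (hz i).1.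
- apply: filterS hel => w h; apply: h; have /andP[r0 rt] := opt.1 w; exact: date_le dt r0 rt.
Qed.

(** Domination is given for the limit integrand but not for its approximations. These are stopped
    when their integral leaves the limit integral by more than 1, a time that eventually no longer
    interferes with r; for this reason the induction is over a statement about all r. *)
Theorem zero_expectation K t r : bp K -> date T t -> optional F 0 t r -> dominated K r ->
  ex Q (fun w => J K (r w) w) = 0.
Proof.
move=> bK dt; have d0 := date0 T_gt0.
suff H L : predictable T F L -> bounded1 T L -> bp L /\ forall r, optional F 0 t r -> dominated L r ->
    ex Q (fun w => J L (r w) w) = 0.
  have [c [L [c0 pL bL KE]]] := bp_scale T_gt0 filtF bK => opt [V [iV hV]].
  have hz := intZ T_gt0 filtF hJ c (bpP pL bL).
  rewrite -KE in hz; have [bpL' HL] := H L pL bL.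
  have ar w : date T (r w) by have /andP[r0 rt] := opt.1 w; exact: date_le dt r0 rt.
  have mL := optional_meas filtF (int_cadlag hJ bpL') d0 dt dt.1 opt.
  have mK := optional_meas filtF (int_cadlag hJ bK) d0 dt dt.1 opt.
  pose V' w := (1 + c^-1) * V w.
  have hd : {ae Q, forall w s, 0 <= s <= r w -> `|M s w| <= V' w /\ `|J L s w| <= V' w}.
    apply: filterS2 hV hz => w h1 h2 s sr; have [g1 g2] := h1 s sr.
    have dsd : date T s by case/andP: sr => s0 s1; exact: date_le (ar w) s0 s1.
    have V0 : 0 <= V w by apply: le_trans g1.
    have ci : 0 < c^-1 by rewrite invr_gt0.
    split; first by apply: le_trans g1 _; rewrite ler_peMl// lerDl ltW.
    move: g2; rewrite h2// normrM gtr0_norm// mulrC -ler_pdivlMr// => g2.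
    by apply: le_trans g2 _; rewrite mulrC ler_wpM2r// lerDr.
  have iL : L1 Q (fun w => J L (r w) w).
    apply: (L1_dom mL (L1Z (1 + c^-1) iV)); apply: filterS hd => w h.
    by have [] := h (r w) ltac:(by rewrite lexx andbT; have /andP[] := opt.1 w).
  have -> : ex Q (fun w => J K (r w) w) = ex Q (fun w => c * J L (r w) w).
    apply: ex_eq => //; first exact: measurable_funM.
    by apply: filterS hz => w h; exact: h.
  rewrite exZ// HL ?mulr0//; exists V'; split => //; exact: L1Z.
move: L; apply: (int_rec T_gt0 filtF hJ (t0 := t) (Pr := fun L => bp L /\ forall r, optional F 0 t r -> dominated L r ->
    ex Q (fun w => J L (r w) w) = 0) dt).
- move=> e he _; split; first exact: (bp_el T_gt0 filtF he).
  by move=> r' opt _; exact: (el_zero he dt).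
- move=> L L' LL' [bL hL]; have [bL' hLL] := int_ext T_gt0 filtF hJ bL LL'.
  split => // r' opt [V [iV hV]].
  have ar w : date T (r' w) by have /andP[r0 rt] := opt.1 w; exact: date_le dt r0 rt.
  have mL := optional_meas filtF (int_cadlag hJ bL) d0 dt dt.1 opt.
  have mL' := optional_meas filtF (int_cadlag hJ bL') d0 dt dt.1 opt.
  have -> : ex Q (fun w => J L' (r' w) w) = ex Q (fun w => J L (r' w) w).
    by apply: ex_eq => //; apply: filterS hLL => w h; exact: h.
  apply: hL => //; exists V; split => //; apply: filterS2 hV hLL => w h1 h2 s sr.
  have dsd : date T s by case/andP: sr => s0 s1; exact: date_le (ar w) s0 s1.
  by have := h1 s sr; rewrite h2.
move=> Kn L pKn bKn hKn pL bL _ hu; have bpL' : bp L := bpP pL bL.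
split => // r' opt [V [iV hV]].
have ar w : date T (r' w) by have /andP[r0 rt] := opt.1 w; exact: date_le dt r0 rt.
pose D n : process := fun s w => 1 * J (Kn n) s w + -1 * J L s w.
have cJ n : cadlag_adapted T F (J (Kn n)) := int_cadlag hJ (hKn n).1.
have cL : cadlag_adapted T F (J L) := int_cadlag hJ bpL'.
have cD n : cadlag_adapted T F (D n) by exact: cadlag_adapted_lin.
pose tau n w := debut (D n) 1 t w.
pose rn n w := Num.min (r' w) (tau n w).
have opn n : optional F 0 t (rn n).
  by apply: (optional_min filtF d0 dt opt); exact: (debut_optional filtF).
(* Before the stopping time the integral is at most V + 1, and the last jump, with an integrand
   bounded by 1, adds at most 2 V. *)
pose V' w := 3 * V w + 1.
have iV' : L1 Q V' by apply: L1D; [exact: L1Z|exact: L1_cst].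
have hjump : {ae Q, forall w n, forall s, date T s -> 0 < s -> jump_eq M (J (Kn n)) (Kn n) s w}.
  by apply: ae_foralln => n; exact: (int_jump T_gt0 filtF hJ cM (hKn n).1).
have hst : {ae Q, forall w n, J (Kn n) 0 w = 0}.
  by apply: ae_foralln => n; exact: (int_start T_gt0 filtF hJ (hKn n).1).
have hd : {ae Q, forall w n s, 0 <= s <= rn n w -> `|M s w| <= V' w /\ `|J (Kn n) s w| <= V' w}.
  apply: filterS3 hV hjump hst => w h1 h2 h3 n s /andP[s0]; rewrite /rn le_min => /andP[sr stau].
  have dsd : date T s by exact: date_le (ar w) s0 sr.
  have [g1 g2] := h1 s ltac:(by rewrite s0).
  have V0 : 0 <= V w by apply: le_trans g1.
  split; first by rewrite /V'; lra.
  have bd q : 0 <= q < s -> `|J (Kn n) q w| <= V w + 1.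
    move=> /andP[q0 qs].
    have := @before_debut _ _ _ (D n) 1 t w dt.1 q ltac:(by rewrite q0 (lt_le_trans qs)).
    have [_] := h1 q ltac:(by rewrite q0 (le_trans (ltW qs))).
    rewrite /D mul1r mulN1r => a1 a2.
    have -> : J (Kn n) q w = J L q w + (J (Kn n) q w - J L q w) by ring.
    by apply: le_trans (ler_normD _ _) _; exact: lerD.
  have := s0; rewrite le_eqVlt => /predU1P[<-|spos]; first by rewrite h3 normr0 /V'; lra.
  have := @jump_bound _ (fun q => J (Kn n) q w) (fun q => M q w) (Kn n s w) (V w + 1) (V w) 1 s spos
    (bKn n s w dsd) (h2 n s dsd spos) bd.
  rewrite /V' => /(_ _)/le_trans; apply; last by lra.
  by move=> q /andP[q0 qs]; have [] := h1 q ltac:(by rewrite q0 (le_trans qs)).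
have hz n : ex Q (fun w => J (Kn n) (rn n w) w) = 0.
  apply: (hKn n).2 => //; exists V'; split => //; apply: filterS hd => w h s; exact: h.
have [_ hl] := @ex_dct _ _ _ Q (fun n w => J (Kn n) (rn n w) w) (fun w => J L (r' w) w) V'
  (fun n => optional_meas filtF (cJ n) d0 dt dt.1 (opn n)) (optional_meas filtF cL d0 dt dt.1 opt) iV'
  ltac:(by apply: filterS hd => w h n; have [] := h n (rn n w) ltac:(by rewrite lexx andbT; have /andP[] := (opn n).1 w))
  ltac:(apply: filterS hu => w u;
    have /andP[r0 rt] := opt.1 w;
    have rt' : 0 <= r' w <= t by [rewrite r0|];
    apply: cvg_trans (unif_cvg_pt u rt');
    have [N hN] := u 1 ltr01;
    apply: near_eq_cvg; exists N => // n /= Nn;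
    rewrite /rn /tau debut_full ?min_l//; [exact: dt.1|];
    by move=> s st; rewrite /D mul1r mulN1r; exact: hN).
have h0 : ex Q (fun w => J (Kn n) (rn n w) w) @[n --> \oo] --> (0 : R).
  by under eq_fun do rewrite hz; exact: cvg_cst.
by rewrite -(cvg_lim (@Rhausdorff R) hl) (cvg_lim (@Rhausdorff R) h0).
Qed.

End ZeroExpectation.

(** * Sigma-martingale measures: gains have nonpositive mean *)

Section ElementaryIntegral.
Context {R : realType} {dO : measure_display} {Omega : measurableType dO}.
Variables (T : \bar R) (F : R -> set (set Omega)).
Hypotheses (T_gt0 : (0 < T)%E) (filtF : is_filtration T F).
Local Notation process := (@process R dO Omega).

Lemma cadlag_stop (X : process) u : cadlag T X -> cadlag T (fun t w => X (Num.min u t) w).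
Proof.
move=> cX w; have [rX lX] := cX w; split.
  move=> t dt tT; have [ut|tu] := leP u t.
    apply: cvg_near_cst; near=> s; congr (X _ w).
    by rewrite min_l//; apply: le_trans ut _; apply: ltW; near: s; exact: nbhs_right_gt.
  apply: cvg_trans (rX t dt tT); apply: near_eq_cvg; near=> s.
  by rewrite min_r//; apply: ltW; near: s; exact: nbhs_right_lt.
move=> t dt t0; have [tu|ut] := leP t u.
  apply/cvg_ex; have /cvg_ex[l hl] := lX t dt t0; exists l; apply: cvg_trans hl.
  apply: near_eq_cvg; near=> s.
  by rewrite min_r//; apply: le_trans tu; apply: ltW; near: s; exact: nbhs_left_lt.
apply/cvg_ex; exists (X u w); apply: cvg_near_cst; near=> s; congr (X _ w).
by rewrite min_l//; apply: ltW; near: s; exact: nbhs_left_gt.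
Unshelve. all: by end_near. Qed.

Lemma el_term_cadlag (X : process) c s u : cadlag_adapted T F X -> date T s -> date T u -> s <= u ->
  wrt (F s) c -> cadlag_adapted T F (fun t w => c w * (X (Num.min u t) w - X (Num.min s t) w)).
Proof.
move=> [cX aX] ds du su mc; split.
  move=> w; have [r1 l1] := cadlag_stop u cX w; have [r2 l2] := cadlag_stop s cX w; split.
    by move=> t dt tT; apply: cvgM; [exact: cvg_cst|apply: cvgB; [exact: r1|exact: r2]].
  by move=> t dt t0; apply: is_cvgM; [exact: is_cvg_cst|apply: is_cvgB; [exact: l1|exact: l2]].
move=> t dt; have [st|ts] := leP s t.
  have d1 : date T (Num.min u t) by apply: (date_le dt); [rewrite le_min du.1 dt.1|rewrite ge_min lexx orbT].
  apply/(wrtP filtF dt); apply: measurable_funM.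
    by apply/(wrtP filtF dt); exact: (wrt_le filtF ds dt st).
  apply: measurable_funB; apply/(wrtP filtF dt).
    apply: (wrt_le filtF d1 dt _ (aX _ d1)); by rewrite ge_min lexx orbT.
  exact: (wrt_le filtF ds dt st (aX _ ds)).
rewrite (_ : (fun w => _) = fun _ => 0); first by apply/(wrtP filtF dt); exact: measurable_cst.
apply/funext => w; rewrite min_r ?(le_trans (ltW ts))// subrr mulr0//.
Qed.

Lemma el_int_cadlag (X : process) e : cadlag_adapted T F X -> elementary_integrand T F e ->
  cadlag_adapted T F (el_int X e).
Proof.
move=> cX [_ _ h]; apply: (cadlag_adapted_sum filtF
  (X := fun (i : 'I_(el_size e)) t w => el_c e i w * (X (Num.min (el_t e i) t) w - X (Num.min (el_s e i) t) w))).
by move=> i; have [d1 d2 d3 d4 _] := h i (ltn_ord i); exact: el_term_cadlag.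
Qed.

Lemma cadlag_adaptedB (X Y : process) : cadlag_adapted T F X -> cadlag_adapted T F Y ->
  cadlag_adapted T F (fun t w => X t w - Y t w).
Proof.
move=> cX cY; have := cadlag_adapted_lin filtF 1 (-1) cX cY.
by rewrite (_ : (fun _ _ => 1 * _ + _) = (fun t w => X t w - Y t w))//; apply/funext => s; apply/funext => w; rewrite mul1r mulN1r.
Qed.

Lemma emery_measurable (Z : process) e (t eps : R) : cadlag_adapted T F Z -> elementary_integrand T F e ->
  date T t -> measurable [set w | exists2 s, 0 <= s <= t & eps < `|Z 0 w| + `|el_int Z e s w|].
Proof.
move=> cZ he dt; have d0 := date0 T_gt0; have cE := el_int_cadlag cZ he.
pose Z' : process := fun s w => `|Z 0 w| + `|el_int Z e s w|.
have cZ0 : cadlag_adapted T F (fun _ w => Z 0 w).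
  split; first by move=> w; split => [s _ _|s _ _]; [exact: cvg_cst|exact: is_cvg_cst].
  by move=> s ds; exact: (wrt_le filtF d0 ds ds.1 (cZ.2 0 d0)).
have c1 := cadlag_adapted_norm cZ0; have c2 := cadlag_adapted_norm cE.
have cZ' : cadlag_adapted T F Z'.
  have := cadlag_adapted_lin filtF 1 1 c1 c2.
  by rewrite (_ : (fun _ _ => 1 * _ + _) = Z')//; apply/funext => s; apply/funext => w; rewrite !mul1r.
have := exceed_measurable filtF eps cZ' dt => /((filtF.1 t dt).2).
have E s w : `|Z' s w| = `|Z 0 w| + `|el_int Z e s w| by rewrite ger0_norm// addr_ge0.
by congr measurable; apply/seteqP; split => w [s st hs]; exists s => //; move: hs; rewrite E.
Qed.

End ElementaryIntegral.

(** * Calculus of convergence uniformly on compacts in probability *)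

Section Ucp.
Context {R : realType} {dO : measure_display} {Omega : measurableType dO}.
Variables (T : \bar R) (F : R -> set (set Omega)).
Hypotheses (T_gt0 : (0 < T)%E) (filtF : is_filtration T F).
Local Notation process := (@process R dO Omega).
Variable Q : probability Omega R.

Definition far (t eps : R) (X Y : process) := [set w | exists2 s, 0 <= s <= t & eps < `|X s w - Y s w|].

Lemma far_measurable t eps X Y : cadlag_adapted T F X -> cadlag_adapted T F Y -> date T t ->
  measurable (far t eps X Y).
Proof. exact: (exceed_measurableB filtF). Qed.

Lemma ucpP (Xn : nat -> process) X : (forall n, cadlag_adapted T F (Xn n)) -> cadlag_adapted T F X ->
  ucp_cvg T Q Xn X <-> forall t eps dl, date T t -> 0 < eps -> 0 < dl ->
    \forall n \near \oo, (Q (far t eps (Xn n) X) <= dl%:E)%E.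
Proof.
move=> cXn cX; split => [h t eps dl dt e0 d0|h t eps dt e0].
  have /fine_cvgP[fin /cvgrPdist_le/(_ _ d0)] := h t eps dt e0.
  apply: filterS2 fin => n f1; rewrite sub0r normrN => f2.
  by rewrite -[X in (X <= _)%E]fineK// lee_fin (le_trans (ler_norm _)).
have mD n := far_measurable eps (cXn n) cX dt.
apply/fine_cvgP; split; first by apply: nearW => n; rewrite fin_num_measure//; exact: mD.
apply/cvgrPdist_le => e e0'; apply: filterS (h t eps e dt e0 e0') => n hn.
rewrite sub0r normrN ger0_norm ?fine_ge0// -lee_fin fineK// fin_num_measure//; exact: mD.
Qed.

Lemma far_triangle t a b X Y Z : cadlag_adapted T F X -> cadlag_adapted T F Y -> cadlag_adapted T F Z ->
  date T t -> (Q (far t (a + b) X Z) <= Q (far t a X Y) + Q (far t b Y Z))%E.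
Proof.
move=> cX cY cZ dt; have m1 := far_measurable a cX cY dt; have m2 := far_measurable b cY cZ dt.
apply: le_trans (measureU2 Q m1 m2); apply: le_measure; rewrite ?inE; [exact: far_measurable|exact: measurableU|].
move=> w [s st h]; have [h1|h1] := ltP a `|X s w - Y s w|; first by left; exists s.
right; exists s => //; rewrite -(ltrD2l a); apply: lt_le_trans h _.
have -> : X s w - Z s w = (X s w - Y s w) + (Y s w - Z s w) by ring.
by apply: le_trans (ler_normD _ _) _; rewrite lerD2r.
Qed.

Lemma far_congr t a X Y X' Y' : cadlag_adapted T F X -> cadlag_adapted T F Y ->
  cadlag_adapted T F X' -> cadlag_adapted T F Y' -> indist T Q X X' -> indist T Q Y Y' -> date T t ->
  (Q (far t a X Y) <= Q (far t a X' Y'))%E.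
Proof.
move=> cX cY cX' cY' hX hY dt; apply: le_measure_ae; [exact: far_measurable|exact: far_measurable|].
apply: filterS2 hX hY => w h1 h2 [s st h]; exists s => //.
have ds : date T s by case/andP: st => s0; exact: date_le.
by rewrite -h1// -h2.
Qed.

Lemma ucp_sum d (Xn : nat -> 'I_d -> process) (X : 'I_d -> process) :
  (forall n i, cadlag_adapted T F (Xn n i)) -> (forall i, cadlag_adapted T F (X i)) ->
  (forall i, ucp_cvg T Q (fun n => Xn n i) (X i)) ->
  ucp_cvg T Q (fun n t w => \sum_(i < d) Xn n i t w) (fun t w => \sum_(i < d) X i t w).
Proof.
elim: d Xn X => [|d ih] Xn X cXn cX h.
  apply/ucpP.
  - by move=> n; apply: (cadlag_adapted_sum filtF (X := Xn n)).
  - exact: (cadlag_adapted_sum filtF (X := X)).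
  move=> t eps dl dt e0 d0; apply: nearW => n; rewrite (_ : far _ _ _ _ = set0) ?measure0 ?lee_fin ?ltW//.
  by apply/seteqP; split => w // [s _]; rewrite !big_ord0 subrr normr0 ltNge ltW.
have c1 n : cadlag_adapted T F (fun t w => \sum_(i < d.+1) Xn n i t w) by apply: (cadlag_adapted_sum filtF (X := Xn n)).
have c2 : cadlag_adapted T F (fun t w => \sum_(i < d.+1) X i t w) by apply: (cadlag_adapted_sum filtF (X := X)).
have c3 n : cadlag_adapted T F (fun t w => \sum_(i < d) Xn n (widen_ord (leqnSn d) i) t w).
  by apply: (cadlag_adapted_sum filtF (X := fun i => Xn n (widen_ord (leqnSn d) i))).
have c4 : cadlag_adapted T F (fun t w => \sum_(i < d) X (widen_ord (leqnSn d) i) t w).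
  by apply: (cadlag_adapted_sum filtF (X := fun i => X (widen_ord (leqnSn d) i))).
have h1 : ucp_cvg T Q (fun n t w => \sum_(i < d) Xn n (widen_ord (leqnSn d) i) t w)
    (fun t w => \sum_(i < d) X (widen_ord (leqnSn d) i) t w).
  by apply: (ih (fun n i => Xn n (widen_ord (leqnSn d) i)) (fun i => X (widen_ord (leqnSn d) i))).
have h2 := h ord_max.
apply/(ucpP c1 c2) => t eps dl dt e0 d0.
have e2 : 0 < eps / 2 by lra. have d2 : 0 < dl / 2 by lra.
move/(ucpP c3 c4)/(_ t _ _ dt e2 d2) : h1; move/(ucpP (fun n => cXn n ord_max) (cX ord_max))/(_ t _ _ dt e2 d2) : h2.
apply: filterS2 => n k1 k2; rewrite [dl]splitr EFinD; apply: le_trans (leeD k2 k1).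
have m1 := far_measurable (eps / 2) (c3 n) c4 dt; have m2 := far_measurable (eps / 2) (cXn n ord_max) (cX ord_max) dt.
apply: le_trans (measureU2 Q m1 m2); apply: le_measure; rewrite ?inE; [exact: far_measurable|exact: measurableU|].
move=> w [s st]; rewrite !big_ord_recr/= => hs.
case: (ltP (eps / 2) `|\sum_(i < d) Xn n (widen_ord (leqnSn d) i) s w - \sum_(i < d) X (widen_ord (leqnSn d) i) s w|) => h3; first by left; exists s.
right; exists s => //; rewrite -(ltrD2l (eps / 2)) -splitr; apply: lt_le_trans hs _.
rewrite opprD addrACA; apply: le_trans (ler_normD _ _) _; by rewrite lerD2r.
Qed.

(** At stage k the approximation is within 2^-k of [Y k] on [0, [cap k]], an interval that
    eventually contains any given one. *)
Lemma ucp_diag (Z : nat -> nat -> process) (Y : nat -> process) X :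
  (forall k m, cadlag_adapted T F (Z k m)) -> (forall k, cadlag_adapted T F (Y k)) ->
  cadlag_adapted T F X -> (forall k, ucp_cvg T Q (Z k) (Y k)) -> ucp_cvg T Q Y X ->
  exists m : nat -> nat, ucp_cvg T Q (fun k => Z k (m k)) X.
Proof.
move=> cZ cY cX hZ hY.
have pos k : 0 < 2 ^- k :> R by rewrite invr_gt0 exprn_gt0.
have /choice[m hm] : forall k, exists m, (Q (far (cap T k%:R) (2 ^- k) (Z k m) (Y k)) <= (2 ^- k)%:E)%E.
  move=> k; have dk := cap_date T_gt0 (ler0n R k).
  move/(ucpP (cZ k) (cY k))/(_ _ _ _ dk (pos k) (pos k)) : (hZ k) => [N _ hN].
  by exists N; exact: hN (leqnn N).
exists m; apply/ucpP => //; move=> t eps dl dt e0 d0.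
have e2 : 0 < eps / 2 by lra. have d2 : 0 < dl / 2 by lra.
have [N tN] := date_nat dt.
have hg e : 0 < e -> \forall k \near \oo, (2 ^- k : R) <= e.
  move=> ep; have /cvgrPdist_lt /(_ e ep) : ((2^-1 : R) ^+ n) @[n --> \oo] --> (0:R).
    by apply: cvg_expr; rewrite ger0_norm ?invr_ge0// invf_lt1// ltr1n.
  by apply: filterS => n; rewrite sub0r normrN exprVn => h; apply: ltW; apply: le_lt_trans h; exact: ler_norm.
move/(ucpP cY cX)/(_ t _ _ dt e2 d2) : hY => hY.
near=> k; rewrite [eps]splitr [dl]splitr EFinD.
apply: le_trans (far_triangle _ _ (cZ k (m k)) (cY k) cX dt) _; apply: leeD; last by near: k.
apply: le_trans (_ : (2 ^- k)%:E <= _)%E; last by rewrite lee_fin; near: k; exact: hg.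
apply: le_trans (hm k); apply: le_measure; rewrite ?inE; [exact: far_measurable| |].
  by apply: far_measurable => //; exact: (cap_date T_gt0).
have tk : t <= cap T k%:R.
  by apply: le_trans tN _; apply: le_cap; rewrite ler_nat; near: k; exact: nbhs_infty_ge.
have ek : 2 ^- k <= eps / 2 by near: k; exact: hg.
move=> w [s /andP[s0 st] h]; exists s; first by rewrite s0 (le_trans st).
exact: le_lt_trans h.
Unshelve. all: by end_near. Qed.

End Ucp.

Section LowerBounded.
Context {R : realType} {dO : measure_display} {Omega : measurableType dO}.
Variables (T : \bar R) (F : R -> set (set Omega)).
Hypotheses (T_gt0 : (0 < T)%E) (filtF : is_filtration T F).
Local Notation process := (@process R dO Omega).
Local Notation bp := (bounded_predictable T F).
Variables (Q : probability Omega R) (d : nat) (M G : 'I_d -> process) (J : 'I_d -> process -> process).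
Hypotheses (hM : forall i, martingale T Q F (M i)) (hJ : forall i, bounded_integral T Q F (M i) (J i))
  (bG : forall i, bp (G i)).

Let cM i : cadlag_adapted T F (M i). Proof. by have [] := hM i. Qed.
Let cJ i : cadlag_adapted T F (J i (G i)). Proof. exact: (int_cadlag (hJ i) (bG i)). Qed.

Definition vector_int : process := fun t w => \sum_(i < d) J i (G i) t w.

Lemma vector_int_cadlag : cadlag_adapted T F vector_int.
Proof. by apply: (cadlag_adapted_sum filtF (X := fun i => J i (G i))). Qed.

(** Stopping at the level j of the combined size of the martingales and their integrals gives mean
    zero; the integrable lower bound then lets Fatou's lemma remove the localization. *)
Theorem lower_bounded t r Y0 : date T t -> optional F 0 t r -> L1 Q Y0 ->
  {ae Q, forall w s, 0 <= s <= r w -> - Y0 w <= vector_int s w} ->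
  L1 Q (fun w => vector_int (r w) w) /\ ex Q (fun w => vector_int (r w) w) <= 0.
Proof.
move=> dt opt iY lb; have d0 := date0 T_gt0.
pose A : process := fun s w => \sum_(i < d) (`|M i s w| + `|J i (G i) s w|).
have cA : cadlag_adapted T F A.
  apply: (cadlag_adapted_sum filtF (X := fun i s w => `|M i s w| + `|J i (G i) s w|)) => i.
  have := cadlag_adapted_lin filtF 1 1 (cadlag_adapted_norm (cM i)) (cadlag_adapted_norm (cJ i)).
  by rewrite (_ : (fun _ _ => 1 * _ + _) = (fun s w => `|M i s w| + `|J i (G i) s w|))//; apply/funext => s; apply/funext => w; rewrite !mul1r.
have A0 i s w : `|M i s w| + `|J i (G i) s w| <= `|A s w|.
  apply: le_trans (ler_norm _); rewrite /A (bigD1 i)//= lerDl sumr_ge0// => j _; exact: addr_ge0.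
pose rj (j : nat) w := Num.min (r w) (debut A j%:R t w).
have opj j : optional F 0 t (rj j).
  by apply: (optional_min filtF d0 dt opt); exact: (debut_optional filtF).
have ar w : date T (r w) by have /andP[r0 rt] := opt.1 w; exact: date_le dt r0 rt.
have hjump : {ae Q, forall w i, forall s, date T s -> 0 < s -> jump_eq (M i) (J i (G i)) (G i) s w}.
  by apply: ae_ord => i; exact: (int_jump T_gt0 filtF (hJ i) (cM i) (bG i)).
have hst : {ae Q, forall w i, J i (G i) 0 w = 0}.
  by apply: ae_ord => i; exact: (int_start T_gt0 filtF (hJ i) (bG i)).
have iMj i j : L1 Q (fun w => M i (rj j w) w).
  by have [] := optional_stopping filtF (hM i) d0 dt dt.1 (opj j).
have dom i j : dominated Q (M i) (J i) (G i) (rj j).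
  have [_ [c hc]] := bG i.
  have c0 : 0 <= c by apply: le_trans (hc 0 point d0).
  (* Before rj everything is at most j; at rj the martingale is controlled by its own value,
     integrable by optional stopping. The factor 1 + 2 c below accounts for the value before rj and
     for one jump with integrand bounded by c. *)
  pose a w := j%:R + `|M i (rj j w) w|.
  have ia : L1 Q a by apply: L1D; [exact: L1_cst|exact: L1_norm].
  exists (fun w => (1 + 2 * c) * a w); split; first exact: L1Z.
  apply: filterS2 hjump hst => w h1 h2 s /andP[s0 sr].
  have a0 : 0 <= a w by rewrite addr_ge0.
  have dj : date T (rj j w) by have /andP[? ?] := (opj j).1 w; exact: date_le dt _ _.
  have before q : 0 <= q < rj j w -> `|M i q w| + `|J i (G i) q w| <= j%:R.
    rewrite /rj lt_min => /and3P[q0 _ qd]; apply: le_trans (A0 i q w) _.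
    by apply: (before_debut dt.1 (t := t)); rewrite q0.
  have Mb q : 0 <= q <= rj j w -> `|M i q w| <= a w.
    move=> /andP[q0]; rewrite le_eqVlt => /predU1P[->|qr]; first by rewrite /a lerDr.
    have := before q ltac:(by rewrite q0); have := normr_ge0 (J i (G i) q w); rewrite /a; have := normr_ge0 (M i (rj j w) w); lra.
  have a1 : a w <= (1 + 2 * c) * a w by rewrite ler_peMl// lerDl mulr_ge0.
  split; first by apply: le_trans (Mb s _) a1; rewrite s0.
  move: sr; rewrite le_eqVlt => /predU1P[sE|sr]; last first.
    apply: le_trans a1; have := before s ltac:(by rewrite s0); have := normr_ge0 (M i s w); rewrite /a; have := normr_ge0 (M i (rj j w) w); lra.
  have := s0; rewrite le_eqVlt => /predU1P[<-|spos]; first by rewrite h2 normr0 mulr_ge0// addr_ge0// mulr_ge0.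
  rewrite -sE in dj.
  have := @jump_bound _ (fun q => J i (G i) q w) (fun q => M i q w) (G i s w) (a w) (a w) c s spos
    (hc s w dj) (h1 i s dj spos).
  have -> : (1 + 2 * c) * a w = a w + c * (a w + a w) by ring.
  apply.
    move=> q /andP[q0 qs]; have := before q ltac:(by rewrite q0 -sE).
    have := normr_ge0 (M i q w); rewrite /a; have := normr_ge0 (M i (rj j w) w); lra.
  by move=> q /andP[q0 qs]; apply: Mb; rewrite q0 -sE.
have iJ i j : L1 Q (fun w => J i (G i) (rj j w) w).
  have [V [iV hV]] := dom i j.
  apply: (L1_dom (optional_meas filtF (cJ i) d0 dt dt.1 (opj j)) iV); apply: filterS hV => w h.
  by have [] := h (rj j w) ltac:(by rewrite lexx andbT; have /andP[] := (opj j).1 w).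
have ez j : ex Q (fun w => vector_int (rj j w) w) = 0.
  by rewrite /vector_int ex_sum//; apply: big1 => i _; exact: (zero_expectation T_gt0 filtF (hM i) (hJ i) (bG i) dt (opj j) (dom i j)).
have iZ j : L1 Q (fun w => vector_int (rj j w) w) by exact: L1_sum.
have mZ := optional_meas filtF vector_int_cadlag d0 dt dt.1 opt.
have [i1 e1] : L1 Q (fun w => vector_int (r w) w + Y0 w) /\ ex Q (fun w => vector_int (r w) w + Y0 w) <= ex Q Y0.
  apply: (ex_fatou (fn := fun j w => vector_int (rj j w) w + Y0 w)).
  - by move=> j; exact: L1D.
  - by apply: measurable_funD => //; exact: L1_meas iY.
  - apply: filterS lb => w h j; rewrite -lerBlDr sub0r; apply: h.
    by have /andP[-> _] := (opj j).1 w; rewrite ge_min lexx.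
  - by move=> j; rewrite exD// ez add0r.
  - apply: nearW => w; apply: cvg_near_cst.
    have [C hC] := cadlag_bounded w cA.1 dt dt.1.
    near=> j; rewrite /rj debut_full ?min_l//.
    + by have /andP[] := opt.1 w.
    + exact: dt.1.
    + move=> s st; apply: le_trans (hC s st) _; near: j; exact: nbhs_infty_ger.
have := L1B i1 iY; under eq_fun do rewrite addrK.
move=> i2; split => //.
by move: e1; rewrite exD// gerDr.
Unshelve. all: by end_near. Qed.

End LowerBounded.

(** * Integrals against a sigma-martingale through its martingale *)

Section SigmaApprox.
Context {R : realType} {dO : measure_display} {Omega : measurableType dO}.
Variables (T : \bar R) (F : R -> set (set Omega)).
Hypotheses (T_gt0 : (0 < T)%E) (filtF : is_filtration T F).
Local Notation process := (@process R dO Omega).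
Local Notation bp := (bounded_predictable T F).
Variables (Q : probability Omega R) (M phi S X' : process) (J I : process -> process).
Hypotheses (pphi : predictable T F phi) (cX' : cadlag_adapted T F X')
  (hJ : bounded_integral T Q F M J) (hI : bounded_integral T Q F S I)
  (SX : indist T Q S (fun t w => S 0 w + X' t w)).

Definition trunc_phi m : process := truncate m (fun _ : 'I_1 => phi) ord0.
Hypothesis em : emery_cvg T Q F (fun m t w => J (trunc_phi m) t w) X'.

Lemma bp_trunc_phi m : bp (trunc_phi m).
Proof. exact: (bp_truncate T_gt0 filtF (fun _ => pphi)). Qed.

Lemma bp_trunc_mul m K : bp K -> bp (fun t w => trunc_phi m t w * K t w).
Proof. by move=> bK; exact: (bpM T_gt0 filtF (bp_trunc_phi m) bK). Qed.

Let cJ m K : bp K -> cadlag_adapted T F (J (fun t w => trunc_phi m t w * K t w)).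
Proof. by move=> bK; exact: (int_cadlag hJ (bp_trunc_mul m bK)). Qed.

(** The Emery distance tests elementary K only. Induction extends the estimate to all predictable K
    bounded by 1, for every eps' > eps: each limit step uses up part of the gap. *)
Let uniform_close t eps : date T t -> 0 < eps -> \forall m \near \oo, forall K, predictable T F K ->
  bounded1 T K -> forall eps', eps < eps' ->
  (Q (far t eps' (J (fun t w => (trunc_phi m t w * K t w)%R)) (I K)) <= eps'%:E)%E.
Proof.
move=> dt e0; have d0 := date0 T_gt0; apply: filterS (em dt e0) => m hm K pK bK.
suff [] : bp K /\ forall eps', eps < eps' ->
  (Q (far t eps' (J (fun t w => (trunc_phi m t w * K t w)%R)) (I K)) <= eps'%:E)%E by [].
move: K pK bK; apply: (predictable_rec T_gt0 filtF (Pr := fun K => bp K /\ forall eps', eps < eps' ->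
  (Q (far t eps' (J (fun t w => (trunc_phi m t w * K t w)%R)) (I K)) <= eps'%:E)%E)).
- move=> e he be; have bpe := bp_el T_gt0 filtF he; split => // eps' ee'.
  have cY : cadlag_adapted T F (J (trunc_phi m)) := int_cadlag hJ (bp_trunc_phi m).
  have cZ : cadlag_adapted T F (fun t w => J (trunc_phi m) t w - X' t w) by exact: cadlag_adaptedB.
  apply: (@le_trans _ _ eps%:E); last by rewrite lee_fin ltW.
  apply: le_trans (hm e he be).
  apply: le_measure_ae.
  - exact: (far_measurable filtF _ (cJ m bpe) (int_cadlag hI bpe) dt).
  - exact: (emery_measurable T_gt0 filtF eps cZ he dt).
  apply: filterS3 (int_assoc_el T_gt0 filtF hJ (bp_trunc_phi m) he) (int_el hI he) SX => w h1 h2 h3 [s st hs].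
  have ds : date T s by case/andP: st => s0 st; exact: date_le dt s0 st.
  exists s => //; apply: (lt_trans ee'); apply: lt_le_trans hs _.
  rewrite -[leLHS]add0r; apply: lerD => //; rewrite h1// h2//.
  rewrite /el_int -sumrB le_eqVlt; apply/orP; left; apply/eqP; congr (`|_|); apply: eq_bigr => i _.
  have [_ _ /(_ i (ltn_ord i))[ds1 du1 _ _ _]] := he.
  have dmin u : date T u -> date T (Num.min u s).
    by move=> du; apply: (date_le ds); [rewrite le_min du.1 ds.1|rewrite ge_min lexx orbT].
  rewrite (h3 _ (dmin _ du1)) (h3 _ (dmin _ ds1)); ring.
- move=> K L KL [bK hK]; have [bL hIL] := int_ext T_gt0 filtF hI bK KL; split => // eps' ee'.
  have [b2 hJL] := int_ext T_gt0 filtF hJ (bp_trunc_mul m bK)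
    (fun t w dt => congr1 (fun x => trunc_phi m t w * x) (KL t w dt)).
  apply: le_trans (hK _ ee').
  exact: (far_congr filtF eps' (int_cadlag hJ b2) (int_cadlag hI bL) (cJ m bK) (int_cadlag hI bK) hJL hIL dt).
move=> Kn K pKn bKn hKn pK bK l; have bpK := bpP pK bK; split => // eps' ee'.
have u1 : ucp_cvg T Q (fun n => J (fun t w => trunc_phi m t w * Kn n t w)) (J (fun t w => trunc_phi m t w * K t w)).
  have [_ [c hc]] := bp_trunc_phi m.
  apply: (int_dct hJ (c := c * 1)).
  - by move=> n; have [] := bp_trunc_mul m (hKn n).1.
  - by have [] := bp_trunc_mul m bpK.
  - by move=> n s w ds; rewrite normrM ler_pM//; [exact: hc|exact: bKn].
  - by move=> s w ds; apply: cvgM; [exact: cvg_cst|exact: l].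
have u2 := int_dct hI pKn pK bKn l.
(* The gap is cut in four: one part for each of the two limits, and two parts to apply the induction
   hypothesis at a level strictly above eps. *)
pose dl := (eps' - eps) / 4; have dl0 : 0 < dl by rewrite /dl; lra.
have cJn n := cJ m (hKn n).1; have cIn n := int_cadlag hI (hKn n).1.
move/(ucpP filtF Q cJn (cJ m bpK))/(_ t _ _ dt dl0 dl0) : u1 => u1.
move/(ucpP filtF Q cIn (int_cadlag hI bpK))/(_ t _ _ dt dl0 dl0) : u2 => u2.
have [n [q1 q2]] := filter_ex (filterI u1 u2).
have eE : eps' = dl + ((eps + dl + dl) + dl) by rewrite /dl; field.
have cc1 := cJ m bpK; have cc2 := int_cadlag hI bpK.
have q3 := (hKn n).2 (eps + dl + dl) ltac:(lra).
rewrite {1}eE; apply: le_trans (far_triangle filtF _ _ _ cc1 (cJn n) cc2 dt) _.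
rewrite eE EFinD; apply: leeD.
  apply: le_trans q1; rewrite le_eqVlt; apply/orP; left; apply/eqP; congr (Q _).
  by apply/seteqP; split => w [s st hs]; exists s => //; rewrite distrC.
apply: le_trans (far_triangle filtF _ _ _ (cJn n) (cIn n) cc2 dt) _.
by rewrite EFinD; apply: leeD.
Qed.

(** Integration against S is moved to the martingale M; the possibly unbounded integrand phi enters
    only through its truncations. *)
Theorem sigma_approx K : bp K -> ucp_cvg T Q (fun m => J (fun t w => trunc_phi m t w * K t w)) (I K).
Proof.
move=> bK; have [c [L [c0 pL bL KE]]] := bp_scale T_gt0 filtF bK; have bpL' := bpP pL bL.
have cI := int_cadlag hI bK; have cIL := int_cadlag hI bpL'.
have cJK m := cJ m bK; apply/(ucpP filtF _ cJK cI) => t eps dl dt e0 d0.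
pose e := Num.min (eps / c) dl / 2.
have m0 : 0 < Num.min (eps / c) dl by rewrite lt_min d0 divr_gt0.
have e0' : 0 < e by rewrite divr_gt0.
apply: filterS (uniform_close dt e0') => m /(_ L pL bL (Num.min (eps / c) dl)) h.
have {}h := h ltac:(rewrite /e; lra).
apply: (@le_trans _ _ (Num.min (eps / c) dl)%:E); last by rewrite lee_fin ge_min lexx orbT.
apply: le_trans h.
have h1 := intZ T_gt0 filtF hI c bpL'.
have h2 := intZ T_gt0 filtF hJ c (bp_trunc_mul m bpL').
rewrite -KE in h1.
have KE' : (fun t w => c * (trunc_phi m t w * L t w)) = (fun t w => trunc_phi m t w * K t w).
  by apply/funext => s; apply/funext => w; rewrite KE; ring.
rewrite KE' in h2.
apply: le_measure_ae; [exact: (far_measurable filtF _ (cJ m bK) cI dt)|exact: (far_measurable filtF _ (cJ m bpL') cIL dt)|].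
apply: filterS2 h1 h2 => w g1 g2 [s st hs]; exists s => //.
have ds : date T s by case/andP: st => s0 st; exact: date_le dt s0 st.
move: hs; rewrite g1// g2// -mulrBr normrM gtr0_norm// mulrC -ltr_pdivrMr// => hs.
by apply: le_lt_trans hs; rewrite ge_min lexx.
Qed.

End SigmaApprox.

Lemma near_left_ex {R : realType} (s : R) (A : R -> Prop) : 0 < s -> (\forall q \near s^'-, A q) ->
  exists2 q, 0 <= q < s & A q.
Proof.
move=> s0 /near_leftP[e e0 h]; exists (Num.max 0 (s - e / 2)).
  by rewrite le_max lexx/= gt_max s0/=; lra.
by apply: h; rewrite lt_max gt_max s0/=; apply/andP; split; [apply/orP; right; lra|lra].
Qed.

Section GainMean.
Context {R : realType} {dO : measure_display} {Omega : measurableType dO}.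
Variables (T : \bar R) (F : R -> set (set Omega)).
Hypotheses (T_gt0 : (0 < T)%E) (filtF : is_filtration T F).
Local Notation process := (@process R dO Omega).
Variables (P Q : probability Omega R).
Hypothesis QP : Q `<< P.
Local Notation F' := (augment Q F).
Local Notation bp' := (bounded_predictable T F').

Lemma ucp_indist (Xn : nat -> process) X Y : (forall n, cadlag_adapted T F' (Xn n)) ->
  cadlag_adapted T F' X -> cadlag_adapted T F' Y -> indist T Q X Y -> ucp_cvg T Q Xn X -> ucp_cvg T Q Xn Y.
Proof.
have filtF' := augment_filtration Q filtF.
move=> cXn cX cY XY h; apply/(ucpP filtF' Q cXn cY) => t eps dl dt e0 d0.
move/(ucpP filtF' Q cXn cX)/(_ t _ _ dt e0 d0) : h; apply: filterS => n; apply: le_trans.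
apply: (far_congr filtF' _ (cXn n) cY (cXn n) cX) => //; first by apply: nearW.
by apply: filterS XY => w h t' dt'; rewrite h.
Qed.

Variables (d : nat) (S H : 'I_d -> process) (X : process).
Hypotheses (cS : forall i, cadlag_adapted T F (S i)) (sig : sigma_martingale T Q F' S)
  (hX : stoch_int T P F S H X).

Let cX : cadlag_adapted T F X. Proof. by have [] := hX. Qed.

(* Z k = sum_i J_i(H_i phi 1_{|H| <= k, phi <= m_k}), an integral of a bounded integrand
   against martingales, has at each date either no jump or the jump of X. *)
Lemma martingale_approx : exists (M G : nat -> 'I_d -> process) (J : nat -> 'I_d -> process -> process),
  [/\ forall k i, martingale T Q F' (M k i), forall k i, bounded_integral T Q F' (M k i) (J k i),
   forall k i, bp' (G k i),
   ucp_cvg T Q (fun k => vector_int (G k) (J k)) X &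
   forall k, {ae Q, forall w t, date T t -> 0 < t ->
     (vector_int (G k) (J k) t w - vector_int (G k) (J k) s w) @[s --> t^'-] --> (0 : R) \/
     (vector_int (G k) (J k) t w - vector_int (G k) (J k) s w - (X t w - X s w)) @[s --> t^'-] --> (0 : R)}].
Proof.
have filtF' := augment_filtration Q filtF.
have [M [phi [hM [phi0 hall]]]] := sig.
have /choice[X' hX'] := hall.
have pphi0 (i : 'I_d) : predictable T F' phi by have [[h _ _] _] := hX' i; exact: (h ord0).
have cX' i : cadlag_adapted T F' (X' i) by have [[]] := hX' i.
have SX i : indist T Q (S i) (fun t w => S i 0 w + X' i t w) by have [] := hX' i.
have /choice[J0 hJ0] : forall i, exists J0 : 'I_1 -> process -> process,
    (forall j, bounded_integral T Q F' (M i) (J0 j)) /\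
    emery_cvg T Q F' (fun m t w => \sum_(j < 1) J0 j (truncate m (fun _ => phi) j) t w) (X' i).
  by move=> i; have [[_ _ [J0 hJ0]] _] := hX' i; exists J0.
pose J i := J0 i ord0.
have hJ i : bounded_integral T Q F' (M i) (J i) by exact: (hJ0 i).1.
have emJ i : emery_cvg T Q F' (fun m t w => J i (trunc_phi phi m) t w) (X' i).
  have := (hJ0 i).2; congr (emery_cvg _ _ _ _ _).
  by apply/funext => m; apply/funext => t; apply/funext => w; rewrite big_ord1.
have [pH _ [I [hI em]]] := hX.
have /choice[I' hI'] : forall i, exists I', bounded_integral T Q F' (S i) I' /\
    (forall K, bounded_predictable T F K -> indist T Q (I' K) (I i K)).
  by move=> i; exact: (augment_integral T_gt0 filtF QP (hI i)).
have bi' i : bounded_integral T Q F' (S i) (I' i) by exact: (hI' i).1.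
have cS' i : cadlag_adapted T F' (S i) by exact: augment_cadlag.
have cM i : cadlag_adapted T F' (M i) by have [] := hM i.
have cXa : cadlag_adapted T F' X by exact: augment_cadlag.
have bH k i : bounded_predictable T F (truncate k H i) := bp_truncate T_gt0 filtF pH k i.
have bH' k i : bp' (truncate k H i) by exact: augment_bp.
have bG k m i : bp' (fun t w => trunc_phi phi m t w * truncate k H i t w).
  by apply: (bp_trunc_mul T_gt0 filtF' (pphi0 i)).
pose Z k m := vector_int (fun i t w => trunc_phi phi m t w * truncate k H i t w) J.
have cZ k m : cadlag_adapted T F' (Z k m) by exact: (vector_int_cadlag filtF' hJ (bG k m)).
pose Y k := truncated_int H I k.
have cY k : cadlag_adapted T F (Y k) := truncated_int_cadlag T_gt0 filtF pH hI k.
have cY' k : cadlag_adapted T F' (Y k) by exact: augment_cadlag.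
have uY : ucp_cvg T Q Y X.
  apply: (ac_ucp QP filtF cY cX); exact: (truncated_ucp T_gt0 filtF pH cX hI em).
have uZ k : ucp_cvg T Q (Z k) (Y k).
  pose Y' : process := fun t w => \sum_(i < d) I' i (truncate k H i) t w.
  have cY2 : cadlag_adapted T F' Y'.
    apply: (cadlag_adapted_sum filtF' (X := fun i => I' i (truncate k H i))) => i.
    exact: (int_cadlag (bi' i) (bH' k i)).
  apply: (ucp_indist (cZ k) cY2 (cY' k)).
    have h : {ae Q, forall w i t, date T t -> I' i (truncate k H i) t w = I i (truncate k H i) t w}.
      by apply: ae_ord => i; exact: ((hI' i).2 _ (bH k i)).
    by apply: filterS h => w h t dt; apply: eq_bigr => i _; exact: h.
  apply: (ucp_sum filtF' (Xn := fun m i => J i (fun t w => trunc_phi phi m t w * truncate k H i t w))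
    (X := fun i => I' i (truncate k H i))).
  - by move=> m i; exact: (int_cadlag (hJ i) (bG k m i)).
  - by move=> i; exact: (int_cadlag (bi' i) (bH' k i)).
  - move=> i; exact: (sigma_approx T_gt0 filtF' (pphi0 i) (cX' i) (hJ i) (bi' i) (SX i) (emJ i) (bH' k i)).
have [m hm] := ucp_diag T_gt0 filtF' cZ cY' cXa uZ uY.
exists (fun _ => M), (fun k i t w => trunc_phi phi (m k) t w * truncate k H i t w), (fun _ => J).
split => // k.
have j1 : {ae Q, forall w i t, date T t -> 0 < t -> jump_eq (M i)
    (J i (fun t w => trunc_phi phi (m k) t w * truncate k H i t w))
    (fun t w => trunc_phi phi (m k) t w * truncate k H i t w) t w}.
  by apply: ae_ord => i; exact: (int_jump T_gt0 filtF' (hJ i) (cM i) (bG k (m k) i)).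
have j2 : {ae Q, forall w i t, date T t -> 0 < t ->
    (X' i t w - X' i s w - phi t w * (M i t w - M i s w)) @[s --> t^'-] --> (0 : R)}.
  apply: ae_ord => i.
  have := @stoch_int_jump _ _ _ T F' T_gt0 filtF' Q 1 (fun _ => M i) (fun _ => phi) (X' i) (J0 i)
    (fun _ => cM i) (fun _ => pphi0 i) (cX' i) (hJ0 i).1 (hJ0 i).2.
  apply: filterS => w h t dt t0; apply: cvg_trans (h t dt t0).
  by apply: near_eq_cvg; apply: nearW => s; rewrite big_ord1.
have j3 := ac_ae QP (stoch_int_jump T_gt0 filtF cS pH cX hI em).
have j4 : {ae Q, forall w i t, date T t -> S i t w = S i 0 w + X' i t w} by apply: ae_ord => i; exact: SX.
apply: filterS3 (filterI j1 j2) j3 j4 => w [h1 h2] h3 h4 t dt t0.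
(* The truncation of H acts on the whole vector through its norm, and phi is the same for all
   coordinates. Hence one factor B, 0 or 1, multiplies the entire jump. *)
pose B := (\sum_(j < d) H j t w ^+ 2 <= k%:R ^+ 2) && (\sum_(j < 1) phi t w ^+ 2 <= (m k)%:R ^+ 2).
have GE i : trunc_phi phi (m k) t w * truncate k H i t w = B%:R * (H i t w * phi t w).
  rewrite /trunc_phi /truncate /B; case: ifP => _; case: ifP => _; rewrite /= ?mulr1n ?mulr0n ?mul0r ?mulr0//.
  by rewrite mul1r mulrC.
have hZ : (vector_int (fun i t w => trunc_phi phi (m k) t w * truncate k H i t w) J t w -
    vector_int (fun i t w => trunc_phi phi (m k) t w * truncate k H i t w) J s w -
    \sum_(i < d) B%:R * (H i t w * phi t w) * (M i t w - M i s w)) @[s --> t^'-] --> (0 : R).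
  have hs : (\sum_(i < d) (J i (fun t w => trunc_phi phi (m k) t w * truncate k H i t w) t w -
      J i (fun t w => trunc_phi phi (m k) t w * truncate k H i t w) s w -
      trunc_phi phi (m k) t w * truncate k H i t w * (M i t w - M i s w))) @[s --> t^'-] --> \sum_(i < d) (0 : R).
    by apply: (cvg_big (op := +%R) (x0 := 0)) => //; [exact: add_continuous|move=> i _; exact: (h1 i t dt t0)].
  rewrite big1_eq in hs; apply: cvg_trans hs; apply: near_eq_cvg; apply: nearW => s.
  by rewrite /vector_int !sumrB; congr (_ - _); apply: eq_bigr => i _; rewrite GE.
(* The jump relations of X with respect to S and of S with respect to M are composed, so that X and
   the approximation are compared through the same increments of M. *)
have hXM : (X t w - X s w - \sum_(i < d) (H i t w * phi t w) * (M i t w - M i s w)) @[s --> t^'-] --> (0 : R).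
  have hs : (\sum_(i < d) H i t w * (X' i t w - X' i s w - phi t w * (M i t w - M i s w))) @[s --> t^'-]
      --> \sum_(i < d) (0 : R).
    apply: (cvg_big (op := +%R) (x0 := 0)) => //; first exact: add_continuous.
    by move=> i _; rewrite -(mulr0 (H i t w)); apply: cvgM; [exact: cvg_cst|exact: (h2 i t dt t0)].
  rewrite big1_eq in hs.
  have : ((X t w - X s w - \sum_(i < d) H i t w * (S i t w - S i s w)) +
      \sum_(i < d) H i t w * (X' i t w - X' i s w - phi t w * (M i t w - M i s w))) @[s --> t^'-] --> (0 + 0 : R).
    by apply: cvgD => //; exact: h3.
  rewrite addr0; apply: cvg_trans.
  apply: near_eq_cvg; near=> s.
  have s0 : 0 <= s by near: s; exact: nbhs_left_ge.
  have ds : date T s by apply: (date_le dt s0); near: s; exact: nbhs_left_le.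
  have -> : \sum_(i < d) H i t w * (X' i t w - X' i s w - phi t w * (M i t w - M i s w)) =
      \sum_(i < d) H i t w * (S i t w - S i s w) - \sum_(i < d) H i t w * phi t w * (M i t w - M i s w).
    by rewrite -sumrB; apply: eq_bigr => i _; rewrite (h4 i t dt) (h4 i s ds); ring.
  by rewrite addrA subrK.
case: (boolP B) hZ => _ hZ; [right|left].
  rewrite -(subr0 (0 : R)); apply: cvg_trans (cvgB hZ hXM); apply: near_eq_cvg; apply: nearW => s.
  under [X in _ - X - _ = _]eq_bigr do rewrite mulr1n mul1r.
  by set a := \sum_(i < d) _; ring.
apply: cvg_trans hZ; apply: near_eq_cvg; apply: nearW => s /=.
by rewrite big1 ?subr0// => i _; rewrite mulr0n !mul0r.
Unshelve. all: by end_near. Qed.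

Theorem gain_mean Y0 t : date T t -> L1 Q Y0 -> {ae P, forall w, 0 <= Y0 w} ->
  {ae P, forall w t, date T t -> - Y0 w <= X t w} -> L1 Q (X t) /\ ex Q (X t) <= 0.
Proof.
have filtF' := augment_filtration Q filtF.
move=> dt iY Y0_ge0 lbX; have d0 := date0 T_gt0.
have [M [G [J [hM hJ bG ucp hjump]]]] := martingale_approx.
pose Z k := vector_int (G k) (J k).
have cXa : cadlag_adapted T F' X by exact: augment_cadlag.
have cZ k : cadlag_adapted T F' (Z k) by exact: (vector_int_cadlag filtF' (hJ k) (bG k)).
pose D k : process := fun t w => Z k t w - X t w.
have cD k : cadlag_adapted T F' (D k) by exact: (cadlag_adaptedB filtF').
pose sg k := debut (D k) 1 t.
have opt k : optional F' 0 t (sg k) by exact: (debut_optional filtF').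
pose Y1 w := Y0 w + 1.
have iY1 : L1 Q Y1 by apply: L1D => //; exact: L1_cst.
have hst : {ae Q, forall w k i, J k i (G k i) 0 w = 0}.
  by apply: ae_foralln => k; apply: ae_ord => i; exact: (int_start T_gt0 filtF' (hJ k i) (bG k i)).
have lbZ : {ae Q, forall w k s, 0 <= s <= sg k w -> - Y1 w <= Z k s w}.
  have hj : {ae Q, forall w k t, date T t -> 0 < t ->
     (Z k t w - Z k s w) @[s --> t^'-] --> (0 : R) \/
     (Z k t w - Z k s w - (X t w - X s w)) @[s --> t^'-] --> (0 : R)} by exact: ae_foralln.
  apply: filterS3 (filterI (ac_ae QP lbX) (ac_ae QP Y0_ge0)) hj hst => w [h1 h2] h3 h4 k s /andP[s0 ss].
  have st : s <= t by apply: le_trans ss _; exact: (debut_le (D k) 1 w dt.1).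
  have ds : date T s by exact: date_le dt s0 st.
  have bef q : 0 <= q < s -> - Y1 w <= Z k q w /\ -1 <= Z k q w - X q w.
    move=> /andP[q0 qs].
    have := @before_debut _ _ _ (D k) 1 t w dt.1 q ltac:(by rewrite q0 (lt_le_trans qs)).
    rewrite /D ler_norml => /andP[a1 _]; split => //.
    have := h1 q (date_le ds q0 (ltW qs)); rewrite /Y1; lra.
  have := s0; rewrite le_eqVlt => /predU1P[<-|spos].
    by rewrite /Z /vector_int big1 ?/Y1 => [|i _]; [lra|exact: h4].
  (* Without a jump at s the lower bound valid before s persists. With the jump of X the difference
     Z - X does not move, so it stays at least - 1 and the bound on X applies. *)
  case: (h3 k s ds spos) => hl.
    apply/ler_addgt0Pr => e e0.
    have /cvgrPdist_le/(_ _ e0) n1 := hl.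
    have [q /andP[q2 q3] q1] := near_left_ex spos n1.
    have [b1 _] := bef q ltac:(by rewrite q2 q3).
    by move: q1; rewrite sub0r normrN ler_norml => /andP[? ?]; lra.
  apply/ler_addgt0Pr => e e0.
  have /cvgrPdist_le/(_ _ e0) n1 := hl.
  have [q /andP[q2 q3] q1] := near_left_ex spos n1.
  have [_ b1] := bef q ltac:(by rewrite q2 q3).
  by have := h1 s ds; move: q1; rewrite sub0r normrN ler_norml /Y1 => /andP[? ?]; lra.
have hk k : L1 Q (fun w => Z k (sg k w) w) /\ ex Q (fun w => Z k (sg k w) w) <= 0.
  apply: (lower_bounded T_gt0 filtF' (hM k) (hJ k) (bG k) dt (opt k) iY1).
  by apply: filterS lbZ => w h s; exact: h.
have [sub [_ hu]] := ucp_as filtF' cZ cXa ucp dt.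
have mX : measurable_fun setT (X t) by apply: (wrt_measurable filtF dt); exact: cX.2.
have [i1 e1] : L1 Q (fun w => X t w + Y1 w) /\ ex Q (fun w => X t w + Y1 w) <= ex Q Y1.
  apply: (ex_fatou (fn := fun n w => Z (sub n) (sg (sub n) w) w + Y1 w)).
  - by move=> n; apply: L1D => //; exact: (hk _).1.
  - by apply: measurable_funD => //; exact: L1_meas iY1.
  - apply: filterS lbZ => w h n; rewrite -lerBlDr sub0r; apply: h.
    by rewrite lexx andbT; have /andP[] := (opt (sub n)).1 w.
  - by move=> n; rewrite exD//; [rewrite gerDr; exact: (hk _).2|exact: (hk _).1].
  - apply: filterS hu => w u; apply: cvgD; last exact: cvg_cst.
    have tt : 0 <= t <= t by rewrite lexx dt.1.
    apply: cvg_trans (unif_cvg_pt u tt); have [N hN] := u 1 ltr01.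
    apply: near_eq_cvg; exists N => // n /= Nn; rewrite /sg debut_full//; first exact: dt.1.
    by move=> s st; exact: hN.
have := L1B i1 iY1; under eq_fun do rewrite addrK.
move=> i2; split => //.
by move: e1; rewrite exD// gerDr.
Qed.

End GainMean.

(** * Weak duality *)

Section Terminal.
Context {R : realType} {dO : measure_display} {Omega : measurableType dO}.
Variables (T : \bar R) (F : R -> set (set Omega)) (P : probability Omega R).
Hypotheses (T_gt0 : (0 < T)%E) (filtF : is_filtration T F)
  (negl : forall N, P.-negligible N -> F 0 N).
Local Notation process := (@process R dO Omega).

Lemma negligible_meas N : P.-negligible N -> measurable N.
Proof. by move=> /negl; apply: (filt_meas filtF (date0 T_gt0)). Qed.

Lemma complete_measurable (f g : Omega -> R) : measurable_fun setT f ->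
  {ae P, forall w, f w = g w} -> measurable_fun setT g.
Proof.
move=> mf h; have [N [mN N0 hN]] := h.
move=> _ Y mY; rewrite setTI.
have -> : g @^-1` Y = (f @^-1` Y `\` N) `|` (g @^-1` Y `&` N).
  apply/seteqP; split => w /=.
    move=> gY; have [Nw|nNw] := pselect (N w); [by right|left; split => //].
    have : f w = g w by apply: contrapT => fg; apply: nNw; apply: hN.
    by rewrite /preimage/= => ->.
  move=> [[fY nNw]|[]//]; have : f w = g w by apply: contrapT => fg; apply: nNw; apply: hN.
  by move=> <-.
apply: measurableU.
  by apply: measurableD => //; rewrite -[X in measurable X]setTI; exact: mf.
apply: negligible_meas; exists N; split => //; exact: subIsetr.
Qed.

(** Terminal values are limits only almost everywhere; they are measurable because negligible sets
    belong to F 0. *)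
Lemma complete_cvg (f : nat -> Omega -> R) (g : Omega -> R) : (forall n, measurable_fun setT (f n)) ->
  {ae P, forall w, f n w @[n --> \oo] --> g w} -> measurable_fun setT g.
Proof.
move=> mf h; have [N [mN N0 hN]] := h.
pose g' w := if w \in N then 0 else g w.
apply: (@complete_measurable g').
  apply: (measurable_fun_cvg (h := fun n w => if w \in N then 0 else f n w)).
    move=> n; apply: measurable_fun_ifT => //.
    apply: (measurable_fun_bool true); rewrite setTI (_ : _ @^-1` _ = N)//.
      by apply/seteqP; split => w /=; [move/set_mem|move=> Nw; exact: mem_set].
  move=> w _; rewrite /g'; case: ifPn => Nw; first exact: cvg_cst.
  by apply: contrapT => nc; move/negP: Nw; apply; rewrite inE; apply: hN.
exists N; split => // w /= gw; apply: contrapT => nNw; apply: gw.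
by rewrite /g' memNset.
Qed.

Lemma terminal_cvg X : has_terminal T P X -> exists2 t : nat -> R, forall n, date T (t n) &
  {ae P, forall w, X (t n) w @[n --> \oo] --> terminal T X w}.
Proof.
rewrite /has_terminal /terminal; case: T T_gt0 => [t t0|_|//] hX.
  exists (fun _ => t); first by move=> n; split => //; exact: ltW.
  by apply: nearW => w; exact: cvg_cst.
exists (fun n => n%:R); first by move=> n; split => //; rewrite leey.
apply: filterS (hX erefl) => w /cvg_ex[l hl].
rewrite (cvg_lim (@Rhausdorff R) hl); apply: (cvg_comp _ _ _ hl).
exact: cvgr_idn.
Qed.

Lemma terminal_meas X : cadlag_adapted T F X -> has_terminal T P X -> measurable_fun setT (terminal T X).
Proof.
move=> cX /terminal_cvg[t dt h]; apply: (complete_cvg (f := fun n => X (t n))) => // n.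
by apply: (wrt_measurable filtF (dt n)); exact: cX.2.
Qed.

(** The bound on the mean at finite dates passes to the horizon by Fatou's lemma, thanks to the
    common lower bound - Y0. *)
Lemma terminal_mean d (S H : 'I_d -> process) X (Q : probability Omega R) Y0 : Q `<< P ->
  (forall i, cadlag_adapted T F (S i)) -> sigma_martingale T Q (augment Q F) S ->
  gain P T F S H X -> L1 Q Y0 -> {ae P, forall w, 0 <= Y0 w} ->
  {ae P, forall w t, date T t -> - Y0 w <= X t w} ->
  L1 Q (terminal T X) /\ ex Q (terminal T X) <= 0.
Proof.
move=> QP cS sig [hX tX] iY Y0_ge0 lb; have [_ cX _] := hX.
have [t dt ht] := terminal_cvg tX.
have hm n := gain_mean T_gt0 filtF QP cS sig hX (dt n) iY Y0_ge0 lb.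
have [i1 e1] : L1 Q (fun w => terminal T X w + Y0 w) /\ ex Q (fun w => terminal T X w + Y0 w) <= ex Q Y0.
  apply: (ex_fatou (fn := fun n w => X (t n) w + Y0 w)).
  - by move=> n; apply: L1D => //; exact: (hm n).1.
  - by apply: measurable_funD; [exact: terminal_meas|exact: L1_meas iY].
  - by apply: filterS (ac_ae QP lb) => w h n; rewrite -lerBlDr sub0r; exact: h.
  - by move=> n; rewrite exD//; [rewrite gerDr; exact: (hm n).2|exact: (hm n).1].
  - by apply: filterS (ac_ae QP ht) => w h; apply: cvgD => //; exact: cvg_cst.
have := L1B i1 iY; under eq_fun do rewrite addrK.
move=> i2; split => //; by move: e1; rewrite exD// gerDr.
Qed.

End Terminal.

(** * Uniqueness of the stochastic integral *)

Section Uniqueness.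
Context {R : realType} {dO : measure_display} {Omega : measurableType dO}.
Variables (T : \bar R) (F : R -> set (set Omega)).
Hypotheses (T_gt0 : (0 < T)%E) (filtF : is_filtration T F).
Local Notation process := (@process R dO Omega).
Variable (Q : probability Omega R).

Lemma ucp_limit_unique (Xn Yn : nat -> process) X Y : (forall n, cadlag_adapted T F (Xn n)) ->
  (forall n, cadlag_adapted T F (Yn n)) ->
  cadlag_adapted T F X -> cadlag_adapted T F Y -> (forall n, indist T Q (Xn n) (Yn n)) ->
  ucp_cvg T Q Xn X -> ucp_cvg T Q Yn Y -> indist T Q X Y.
Proof.
move=> cXn cYn cX cY XY hX hY; apply: (ae_dates T_gt0) => t dt.
have [s [ns hs]] := ucp_as filtF cXn cX hX dt.
have hY' : ucp_cvg T Q (fun n => Yn (s n)) Y.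
  move=> t' eps dt' e0; apply: cvg_trans (hY t' eps dt' e0).
  apply: (@cvg_app _ _ (s n @[n --> \oo]) \oo).
  by move=> A [N _ hA]; exists N => // n Nn; apply: hA => /=; exact: leq_trans (ns n).
have [s' [ns' hs']] := ucp_as filtF (fun n => cYn (s n)) cY hY' dt.
have hXY : {ae Q, forall w n t, date T t -> Xn n t w = Yn n t w} by exact: ae_foralln.
apply: filterS3 hs hs' hXY => w u u' h r rt.
have dr : date T r by case/andP: rt => r0 rt; exact: date_le dt r0 rt.
have h1 : Xn (s (s' n)) r w @[n --> \oo] --> X r w.
  apply: cvg_trans (unif_cvg_pt u rt); apply: (@cvg_app _ _ (s' n @[n --> \oo]) \oo).
  by move=> A [N _ hA]; exists N => // n Nn; apply: hA => /=; exact: leq_trans (ns' n).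
have h2 := unif_cvg_pt u' rt.
have h3 : Yn (s (s' n)) r w @[n --> \oo] --> X r w.
  by apply: cvg_trans h1; apply: near_eq_cvg; apply: nearW => n; rewrite h.
by rewrite -(cvg_lim (@Rhausdorff R) h3) (cvg_lim (@Rhausdorff R) h2).
Qed.

Lemma integral_unique (X : process) I I' K : bounded_integral T Q F X I -> bounded_integral T Q F X I' ->
  bounded_predictable T F K -> indist T Q (I K) (I' K).
Proof.
move=> hI hI' bK; have [c [L [c0 pL bL KE]]] := bp_scale T_gt0 filtF bK.
suff H L' : predictable T F L' -> bounded1 T L' -> bounded_predictable T F L' /\ indist T Q (I L') (I' L').
  have [bL' h] := H L pL bL; have h1 := intZ T_gt0 filtF hI c bL'; have h2 := intZ T_gt0 filtF hI' c bL'.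
  rewrite -KE in h1 h2.
  by apply: filterS3 h h1 h2 => w g1 g2 g3 t dt; rewrite g2// g3// g1.
move: L'; apply: (predictable_rec T_gt0 filtF
  (Pr := fun L' => bounded_predictable T F L' /\ indist T Q (I L') (I' L'))).
- move=> e he _; split; first exact: bp_el.
  by apply: filterS2 (int_el hI he) (int_el hI' he) => w h1 h2 t dt; rewrite h1// h2.
- move=> K1 K2 K12 [b1 h]; have [b2 h1] := int_ext T_gt0 filtF hI b1 K12; split => //.
  have [_ h2] := int_ext T_gt0 filtF hI' b1 K12.
  by apply: filterS3 h h1 h2 => w g1 g2 g3 t dt; rewrite g2// g3// g1.
move=> Kn K0 pKn bKn hKn pK0 bK0 l; have bK0' := bpP pK0 bK0; split => //.
exact: (ucp_limit_unique (fun n => int_cadlag hI (hKn n).1) (fun n => int_cadlag hI' (hKn n).1)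
  (int_cadlag hI bK0') (int_cadlag hI' bK0') (fun n => (hKn n).2)
  (int_dct hI pKn pK0 bKn l) (int_dct hI' pKn pK0 bKn l)).
Qed.

(** Admissibility and terminal gains each come with their own version of H . S, and so does the
    underlying bounded integral; this identifies the versions. *)
Lemma stoch_int_unique d (S H : 'I_d -> process) X Y :
  stoch_int T Q F S H X -> stoch_int T Q F S H Y -> indist T Q X Y.
Proof.
move=> [pH cX [I [hI em]]] [_ cY [I' [hI' em']]].
apply: (ucp_limit_unique _ _ cX cY _ (truncated_ucp T_gt0 filtF pH cX hI em) (truncated_ucp T_gt0 filtF pH cY hI' em')).
- by move=> n; exact: (truncated_int_cadlag T_gt0 filtF pH hI n).
- by move=> n; exact: (truncated_int_cadlag T_gt0 filtF pH hI' n).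
move=> n; have h : {ae Q, forall w i t, date T t -> I i (truncate n H i) t w = I' i (truncate n H i) t w}.
  by apply: ae_ord => i; exact: (integral_unique (hI i) (hI' i) (bp_truncate T_gt0 filtF pH n i)).
by apply: filterS h => w h t dt; apply: eq_bigr => i _; exact: h.
Qed.

End Uniqueness.

(** * Densities and change of measure *)

Section Density.
Context {R : realType} {dO : measure_display} {Omega : measurableType dO}.
Variables (P Q : probability Omega R).
Hypothesis QP : Q `<< P.
Local Notation z := (density P Q).

Let zE w : (z w)%:E = Radon_Nikodym (charge_of_finite_measure Q) P w.
Proof. by rewrite /density fineK// Radon_Nikodym_fin_num. Qed.

Lemma density_L1 : L1 P z.
Proof.
have : P.-integrable setT (Radon_Nikodym (charge_of_finite_measure Q) P) by exact: Radon_Nikodym_integrable.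
by apply: eq_integrable => // w _; rewrite /= zE.
Qed.

(** The derivative is that of a charge, so its sign has to be recovered: its integral over {z < 0}
    is a Q-measure, hence nonnegative, while the integrand is nonpositive. *)
Lemma density_ge0 : {ae P, forall w, 0 <= z w}.
Proof.
have mz := L1_meas density_L1.
pose A := [set w | z w < 0].
have mA : measurable A.
  rewrite (_ : A = z @^-1` `]-oo, 0[%classic); last by apply/seteqP; split => w /=; rewrite in_itv.
  by rewrite -[X in measurable X]setTI; exact: mz.
have h : ex P (fun w => \1_A w * z w) = fine (Q A).
  rewrite ex_indE /Rintegral; congr fine.
  have -> : Q A = (\int[P]_(x in A) Radon_Nikodym (charge_of_finite_measure Q) P x)%E.
    by rewrite -Radon_Nikodym_integral.
  by apply: eq_integral => w _; rewrite zE.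
have i1 : L1 P (fun w => \1_A w * z w) by exact: L1_ind density_L1.
pose f w := - (\1_A w * z w).
have mf : measurable_fun setT (EFin \o f).
  by apply/measurable_EFinP; apply: measurableT_comp => //; exact: L1_meas i1.
have f0 w : 0 <= f w.
  rewrite /f indicE; case: (boolP (w \in A)) => [|_]; last by rewrite mul0r oppr0.
  by rewrite inE /A /= => h'; rewrite mul1r oppr_ge0 ltW.
have i2 : L1 P f by have := L1Z (-1) i1; under eq_fun do rewrite mulN1r.
have ef : ex P f = - fine (Q A).
  by rewrite -h -mulN1r -exZ//; congr ex; apply/funext => w; rewrite mulN1r.
have e0 : (\int[P]_w `|(EFin \o f) w| = 0)%E.
  under eq_integral do rewrite gee0_abs ?lee_fin//.
  have := exE i2; rewrite /= => ->; congr EFin; apply/eqP; rewrite eq_le.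
  rewrite {1}ef oppr_le0 fine_ge0//= ex_ge0//; first exact: nearW.
  by apply/measurable_EFinP.
have /(ae_eq_integral_abs P measurableT mf)/= := e0.
apply: filterS => w /(_ Logic.I) [fw]; rewrite leNgt; apply/negP => zw.
move: fw; rewrite /f indicE mem_set// mul1r => /eqP; rewrite oppr_eq0 => /eqP zw0.
by move: zw; rewrite zw0 ltxx.
Qed.

Lemma change_var f : L1 Q f -> L1 P (fun w => f w * z w) /\ ex P (fun w => f w * z w) = ex Q f.
Proof.
have cv g : L1 Q g -> (\int[P]_w (g w * z w)%:E = \int[Q]_w (g w)%:E)%E.
  move=> ig; rewrite -(Radon_Nikodym_change_of_variables QP measurableT ig).
  by apply: eq_integral => w _; rewrite EFinM zE.
move=> hf; have mz := L1_meas density_L1; have mf := L1_meas hf.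
have i1 : L1 P (fun w => f w * z w).
  apply/integrableP; split; first by apply/measurable_EFinP; exact: measurable_funM.
  have h := cv _ (L1_norm hf).
  rewrite (_ : (\int[P]_x _)%E = (\int[P]_w (`|f w|%R * z w)%:E)%E).
    by rewrite h exE ?ltry//; exact: L1_norm.
  apply: ae_eq_integral => //.
  - by apply: measurableT_comp => //; apply/measurable_EFinP; exact: measurable_funM.
  - by apply/measurable_EFinP; apply: measurable_funM => //; exact: measurableT_comp.
  - by apply: filterS density_ge0 => w h' _ /=; rewrite normrM (ger0_norm h').
split => //; have := cv f hf; rewrite !exE//; exact: EFin_inj.
Qed.

(** Bounded truncations are Q-integrable and obey the change of variables, which bounds their
    Q-means; Fatou's lemma removes the truncation. *)
Lemma change_var_inv (f : Omega -> R) : measurable_fun setT f -> {ae P, forall w, 0 <= f w} ->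
  L1 P (fun w => f w * z w) -> L1 Q f.
Proof.
move=> mf f0 hf.
pose fn (n : nat) w := Num.min n%:R (Num.max 0 (f w)).
have fn0 n w : 0 <= fn n w by rewrite le_min ler0n le_max lexx.
have mfn n : measurable_fun setT (fn n).
  by apply: measurable_minr => //; apply: measurable_maxr.
have ifn n : L1 Q (fn n).
  by apply: (@L1_bound _ _ _ _ _ n%:R) => // w; rewrite ger0_norm// ge_min lexx.
have h n : ex Q (fn n) <= ex P (fun w => f w * z w).
  have [i1 <-] := change_var (ifn n); apply: ex_le => //.
  apply: filterS2 f0 density_ge0 => w h1 h2; rewrite ler_wpM2r// /fn ge_min; apply/orP; right.
  by rewrite ge_max h1 lexx.
apply: (ex_fatou ifn mf _ h _).1; first exact: nearW.
apply: filterS (ac_ae QP f0) => w fw; apply: cvg_near_cst; near=> n.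
rewrite /fn (max_r fw) min_r//; near: n; exact: nbhs_infty_ger.
Unshelve. all: by end_near. Qed.

End Density.

Section ExtendedIntegrals.
Context {R : realType} {dO : measure_display} {Omega : measurableType dO}.
Variable P : probability Omega R.

Lemma monotone_measurable (u : R -> \bar R) : (forall x y, x <= y -> (u x <= u y)%E) ->
  measurable_fun setT u.
Proof.
move=> mono; apply: (measurability (@ErealGenOInfty.G R)) => [|_ [_ [r ->] <-]].
  exact: ErealGenOInfty.measurableE.
rewrite setTI; apply: is_interval_measurable => x y /=; rewrite !in_itv/= !andbT => hx hy q /andP[xq _].
by rewrite in_itv/= andbT; apply: lt_le_trans hx _; exact: mono.
Qed.

Lemma L1_of_lt (f : Omega -> \bar R) (c : R) : measurable_fun setT f -> (forall w, (c%:E <= f w)%E) ->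
  (\int[P]_w f w < +oo)%E -> [/\ L1 P (fine \o f), {ae P, forall w, f w = (fine (f w))%:E} &
    (\int[P]_w f w = (ex P (fine \o f))%:E)%E].
Proof.
move=> mf fc fi.
have ineg : (\int[P]_w (f^\- w) <= `|c|%:E)%E.
  apply: (@le_trans _ _ (\int[P]_w (cst `|c|%:E) w)%E).
    apply: ge0_le_integral => //; first exact: measurable_funeneg.
    move=> w _; rewrite funenegE /cst ge_max lee_fin normr_ge0 andbT leeNl.
    by apply: le_trans (fc w); rewrite lee_fin lerNl -normrN; exact: ler_norm.
  by rewrite integral_cst// [X in (_ * X)%E](_ : _ = 1%E) ?mule1//; exact: probability_setT.
have ipos : (\int[P]_w (f^\+ w) < +oo)%E.
  move: fi; rewrite integralE; case: (\int[P]_x f^\+ x)%E => [r|//|]; last by [].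
    by rewrite ltry.
  have : (\int[P]_x f^\- x)%E \is a fin_num.
    rewrite ge0_fin_numE; first exact: le_lt_trans ineg (ltry _).
    by apply: integral_ge0.
  by move=> /fineK <-.
have fi' : P.-integrable setT f.
  apply/integrableP; split => //.
  rewrite (_ : (\int[P]_x `|f x|)%E = (\int[P]_x (f^\+ x + f^\- x))%E); last first.
    by apply: eq_integral => w _; rewrite -[LHS]/((abse \o f) w) fune_abse.
  rewrite ge0_integralD//; [|exact: measurable_funepos|exact: measurable_funeneg].
  by apply: lte_add_pinfty => //; exact: le_lt_trans ineg (ltry _).
have ffin := integrable_ae measurableT fi'.
have h : {ae P, forall w, f w = (fine (f w))%:E}.
  by apply: filterS ffin => w h; rewrite fineK//; exact: h.
have mfine : measurable_fun setT (fine \o f) by exact: measurableT_comp.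
have hi : L1 P (fine \o f).
  apply/integrableP; split; first exact/measurable_EFinP.
  have /integrableP[_] := fi'; apply: le_lt_trans.
  apply: ae_ge0_le_integral => //.
  - by apply: measurableT_comp => //; exact/measurable_EFinP.
  - exact: measurableT_comp.
  - by apply: filterS h => w h _; rewrite -[X in (`|X| <= _)%E]/((fine (f w))%:E) -h.
split => //; rewrite -exE//; apply: ae_eq_integral => //; first exact/measurable_EFinP.
by apply: filterS h => w {1}->.
Qed.

(** Compared on positive and negative parts separately, since the negative part of g may have
    infinite expectation. *)
Lemma integral_le_ex (g h : Omega -> R) : measurable_fun setT g -> L1 P h ->
  {ae P, forall w, g w <= h w} -> (\int[P]_w (g w)%:E <= (ex P h)%:E)%E.
Proof.
move=> mg ih gh; rewrite -exE// integralE [leRHS]integralE.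
have mg' : measurable_fun setT (EFin \o g) by exact/measurable_EFinP.
have mh' : measurable_fun setT (EFin \o h) by apply/measurable_EFinP; exact: L1_meas ih.
apply: leeB; apply: ae_ge0_le_integral => //.
- exact: measurable_funepos.
- exact: measurable_funepos.
- apply: filterS gh => w hw _; by rewrite !funeposE ge_max !le_max /= lee_fin hw lexx orbT.
- exact: measurable_funeneg.
- exact: measurable_funeneg.
- apply: filterS gh => w hw _; by rewrite !funenegE ge_max !le_max leeN2 /= lee_fin hw lexx orbT.
Qed.

End ExtendedIntegrals.

Section RealUtility.
Context {R : realType} {dO : measure_display} {Omega : measurableType dO}.
Variable P : probability Omega R.

(** If u took the value -oo at x, the multiple al = max(1, - x) would give - al W <= x wherever W >=
    1, so [u_hat] of al W would be infinite almost surely. *)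
Lemma M_hat_finite (a : \bar R) (u : R -> \bar R) W : (a < 0)%E -> utility a u -> M_hat P u W ->
  {ae P, forall w, 1 <= W w} -> exists v : R -> R, u = EFin \o v.
Proof.
move=> a0 [unoo [ufin _] mono _ _] [mW hW] W1.
suff h x : u x != -oo%E.
  exists (fine \o u); apply/funext => x /=; rewrite fineK// fin_numE h unoo//.
apply/eqP => ux; pose al := Num.max 1 (- x).
have al0 : 0 < al by rewrite lt_max ltr01.
have u0 : u 0 \is a fin_num by rewrite fin_numE ufin ?unoo.
have hv w : 1 <= W w -> u_hat u (al * W w) = +oo%E.
  move=> w1; rewrite /u_hat.
  have -> : u (- `|al * W w|) = -oo%E.
    apply/eqP; rewrite -leeNy_eq -ux; apply: mono.
    rewrite ger0_norm; last by rewrite mulr_ge0 ?(ltW al0)//; lra.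
    rewrite lerNl; apply: (@le_trans _ _ al); first by rewrite le_max lexx orbT.
    by rewrite ler_peMr// ltW.
  by move: u0 => /fineK <-.
have mu : measurable_fun setT u := monotone_measurable mono.
have := hW al al0; rewrite (_ : (\int[P]_w _)%E = (\int[P]_w (cst +oo%E) w)%E) ?ltxx//.
  by rewrite integral_cst// [X in (_ * X)%E](_ : _ = 1%E) ?mule1//; exact: probability_setT.
apply: ae_eq_integral => //.
  apply: emeasurable_funD => //; apply: measurableT_comp => //.
  apply: measurableT_comp => //; apply: measurableT_comp => //; apply: measurableT_comp => //.
  exact: measurable_funM.
by apply: filterS W1 => w h _; rewrite hv.
Qed.

End RealUtility.

Section WeakDuality.
Context {R : realType} {dO : measure_display} {Omega : measurableType dO}.
Variables (P : probability Omega R) (v : R -> R).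
Local Notation u := (EFin \o v).
Hypothesis mono : {homo v : x y / x <= y}.

Lemma Phi_ge x y : ((v x - x * y)%:E <= Phi u y)%E.
Proof. by apply: ereal_sup_ubound; exists x. Qed.

(** A supremum of affine functions is lower semicontinuous: its strict superlevel sets are unions of
    open sets. *)
Lemma Phi_measurable : measurable_fun setT (Phi u).
Proof.
apply: (measurability (@ErealGenOInfty.G R)) => [|_ [_ [r ->] <-]].
  exact: ErealGenOInfty.measurableE.
rewrite setTI; apply: open_measurable.
have -> : Phi u @^-1` `]r%:E, +oo[%classic = \bigcup_(x in setT) [set y | r < v x - x * y].
  apply/seteqP; split => y /=.
    rewrite in_itv/= andbT => /ereal_sup_gt[_ [x _ <-]] h.
    by exists x => //=; move: h; rewrite /= -EFinB lte_fin.
  move=> [x _ /= h]; rewrite in_itv/= andbT; apply: lt_le_trans (Phi_ge x y).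
  by rewrite lte_fin.
apply: bigcup_open => x _.
apply: (@open_comp _ _ (fun y => v x - x * y) [set z | r < z]); last exact: open_gt.
move=> y _; apply: cvgB; first exact: cvg_cst.
by apply: cvgM; [exact: cvg_cst|exact: cvg_id].
Qed.

Lemma v_measurable : measurable_fun setT v.
Proof. exact: nondecreasing_measurable. Qed.

Lemma Phi_L1 (Q : probability Omega R) lam : Q `<< P ->
  (\int[P]_w Phi u (lam * density P Q w)%R < +oo)%E ->
  [/\ L1 P (fun w => fine (Phi u (lam * density P Q w))),
     {ae P, forall w, Phi u (lam * density P Q w) = (fine (Phi u (lam * density P Q w)))%:E} &
     (\int[P]_w Phi u (lam * density P Q w)%R = (ex P (fun w => fine (Phi u (lam * density P Q w))))%:E)%E].
Proof.
move=> QP h; apply: (L1_of_lt (f := fun w => Phi u (lam * density P Q w)) (c := v 0)) => //.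
  apply: (measurableT_comp Phi_measurable); apply: measurable_funM => //.
  exact: L1_meas (density_L1 QP).
by move=> w; have := Phi_ge 0 (lam * density P Q w); rewrite mul0r subr0.
Qed.

Lemma L_hat_L1 (Q : probability Omega R) W : L_hat P u W -> {ae P, forall w, 0 <= W w} ->
  P_of P (Phi u) Q -> L1 Q W.
Proof.
move=> [mW [al al0 hW]] W0 [QP hPhi].
have [|iG hG _] := @Phi_L1 Q 1 QP; first by under eq_integral do rewrite mul1r.
have mu : measurable_fun setT (fun w => v 0 - v (- `|al * W w|)).
  apply: measurable_funB => //; apply: (measurableT_comp v_measurable).
  by apply: measurableT_comp => //; apply: measurableT_comp => //; exact: measurable_funM.
have [|||i1 _ _] := @L1_of_lt _ _ _ P (fun w => (v 0 - v (- `|al * W w|))%:E) 0.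
- exact/measurable_EFinP.
- by move=> w; rewrite lee_fin subr_ge0; apply: mono; rewrite oppr_le0.
- move: hW; congr (_ < _)%E; apply: eq_integral => w _.
  by rewrite -[LHS]/((- v (- `|al * W w|) + v 0)%:E); congr EFin; ring.
apply: (change_var_inv QP mW W0).
have mz := L1_meas (density_L1 QP).
pose h w := al^-1 * ((v 0 - v (- `|al * W w|)) + fine (Phi u (1 * density P Q w)) - v 0).
apply: (@L1_dom _ _ _ _ _ h); first exact: measurable_funM.
  by apply: L1Z; apply: L1B; [exact: L1D|exact: L1_cst].
apply: filterS3 W0 (density_ge0 QP) hG => w w0 z0 hg.
rewrite normrM !ger0_norm// /h ler_pdivlMl//.
have a0 : 0 <= al * W w by rewrite mulr_ge0// ltW.
have : v (- (al * W w)) + al * W w * density P Q w <= fine (Phi u (1 * density P Q w)).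
  have := Phi_ge (- (al * W w)) (1 * density P Q w).
  by rewrite {1}hg lee_fin mul1r mulNr opprK.
by rewrite (ger0_norm a0); lra.
Qed.

Variables (T : \bar R) (F : R -> set (set Omega)) (d : nat) (S : 'I_d -> @process R dO Omega).
Hypotheses (T_gt0 : (0 < T)%E) (filtF : is_filtration T F)
  (negl : forall N, P.-negligible N -> F 0 N) (cS : forall i, cadlag_adapted T F (S i))
  (hA2 : A2 P u).

Lemma gain_facts W k : terminal_gains P T F S (admissible P T F S W) k ->
  exists c H X, [/\ 0 < c, gain P T F S H X, k = terminal T X &
    {ae P, forall w t, date T t -> - (c * W w) <= X t w}].
Proof.
move=> [H [X' [[X [c [gX c0 lb]]] gX' ->]]]; exists c, H, X'; split => //.
have XX := stoch_int_unique T_gt0 filtF gX.1 gX'.1.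
by apply: filterS2 lb XX => w h1 h2 t dt; rewrite -h2// h1.
Qed.

Theorem weak_duality W k x lam Q : L_hat P u W -> {ae P, forall w, 0 <= W w} ->
  terminal_gains P T F S (admissible P T F S W) k -> 0 < lam ->
  M_sigma P T F S Q -> P_of P (Phi u) Q ->
  (\int[P]_w u (x + k w)%R <= dual_value P u x lam Q)%E.
Proof.
move=> hW W0 /gain_facts[c [H [X [c0 gX -> lb]]]] l0 [QP sig] hQ.
have iW : L1 Q (fun w => c * W w) by apply: L1Z; exact: L_hat_L1.
have cW0 : {ae P, forall w, 0 <= c * W w} by apply: filterS W0 => w w0; rewrite mulr_ge0// ltW.
have [iT eT] := terminal_mean T_gt0 filtF negl QP cS sig gX iW cW0 lb.
(* Condition (A2) provides finiteness at the scaled density lam dQ/dP. *)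
have : P_of P (fun y => Phi u (lam * y)) Q by rewrite -hA2.
move=> [_ hPhi].
have [iG hG eG] := Phi_L1 QP hPhi.
rewrite /dual_value eG -EFinD.
pose G w := fine (Phi u (lam * density P Q w)).
have [ik ek] := change_var QP iT.
have [i1 e1] := change_var QP (L1_cst Q x).
rewrite ex_cst in e1.
pose h w := G w + (lam * (x * density P Q w) + lam * (terminal T X w * density P Q w)).
have ih : L1 P h by apply: L1D => //; apply: L1D; exact: L1Z.
apply: (@le_trans _ _ (ex P h)%:E).
  apply: (integral_le_ex (g := fun w => v (x + terminal T X w))) => //.
    apply: (measurableT_comp v_measurable); apply: measurable_funD => //.
    by have [[_ cX _] tX] := gX; exact: (terminal_meas T_gt0 filtF negl).
  apply: filterS hG => w hg; have := Phi_ge (x + terminal T X w) (lam * density P Q w).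
  rewrite hg lee_fin /h /G; lra.
rewrite lee_fin /h exD//; last by apply: L1D; exact: L1Z.
rewrite exD; [|exact: L1Z|exact: L1Z].
rewrite (exZ _ i1) (exZ _ ik) e1 ek addrC lerD2r gerDl.
by rewrite pmulr_rle0.
Qed.

Corollary U_W_le_U_Phi W x : L_hat P u W -> {ae P, forall w, 0 <= W w} ->
  (U_W P T F S u W x <= U_Phi P T F S u x)%E.
Proof.
move=> hW W0; apply: le_ereal_inf_tmp => _ [lam [Q [l0 hM hP ->]]].
by apply: ge_ereal_sup => _ [k hk <-]; exact: weak_duality hW W0 hk l0 hM hP.
Qed.

End WeakDuality.

(** * Orthogonal measures are sigma-martingale measures *)

Section OrthogonalMeasure.
Context {R : realType} {dO : measure_display} {Omega : measurableType dO}.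
Variables (T : \bar R) (F : R -> set (set Omega)).
Hypotheses (T_gt0 : (0 < T)%E) (filtF : is_filtration T F).
Local Notation process := (@process R dO Omega).
Variables (P Q : probability Omega R).
Hypothesis QP : Q `<< P.
Local Notation F' := (augment Q F).
Variables (d : nat) (S : 'I_d -> process) (phi : process) (I : 'I_d -> process -> process) (W : Omega -> R).
Hypotheses (cS : forall i, cadlag_adapted T F (S i)) (bphi : bounded_predictable T F phi)
  (phi0 : forall t w, date T t -> 0 < phi t w)
  (hI : forall i, bounded_integral T P F (S i) (I i))
  (iW : L1 Q W) (bd : forall i, {ae P, forall w t, date T t -> `|I i phi t w| <= W w})
  (orth : forall i s t A, date T s -> date T t -> s <= t -> F s A ->
    ex Q (fun w => \1_A w * (I i phi t w - I i phi s w)) = 0).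

(** Orthogonality is known for events of F; an event of the augmented filtration agrees with one of
    F up to a Q-null set. *)
Lemma density_martingale i : martingale T Q F' (I i phi).
Proof.
have cM : cadlag_adapted T F (I i phi) by exact: (int_cadlag (hI i) bphi).
have iM t : date T t -> L1 Q (I i phi t).
  move=> dt; apply: (L1_dom _ iW); first by apply: (wrt_measurable filtF dt); exact: cM.2.
  by apply: filterS (ac_ae QP (bd i)) => w h; exact: h.
split; [exact: augment_cadlag|exact: iM|].
move=> s t A ds dt st F'A.
have [A' FA hA] := augment_version filtF ds F'A.
have mA : measurable A by exact: (filt_meas (augment_filtration Q filtF) ds F'A).
have mA' := filt_meas filtF ds FA.
have e r : date T r -> (\int[Q]_(w in A) (I i phi r w)%:E = (ex Q (fun w => \1_A' w * I i phi r w))%:E)%E.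
  move=> dr; have ir := iM r dr.
  rewrite -(@ex_eq _ _ _ Q (fun w => \1_A w * I i phi r w)).
  - rewrite ex_indE /Rintegral fineK//.
    by apply: (integrable_fin_num mA); apply: integrableS ir.
  - exact: L1_meas (L1_ind mA ir).
  - exact: L1_meas (L1_ind mA' ir).
  - apply: filterS hA => w h; congr (_ * _); rewrite !indicE; congr (_%:R).
    by congr nat_of_bool; apply/idP/idP; rewrite !inE => /h.
rewrite !e//; congr EFin; apply/eqP; rewrite -subr_eq0 -exB; try (apply: L1_ind => //; exact: iM).
by rewrite -[X in _ == X](orth i ds dt st FA); apply/eqP; congr ex; apply/funext => w; rewrite mulrBr.
Qed.

(** S is recovered by integrating 1 / phi against phi . S. Truncating 1 / phi at n misses the
    increments of S by the integral of [K n], the indicator of {1 / phi > n}. The Emery topology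
    asks for uniformity over test integrands: if a violating one is selected for each n, its product
    with [K n] still tends to 0 pointwise, and dominated convergence excludes violation for large
    n. *)
Theorem orthogonal_sigma_martingale : sigma_martingale T Q F' S.
Proof.
have filtF' := augment_filtration Q filtF; have d0 := date0 T_gt0.
(* A Borel function of phi that is defined everywhere and equals the inverse where phi is positive,
   in particular at all dates. *)
pose psi : process := fun t w => (phi t w) `^ (-1).
have psiE t w : date T t -> psi t w = (phi t w)^-1.
  by move=> dt; rewrite /psi powR_inv1// ltW// phi0.
have bphi' : bounded_predictable T F' phi by exact: augment_bp.
have ppsi : predictable T F' psi.
  by apply: (predictable_borel T_gt0 filtF' (f := fun x => x `^ (-1))); [exact: measurable_powR|exact: bphi'.1].
exists (fun i => I i phi), psi; split; first by move=> i; exact: density_martingale.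
split; first by move=> t w dt; rewrite powR_gt0// phi0.
move=> i; exists (fun t w => S i t w - S i 0 w); split; last first.
  by apply: nearW => w t dt; rewrite addrC subrK.
have cSi : cadlag_adapted T F' (S i) by exact: augment_cadlag.
have cS0 : cadlag_adapted T F' (fun _ w => S i 0 w).
  split; first by move=> w; split => [s _ _|s _ _]; [exact: cvg_cst|exact: is_cvg_cst].
  by move=> s ds; exact: (wrt_le filtF' d0 ds ds.1 (cSi.2 0 d0)).
have cX : cadlag_adapted T F' (fun t w => S i t w - S i 0 w) by exact: (cadlag_adaptedB filtF').
have [I' [hI' II']] := augment_integral T_gt0 filtF QP (hI i).
have hM : indist T Q (I' phi) (I i phi) by exact: II'.
have hJ : bounded_integral T Q F' (I i phi) (fun K => I' (fun t w => phi t w * K t w)).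
  have [j1 j2 j3 j4] := int_density T_gt0 filtF' hI' bphi'; split => //.
  move=> e he; apply: filterS2 (j2 e he) hM => w h1 h2 t dt; rewrite h1//.
  apply: eq_bigr => k _; have [_ _ /(_ k (ltn_ord k))[ds du _ _ _]] := he.
  have dmin r : date T r -> date T (Num.min r t).
    by move=> dr; apply: (date_le dt); [rewrite le_min dr.1 dt.1|rewrite ge_min lexx orbT].
  by rewrite !h2//; exact: dmin.
split => //; exists (fun _ K => I' (fun t w => phi t w * K t w)); split => //.
move=> t eps dt e0.
pose K n : process := fun t w => 1 - (psi t w ^+ 2 <= n%:R ^+ 2)%R%:R.
have b1 := bp_cst T_gt0 filtF' 1.
have K01 n t' w : `|K n t' w| <= 1.
  by rewrite /K; case: (psi t' w ^+ 2 <= _); rewrite /= ?mulr1n ?mulr0n ?subrr ?subr0 ?normr0 ?normr1.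
have pK n : predictable T F' (K n).
  apply: (predictable_borel T_gt0 filtF' (f := fun x => 1 - (x ^+ 2 <= n%:R ^+ 2)%R%:R)) => //.
  apply: measurable_funB => //.
  rewrite (_ : (fun x => _) = fun x : R => if x ^+ 2 <= n%:R ^+ 2 then 1 else 0); last first.
    by apply/funext => x; case: (_ <= _).
  by apply: measurable_fun_ifT => //; apply: measurable_fun_ler => //; exact: measurable_funX.
have bK n : bounded_predictable T F' (K n) by apply: bpP => // t' w _; exact: K01.
have K0 t' w : K n t' w @[n --> \oo] --> 0.
  apply: cvg_near_cst; near=> n; rewrite /K (_ : psi t' w ^+ 2 <= n%:R ^+ 2) ?subrr//.
  rewrite -[X in X <= _]real_normK ?num_real// ler_pXn2r ?nnegrE//.
  by near: n; exact: nbhs_infty_ger.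
have trE n t' w : date T t' -> phi t' w * truncate n (fun _ : 'I_1 => psi) ord0 t' w = 1 - K n t' w.
  move=> dt'; rewrite /truncate big_ord1 /K subKr; case: ifP => _; rewrite ?mulr0//.
  by rewrite psiE// mulfV// gt_eqF// phi0.
have hX n : indist T Q (fun t w => \sum_(j < 1) I' (fun t' w => phi t' w * truncate n (fun _ => psi) j t' w) t w -
    (S i t w - S i 0 w)) (fun t w => - I' (K n) t w).
  have bphit : bounded_predictable T F' (fun t w => phi t w * truncate n (fun _ : 'I_1 => psi) ord0 t w).
    by apply: (bpM T_gt0 filtF' bphi'); exact: (bp_truncate T_gt0 filtF' (fun _ => ppsi)).
  have g1 := int_congr T_gt0 filtF' hI' bphit (trE n).
  have g2 := intB hI' b1 (bK n).
  have g3 := int_one T_gt0 filtF' hI' cSi.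
  apply: filterS3 g1 g2 g3 => w h1 h2 h3 t' dt'.
  by rewrite big_ord1 -h1// h2// h3//; ring.
pose Z n : process := fun t w => \sum_(j < 1) I' (fun t' w => phi t' w * truncate n (fun _ => psi) j t' w) t w - (S i t w - S i 0 w).
pose E n e : set Omega := [set w | exists2 s, 0 <= s <= t & eps < `|Z n 0 w| + `|el_int (Z n) e s w|].
pose bad (n : nat) (e : @elementary R dO Omega) := [/\ elementary_integrand T F' e, (forall (s : R) (w : Omega), date T s -> `|el_val e s w| <= 1) &
  ~ (Q (E n e) <= eps%:E)%E].
pose e00 : @elementary R dO Omega := Elementary 0 (fun _ => 0) (fun _ => 0) (fun _ => 0) (fun _ _ => 0).
have he00 : elementary_integrand T F' e00.
  split => //; last by exists 0 => w; rewrite normr0.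
  by apply/(wrtP filtF' d0); exact: measurable_cst.
have be00 s w : `|el_val e00 s w| <= 1.
  by rewrite /el_val big_ord0 mul0r addr0 normr0.
(* A violating test integrand whenever there is one, and the zero integrand otherwise. *)
have /choice[e he] : forall n, exists e, [/\ elementary_integrand T F' e,
    (forall s w, date T s -> `|el_val e s w| <= 1) & (exists e', bad n e') -> bad n e].
  move=> n; have [[e' be']|nb] := pselect (exists e', bad n e').
    by exists e'; have [h1 h2 _] := be'.
  by exists e00; split => // /nb.
have he1 n : elementary_integrand T F' (e n) by have [] := he n.
have he2 n s w : date T s -> `|el_val (e n) s w| <= 1 by move=> ds; have [_ h _] := he n; exact: h.
pose L n : process := fun t w => K n t w * el_val (e n) t w.
have bL n : bounded_predictable T F' (L n).
  by apply: (bpM T_gt0 filtF' (bK n)); exact: (bp_el T_gt0 filtF' (he1 n)).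
have L0 t' w : date T t' -> L n t' w @[n --> \oo] --> 0.
  move=> dt'; apply: cvg_near_eq; have /cvgrPdist_lt/(_ _ ltr01) := K0 t' w.
  apply: filterS => n; rewrite sub0r normrN /L /K; case: (psi t' w ^+ 2 <= _); rewrite /= ?mulr1n ?mulr0n.
    by rewrite subrr mul0r.
  by rewrite subr0 normr1 ltxx.
have ucp : ucp_cvg T Q (fun n => I' (L n)) (I' (fun _ _ => 0)).
  apply: (int_dct hI' (c := 1 * 1)).
  - by move=> n; have [] := bL n.
  - by have [] := bp_cst T_gt0 filtF' 0.
  - by move=> n t' w dt'; rewrite normrM ler_pM//; exact: he2.
  - by move=> t' w dt'; exact: L0.
have cL n := int_cadlag hI' (bL n).
have cI0 := int_cadlag hI' (bp_cst T_gt0 filtF' 0).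
have e2 : 0 < eps / 2 by lra.
move/(ucpP filtF' Q cL cI0)/(_ t _ _ dt e2 e0) : ucp.
apply: filterS => n hn K' eK' bK'; apply: contrapT => nK'.
have [h1 h2 []] : bad n (e n) by have [_ _ h] := he n; apply: h; exists K'.
apply: le_trans hn.
have cZ : cadlag_adapted T F' (Z n).
  apply: (cadlag_adaptedB filtF') => //.
  apply: (cadlag_adapted_sum filtF' (X := fun j => I' (fun t' w => phi t' w * truncate n (fun _ : 'I_1 => psi) j t' w))) => j.
  apply: (int_cadlag hI'); apply: (bpM T_gt0 filtF' bphi').
  exact: (bp_truncate T_gt0 filtF' (fun _ => ppsi)).
apply: le_measure_ae.
- exact: (emery_measurable T_gt0 filtF' eps cZ h1 dt).
- exact: (far_measurable filtF' _ (cL n) cI0 dt).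
have a1 := int_assoc_el T_gt0 filtF' hI' (bK n) h1.
have a2 := int_start T_gt0 filtF' hI' (bK n).
have a3 := int0 T_gt0 filtF' hI'.
apply: filterS3 (filterI a1 a2) a3 (hX n : indist T Q (Z n) _) => w [g1 g2] g3 g4 [s st hs].
have ds : date T s by case/andP: st => s0 st; exact: date_le dt s0 st.
exists s => //; rewrite g3// subr0 g1//.
apply: lt_le_trans (_ : eps <= _); first lra.
apply: ltW; apply: lt_le_trans hs _.
have g40 : Z n 0 w = 0 by rewrite [LHS](g4 0 d0) g2 oppr0.
have g4' r : date T r -> Z n r w = - I' (K n) r w by move=> dr; exact: (g4 r dr).
rewrite g40 normr0 add0r le_eqVlt; apply/orP; left; apply/eqP.
rewrite -normrN; congr (`|_|); rewrite /el_int -sumrN; apply: eq_bigr => k _.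
have [_ _ /(_ k (ltn_ord k))[dsk duk _ _ _]] := h1.
have dmin r : date T r -> date T (Num.min r s).
  by move=> dr; apply: (date_le ds); [rewrite le_min dr.1 ds.1|rewrite ge_min lexx orbT].
rewrite (g4' _ (dmin _ duk)) (g4' _ (dmin _ dsk)); ring.
Unshelve. all: by end_near. Qed.

End OrthogonalMeasure.

(** * Attainment in the dual problem *)

Section HahnBanach.
Variables (R : realType) (V : lmodType R) (L D : set V) (C : V -> R).
Hypotheses (Llin : forall (a : R) f g, L f -> L g -> L (a *: f + g))
  (DL : D `<=` L) (D0 : D 0) (Dlin : forall (a : R) f g, D f -> D g -> D (a *: f + g))
  (C_convex : forall (t : R) f g, 0 <= t <= 1 -> L f -> L g ->
     C (t *: f + (1 - t) *: g) <= t * C f + (1 - t) * C g)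
  (C_D : forall f, D f -> 0 <= C f).

(** Graphs of partial linear functionals that are dominated by C and null on D. Single-valuedness
    follows from domination: two values at one point would put all multiples of their difference
    below [C 0]. The last clause is conditional so that the empty chain has a good union. *)
Let good (G : set (V * R)) := [/\
  forall z, G z -> L z.1 /\ z.2 <= C z.1,
  forall (a : R) z z', G z -> G z' -> G (a *: z.1 + z'.1, a * z.2 + z'.2) &
  G !=set0 -> forall f, D f -> G (f, 0)].

Let good_chain (A : set (set (V * R))) : A `<=` good -> total_on A subset ->
  good (\bigcup_(X in A) X).
Proof.
move=> Ag tot; split.
- by move=> z [X AX Xz]; have [h _ _] := Ag X AX; exact: h.
- move=> a z z' [X AX Xz] [Y AY Yz]; have [XY|YX] := tot X Y AX AY.
    by exists Y => //; have [_ h _] := Ag Y AY; apply: h => //; exact: XY.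
  by exists X => //; have [_ h _] := Ag X AX; apply: h => //; exact: YX.
- move=> [z [X AX Xz]] f Df; exists X => //; have [_ _ h] := Ag X AX; apply: h => //; by exists z.
Qed.

Section Extension.
Variables (G : set (V * R)) (f : V).
Hypotheses (gG : good G) (G0 : G (0, 0)) (Lf : L f).


(** With weights s / (s + s') and s' / (s + s') the multiples of f cancel; convexity of C plays the
    part of sublinearity in the classical extension step. *)
Lemma extension_bound (e e' : V) (a a' s s' : R) : G (e, a) -> G (e', a') -> 0 < s -> 0 < s' ->
  (a' - C (e' - s' *: f)) / s' <= (C (e + s *: f) - a) / s.
Proof.
move=> Ge Ge' s0 s0'; have [h1 h2 _] := gG.
have [Le _] := h1 _ Ge; have [Le' _] := h1 _ Ge'.
rewrite ler_pdivrMr// mulrAC ler_pdivlMr//.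
have ss : 0 < s + s' by rewrite addr_gt0.
pose t := s / (s + s'); have t01 : 0 <= t <= 1.
  by rewrite divr_ge0 ?(ltW s0) ?(ltW ss)//= ler_pdivrMr// mul1r lerDl ltW.
have t1 : 1 - t = s' / (s + s') by rewrite /t; field; rewrite gt_eqF.
have L1' : L (e' - s' *: f) by rewrite addrC -scaleNr; exact: Llin.
have L2' : L (e + s *: f) by rewrite addrC; exact: Llin.
have cv := C_convex t01 L1' L2'.
have G0' := h2 t _ _ Ge' G0; have G1 := h2 (1 - t) _ _ Ge G0'.
have [_] := h1 _ G1; rewrite /= !addr0 => hG.
have E : (1 - t) *: e + t *: e' = t *: (e' - s' *: f) + (1 - t) *: (e + s *: f).
  rewrite scalerBr scalerDr !scalerA t1.
  have -> : t * s' = s' / (s + s') * s by rewrite /t; ring.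
  by rewrite addrACA addNr addr0 addrC.
rewrite E in hG; have := le_trans hG cv; rewrite t1 /t => h.
have := ler_wpM2r (ltW ss) h; rewrite !mulrDl.
have k (p q : R) : p / (s + s') * q * (s + s') = p * q by field; rewrite gt_eqF.
by rewrite !k; lra.
Qed.

End Extension.

Theorem convex_hahn_banach : exists m : V -> R,
  [/\ forall (a : R) f g, L f -> L g -> m (a *: f + g) = a * m f + m g,
      forall f, L f -> m f <= C f & forall f, D f -> m f = 0].
Proof.
have [G [gG Gmax]] := Zorn_bigcup good_chain.
have [h1 h2 h3] := gG.
have Gne : G !=set0.
  apply/set0P/negP => /eqP G0.
  pose D' : set (V * R) := [set z | D z.1 /\ z.2 = 0].
  apply: (Gmax D'); first by rewrite G0; split; [exact: sub0set|move=> /(_ (0, 0)) h; apply: h].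
  split.
  - by move=> [f a] [/= Df ->]; split; [exact: DL|exact: C_D].
  - by move=> a [f b] [g c] [/= Df ->] [/= Dg ->]; split => /=; [exact: Dlin|rewrite mulr0 addr0].
  - by move=> _ f Df.
have GD f : D f -> G (f, 0) by exact: h3.
have G00 := GD 0 D0.
have Gfun f a b : G (f, a) -> G (f, b) -> a = b.
  move=> Ga Gb; have := h2 (-1) _ _ Gb Ga; rewrite /= scaleN1r addNr mulN1r => G1.
  have hs (s : R) : s * (a - b) <= C 0.
    have := h2 s _ _ G1 G00; rewrite /= scaler0 !addr0 addrC => /h1[_ /=].
    by apply: le_trans; rewrite [a - b]addrC.
  apply/eqP; rewrite -subr_eq0; apply/negPn/negP => ab.
  have := hs ((C 0 + 1) / (a - b)); rewrite divfK//; lra.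
have Gdom f : L f -> exists a, G (f, a).
  move=> Lf; apply: contrapT => nf.
  (* Lower bounds on the possible values at f; their supremum t stays below all upper bounds, so it
     is a valid value. *)
  pose E := [set y | exists e a s, [/\ G (e, a), 0 < s & y = (a - C (e - s *: f)) / s]].
  have bound e a s : G (e, a) -> 0 < s -> forall y, E y -> y <= (C (e + s *: f) - a) / s.
    move=> Ge s0 _ [e' [a' [s' [Ge' s0' ->]]]]; exact: extension_bound gG G00 Lf _ _ _ _ _ _ Ge Ge' s0 s0'.
  have hE : has_sup E.
    split; first by exists ((0 - C (0 - 1 *: f)) / 1), 0, 0, 1; split.
    by exists ((C (0 + 1 *: f) - 0) / 1) => y; apply: bound.
  pose t := sup E.
  have lo e a s : G (e, a) -> 0 < s -> (a - C (e - s *: f)) / s <= t.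
    by move=> Ge s0; apply: ub_le_sup; [exact: hE.2|exists e, a, s].
  have up e a s : G (e, a) -> 0 < s -> t <= (C (e + s *: f) - a) / s.
    by move=> Ge s0; apply: ge_sup; [exact: hE.1|move=> y; exact: bound].
  pose B : set (V * R) := [set z | exists e a s, G (e, a) /\ z = (e + s *: f, a + s * t)].
  apply: (Gmax B).
    split; first by move=> [e a] Ge; exists e, a, 0; rewrite scale0r mul0r !addr0.
    move=> /(_ (0 + 1 *: f, 0 + 1 * t)) h; apply: nf; exists (0 + 1 * t).
    by rewrite -[f]scale1r -[1 *: f]add0r; apply: h; exists 0, 0, 1.
  split.
  - move=> _ [e [a [s [Ge ->]]]] /=; have [Le ae] := h1 _ Ge.
    split; first by rewrite addrC; exact: Llin.
    have [s0|s0|->] := ltgtP s 0; last by rewrite scale0r mul0r !addr0.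
      have ns : 0 < - s by rewrite oppr_gt0.
      have := lo e a (- s) Ge ns; rewrite ler_pdivrMr// scaleNr opprK; lra.
    have := up e a s Ge s0; rewrite ler_pdivlMr//; lra.
  - move=> c _ _ [e [a [s [Ge ->]]]] [e' [a' [s' [Ge' ->]]]] /=.
    exists (c *: e + e'), (c * a + a'), (c * s + s'); split; first exact: (h2 c _ _ Ge Ge').
    congr (_, _); last by ring.
    by rewrite scalerDr scalerDl scalerA addrACA.
  - move=> _ g Dg; exists g, 0, 0; split; first exact: GD.
    by rewrite scale0r mul0r !addr0.
have /choice[m hm] : forall f, exists a, L f -> G (f, a).
  by move=> f; have [/Gdom[a Ga]|nL] := pselect (L f); [exists a|exists 0].
exists m; split.
- move=> a f g Lf Lg; apply: (Gfun (a *: f + g)); first by apply: hm; exact: Llin.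
  exact: (h2 a _ _ (hm f Lf) (hm g Lg)).
- by move=> f Lf; have [_] := h1 _ (hm f Lf).
- by move=> f Df; apply: (Gfun f); [exact: hm (DL Df)|exact: GD].
Qed.

End HahnBanach.

Corollary hahn_banach_fun (R : realType) (X : Type) (L D : set (X -> R)) (C : (X -> R) -> R) :
  (forall (a : R) f g, L f -> L g -> L (fun w => a * f w + g w)) ->
  D `<=` L -> D (fun _ => 0) -> (forall (a : R) f g, D f -> D g -> D (fun w => a * f w + g w)) ->
  (forall (t : R) f g, 0 <= t <= 1 -> L f -> L g ->
     C (fun w => t * f w + (1 - t) * g w) <= t * C f + (1 - t) * C g) ->
  (forall f, D f -> 0 <= C f) -> exists m : (X -> R) -> R,
  [/\ forall (a : R) f g, L f -> L g -> m (fun w => a * f w + g w) = a * m f + m g,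
      forall f, L f -> m f <= C f & forall f, D f -> m f = 0].
Proof. exact: (@convex_hahn_banach R (X -> R^o) L D C). Qed.

Section ProbabilityOf.
Context {R : realType} {dO : measure_display} {Omega : measurableType dO}.
Variable q : set Omega -> \bar R.
Hypotheses (q0 : q set0 = 0%E) (q_ge0 : forall A, (0 <= q A)%E) (q_sigma : semi_sigma_additive q)
  (qT : q setT = 1%E).

Lemma probability_of : exists Q : probability Omega R, forall A, Q A = q A.
Proof.
pose m1 := isMeasure.Build _ _ _ q q0 q_ge0 q_sigma.
pose mu : {measure set Omega -> \bar R} := HB.pack q m1.
have muT : mu setT = 1%E by exact: qT.
pose m2 := Measure_isProbability.Build _ _ _ mu muT.
pose Q : probability Omega R := HB.pack q m1 m2.
by exists Q.
Qed.

End ProbabilityOf.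

(** * Representation of an order continuous positive functional *)

Section FunctionalMeasure.
Context {R : realType} {dO : measure_display} {Omega : measurableType dO}.
Variables (P : probability Omega R) (W : Omega -> R) (l : (Omega -> R) -> R).
Hypothesis (W1 : {ae P, forall w, 1 <= W w}).

Definition dominated_by : set (Omega -> R) := [set f : Omega -> R | measurable_fun setT f /\
  exists c : R, {ae P, forall w, `|f w| <= c * W w}].
Local Notation L := dominated_by.
Implicit Types f g : Omega -> R.

Hypotheses
  (l_lin : forall (a : R) f g, L f -> L g -> l (fun w => a * f w + g w) = a * l f + l g)
  (l_ge0 : forall f, L f -> {ae P, forall w, 0 <= f w} -> 0 <= l f)
  (l_cont : forall (f : nat -> Omega -> R) c, (forall n, measurable_fun setT (f n)) ->
     (forall n, {ae P, forall w, `|f n w| <= c * W w}) ->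
     {ae P, forall w, f n w @[n --> \oo] --> (0 : R)} -> l (f n) @[n --> \oo] --> (0 : R))
  (l1_gt0 : 0 < l (fun _ => 1)).

Lemma dominated_by_lin (a : R) f g : L f -> L g -> L (fun w => a * f w + g w).
Proof.
move=> [mf [c hc]] [mg [c' hc']]; split; first by apply: measurable_funD => //; exact: measurable_funM.
exists (`|a| * c + c'); apply: filterS2 hc hc' => w h1 h2.
apply: le_trans (ler_normD _ _) _; rewrite normrM mulrDl; apply: lerD => //.
by rewrite -mulrA ler_wpM2l.
Qed.

Lemma dominated_by_bounded f b : measurable_fun setT f -> (forall w, `|f w| <= b) -> L f.
Proof.
move=> mf fb; split => //; exists `|b|; apply: filterS W1 => w w1.
apply: le_trans (fb w) _; apply: le_trans (ler_norm b) _; by rewrite ler_peMr.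
Qed.

Lemma dominated_by_cst c : L (fun _ => c).
Proof. by apply: (@dominated_by_bounded _ `|c|). Qed.

Let lZ a f : L f -> l (fun w => a * f w) = a * l f.
Proof.
move=> Lf; have := l_lin a Lf (dominated_by_cst 0).
have l0 : l (fun _ => 0) = 0.
  have := l_lin (-1) (dominated_by_cst 0) (dominated_by_cst 0).
  by under eq_fun do rewrite mulr0 addr0; rewrite mulN1r addNr.
by under eq_fun do rewrite addr0; rewrite l0 addr0.
Qed.

Let l0 : l (fun _ => 0) = 0.
Proof. by have := lZ 0 (dominated_by_cst 0); under eq_fun do rewrite mul0r; rewrite mul0r. Qed.

Let LZ a f : L f -> L (fun w => a * f w).
Proof. by move=> Lf; have := dominated_by_lin a Lf (dominated_by_cst 0); under eq_fun do rewrite addr0. Qed.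

Let LD f g : L f -> L g -> L (fun w => f w + g w).
Proof. by move=> Lf Lg; have := dominated_by_lin 1 Lf Lg; under eq_fun do rewrite mul1r. Qed.

Let lD f g : L f -> L g -> l (fun w => f w + g w) = l f + l g.
Proof. by move=> Lf Lg; have := l_lin 1 Lf Lg; under eq_fun do rewrite mul1r; rewrite mul1r. Qed.

Let LB f g : L f -> L g -> L (fun w => f w - g w).
Proof. by move=> Lf Lg; have := LD Lf (LZ (-1) Lg); under eq_fun do rewrite mulN1r. Qed.

Let lB f g : L f -> L g -> l (fun w => f w - g w) = l f - l g.
Proof.
move=> Lf Lg; have := lD Lf (LZ (-1) Lg); rewrite lZ// mulN1r => <-.
by congr l; apply/funext => w; rewrite mulN1r.
Qed.

Let l_le f g : L f -> L g -> {ae P, forall w, f w <= g w} -> l f <= l g.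
Proof.
move=> Lf Lg h; rewrite -subr_ge0 -lB//; apply: l_ge0; first exact: LB.
by apply: filterS h => w; rewrite subr_ge0.
Qed.

Let L_ind A : measurable A -> L \1_A.
Proof.
move=> mA; apply: (@dominated_by_bounded _ 1); first exact: measurable_indic.
by move=> w; rewrite indicE; case: (_ \in _); rewrite ?normr1 ?normr0.
Qed.

Let LL_sum n (f : 'I_n -> Omega -> R) : (forall i, L (f i)) ->
  L (fun w => \sum_(i < n) f i w) /\ l (fun w => \sum_(i < n) f i w) = \sum_(i < n) l (f i).
Proof.
elim: n f => [|n ih] f h.
  by under eq_fun do rewrite big_ord0; rewrite big_ord0 l0; split => //; exact: dominated_by_cst.
have [h1 h2] := ih (fun i => f (widen_ord (leqnSn n) i)) (fun i => h _).
under eq_fun do rewrite big_ord_recr/=.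
by split; [exact: LD|rewrite lD// h2 big_ord_recr].
Qed.

(** The value 0 on nonmeasurable sets makes nonnegativity hold for every set, as the construction of
    the probability asks. *)
Let q (A : set Omega) : \bar R := (if `[< measurable A >] then l \1_A / l (fun _ => 1) else 0)%:E.

Let qE A : measurable A -> q A = (l \1_A / l (fun _ => 1))%:E.
Proof. by move=> mA; rewrite /q asboolT. Qed.

Let q_sigma : semi_sigma_additive q.
Proof.
move=> F mF tF mU.
have sE n : (\sum_(0 <= i < n) q (F i))%E = (l (fun w => \sum_(i < n) \1_(F i) w) / l (fun _ => 1))%:E.
  rewrite (LL_sum (f := fun i : 'I_n => \1_(F i)) (fun i => L_ind (mF i))).2 mulr_suml -sumEFin big_mkord.
  by apply: eq_bigr => i _; exact: qE.
rewrite qE// (eq_cvg _ _ sE); apply: cvg_EFin; first exact: nearW.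
apply: cvgM; last exact: cvg_cst.
pose g n w : R := \1_(\bigcup_n F n) w - \sum_(i < n) \1_(F i) w.
have Ls n : L (fun w => \sum_(i < n) \1_(F i) w).
  exact: (LL_sum (f := fun i : 'I_n => \1_(F i)) (fun i => L_ind (mF i))).1.
have LU := L_ind mU.
have sum1 n w : \sum_(i < n) \1_(F i) w = \1_(\big[setU/set0]_(i < n) F i) w :> R.
  elim: n => [|n ih]; first by rewrite !big_ord0 indicE in_set0.
  rewrite !big_ord_recr/= ih !indicE in_setU.
  case: (boolP (w \in F n)) => [wn|_]; last by rewrite orbF addr0.
  rewrite orbT (_ : (w \in \big[setU/set0]_(i < n) F i) = false) ?add0r//.
  apply/negP; rewrite inE -bigcup_mkord => -[k /= kn Fk].
  have : k = n by apply: (tF k n) => //; exists w; split => //; exact: set_mem.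
  by move: kn => /[swap] ->; rewrite ltnn.
have gE n w : g n w = \1_(\bigcup_k F k `\` \big[setU/set0]_(i < n) F i) w.
  rewrite /g sum1 !indicE in_setD.
  have sub : (w \in \big[setU/set0]_(i < n) F i) -> (w \in \bigcup_k F k).
    by rewrite !inE -bigcup_mkord => -[k _ Fk]; exists k.
  by case: (boolP (w \in \big[setU/set0]_(i < n) F i)) sub => [_ /(_ isT) ->|_ _]; rewrite ?subrr ?andbF// subr0 andbT.
have mg n : measurable_fun setT (g n) by exact: (LB LU (Ls n)).1.
have gb n w : `|g n w| <= 1 by rewrite gE indicE; case: (_ \in _); rewrite ?normr1 ?normr0.
have gc : l (g n) @[n --> \oo] --> (0 : R).
  apply: (l_cont (c := 1)) => //.
    by move=> n; apply: filterS W1 => w w1; rewrite mul1r; exact: le_trans w1.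
  apply: nearW => w; apply: cvg_near_cst.
  have [[k _ Fk]|nU] := pselect ((\bigcup_n F n) w).
    exists k.+1 => // n /= kn; rewrite gE indicE memNset// => -[_ nw]; apply: nw.
    by rewrite -bigcup_mkord; exists k.
  by apply: nearW => n; rewrite gE indicE memNset// => -[].
have -> : (fun n => l (fun w => \sum_(i < n) \1_(F i) w)) = (fun n => l \1_(\bigcup_n F n) - l (g n)).
  by apply/funext => n; rewrite /g lB// subKr.
by rewrite -[X in _ --> X]subr0; apply: cvgB => //; exact: cvg_cst.
Qed.

(** Order continuity on tails of disjoint unions gives sigma-additivity. The identity reaches
    bounded functions by uniform step approximation, and unbounded positive ones because f - min n f
    is dominated by the same multiple of W and tends to 0. *)
Theorem functional_measure : exists2 Q : probability Omega R, Q `<< P &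
  forall f, L f -> L1 Q f /\ l f = l (fun _ => 1) * ex Q f.
Proof.
have i1 : (\1_[set: Omega] : Omega -> R) = (fun _ => 1) by apply/funext => w; rewrite indicE in_setT.
have [||||Q hQ] := @probability_of _ _ _ q.
- by rewrite qE// indic0 l0 mul0r.
- move=> A; rewrite /q lee_fin; case: asboolP => // mA; rewrite divr_ge0 ?(ltW l1_gt0)//.
  by apply: l_ge0; [exact: L_ind|exact: nearW].
- exact: q_sigma.
- by rewrite qE// i1 divff// gt_eqF.
have indE A : measurable A -> l \1_A = l (fun _ => 1) * ex Q \1_A.
  move=> mA; have -> : ex Q \1_A = fine (Q A).
    by rewrite /ex /Rintegral; under eq_integral do rewrite -[(\1_A _)%:E]/((EFin \o \1_A) _); rewrite integral_indic// setIT.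
  by rewrite hQ qE//= mulrC divfK// gt_eqF.
exists Q.
  apply/null_content_dominatesP => A mA A0; rewrite hQ qE//; congr EFin.
  have -> : l \1_A = 0; last by rewrite mul0r.
  apply/eqP; rewrite eq_le; apply/andP; split; last by apply: l_ge0; [exact: L_ind|exact: nearW].
  rewrite -l0; apply: l_le; [exact: L_ind|exact: dominated_by_cst|].
  exists A; split => // w /= h; apply: contrapT => nA; apply: h.
  by rewrite indicE memNset.
have bdd f b : measurable_fun setT f -> (forall w, `|f w| <= b) -> l f = l (fun _ => 1) * ex Q f.
  move=> mf fb; have Lf := dominated_by_bounded mf fb; have if_ := L1_bound Q mf fb.
  apply/eqP; rewrite -subr_eq0 -normr_le0; apply/ler_addgt0Pr => e e0; rewrite add0r.
  (* The step approximation costs lam / (m + 1) once in l and once in lam times the expectation; m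
     makes the sum at most e. *)
  pose lam := l (fun _ => 1); pose m := Num.truncn (2 * lam / e).
  have [N [r near]] := step_approx m fb.
  pose A (j : nat) := f @^-1` `[r j, +oo[%classic.
  have mA j : measurable (A j) by rewrite -[A j]setTI; exact: mf.
  pose Sm w : R := \sum_(j < N) \1_(A j) w.
  have [LS lS] := LL_sum (f := fun j : 'I_N => \1_(A j)) (fun j => L_ind (mA j)).
  have iA j : L1 Q \1_(A j) by apply: (@L1_bound _ _ _ _ _ 1); [exact: measurable_indic|move=> w; rewrite indicE; case: (_ \in _); rewrite ?normr1 ?normr0].
  have iS : L1 Q Sm by apply: L1_sum.
  have eS : l Sm = lam * ex Q Sm.
    rewrite /Sm lS ex_sum// mulr_sumr; apply: eq_bigr => j _; exact: indE.
  pose g w := m.+1%:R^-1 * Sm w - b.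
  have Lg : L g by apply: LB; [exact: LZ|exact: dominated_by_cst].
  have ig : L1 Q g by apply: L1B; [exact: L1Z|exact: L1_cst].
  have lc (c : R) : l (fun _ => c) = lam * c.
    by have := lZ c (dominated_by_cst 1); under eq_fun do rewrite mulr1; rewrite mulrC.
  have eg : l g = lam * ex Q g.
    rewrite /g lB; [|exact: LZ|exact: dominated_by_cst].
    by rewrite lZ// eS lc exB; [rewrite exZ// ex_cst; ring|exact: L1Z|exact: L1_cst].
  have h1 : `|l f - l g| <= lam * m.+1%:R^-1.
    rewrite -lB// ler_norml -mulrN -!lc; apply/andP; split; apply: l_le; (try exact: LB); (try exact: dominated_by_cst);
      by apply: nearW => w; have := near w; rewrite ler_norml => /andP[].
  have h2 : `|ex Q f - ex Q g| <= m.+1%:R^-1.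
    rewrite -exB//; apply: le_trans (norm_ex (L1B if_ ig)) _.
    rewrite -[leRHS](ex_cst Q); apply: ex_le; [exact: L1_norm (L1B if_ ig)|exact: L1_cst|].
    by apply: nearW => w; exact: near.
  have -> : l f - lam * ex Q f = (l f - l g) + lam * (ex Q g - ex Q f) by rewrite eg; ring.
  apply: le_trans (ler_normD _ _) _.
  have h3 : `|lam * (ex Q g - ex Q f)| <= lam * m.+1%:R^-1.
    by rewrite normrM (gtr0_norm l1_gt0) ler_wpM2l ?(ltW l1_gt0)// distrC.
  apply: le_trans (lerD h1 h3) _; rewrite -mulr2n -[leLHS]mulr_natl mulrA.
  rewrite ler_pdivrMr// -ler_pdivrMl// mulrC ltW//; exact: truncnS_gt.
have pos f : L f -> (forall w, 0 <= f w) -> L1 Q f /\ l f = l (fun _ => 1) * ex Q f.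
  move=> Lf f0; have [mf [c hc]] := Lf.
  pose fn (n : nat) w := Num.min n%:R (f w).
  have fn0 n w : 0 <= fn n w by rewrite le_min ler0n f0.
  have fnn n w : `|fn n w| <= n%:R by rewrite ger0_norm// ge_min lexx.
  have fnf n w : fn n w <= f w by rewrite ge_min lexx orbT.
  have mfn n : measurable_fun setT (fn n) by exact: measurable_minr.
  have Lfn n : L (fn n) := dominated_by_bounded (mfn n) (fnn n).
  have ifn n : L1 Q (fn n) := L1_bound Q (mfn n) (fnn n).
  have efn n := bdd _ _ (mfn n) (fnn n).
  have cf w : fn n w @[n --> \oo] --> f w.
    apply: cvg_near_cst; near=> n; rewrite /fn min_r//; near: n; exact: nbhs_infty_ger.
  have if_ : L1 Q f.
    apply: (ex_fatou (c := l f / l (fun _ => 1)) ifn mf _ _ _).1.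
    - exact: nearW.
    - move=> n; rewrite ler_pdivlMr// mulrC -efn; apply: l_le => //; exact: nearW.
    - exact: nearW.
  split => //.
  have bfn : {ae Q, forall w n, `|fn n w| <= f w} by apply: nearW => w n; rewrite ger0_norm.
  have afn : {ae Q, forall w, fn n w @[n --> \oo] --> f w} by exact: nearW.
  have [_ e1] := ex_dct mfn mf if_ bfn afn.
  have e2 : l (fun w => f w - fn n w) @[n --> \oo] --> (0 : R).
    apply: (l_cont (c := c)).
    - by move=> n; exact: measurable_funB.
    - move=> n; apply: filterS hc => w; apply: le_trans.
      by rewrite !ger0_norm ?subr_ge0// gerBl.
    - by apply: nearW => w; rewrite -(subrr (f w)); apply: cvgB; [exact: cvg_cst|exact: cf].
  have e3 : l f - l (fn n) @[n --> \oo] --> (0 : R).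
    by apply: cvg_trans e2; apply: near_eq_cvg; apply: nearW => n; rewrite lB.
  have e4 : l f - l (fn n) @[n --> \oo] --> l f - l (fun _ => 1) * ex Q f.
    apply: cvgB; first exact: cvg_cst.
    under eq_fun do rewrite efn; apply: cvgM => //; exact: cvg_cst.
  apply/eqP; rewrite -subr_eq0; apply/eqP.
  by rewrite -(cvg_lim (@Rhausdorff R) e4) (cvg_lim (@Rhausdorff R) e3).
move=> f Lf; have [mf [c hc]] := Lf.
pose fp w := Num.max 0 (f w); pose fm w := Num.max 0 (- f w).
have fE w : f w = fp w - fm w.
  by rewrite /fp /fm; case: (leP 0 (f w)) => h; [rewrite (@max_l _ _ 0)|rewrite max_r]; lra.
have Lp : L fp.
  split; first by apply: measurable_maxr.
  exists c; apply: filterS hc => w; apply: le_trans.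
  by rewrite /fp; case: (leP 0 (f w)) => h; rewrite ?normr0.
have Lm : L fm.
  split; first by apply: measurable_maxr => //; exact: measurableT_comp.
  exists c; apply: filterS hc => w; apply: le_trans.
  by rewrite /fm; case: (leP 0 (- f w)) => h; rewrite ?normr0// normrN.
have [p1 p2] := pos _ Lp (fun w => ltac:(by rewrite le_max lexx)).
have [q1 q2] := pos _ Lm (fun w => ltac:(by rewrite le_max lexx)).
have -> : f = (fun w => fp w - fm w) by exact/funext.
by split; [exact: L1B|rewrite lB// exB// p2 q2; ring].
Unshelve. all: by end_near. Qed.

End FunctionalMeasure.

(** * Measurable near-maximizers for the conjugate *)

Section Conjugate.
Context {R : realType}.
Variable v : R -> R.
Hypothesis v_cont : continuous v.
Local Notation u := (EFin \o v).

(** An enumeration of the rationals preceded by 0: the first candidate provides the lower bound v 0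
    for all approximations. *)
Definition ratseq (n : nat) : R := if n is n'.+1 then (if unpickle n' is Some q then ratr q else 0) else 0.

(** The best of the first n + 1 candidates, replaced only on strict improvement. It is a bounded
    Borel function of y, hence it can be fed to a functional defined on dominated variables. *)
Fixpoint maximizer (n : nat) (y : R) : R :=
  if n is n'.+1 then
    (if v (maximizer n' y) - maximizer n' y * y < v (ratseq n) - ratseq n * y then ratseq n
     else maximizer n' y)
  else 0.

Definition conj_approx n y := v (maximizer n y) - maximizer n y * y.

Lemma conj_approx_nd y : nondecreasing_seq (conj_approx ^~ y).
Proof.
apply/nondecreasing_seqP => n; rewrite /conj_approx /=.
by case: ifP => // /ltW.
Qed.

Lemma conj_approx_ge n y k : (k <= n)%N -> v (ratseq k) - ratseq k * y <= conj_approx n y.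
Proof.
move=> kn; apply: le_trans (conj_approx_nd y kn); rewrite /conj_approx.
by case: k {kn} => [|k] //=; case: ltP.
Qed.

Lemma maximizer_bound n : exists b, forall y, `|maximizer n y| <= b.
Proof.
elim: n => [|n [b hb]]; first by exists 0 => y; rewrite normr0.
exists (Num.max b `|ratseq n.+1|) => y /=; case: ifP => _; rewrite le_max ?lexx ?orbT//.
by rewrite hb.
Qed.

Lemma maximizer_measurable n : measurable_fun setT v -> measurable_fun setT (maximizer n).
Proof.
move=> mv; elim: n => [|n ih]; first exact: measurable_cst.
apply: measurable_fun_ifT => //; apply: measurable_fun_ltr.
  by apply: measurable_funB; [exact: (measurableT_comp mv)|exact: measurable_funM].
by apply: measurable_funB => //; exact: measurable_funM.
Qed.

(** By continuity of v the supremum over the reals is already reached over the rationals. *)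
Lemma conj_approx_cvg y : (conj_approx n y)%:E @[n --> \oo] --> Phi u y.
Proof.
have nd : nondecreasing_seq (fun n => (conj_approx n y)%:E).
  by move=> m n mn; rewrite lee_fin; exact: conj_approx_nd.
suff -> : Phi u y = ereal_sup (range (fun n => (conj_approx n y)%:E)).
  exact: ereal_nondecreasing_cvgn.
apply/eqP; rewrite eq_le; apply/andP; split; last first.
  by apply: ge_ereal_sup => _ [n _ <-]; exact: Phi_ge.
apply: ge_ereal_sup => _ [x _ <-]; rewrite /= -EFinB.
apply/lee_addgt0Pr => e e0; rewrite -leeBlDr//.
have cx : (v q - q * y) @[q --> x] --> v x - x * y.
  by apply: cvgB; [exact: v_cont|apply: cvgM; [exact: cvg_id|exact: cvg_cst]].
have /cvgrPdist_lt/(_ _ e0) := cx => /nbhs_ballP[dl dl0 hdl].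
have dl0' : 0 < dl := dl0.
have [q] := @rat_in_itvoo R x (x + dl) ltac:(by rewrite ltrDl).
rewrite in_itv/= => /andP[q1 q2].
have := hdl (ratr q) ltac:(rewrite /ball/= ltr_norml; apply/andP; split; lra).
rewrite ltr_norml => /andP[_ h].
have [k kE] : exists k, ratseq k = ratr q by exists (pickle q).+1; rewrite /ratseq pickleK.
apply: (@le_trans _ _ (conj_approx k y)%:E); last by apply: ereal_sup_ubound; exists k.
rewrite -EFinB lee_fin; have := @conj_approx_ge k y k (leqnn k); rewrite kE; lra.
Qed.

End Conjugate.

(** * The dual functional and attainment *)

Section DualAttainment.
Context {R : realType} {dO : measure_display} {Omega : measurableType dO}.
Variables (P : probability Omega R) (v : R -> R) (W : Omega -> R) (D : set (Omega -> R)) (x V : R).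
Local Notation u := (EFin \o v).
Local Notation L := (dominated_by P W).
Hypotheses (mono : {homo v : x y / x <= y}) (v_cont : continuous v)
  (concave : forall x y t, 0 <= t <= 1 -> t * v x + (1 - t) * v y <= v (t * x + (1 - t) * y))
  (W_M : M_hat P u W) (W1 : {ae P, forall w, 1 <= W w})
  (DL : D `<=` L) (D0 : D (fun _ => 0))
  (Dlin : forall (a : R) f g, D f -> D g -> D (fun w => a * f w + g w))
  (DV : forall k, D k -> ex P (fun w => v (x + k w)) <= V) (Vlt : exists y, V < v y).

Let mW : measurable_fun setT W. Proof. by have [] := W_M. Qed.
Let mv : measurable_fun setT v. Proof. exact: v_measurable. Qed.

Lemma M_hat_L1 al : 0 < al -> L1 P (fun w => v 0 - v (- `|al * W w|)).
Proof.
move=> al0; have [_ hW] := W_M.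
have mu : measurable_fun setT (fun w => v 0 - v (- `|al * W w|)).
  apply: measurable_funB => //; apply: (measurableT_comp mv).
  by apply: measurableT_comp => //; apply: measurableT_comp => //; exact: measurable_funM.
have [|||i1 _ _] := @L1_of_lt _ _ _ P (fun w => (v 0 - v (- `|al * W w|))%:E) 0.
- exact/measurable_EFinP.
- by move=> w; rewrite lee_fin subr_ge0; apply: mono; rewrite oppr_le0.
- have := hW al al0; congr (_ < _)%E; apply: eq_integral => w _.
  by rewrite -[LHS]/((- v (- `|al * W w|) + v 0)%:E); congr EFin; ring.
exact: i1.
Qed.

(** Midpoint concavity between a and - a bounds the gain v a - v 0 by the loss v 0 - v (- a), so the
    Orlicz condition on losses controls both tails. *)
Lemma utility_bound (a y : R) : `|y| <= a -> `|v y - v 0| <= v 0 - v (- a).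
Proof.
move=> ya; have := concave a (- a) (t := 2^-1) ltac:(lra).
have -> : 2^-1 * a + (1 - 2^-1) * - a = 0 by field.
move: ya; rewrite ler_norml => /andP[y1 y2] h.
have h1 := mono y1; have h2 := mono y2.
by rewrite ler_norml; apply/andP; split; lra.
Qed.

Lemma dominated_utility (c : R) (f : Omega -> R) : measurable_fun setT f -> {ae P, forall w, `|f w| <= c * W w} ->
  {ae P, forall w, `|v (x + f w)| <= `|v 0| + (v 0 - v (- `|(`|x| + `|c| + 1) * W w|))}.
Proof.
move=> mf; apply: filterS2 W1 => w w1 hf.
have -> : v (x + f w) = v 0 + (v (x + f w) - v 0) by ring.
apply: le_trans (ler_normD _ _) _; rewrite lerD2l; apply: utility_bound.
apply: le_trans (ler_norm _); apply: le_trans (ler_normD _ _) _.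
have := ler_norm (c * W w); rewrite normrM (ger0_norm (le_trans ler01 w1)) => h1.
have : `|x| <= `|x| * W w by rewrite ler_peMr.
by rewrite !mulrDl mul1r; lra.
Qed.

Lemma utility_L1 f : L f -> L1 P (fun w => v (x + f w)).
Proof.
move=> [mf [c hc]]; have al0 : 0 < `|x| + `|c| + 1 by rewrite ltr_pwDr// addr_ge0.
apply: (L1_dom _ _ (dominated_utility mf hc)).
  by apply: (measurableT_comp mv); exact: measurable_funD.
by apply: L1D; [exact: L1_cst|exact: M_hat_L1].
Qed.

Let J f := ex P (fun w => v (x + f w)).

Let V_ge : v x <= V.
Proof. by have := DV D0; under eq_fun do rewrite addr0; rewrite ex_cst. Qed.

(** Hahn-Banach for V - E[u(x + f)], which is convex in f and nonnegative on D; the sign of the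
    functional is reversed at the end. *)
Lemma dual_functional : exists l : (Omega -> R) -> R,
  [/\ forall (a : R) f g, L f -> L g -> l (fun w => a * f w + g w) = a * l f + l g,
    forall f, L f -> J f <= V + l f & forall k, D k -> l k = 0].
Proof.
have [||m [m1 m2 m3]] := @hahn_banach_fun R Omega L D (fun f => V - J f)
    (@dominated_by_lin _ _ _ P W) DL D0 Dlin.
- move=> t f g t01 Lf Lg; rewrite !mulrBr.
  have Lfg : L (fun w => t * f w + (1 - t) * g w).
    apply: dominated_by_lin => //; have := dominated_by_lin (1 - t) Lg (dominated_by_cst W1 0).
    by under eq_fun do rewrite addr0.
  have [i1 i2 i3] := And3 (utility_L1 Lf) (utility_L1 Lg) (utility_L1 Lfg).
  suff : t * J f + (1 - t) * J g <= J (fun w => t * f w + (1 - t) * g w) by lra.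
  rewrite /J -[(1 - t) * _]exZ// -exL//; last exact: L1Z.
  apply: ex_le => //; first by apply: L1_lin => //; exact: L1Z.
  apply: nearW => w; apply: le_trans (concave _ _ t01) _; rewrite le_eqVlt; apply/orP; left.
  by apply/eqP; congr v; ring.
- by move=> k Dk; rewrite subr_ge0; exact: DV.
exists (fun f => - m f); split.
- by move=> a f g Lf Lg; rewrite m1//; ring.
- by move=> f Lf; have := m2 f Lf; lra.
- by move=> k Dk; rewrite m3// oppr0.
Qed.

Theorem dual_attainment : exists (lam : R) (Q : probability Omega R), [/\ 0 < lam, Q `<< P, L1 Q W,
  forall k, D k -> ex Q k = 0 & (dual_value P u x lam Q <= V%:E)%E].
Proof.
have [l [l_lin lJ lD]] := dual_functional.
have Lc c : L (fun _ => c) := dominated_by_cst W1 c.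
have l0 : l (fun _ => 0) = 0 by exact: lD.
have LZ a f : L f -> L (fun w => a * f w).
  by move=> Lf; have := dominated_by_lin a Lf (Lc 0); under eq_fun do rewrite addr0.
have lZ a f : L f -> l (fun w => a * f w) = a * l f.
  by move=> Lf; have := l_lin a _ _ Lf (Lc 0); under eq_fun do rewrite addr0; rewrite l0 addr0.
have l_ge0 f : L f -> {ae P, forall w, 0 <= f w} -> 0 <= l f.
  move=> Lf f0; rewrite leNgt; apply/negP => lf0.
  (* With this multiple the bound V + l (n f) drops to v x - 1, while u(x + n f) is at least
     u(x). *)
  pose n : R := (V - v x + 1) / - l f.
  have n0 : 0 <= n by rewrite divr_ge0//; have := V_ge; lra.
  have := lJ _ (LZ n _ Lf); rewrite lZ//.
  have -> : n * l f = - (V - v x + 1) by rewrite /n; field; rewrite lt_eqF.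
  have : v x <= J (fun w => n * f w).
    rewrite -[leLHS](ex_cst P); apply: ex_le; [exact: L1_cst|exact: utility_L1 (LZ _ _ Lf)|].
    by apply: filterS f0 => w fw; apply: mono; rewrite lerDl mulr_ge0.
  lra.
have l_upper (f : nat -> Omega -> R) c : (forall n, measurable_fun setT (f n)) ->
     (forall n, {ae P, forall w, `|f n w| <= c * W w}) ->
     {ae P, forall w, f n w @[n --> \oo] --> (0 : R)} -> forall e, 0 < e -> \forall n \near \oo, l (f n) <= e.
  move=> mf hf cf e e0; have Lf n : L (f n) by split => //; exists c.
  (* The inequality is tested with - b f n, whose expected utility tends to v x and so eventually
     exceeds v x - 1; the bound on b l (f n) is then V - v x + 1, that is b e. *)
  pose b := (V - v x + 1) / e.
  have b0 : 0 < b by rewrite divr_gt0//; have := V_ge; lra.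
  have Lb n : L (fun w => - b * f n w) by exact: LZ.
  have hfb n : {ae P, forall w, `|- b * f n w| <= (b * c) * W w}.
    by apply: filterS (hf n) => w h; rewrite normrM normrN (gtr0_norm b0) -[leRHS]mulrA ler_pM2l.
  have al0 : 0 < `|x| + `|b * c| + 1 by rewrite ltr_pwDr// addr_ge0.
  have cJ : J (fun w => - b * f n w) @[n --> \oo] --> v x.
    rewrite -(ex_cst P (v x)).
    apply: (ex_dct (g := fun w => `|v 0| + (v 0 - v (- `|(`|x| + `|b * c| + 1) * W w|))) _ _ _ _ _).2.
    - by move=> n; exact: L1_meas (utility_L1 (Lb n)).
    - exact: measurable_cst.
    - by apply: L1D; [exact: L1_cst|exact: M_hat_L1].
    - by apply: ae_foralln => n; apply: dominated_utility (hfb n); exact: (Lb n).1.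
    - apply: filterS cf => w h.
      have h1 : x + - b * f n w @[n --> \oo] --> x.
        rewrite -[X in _ --> X]addr0 -(mulr0 (- b)); apply: cvgD; first exact: cvg_cst.
        by apply: cvgM => //; exact: cvg_cst.
      exact: (cvg_comp _ _ h1 (@v_cont _)).
  have /cvgrPdist_lt/(_ _ ltr01) := cJ; apply: filterS => n.
  rewrite ltr_norml => /andP[_ h1]; have := lJ _ (Lb n); rewrite lZ// => h2.
  have : b * l (f n) <= V - v x + 1 by lra.
  have <- : b * e = V - v x + 1 by rewrite /b divfK// gt_eqF.
  by rewrite ler_pM2l.
have l_cont (f : nat -> Omega -> R) c : (forall n, measurable_fun setT (f n)) ->
     (forall n, {ae P, forall w, `|f n w| <= c * W w}) ->
     {ae P, forall w, f n w @[n --> \oo] --> (0 : R)} -> l (f n) @[n --> \oo] --> (0 : R).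
  move=> mf hf cf; have Lf n : L (f n) by split => //; exists c.
  apply/cvgrPdist_le => e e0.
  have h1 := l_upper f c mf hf cf e e0.
  have h2 : \forall n \near \oo, l (fun w => - 1 * f n w) <= e.
    apply: (l_upper (fun n w => - 1 * f n w) c) => //.
    - by move=> n; exact: (LZ (-1) _ (Lf n)).1.
    - by move=> n; apply: filterS (hf n) => w; rewrite mulN1r normrN.
    - apply: filterS cf => w h; rewrite -(mulr0 (-1)); apply: cvgM => //; exact: cvg_cst.
  apply: filterS2 h1 h2 => n a1; rewrite lZ// sub0r normrN ler_norml => a2.
  by apply/andP; split; lra.
(* If l vanished on constants, the utility of x plus any constant would be at most V, against
   [Vlt]. *)
have l1_gt0 : 0 < l (fun _ => 1).
  rewrite lt_neqAle l_ge0 ?andbT//; last exact: nearW.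
  apply/negP => /eqP l1; have [y Vy] := Vlt.
  have := lJ _ (LZ `|y - x| _ (Lc 1)); rewrite lZ// -l1 mulr0 addr0.
  rewrite /J ex_cst mulr1 => h; have : v y <= v (x + `|y - x|).
    by apply: mono; have := ler_norm (y - x); lra.
  lra.
have [Q QP hQ] := functional_measure W1 l_lin l_ge0 l_cont l1_gt0.
pose lam := l (fun _ => 1).
exists lam, Q; split => //.
- have LW : L W.
    split => //; exists 1; apply: filterS W1 => w w1; rewrite mul1r ger0_norm//; exact: le_trans w1.
  by have [] := hQ _ LW.
- move=> k Dk; have [_] := hQ _ (DL Dk); rewrite lD// => /esym/eqP.
  by rewrite mulf_eq0 gt_eqF//= => /eqP.
pose z := density P Q; pose y w := lam * z w.
have iz := density_L1 QP.
have my : measurable_fun setT y by apply: measurable_funM => //; exact: L1_meas iz.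
(* The functional inequality is applied to g - x, where g is the near-maximizer evaluated at the
   density y: the utility becomes v (g), and l becomes lam times a Q-mean, that is a P-mean against
   y. *)
have bound n : L1 P (fun w => conj_approx v n (y w)) /\ ex P (fun w => conj_approx v n (y w)) <= V - lam * x.
  have [b hb] := maximizer_bound v n.
  pose g w := maximizer v n (y w).
  have mg : measurable_fun setT g by apply: (measurableT_comp (maximizer_measurable n mv)).
  have gb w : `|g w| <= b by exact: hb.
  have Lg : L g := dominated_by_bounded W1 mg gb.
  have Lgx : L (fun w => g w - x).
    apply: (dominated_by_bounded W1 (b := b + `|x|)); first exact: measurable_funB.
    by move=> w; apply: le_trans (ler_normB _ _) _; rewrite lerD2r.
  have [ig eg] := hQ _ Lgx.
  have h := lJ _ Lgx; rewrite eg -/lam in h.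
  have igQ := L1_bound Q mg gb.
  have [igz egz] := change_var QP igQ.
  have iv : L1 P (fun w => v (g w)).
    have := utility_L1 Lgx; congr (L1 P _); apply/funext => w; congr v; ring.
  have JE : J (fun w => g w - x) = ex P (fun w => v (g w)).
    by congr ex; apply/funext => w; congr v; ring.
  have cE : (fun w => conj_approx v n (y w)) = (fun w => v (g w) - lam * (g w * z w)).
    by apply/funext => w; rewrite /conj_approx -/(g w) /y; ring.
  rewrite cE; split; first by apply: L1B => //; exact: L1Z.
  rewrite exB//; last exact: L1Z.
  rewrite exZ// egz; move: h; rewrite JE exB//; last exact: L1_cst.
  rewrite ex_cst; lra.
(* Subtracting the value v 0 of the first candidate gives a nonnegative increasing sequence for
   monotone convergence. *)
pose h (n : nat) w := (conj_approx v n (y w) - v 0)%:E.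
have mh n : measurable_fun setT (h n).
  apply/measurable_EFinP; apply: measurable_funB => //; exact: L1_meas (bound n).1.
have h0 n w : (0 <= h n w)%E.
  rewrite lee_fin subr_ge0; have := conj_approx_ge v (y w) (leq0n n).
  by rewrite /ratseq mul0r subr0.
have hnd w : nondecreasing_seq (h ^~ w).
  by move=> m n mn; rewrite lee_fin lerB// conj_approx_nd.
pose hl w := (Phi u (y w) - (v 0)%:E)%E.
have hlE w : limn (h ^~ w) = hl w.
  apply: cvg_lim => //; rewrite /hl; have c := @conj_approx_cvg _ v v_cont (y w).
  have {}c : ((conj_approx v n (y w))%:E - (v 0)%:E)%E @[n --> \oo] --> (Phi u (y w) - (v 0)%:E)%E.
    by apply: cvgeB; [exact: fin_num_adde_defl|exact: c|exact: cvg_cst].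
  exact: c.
have mhl : measurable_fun setT hl.
  apply: emeasurable_funB => //; exact: (measurableT_comp (Phi_measurable v)).
have eh : (\int[P]_w hl w <= (V - lam * x - v 0)%:E)%E.
  have := monotone_convergence P measurableT mh (fun n w _ => h0 n w) (fun w _ => hnd w).
  under eq_integral do rewrite hlE; move=> ->.
  apply: lime_le.
    apply: ereal_nondecreasing_is_cvgn => m n mn; apply: ge0_le_integral => //.
    by move=> w _; exact: hnd.
  apply: nearW => n; rewrite /h exE; last by apply: L1B; [exact: (bound n).1|exact: L1_cst].
  rewrite lee_fin exB ?ex_cst; [|exact: (bound n).1|exact: L1_cst].
  by rewrite lerB// (bound n).2.
have hl0 w : (0 <= hl w)%E.
  rewrite -hlE; apply: lime_ge; first exact: (ereal_nondecreasing_is_cvgn (hnd w)).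
  exact: nearW.
have ihl : P.-integrable setT hl.
  apply/integrableP; split => //; under eq_integral do rewrite gee0_abs//.
  by apply: le_lt_trans eh _; rewrite ltry.
have PhiE : (\int[P]_w Phi u (lam * density P Q w)%R = \int[P]_w hl w + (v 0)%:E)%E.
  rewrite -[X in (_ + X)%E](_ : (\int[P]_w (v 0)%:E)%E = _); last by rewrite exE ?ex_cst//; exact: L1_cst.
  rewrite -integralD//; last exact: (L1_cst P (v 0)).
  by apply: eq_integral => w _; rewrite /hl subeK.
rewrite /dual_value PhiE addeA.
rewrite (_ : V%:E = (lam * x)%:E + (V - lam * x - v 0)%:E + (v 0)%:E)%E.
  by apply: leeD2r; apply: leeD2l.
by rewrite -!EFinD; congr EFin; ring.
Qed.

End DualAttainment.

(** * The market dual problem *)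

Section MarketGains.
Context {R : realType} {dO : measure_display} {Omega : measurableType dO}.
Variables (T : \bar R) (F : R -> set (set Omega)).
Hypotheses (T_gt0 : (0 < T)%E) (filtF : is_filtration T F).
Local Notation process := (@process R dO Omega).
Local Notation bp := (bounded_predictable T F).
Variables (P : probability Omega R) (d : nat) (S : 'I_d -> process) (I : 'I_d -> process -> process).
Hypothesis (hI : forall i, bounded_integral T P F (S i) (I i)).

(** A bounded integrand equals its truncations from some n on, so the Emery distance is eventually
    zero. *)
Lemma bounded_stoch_int (H : 'I_d -> process) : (forall i, bp (H i)) ->
  stoch_int T P F S H (vector_int H I).
Proof.
move=> bH; have pH i : predictable T F (H i) by have [] := bH i.
have cX : cadlag_adapted T F (vector_int H I) := vector_int_cadlag filtF hI bH.
split => //; exists I; split => // t eps dt e0.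
have /choice[c hc] := fun i => (bH i).2.
pose C := \sum_(j < d) c j ^+ 2.
near=> n => K hK bK.
have nC : C <= n%:R ^+ 2.
  have C0 : 0 <= C by apply: sumr_ge0 => j _; exact: sqr_ge0.
  have h : C + 1 <= n%:R by near: n; exact: nbhs_infty_ger.
  rewrite expr2; have : (C + 1) * (C + 1) <= n%:R * n%:R :> R by apply: ler_pM => //; lra.
  by apply: le_trans; nra.
have trE i t' w : date T t' -> truncate n H i t' w = H i t' w.
  move=> dt'; rewrite /truncate ifT//; apply: le_trans nC; apply: ler_sum => j _.
  by rewrite -[X in X <= _]real_normK ?num_real// lerXn2r ?nnegrE//; [exact: le_trans (hc j t' w dt')|exact: hc].
have hX : {ae P, forall w i t, date T t -> I i (truncate n H i) t w = I i (H i) t w}.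
  apply: ae_ord => i.
  have := int_congr T_gt0 filtF (hI i) (bH i) (fun t' w dt' => esym (trE i t' w dt')).
  by apply: filterS => w h t' dt'; exact: h.
pose Z : process := fun t w => truncated_int H I n t w - vector_int H I t w.
have cZ : cadlag_adapted T F Z.
  by apply: (cadlag_adaptedB filtF) => //; exact: truncated_int_cadlag.
apply: (@le_trans _ _ (P set0)); last by rewrite measure0 lee_fin ltW.
apply: le_measure_ae => //; first exact: (emery_measurable T_gt0 filtF eps cZ hK dt).
have d0 := date0 T_gt0.
apply: filterS hX => w h [s st]; apply/negP; rewrite -leNgt.
have Z0 r : date T r -> Z r w = 0.
  by move=> dr; rewrite /Z /truncated_int /vector_int -sumrB big1// => i _; rewrite h// subrr.
have ds : date T s by case/andP: st => s0 st; exact: date_le dt s0 st.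
have -> : el_int Z K s w = 0.
  rewrite /el_int big1// => k _; have [_ _ /(_ k (ltn_ord k))[dk uk _ _ _]] := hK.
  have dmin r : date T r -> date T (Num.min r s).
    by move=> dr; apply: (date_le ds); [rewrite le_min dr.1 ds.1|rewrite ge_min lexx orbT].
  by rewrite !Z0 ?subrr ?mulr0//; exact: dmin.
by rewrite [X in `|X| + _](Z0 0 d0) normr0 addr0 ltW.
Unshelve. all: by end_near. Qed.

Variable W : Omega -> R.
Hypothesis (W1 : {ae P, forall w, 1 <= W w}).

(* Two-sided domination makes this a linear space, unlike terminal_gains, so a functional
   that is bounded above on it vanishes there. *)
Definition bounded_gains : set (Omega -> R) := [set f : Omega -> R | measurable_fun setT f /\
  exists (H : 'I_d -> process) (t c : R), [/\ forall i, bp (H i), date T t &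
    {ae P, forall w r, date T r -> (t <= r -> vector_int H I r w = f w) /\ `|vector_int H I r w| <= c * W w}]].
Local Notation D := bounded_gains.

Lemma bounded_gains_dominated : D `<=` dominated_by P W.
Proof.
move=> f [mf [H [t [c [bH dt h]]]]]; split => //; exists c.
by apply: filterS h => w h; have [<-] := h t dt.
Qed.

Lemma bounded_gains0 : D (fun _ => 0).
Proof.
split => //; exists (fun _ _ _ => 0), 0, 0; split => //.
- by move=> i; exact: (bp_cst T_gt0 filtF).
- exact: (date0 T_gt0).
have h : {ae P, forall w i t, date T t -> I i (fun _ _ => 0) t w = 0}.
  by apply: ae_ord => i; exact: (int0 T_gt0 filtF (hI i)).
apply: filterS h => w h r dr; have -> : vector_int (fun (_ : 'I_d) _ _ => 0) I r w = 0.
  by rewrite /vector_int big1// => i _; rewrite h.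
by rewrite normr0 mul0r.
Qed.

Lemma bounded_gains_lin (a : R) f g : D f -> D g -> D (fun w => a * f w + g w).
Proof.
move=> [mf [H [t [c [bH dt h]]]]] [mg [H' [t' [c' [bH' dt' h']]]]]; split.
  by apply: measurable_funD => //; exact: measurable_funM.
exists (fun i t w => a * H i t w + H' i t w), (Num.max t t'), (`|a| * c + c'); split => //.
- by move=> i; exact: (bpL T_gt0 filtF).
- by case: (leP t t').
have hl : {ae P, forall w i t, date T t -> I i (fun t w => a * H i t w + H' i t w) t w =
    a * I i (H i) t w + I i (H' i) t w}.
  by apply: ae_ord => i; exact: (int_lin (hI i)).
apply: filterS3 h h' hl => w h1 h2 h3 r dr.
have -> : vector_int (fun i t w => a * H i t w + H' i t w) I r w = a * vector_int H I r w + vector_int H' I r w.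
  by rewrite /vector_int mulr_sumr -big_split; apply: eq_bigr => i _; rewrite h3.
have [g1 g2] := h1 r dr; have [g3 g4] := h2 r dr; split.
  by rewrite ge_max => /andP[tr t'r]; rewrite g1// g3.
apply: le_trans (ler_normD _ _) _; rewrite normrM mulrDl; apply: lerD => //.
by rewrite -mulrA ler_wpM2l.
Qed.

(** Being constant after a date, such a gain has a limit at an infinite horizon, and its two-sided
    bound contains the lower bound of admissibility. *)
Lemma bounded_gains_terminal f : D f ->
  exists2 k, terminal_gains P T F S (admissible P T F S W) k & {ae P, forall w, f w = k w}.
Proof.
move=> [mf [H [t [c [bH dt h]]]]]; pose X := vector_int H I.
have sX := bounded_stoch_int bH.
have gX : gain P T F S H X.
  split => // TE; apply: filterS h => w h; apply/cvg_ex; exists (f w).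
  apply: cvg_near_cst; near=> r.
  have tr : t <= r by near: r; apply: nbhs_pinfty_ge; exact: num_real.
  have dr : date T r by split; [exact: le_trans dt.1 tr|rewrite TE leey].
  by have [h1 _] := h r dr; exact: h1.
exists (terminal T X).
  exists H, X; split => //; exists X, (`|c| + 1); split; [exact: gX|by rewrite ltr_wpDl|].
  apply: filterS2 h W1 => w h w1 r dr; have [_] := h r dr; rewrite ler_norml => /andP[h1 _].
  apply: le_trans h1; rewrite lerN2; apply: ler_wpM2r; first exact: le_trans w1.
  by apply: le_trans (ler_norm c) _; rewrite lerDl.
apply: filterS h => w h; rewrite /terminal /X; case: T T_gt0 dt h => [t1 t10 dt h|_ dt h|//].
  have d1 : date t1%:E t1 by split => //; exact: ltW.
  by have [h1 _] := h t1 d1; rewrite h1//; have [_] := dt; rewrite lee_fin.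
symmetry; apply: cvg_lim => //; apply: cvg_near_cst; near=> r.
have tr : t <= r by near: r; apply: nbhs_pinfty_ge; exact: num_real.
have dr : date +oo%E r by split; [exact: le_trans dt.1 tr|rewrite leey].
by have [h1 _] := h r dr; exact: h1.
Unshelve. all: by end_near. Qed.

(** These are the variables that test the martingale property of phi . S i; the factor 2 comes from
    two values each bounded by W. *)
Lemma bounded_gains_increment phi i s t A : bp phi ->
  {ae P, forall w t, date T t -> `|I i phi t w| <= W w} -> date T s -> date T t -> s <= t -> F s A ->
  D (fun w => \1_A w * (I i phi t w - I i phi s w)).
Proof.
move=> bphi bd ds dt st FA.
have mA : wrt (F s) (\1_A : Omega -> R).
  apply/(wrtP filtF ds); apply: measurable_indic; apply: sub_sigma_algebra; exact: FA.
have bA : exists b : R, forall w, `|\1_A w : R| <= b.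
  by exists 1 => w; rewrite indicE; case: (_ \in _); rewrite ?normr1 ?normr0.
have cI := int_cadlag (hI i) bphi.
have bK := bpM T_gt0 filtF bphi (bp_cell T_gt0 filtF ds dt mA bA).
split.
  apply: measurable_funM; first by apply: measurable_indic; exact: (filt_meas filtF ds FA).
  by apply: measurable_funB; [exact: (wrt_measurable filtF dt (cI.2 t dt))|exact: (wrt_measurable filtF ds (cI.2 s ds))].
exists (fun j t' w => if j == i then phi t' w * cell s t \1_A t' w else 0), t, 2; split => //.
  move=> j; case: (j == i); first exact: bK.
  exact: (bp_cst T_gt0 filtF).
have h0 : {ae P, forall w j t', date T t' -> j != i ->
    I j (fun t' w => if j == i then phi t' w * cell s t \1_A t' w else 0) t' w = 0}.
  apply: ae_ord => j; have [ji|ji] := eqVneq j i; first by apply: nearW.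
  by apply: filterS (int0 T_gt0 filtF (hI j)) => w h t' dt' _; exact: h.
have hc := int_cell T_gt0 filtF (hI i) bphi ds dt st mA bA.
apply: filterS3 h0 hc bd => w h1 h2 h3 r dr.
have -> : vector_int (fun j t' w => if j == i then phi t' w * cell s t \1_A t' w else 0) I r w =
    \1_A w * (I i phi (Num.min t r) w - I i phi (Num.min s r) w).
  rewrite /vector_int (bigD1 i)//= eqxx h2// big1 ?addr0// => j ji; exact: h1.
split; first by move=> tr; rewrite (min_l tr) (min_l (le_trans st tr)).
have dmin q : date T q -> date T (Num.min q r).
  by move=> dq; apply: (date_le dr); [rewrite le_min dq.1 dr.1|rewrite ge_min lexx orbT].
rewrite normrM; apply: (@le_trans _ _ (1 * `|I i phi (Num.min t r) w - I i phi (Num.min s r) w|)).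
  by apply: ler_wpM2r => //; rewrite indicE; case: (_ \in _); rewrite ?normr1 ?normr0.
rewrite mul1r mulr_natl mulr2n; apply: le_trans (ler_normB _ _) _.
by apply: lerD; apply: h3; exact: dmin.
Qed.

End MarketGains.

(** * Existence of a dual optimizer *)

Section Existence.
Context {R : realType} {dO : measure_display} {Omega : measurableType dO}.
Variables (T : \bar R) (F : R -> set (set Omega)) (P : probability Omega R) (d : nat)
  (S : 'I_d -> @process R dO Omega) (v : R -> R).
Local Notation u := (EFin \o v).
Hypotheses (T_gt0 : (0 < T)%E) (filtF : is_filtration T F)
  (negl : forall N, P.-negligible N -> F 0 N) (cS : forall i, cadlag_adapted T F (S i))
  (mono : {homo v : x y / x <= y}) (v_cont : continuous v)
  (concave : forall x y t, 0 <= t <= 1 -> t * v x + (1 - t) * v y <= v (t * x + (1 - t) * y))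
  (hA2 : A2 P u).

Lemma u_inf_le (V : \bar R) : (forall y, (u y <= V)%E) -> (u_inf u <= V)%E.
Proof.
move=> h; apply: lime_le.
  by apply: nondecreasing_is_cvge => x y xy; rewrite lee_fin mono.
by apply: nearW.
Qed.

Theorem dual_exists W x : M_hat P u W -> suitable P T F S W -> (U_W P T F S u W x < u_inf u)%E ->
  exists (lam : R) (Q : probability Omega R), [/\ 0 < lam, M_sigma P T F S Q, P_of P (Phi u) Q &
    (dual_value P u x lam Q <= U_W P T F S u W x)%E].
Proof.
move=> hW sW Ult; have [mW W1 _] := sW.
have [phi [I [bphi phi0 hI bd]]] := suitable_density T_gt0 filtF cS sW.
pose D := bounded_gains T F P I W.
have DL : D `<=` dominated_by P W by exact: bounded_gains_dominated.
have D0 : D (fun _ => 0) := bounded_gains0 T_gt0 filtF hI W.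
have DU k : D k -> ((ex P (fun w => v (x + k w)))%:E <= U_W P T F S u W x)%E.
  move=> Dk; have [k' tk' kk'] := bounded_gains_terminal T_gt0 filtF hI W1 Dk.
  have mk : measurable_fun setT k by have [] := DL _ Dk.
  have mk' := complete_measurable T_gt0 filtF negl mk kk'.
  have mv := v_measurable mono.
  apply: ereal_sup_ubound; exists k' => //; rewrite -exE; last exact: (utility_L1 x mono concave hW W1 (DL _ Dk)).
  apply: ae_eq_integral => //.
  - by apply/measurable_EFinP; apply: (measurableT_comp mv); exact: measurable_funD.
  - by apply/measurable_EFinP; apply: (measurableT_comp mv); exact: measurable_funD.
  - by apply: filterS kk' => w ->.
have Uge := DU _ D0.
(* The value is finite: at least the expected utility of the zero gain, and below u(oo). *)
have [V VE] : exists V, U_W P T F S u W x = V%:E.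
  case: (U_W P T F S u W x) Uge Ult => [V _ _|_|//]; first by exists V.
  by rewrite ltNge leey.
rewrite VE in DU Ult *.
have Vlt : exists y, V < v y.
  apply: contrapT => h; move: Ult; rewrite ltNge => /negP; apply; apply: u_inf_le => y.
  by rewrite lee_fin leNgt; apply/negP => Vy; apply: h; exists y.
have DV k : D k -> ex P (fun w => v (x + k w)) <= V by move=> /DU; rewrite lee_fin.
have [lam [Q [l0 QP iW hD hdual]]] := dual_attainment mono v_cont concave hW W1 DL D0
  (fun a f g => @bounded_gains_lin _ _ _ T F T_gt0 filtF P d S I hI W a f g) DV Vlt.
exists lam, Q; split => //.
  split => //; apply: (orthogonal_sigma_martingale T_gt0 filtF QP cS bphi phi0 hI iW bd) => i s t A ds dt st FA.
  by apply: hD; exact: (bounded_gains_increment T_gt0 filtF hI bphi (bd i) ds dt st FA).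
(* A dual value bounded by the real V forces a finite integral at the scaled density, which (A2)
   identifies with the requirement on Q itself. *)
rewrite (hA2 l0); split => //; move: hdual; rewrite /dual_value.
by case: (\int[P]_w Phi u (lam * density P Q w)%R)%E => [r _|//|//]; rewrite ltry.
Qed.

End Existence.

Theorem proposition44 (R : realType) (dO : measure_display)
    (Omega : measurableType dO) (P : probability Omega R)
    (T : \bar R) (F : R -> set (set Omega))
    (d : nat) (S : 'I_d -> @process R dO Omega)
    (a : \bar R) (u : R -> \bar R)
    (T_gt0 : (0 < T)%E)
    (filtF : is_filtration T F) (usualF : usual_conditions T P F)
    (F0_trivial : trivial_at_0 P F)
    (d_gt0 : (0 < d)%N)
    (S_semi : forall i, semimartingale T P F (S i))
    (S_terminal : forall i, has_terminal T P (S i))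
    (a_lt0 : (a < 0)%E) (u_utility : utility a u)
    (hA1 : A1 a u) (hA2 : A2 P u)
    (W1 : Omega -> R) (x : R)
    (W1_M : M_hat P u W1) (W1_suitable : suitable P T F S W1)
    (U_W1_lt : (U_W P T F S u W1 x < u_inf u)%E) :
  (forall W : Omega -> R, L_hat P u W -> {ae P, forall w, 0 <= W w} ->
     (U_W P T F S u W x <= U_Phi P T F S u x)%E) /\
  (sup_utility P T F S u (admissible_hat P T F S u) x = U_Phi P T F S u x /\
   exists (lam : R) (Q : probability Omega R),
     [/\ 0 < lam, M_sigma P T F S Q, P_of P (Phi u) Q &
         U_Phi P T F S u x = dual_value P u x lam Q]) /\
  (forall W Wbar : Omega -> R, L_hat P u W -> M_hat P u Wbar ->
     suitable P T F S Wbar -> {ae P, forall w, Wbar w <= W w} ->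
     U_W P T F S u W x = U_W P T F S u Wbar x /\
     U_W P T F S u Wbar x = U_Phi P T F S u x).
Proof.
have cS i : cadlag_adapted T F (S i) by have [] := S_semi i.
have negl := usualF.1.
have [_ W1_ge1 _] := W1_suitable.
have [v uE] := M_hat_finite a_lt0 u_utility W1_M W1_ge1; subst u.
have [_ [_ u_low] u_mono u_conc _] := u_utility.
(* Left of a finite a the utility would be -oo, whereas it has been shown to be real-valued. *)
have aE : a = -oo%E.
  case: (a) a_lt0 u_low => [r _ /(_ (r - 1))|//|//].
  by rewrite lte_fin ltrBlDr ltrDl ltr01 => /(_ isT).
have mono : {homo v : y z / y <= z} by move=> y z /u_mono; rewrite lee_fin.
have concave y z t : 0 <= t <= 1 -> t * v y + (1 - t) * v z <= v (t * y + (1 - t) * z).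
  by move=> t01; have := u_conc y z t; rewrite aE => /(_ (ltNyr _) (ltNyr _) t01).
have v_cont : continuous v.
  move=> y; have [_ /(_ y)] := hA1; rewrite aE => /(_ (ltNyr _))[dv _] _ _.
  by apply: differentiable_continuous; apply/derivable1_diffP.
have exist W := @dual_exists _ _ _ T F P d S v T_gt0 filtF negl cS mono v_cont concave hA2 W x.
have upper W : L_hat P (EFin \o v) W -> {ae P, forall w, 0 <= W w} ->
    (U_W P T F S (EFin \o v) W x <= U_Phi P T F S (EFin \o v) x)%E.
  exact: (U_W_le_U_Phi mono T_gt0 filtF negl cS hA2).
have M_L W : M_hat P (EFin \o v) W -> L_hat P (EFin \o v) W.
  by move=> [mW hW]; split => //; exists 1 => //; exact: hW.
have ge0 W : {ae P, forall w, 1 <= W w} -> {ae P, forall w, 0 <= W w :> R}.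
  by apply: filterS => w; exact: le_trans.
have attained W : M_hat P (EFin \o v) W -> suitable P T F S W ->
    (U_W P T F S (EFin \o v) W x < u_inf (EFin \o v))%E ->
    U_W P T F S (EFin \o v) W x = U_Phi P T F S (EFin \o v) x /\
    exists (lam : R) (Q : probability Omega R),
     [/\ 0 < lam, M_sigma P T F S Q, P_of P (Phi (EFin \o v)) Q &
         U_Phi P T F S (EFin \o v) x = dual_value P (EFin \o v) x lam Q].
  move=> hW sW Ult; have [_ W_ge1 _] := sW.
  have [lam [Q [l0 hM hP hdual]]] := exist W hW sW Ult.
  have h1 := upper W (M_L W hW) (ge0 W W_ge1).
  have h2 : (U_Phi P T F S (EFin \o v) x <= dual_value P (EFin \o v) x lam Q)%E.
    by apply: ereal_inf_lbound; exists lam, Q.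
  have e : U_W P T F S (EFin \o v) W x = U_Phi P T F S (EFin \o v) x.
    by apply/eqP; rewrite eq_le h1/=; exact: le_trans h2 hdual.
  split => //; exists lam, Q; split => //.
  by apply/eqP; rewrite eq_le h2/= -e.
have [U1 dual1] := attained W1 W1_M W1_suitable U_W1_lt.
split; first exact: upper.
split; first split => //.
  apply/eqP; rewrite eq_le; apply/andP; split.
    apply: le_ereal_inf_tmp => _ [lam [Q [l0 hM hP ->]]].
    apply: ge_ereal_sup => _ [k [H [X [[W [hW W_ge1] adm] gX ->]]] <-].
    apply: (weak_duality mono T_gt0 filtF negl cS hA2 _ hW (ge0 W W_ge1) _ l0 hM hP).
    by exists H, X.
  rewrite -U1; apply: ereal_sup_le => _ [k [H [X [adm gX ->]]] <-].
  by exists (terminal T X) => //; exists H, X; split => //; exists W1 => //; split => //; exact: M_L.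
move=> W Wbar hW hWbar sWbar WW; have [_ Wbar_ge1 _] := sWbar.
have h1 := upper Wbar (M_L _ hWbar) (ge0 _ Wbar_ge1).
(* The strict inequality known for W1 reaches Wbar through the common dual value, so attainment
   applies to Wbar as well. *)
have lt1 : (U_W P T F S (EFin \o v) Wbar x < u_inf (EFin \o v))%E.
  by apply: le_lt_trans h1 _; rewrite -U1.
have [e _] := attained Wbar hWbar sWbar lt1; split => //.
have W_ge0 : {ae P, forall w, 0 <= W w}.
  by apply: filterS2 WW Wbar_ge1 => w ww w1; apply: le_trans ww; exact: le_trans w1.
apply/eqP; rewrite eq_le; apply/andP; split; first by rewrite e; exact: upper.
(* Integrands admissible for Wbar are admissible for the larger W, with the same constant. *)
apply: ereal_sup_le => _ [k [H [X [[X' [c [gX' c0 lb]]] gX ->]]] <-].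
exists (terminal T X) => //; exists H, X; split => //; exists X', c; split => //.
apply: filterS2 lb WW => w h ww t dt; apply: le_trans (h t dt); rewrite lerN2 ler_pM2l//.
Qed.
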